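(* Let $R>0$ and let $k\ge 0$ be real. Then the Dunkl transform $D_k$ is a bijection from $L_R^2(\mathbb{R},w_k(x)dx)$ onto $\mathcal{H}_R^{2,k}(\mathbb{C})$.
   Context: For $k\ge 0$, the Dunkl operator $T_k$ acts on smooth (or holomorphic) functions by $T_kf(x)=f'(x)+k\,\frac{f(x)-f(-x)}{x}$, equivalently $T_kf(x)=f'(x)+k\int_{-1}^1 f'(tx)\,dt$ (which gives the value at $x=0$). For each $\lambda\in\mathbb{C}$ there is a unique holomorphic function $\psi_\lambda^k:\mathbb{C}\to\mathbb{C}$ with $T_k\psi_\lambda^k=i\lambda\psi_\lambda^k$ and $\psi_\lambda^k(0)=1$; the map $(z,\lambda)\mapsto\psi_\lambda^k(z)$ is entire on $\mathbb{C}^2$, and $\psi^k_\lambda$ is bounded on $\mathbb{R}$ for $\lambda\in\mathbb{R}$. Put $w_k(x)=|x|^{2k}$ and $c_k=\int_{\mathbb{R}}e^{-x^2/2}w_k(x)\,dx$. The Dunkl transform of $f\in L^1(\mathbb{R},w_k(x)dx)$ is $$D_kf(\lambda)=\frac{1}{c_k}\int_{\mathbb{R}}f(x)\,\psi_{-\lambda}^k(x)\,w_k(x)\,dx\qquad(\lambda\in\mathbb{R}).$$ $L_R^2(\mathbb{R},w_k(x)dx)$ is the subspace of $L^2(\mathbb{R},w_k(x)dx)$ consisting of the functions with distributional support in $[-R,R]$ (i.e. vanishing almost everywhere outside $[-R,R]$). Such functions lie in $L^1(\mathbb{R},w_k(x)dx)$, and the integral formula above defines $D_kf(\lambda)$ for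 all $\lambda\in\mathbb{C}$; $D_kf$ is regarded as a function on $\mathbb{C}$ in this way. $\mathcal{H}_R^{2,k}(\mathbb{C})$ is the space of entire functions $f:\mathbb{C}\to\mathbb{C}$ whose restriction to the real line belongs to $L^2(\mathbb{R},w_k(x)dx)$ and for which there is a constant $C_f>0$ with $|f(z)|\le C_fe^{R|\operatorname{Im}z|}$ for all $z\in\mathbb{C}$. *)

(* Defs.v *)
From HB Require Import structures.
From mathcomp Require Import all_boot all_order all_algebra.
From mathcomp Require Import all_classical all_reals all_analysis.
From mathcomp Require Import measurable_realfun complex.

Set Implicit Arguments.
Unset Strict Implicit.
Unset Printing Implicit Defensive.

Import Order.TTheory GRing.Theory Num.Theory.
Import numFieldNormedType.Exports.
Import Normc.

Local Open Scope classical_set_scope.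
Local Open Scope ring_scope.
Local Open Scope complex_scope.

(* R[i] with the norm topology, as a normed space over itself, so that
   [derivable f z 1] and [derive1 f z] are complex differentiability and the
   complex derivative. *)
HB.instance Definition _ (R : realType) := NormedModule.copy R[i] (R[i]^o).

Definition measurableTypeC (R : realType) :=
  g_sigma_algebraType (@open R[i]).

Definition entire (R : realType) (f : R[i] -> R[i]) : Prop :=
  forall z, derivable f z 1.

Definition dunkl_weight (R : realType) (k x : R) : R := `|x| `^ (2 * k).

Section dunkl_measure.
Context (R : realType) (k : R).

Definition dunkl_measure (A : set (measurableTypeR R)) : \bar R :=
  (\int[@lebesgue_measure R]_(x in A) (dunkl_weight k x)%:E)%E.

Lemma measurable_dunkl_weight :
  measurable_fun [set: measurableTypeR R] (dunkl_weight k : _ -> R).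
Proof.
apply: (measurableT_comp (measurable_powR (2 * k))).
exact: normr_measurable.
Qed.

Let dunkl_measure0 : dunkl_measure set0 = 0%E.
Proof. by rewrite /dunkl_measure integral_set0. Qed.

Let dunkl_measure_ge0 A : (0 <= dunkl_measure A)%E.
Proof. by apply: integral_ge0 => x _; rewrite lee_fin powR_ge0. Qed.

Let dunkl_measure_sigma_additive : semi_sigma_additive dunkl_measure.
Proof.
move=> /= F mF tF mUF; rewrite /dunkl_measure; apply: cvg_toP.
  apply: ereal_nondecreasing_is_cvgn => m n mn.
  apply: lee_sum_nneg_natr => // j _ _; apply: integral_ge0 => /= x _.
  by rewrite lee_fin powR_ge0.
rewrite ge0_integral_bigcup//=.
- apply: measurable_funTS; apply/measurable_EFinP.
  exact: measurable_dunkl_weight.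
- by move=> x _; rewrite lee_fin powR_ge0.
Qed.

HB.instance Definition _ := isMeasure.Build _ _ _ dunkl_measure
  dunkl_measure0 dunkl_measure_ge0 dunkl_measure_sigma_additive.

End dunkl_measure.

(* At 0 the difference quotient is replaced by its value in the integral form
   of the operator, the integral of f'(t * 0) over t in [-1, 1]. *)
Definition dunkl_op (R : realType) (k : R) (f : R[i] -> R[i]) (z : R[i]) :
    R[i] :=
  derive1 f z +
  k%:C * (if z == 0 then 2 * derive1 f 0 else (f z - f (- z)) / z).

(* psi_lambda^k: the (unique) element of the set, chosen by [xget]; the constant
   0 is only a default value. *)
Definition dunkl_kernel (R : realType) (k : R) (l : R[i]) : R[i] -> R[i] :=
  xget (fun=> 0)
    [set psi | [/\ entire psi,
                   forall z, dunkl_op k psi z = 'i * l * psi z &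
                   psi 0 = 1]].

Definition dunkl_const (R : realType) (k : R) : R :=
  \int[dunkl_measure k]_x expR (- (x ^+ 2) / 2).

Definition Cintegral (R : realType) d (T : measurableType d)
    (mu : {measure set T -> \bar R}) (f : T -> R[i]) : R[i] :=
  (\int[mu]_x complex.Re (f x)) +i* (\int[mu]_x complex.Im (f x)).

Definition dunkl_transform (R : realType) (k : R) (f : R -> R[i]) (l : R[i]) :
    R[i] :=
  (dunkl_const k)^-1%:C *
  Cintegral (dunkl_measure k) (fun x => f x * dunkl_kernel k (- l) x%:C).

Definition L2 (R : realType) (k : R)
    (f : measurableTypeR R -> measurableTypeC R) : Prop :=
  measurable_fun setT f /\
  (Lnorm (dunkl_measure k) 2%:E (fun x => (normc (f x))%:E) < +oo)%E.

(* Elements are classes of measurable functions modulo equality almost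
   everywhere; such a class is coerced to a representative function, and none
   of the conditions below, nor [dunkl_transform], depends on which one. *)
Definition L2_support (R : realType) (k r : R) :
    set {mfun_ (dunkl_measure k), measurableTypeR R >-> measurableTypeC R} :=
  [set f | L2 k f /\
           {ae dunkl_measure k, forall x : R, x \notin `[- r, r] -> f x = 0}].

Definition paley_wiener (R : realType) (k r : R) : set (R[i] -> R[i]) :=
  [set f | [/\ entire f,
               L2 k (fun x : R => f x%:C) &
               exists2 C : R, 0 < C &
                 forall z, normc (f z) <= C * expR (r * `|complex.Im z|)]].

(* Main.v *)
(** Forward direction: on real points the kernel is a combination of cas(lx) and
    cas(-lx), where cas, the Dunkl analogue of cos + sin, satisfies
    T_k cas(x) = cas(-x). So D_k on the line is controlled by the real transform
    Hf(y) = int f(x) cas(xy) dmu(x). The estimate int (Hf)^2 <= C int f^2 follows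
    by Gaussian regularization: it turns the left side into the quadratic form of
    a Dunkl heat kernel, which has constant mass, and Schur's test applies. The
    bound C exp(R |Im l|) comes from an energy inequality for the kernel.
    Injectivity: the Taylor coefficients of the transform are, up to nonzero
    factors, the moments of f, and a compactly supported integrable function with
    zero moments vanishes almost everywhere.
    Surjectivity: a Paley-Wiener function F times sinc(ez)^m is integrable and has
    iterated Dunkl derivatives of size O(r'^n) for every r' > R + me. As
    H(T_k^n f)(y) = +- y^n Hf(+-y), this forces supp Hf in [-R - me, R + me]; the
    inversion formula H(Hf) = C f is read off the moments of Hf. Letting e -> 0
    along a fast subsequence, these Hf converge almost everywhere, and their limit
    gives the preimage of F. *)

From HB Require Import structures.
Require Import Defs.
From mathcomp Require Import all_boot all_order all_algebra.
From mathcomp Require Import all_classical all_reals all_analysis.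
From mathcomp Require Import ring lra zify measurable_realfun complex.

Set Implicit Arguments.
Unset Strict Implicit.
Unset Printing Implicit Defensive.

Import Order.TTheory GRing.Theory Num.Theory.
Import numFieldNormedType.Exports.
Import Normc.

Local Open Scope classical_set_scope.
Local Open Scope ring_scope.

(** * Power series on the line *)

(** The reflection in T_k destroys translation invariance: an inversion formula proved at one point
    cannot be moved to the others. What replaces translations is the algebra of T_k. It is
    skew-symmetric for |x|^(2k) dx, satisfies T x - x T = 1 + 2k s with s the reflection, and sends
    cas(xy) to y cas(-xy). Hence inversion at the single point 0, obtained from a Gaussian
    approximate identity, suffices: applied to T_k^n f it gives the moment of order n of Hf. A Dunkl
    derivative of order n exceeds the ordinary one at most by a product of factors 1 + 2k/i, which
    grows polynomially; the exponential type survives, but every such loss needs a radius slightly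
    larger than the given one. A Paley-Wiener function is only square integrable on the line, so
    neither its transform nor integration by parts makes sense at once; the sinc power m is chosen
    to beat the weight. Any constant is good enough in the estimate of int (Hf)^2, which permits a
    crude majorant of the heat kernel. On a fixed compact interval mean-square smallness gives
    smallness in L^1, and summable L^1 differences converge almost everywhere. *)

Section power_series.
Context {R : realType}.
Implicit Types (c d : nat -> R) (x y a : R) (n : nat).

(* [ent c]: the power series with coefficients [c] has infinite radius of
   convergence, so that [fs c] below is its sum. *)
Definition ent c := forall r, 0 <= r -> exists C, forall n, `|c n| * r ^+ n <= C.

Definition fs c x : R := limn (pseries c x).

(** On sums, [cshift] is multiplication by x, [calt] is x -> -x and [cdil a] is x -> a x. *)
Definition cshift c n : R := if n is m.+1 then c m else 0.

Definition calt c n : R := (-1) ^+ n * c n.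

Definition cdil a c n : R := a ^+ n * c n.

(** The bound at radius 2|x| + 1 makes the terms at x smaller than those of a geometric series of
    ratio 1/2. *)
Lemma ent_cvg_norm c x : ent c -> cvgn (series (fun n => `|c n * x ^+ n|)).
Proof.
move=> ec; have r0 : 0 < 2 * `|x| + 1 by rewrite ltr_wpDl// mulr_ge0.
have [C HC] := ec _ (ltW r0).
have C0 : 0 <= C by apply: le_trans (HC 0%N); rewrite mulr_ge0.
apply: (@series_le_cvg _ _ (geometric C (1 / 2))) => //=.
- by move=> n; rewrite mulr_ge0// exprn_ge0.
- move=> n; rewrite normrM normrX.
  have h : `|x| ^+ n <= (2 * `|x| + 1) ^+ n * (1 / 2) ^+ n.
    by rewrite -exprMn lerXn2r// ?nnegrE ?mulr_ge0//; have := normr_ge0 x; lra.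
  apply: (le_trans (ler_wpM2l (normr_ge0 _) h)).
  by rewrite mulrA ler_wpM2r ?exprn_ge0.
- by apply: is_cvg_geometric_series; rewrite ger0_norm; lra.
Qed.

Lemma ent_cvg c x : ent c -> cvgn (pseries c x).
Proof. by move=> ec; apply: normed_cvg; exact: ent_cvg_norm. Qed.

Lemma ent_fs c x : ent c -> pseries c x @ \oo --> fs c x.
Proof. exact: ent_cvg. Qed.

Lemma eq_fs c d x : c =1 d -> fs c x = fs d x.
Proof. by move=> /funext ->. Qed.

Lemma eq_ent c d : c =1 d -> ent c -> ent d.
Proof. by move=> /funext ->. Qed.

Lemma entD c d : ent c -> ent d -> ent (fun n => c n + d n).
Proof.
move=> ec ed r r0; have [C HC] := ec _ r0; have [D HD] := ed _ r0.
exists (C + D) => n; apply: le_trans (lerD (HC n) (HD n)).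
by rewrite -mulrDl ler_wpM2r ?exprn_ge0 ?ler_normD.
Qed.

Lemma entZ a c : ent c -> ent (fun n => a * c n).
Proof.
move=> ec r r0; have [C HC] := ec _ r0; exists (`|a| * C) => n.
by rewrite normrM -mulrA ler_wpM2l.
Qed.

Lemma entN c : ent c -> ent (fun n => - c n).
Proof. by move=> /(entZ (-1)); apply: eq_ent => n; rewrite mulN1r. Qed.

Lemma entB c d : ent c -> ent d -> ent (fun n => c n - d n).
Proof. by move=> ec ed; apply: entD => //; exact: entN. Qed.

Lemma ent_le c d : (forall n, `|c n| <= `|d n|) -> ent d -> ent c.
Proof.
move=> cd ed r r0; have [C HC] := ed _ r0; exists C => n.
by apply: le_trans (HC n); rewrite ler_wpM2r ?exprn_ge0.
Qed.

Lemma ent_norm c : ent c -> ent (fun n => `|c n|).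
Proof. by apply: ent_le => n; rewrite normr_id. Qed.

Lemma ent_alt c : ent c -> ent (calt c).
Proof. by apply: ent_le => n; rewrite /calt normrM normrX normrN1 expr1n mul1r. Qed.

Lemma ent_dil a c : ent c -> ent (cdil a c).
Proof.
move=> ec r r0; have [C HC] := ec (`|a| * r) (mulr_ge0 (normr_ge0 _) r0).
by exists C => n; apply: le_trans (HC n); rewrite /cdil normrM normrX exprMn mulrCA mulrA.
Qed.

Lemma ent_shift c : ent c -> ent (cshift c).
Proof.
move=> ec r r0; have [C HC] := ec r r0.
have C0 : 0 <= C by apply: le_trans (HC 0%N); rewrite mulr_ge0.
exists (r * C) => -[|n]; first by rewrite /= normr0 mul0r mulr_ge0.
by rewrite /= exprS mulrCA ler_wpM2l.
Qed.

(** A factor of size 2^n is absorbed by doubling the radius; the extra 2 keeps the radius above 1,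
    which pays for the shift from n to n + 1. *)
Lemma ent_poly c (p : nat -> R) K : ent c -> (forall n, `|p n| <= K * 2 ^+ n) ->
  ent (fun n => p n * c n.+1).
Proof.
move=> ec pK r r0.
have [C HC] := ec (2 * r + 2) ltac:(lra).
have C0 : 0 <= C by apply: le_trans (HC 0%N); rewrite mulr_ge0.
have K0 : 0 <= K.
  by have := pK 0%N; rewrite expr0 mulr1; apply: le_trans.
exists (K * C) => n.
apply: (@le_trans _ _ (K * (`|c n.+1| * (2 * r + 2) ^+ n.+1))); last by rewrite ler_wpM2l.
rewrite normrM; apply: (@le_trans _ _ (K * 2 ^+ n * `|c n.+1| * r ^+ n)).
  by rewrite ler_wpM2r ?exprn_ge0// ler_wpM2r.
rewrite -!mulrA ler_wpM2l// mulrCA ler_wpM2l// -exprMn exprS.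
have h : (2 * r) ^+ n <= (2 * r + 2) ^+ n by rewrite lerXn2r ?nnegrE//; lra.
by apply: (le_trans h); rewrite ler_peMl ?exprn_ge0//; lra.
Qed.

Lemma succn_le_exp2 n : n.+1%:R <= 2 ^+ n :> R.
Proof. by rewrite -natrX ler_nat ltn_expl. Qed.

Lemma ent_diffs c : ent c -> ent (pseries_diffs c).
Proof.
move=> ec; apply: (@ent_poly c (fun n => n.+1%:R) 1) => // n.
by rewrite mul1r ger0_norm// succn_le_exp2.
Qed.

Lemma is_derive_fs c x : ent c -> is_derive x 1 (fs c) (fs (pseries_diffs c) x).
Proof.
move=> ec; apply: (@pseries_snd_diffs _ c (`|x| + 1)).
- exact: ent_cvg.
- by apply: ent_cvg; exact: ent_diffs.
- by apply: ent_cvg; do 2 apply: ent_diffs.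
- by rewrite [ltRHS]ger0_norm ?addr_ge0// ltrDl.
Qed.

Lemma derivable_fs c x : ent c -> derivable (fs c) x 1.
Proof. by move=> /is_derive_fs h; apply: (@ex_derive _ _ _ _ _ _ _ (h x)). Qed.

Lemma continuous_fs c : ent c -> continuous (fs c).
Proof.
by move=> ec x; apply/differentiable_continuous/derivable1_diffP; exact: derivable_fs.
Qed.

Lemma measurable_fs c : ent c -> measurable_fun [set: measurableTypeR R] (fs c).
Proof. by move=> ec; apply: continuous_measurable_fun; exact: continuous_fs. Qed.

Lemma fsD c d x : ent c -> ent d -> fs (fun n => c n + d n) x = fs c x + fs d x.
Proof.
move=> ec ed; rewrite /fs -limD; [|exact: ent_cvg..].
congr (lim (_ @ \oo)); rewrite /pseries.
rewrite (_ : (fun _ => _) = (fun n => c n * x ^+ n) + (fun n => d n * x ^+ n)); last first.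
  by apply/funext => n /=; rewrite mulrDl.
by rewrite seriesD.
Qed.

Lemma fsZ a c x : ent c -> fs (fun n => a * c n) x = a * fs c x.
Proof.
move=> ec; apply/cvg_lim => //.
rewrite (_ : pseries _ _ = (fun n => a * pseries c x n)).
  by apply: cvgMr; exact: ent_cvg.
apply/funext => n; rewrite /pseries /series /= mulr_sumr.
by apply: eq_bigr => i _; rewrite mulrA.
Qed.

Lemma fsN c x : ent c -> fs (fun n => - c n) x = - fs c x.
Proof. by move=> ec; rewrite -mulN1r -fsZ//; apply: eq_fs => n; rewrite mulN1r. Qed.

Lemma fsB c d x : ent c -> ent d -> fs (fun n => c n - d n) x = fs c x - fs d x.
Proof. by move=> ec ed; rewrite fsD ?fsN//; exact: entN. Qed.

Lemma fs_cst0 x : fs (fun=> 0) x = 0.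
Proof.
apply/cvg_lim => //; rewrite (_ : pseries _ _ = fun=> 0); first exact: cvg_cst.
by apply/funext => n; rewrite /pseries /series /=; apply: big1 => i _; rewrite mul0r.
Qed.

Lemma fs_dil a c x : fs (cdil a c) x = fs c (a * x).
Proof.
congr (lim (_ @ \oo)); apply/funext => n; rewrite /pseries /series /=.
by apply: eq_bigr => i _; rewrite /cdil exprMn; ring.
Qed.

Lemma fs_alt c x : fs (calt c) x = fs c (- x).
Proof. by rewrite -(mulN1r x) -fs_dil. Qed.

Lemma fs_shift c x : ent c -> fs (cshift c) x = x * fs c x.
Proof.
move=> ec; apply/cvg_lim => //.
rewrite -cvg_shiftS (_ : (fun n => _) = (fun n => x * pseries c x n)).
  by apply: cvgMr; exact: ent_cvg.
apply/funext => n; rewrite /pseries /series /= big_nat_recl//= mul0r add0r mulr_sumr.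
by apply: eq_bigr => i _; rewrite exprS mulrCA.
Qed.

Lemma fs0 c : fs c 0 = c 0%N.
Proof.
apply/cvg_lim => //; rewrite -cvg_shiftS (_ : (fun n => _) = fun=> c 0%N).
  exact: cvg_cst.
apply/funext => n; rewrite /pseries /series /= big_nat_recl//= expr0 mulr1.
by rewrite big1 ?addr0// => i _; rewrite exprS mul0r mulr0.
Qed.

Lemma fs_ge0 c x : ent c -> (forall n, 0 <= c n) -> 0 <= x -> 0 <= fs c x.
Proof.
move=> ec c0 x0; apply: limr_ge; first exact: ent_cvg.
by near=> n; rewrite /pseries /series /=; apply: sumr_ge0 => i _; rewrite mulr_ge0 ?exprn_ge0.
Unshelve. all: by end_near. Qed.

Lemma ler_fs c d x : ent c -> ent d -> (forall n, c n <= d n) -> 0 <= x -> fs c x <= fs d x.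
Proof.
move=> ec ed cd x0; rewrite -subr_ge0 -fsB//; apply: fs_ge0 => //; first exact: entB.
by move=> n; rewrite subr_ge0.
Qed.

Lemma psum_le_fs c x n : ent c -> (forall m, 0 <= c m) -> 0 <= x -> pseries c x n <= fs c x.
Proof.
move=> ec c0 x0; apply: nondecreasing_cvgn_le; last exact: ent_cvg.
by apply: nondecreasing_series => i _ _; rewrite mulr_ge0 ?exprn_ge0.
Qed.

Lemma term_le_fs c x n : ent c -> (forall m, 0 <= c m) -> 0 <= x -> c n * x ^+ n <= fs c x.
Proof.
move=> ec c0 x0; apply: le_trans (psum_le_fs n.+1 ec c0 x0).
rewrite /pseries /series /= big_nat_recr//= lerDr.
by apply: sumr_ge0 => i _; rewrite mulr_ge0 ?exprn_ge0.
Qed.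

Lemma psum_norm_le c x n : ent c -> `|pseries c x n| <= fs (fun m => `|c m|) `|x|.
Proof.
move=> ec; apply: le_trans (psum_le_fs n (ent_norm ec) _ _) => //.
rewrite /pseries /series /=; apply: (le_trans (ler_norm_sum _ _ _)).
by apply: ler_sum => i _; rewrite normrM normrX.
Qed.

Lemma fs_norm_le c x : ent c -> `|fs c x| <= fs (fun m => `|c m|) `|x|.
Proof.
move=> ec; have h : `|pseries c x n| @[n --> \oo] --> `|fs c x|.
  by apply: cvg_norm; exact: ent_cvg.
rewrite -(cvg_lim _ h)//; apply: limr_le; first by apply/cvg_ex; exists `|fs c x|.
by near=> n; exact: psum_norm_le.
Unshelve. all: by end_near. Qed.

Lemma fs_norm_mono c x y : ent c -> `|x| <= `|y| ->
  fs (fun m => `|c m|) `|x| <= fs (fun m => `|c m|) `|y|.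
Proof.
move=> ec xy; apply: ler_lim; [exact/ent_cvg/ent_norm|exact/ent_cvg/ent_norm|].
near=> n; rewrite /pseries /series /=; apply: ler_sum => i _.
by rewrite ler_wpM2l// lerXn2r ?nnegrE.
Unshelve. all: by end_near. Qed.

(** Differentiation shifts the coefficients up to nonzero factors, so that each one in turn becomes
    a value at 0. *)
Lemma fs_uniq0 c : ent c -> (forall x, fs c x = 0) -> forall n, c n = 0.
Proof.
move=> ec c0 n; elim: n c ec c0 => [|n IH] c ec c0; first by rewrite -fs0 c0.
have h x : fs (pseries_diffs c) x = 0.
  have [_ <-] := is_derive_fs x ec.
  by rewrite (_ : fs c = cst 0) ?derive_cst//; apply/funext => z; rewrite c0.
have /eqP := IH _ (ent_diffs ec) h.
by rewrite /pseries_diffs mulf_eq0 pnatr_eq0 /= => /eqP.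
Qed.

Lemma fs_uniq c d : ent c -> ent d -> (forall x, fs c x = fs d x) -> c =1 d.
Proof.
move=> ec ed cd n; apply/eqP; rewrite -subr_eq0; apply/eqP.
apply: (@fs_uniq0 (fun n => c n - d n)); first exact: entB.
by move=> x; rewrite fsB// cd subrr.
Qed.

Lemma fs_expR x : fs (fun n => (n`!%:R)^-1) x = expR x.
Proof. by rewrite expRE. Qed.

Lemma ent_fact : ent (fun n => (n`!%:R)^-1).
Proof.
move=> r r0; have := cvg_series_bounded (is_cvg_series_exp_coeff r).
move=> [M [_ HM]]; exists (M + 1) => n.
have := HM (M + 1); rewrite ltrDl ltr01 => /(_ isT n I); rewrite /exp_coeff /=.
by apply: le_trans; rewrite ger0_norm ?invr_ge0// mulrC ler_norm.
Qed.

End power_series.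

(** * Derivatives and continuity of real functions; comparison lemmas *)

Section derive_rules.
Context {R : realType}.
Implicit Types (f g : R -> R) (x a b c : R).

Lemma dvD f g x a b : is_derive x (1 : R) f a -> is_derive x (1 : R) g b ->
  is_derive x (1 : R) (fun y => f y + g y) (a + b).
Proof. by move=> *; exact: is_deriveD. Qed.

Lemma dvB f g x a b : is_derive x (1 : R) f a -> is_derive x (1 : R) g b ->
  is_derive x (1 : R) (fun y => f y - g y) (a - b).
Proof. by move=> *; exact: is_deriveB. Qed.

Lemma dvM f g x a b : is_derive x (1 : R) f a -> is_derive x (1 : R) g b ->
  is_derive x (1 : R) (fun y => f y * g y) (a * g x + f x * b).
Proof.
move=> fa gb; have := @is_deriveM _ _ f g x 1 a b fa gb.
by rewrite addrC /GRing.scale /= [_ * a]mulrC.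
Qed.

Lemma dvC c x : is_derive x (1 : R) (fun _ => c) 0.
Proof. exact: is_derive_cst. Qed.

Lemma dvI x : is_derive x (1 : R) (fun y => y) 1.
Proof. exact: is_derive_id. Qed.

Lemma dvZ c f x a : is_derive x (1 : R) f a -> is_derive x (1 : R) (fun y => c * f y) (c * a).
Proof. by move=> fa; have := dvM (dvC c x) fa; rewrite mul0r add0r. Qed.

Lemma dv_comp f g x a b : is_derive (g x) (1 : R) f a -> is_derive x (1 : R) g b ->
  is_derive x (1 : R) (fun y => f (g y)) (a * b).
Proof. exact: is_derive1_comp. Qed.

Lemma dvN f x a : is_derive x (1 : R) f a -> is_derive x (1 : R) (fun y => - f y) (- a).
Proof. by move=> fa; exact: is_deriveN. Qed.

Lemma dv_opp f x a : is_derive (- x) (1 : R) f a -> is_derive x (1 : R) (fun y => f (- y)) (- a).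
Proof.
move=> fa; have := dv_comp fa (dvN (dvI x)).
by rewrite mulrN1.
Qed.

Lemma dv_eq f x a b : is_derive x (1 : R) f a -> a = b -> is_derive x (1 : R) f b.
Proof. by move=> h <-. Qed.

Lemma dvX n f x a : is_derive x (1 : R) f a ->
  is_derive x (1 : R) (fun y => f y ^+ n) (n%:R * f x ^+ n.-1 * a).
Proof.
move=> fa; elim: n => [|n IH].
  rewrite mul0r mul0r (_ : (fun y => _) = fun=> 1); first exact: dvC.
  by apply/funext => y; rewrite expr0.
rewrite (_ : (fun y => _) = fun y => f y * f y ^+ n); last by apply/funext => y; rewrite exprS.
apply: dv_eq (dvM fa IH) _; case: n {IH} => [|n]; first by rewrite !mul0r mulr0 addr0 !expr0; ring.
by rewrite /= -!natr1 exprS; ring.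
Qed.

Lemma dv_exp f x a : is_derive x (1 : R) f a ->
  is_derive x (1 : R) (fun y => expR (f y)) (expR (f x) * a).
Proof. by move=> fa; apply: dv_comp. Qed.

Lemma dv_cont f x a : is_derive x (1 : R) f a -> {for x, continuous f}.
Proof.
by move=> h; apply/differentiable_continuous/derivable1_diffP/(@ex_derive _ _ _ _ _ _ _ h).
Qed.

Lemma ctC c : continuous (fun _ : R => c).
Proof. by move=> x; exact: cvg_cst. Qed.

Lemma ctI : continuous (fun x : R => x).
Proof. by move=> x; exact: cvg_id. Qed.

Lemma ctD f g : continuous f -> continuous g -> continuous (fun x => f x + g x).
Proof. by move=> cf cg x; apply: cvgD; [exact: cf|exact: cg]. Qed.

Lemma ctB f g : continuous f -> continuous g -> continuous (fun x => f x - g x).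
Proof. by move=> cf cg x; apply: cvgB; [exact: cf|exact: cg]. Qed.

Lemma ctM f g : continuous f -> continuous g -> continuous (fun x => f x * g x).
Proof. by move=> cf cg x; apply: cvgM; [exact: cf|exact: cg]. Qed.

Lemma ctN f : continuous f -> continuous (fun x => - f x).
Proof. by move=> cf x; apply: cvgN; exact: cf. Qed.

Lemma ct_comp f g : continuous f -> continuous g -> continuous (fun x => f (g x)).
Proof. by move=> cf cg x; apply: continuous_comp; [exact: cg|exact: cf]. Qed.

Lemma ct_opp f : continuous f -> continuous (fun x => f (- x)).
Proof. by move=> cf; apply: (@ct_comp f (fun x => - x)) => //; apply: ctN; exact: ctI. Qed.

Lemma ctX n f : continuous f -> continuous (fun x => f x ^+ n).
Proof. by move=> cf; apply: (@ct_comp (fun y => y ^+ n) f) => //; exact: exprn_continuous. Qed.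

Lemma ct_exp f : continuous f -> continuous (fun x => expR (f x)).
Proof. by move=> cf; apply: (@ct_comp expR f) => //; exact: continuous_expR. Qed.

(** The derivative is asked for in the open interval only: the formulas for Dunkl derivatives divide
    by x, and the interval will start at 0. *)
Lemma nincr_of_derive f (df : R -> R) (a b : R) : a <= b -> continuous f ->
  (forall x, a < x < b -> is_derive x (1 : R) f (df x)) ->
  (forall x, a < x < b -> df x <= 0) -> f b <= f a.
Proof.
move=> ab cf fd df0; apply: (@ler0_derive1_nincr _ f a b) => //.
- by move=> x; rewrite in_itv /= => /fd h; exact: (@ex_derive _ _ _ _ _ _ _ h).
- move=> x; rewrite in_itv /= => xab; rewrite derive1E.
  by have h := fd _ xab; rewrite derive_val df0.
- by apply: continuous_subspaceT.
Qed.

(** Comparison with B x^(j+1) / (j+1). The gain 1/(j+1) later keeps the cost of one Dunkl derivative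
    down to a factor 1 + 2k/(j+1). *)
Lemma derive_bound_Xn f (df : R -> R) (B : R) j : continuous f -> f 0 = 0 ->
  (forall x, 0 < x < 1 -> is_derive x (1 : R) f (df x)) ->
  (forall x, 0 < x < 1 -> `|df x| <= B * x ^+ j) -> `|f 1| <= B / j.+1%:R.
Proof.
move=> cf f0 fd dfB.
(* The sign s = 1 or s = -1 treats the upper and the lower bound together. *)
have key (s : R) : s ^+ 2 = 1 -> s * f 1 <= B / j.+1%:R.
  move=> s2; have cX : continuous (fun x : R => B / j.+1%:R * x ^+ j.+1).
    by apply: ctM; [exact: ctC|exact: ctX ctI].
  have := @nincr_of_derive (fun x => s * f x - B / j.+1%:R * x ^+ j.+1)
    (fun x => s * df x - B / j.+1%:R * (j.+1%:R * x ^+ j * 1)) 0 1 ler01.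
  rewrite f0 mulr0 expr0n mulr0 subrr expr1n mulr1 subr_le0; apply.
  - by apply: ctB => //; apply: ctM => //; exact: ctC.
  - move=> x x01; apply: dvB; first by apply: dvZ; exact: fd.
    by apply: dvZ; apply: (@dvX j.+1); exact: dvI.
  - move=> x x01; rewrite subr_le0 mulr1 mulrA divfK ?pnatr_eq0//.
    apply: le_trans (dfB _ x01); apply: le_trans (ler_norm _) _.
    rewrite normrM (_ : `|s| = 1) ?mul1r//.
    by apply/eqP; rewrite -sqr_norm_eq1 ?s2.
rewrite ler_norml; have := key 1; rewrite mul1r expr1n => -> //.
by have := key (-1); rewrite mulN1r sqrrN expr1n => /(_ erefl) h; rewrite andbT lerNl.
Qed.

(** Ratio test with an explicit constant: the sum dominates |a i| / q^i for i <= N, and from there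
    on each step costs at most q. *)
Lemma ratio_bound (a : nat -> R) (q : R) N : 0 < q ->
  (forall n, (N <= n)%N -> a n.+1 <= q * a n) -> exists C : R, 0 < C /\ forall n, a n <= C * q ^+ n.
Proof.
move=> q0 Ha; exists (\sum_(i < N.+1) `|a i| / q ^+ i + 1).
have S0 : 0 <= \sum_(i < N.+1) `|a i| / q ^+ i.
  by apply: sumr_ge0 => i _; rewrite mulr_ge0// invr_ge0 exprn_ge0// ltW.
split=> [|n]; first by rewrite ltr_wpDl.
have [nN|] := leqP n N.
  have : `|a n| / q ^+ n <= \sum_(i < N.+1) `|a i| / q ^+ i + 1.
    rewrite ler_wpDr// (bigD1 (Ordinal (nN : (n < N.+1)%N)))//= lerDl.
    by apply: sumr_ge0 => i _; rewrite mulr_ge0// invr_ge0 exprn_ge0// ltW.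
  by rewrite ler_pdivrMr ?exprn_gt0//; apply: le_trans; exact: ler_norm.
elim: n => // n IH; rewrite ltnS leq_eqVlt => /orP[/eqP Nn|Nn]; last first.
  apply: (le_trans (Ha _ (ltnW Nn))).
  by rewrite exprS mulrCA ler_wpM2l ?(ltW q0)// IH.
have h : `|a N| / q ^+ N <= \sum_(i < N.+1) `|a i| / q ^+ i + 1.
  by rewrite ler_wpDr// big_ord_recr/= lerDr sumr_ge0// => i _; rewrite mulr_ge0// invr_ge0 exprn_ge0// ltW.
move: h; rewrite ler_pdivrMr ?exprn_gt0// => h.
rewrite -Nn; apply: (le_trans (Ha _ (leqnn _))).
rewrite exprS mulrCA ler_wpM2l ?(ltW q0)//.
by apply: le_trans h; exact: ler_norm.
Qed.

End derive_rules.

(** * The Dunkl operator on power series *)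

Section dunkl_coefficients.
Context {R : realType} (k : R) (hk : 0 <= k).
Implicit Types (c d : nat -> R) (x y a : R) (n j : nat).

(* T_k x^n = theta_n x^(n-1). *)
Definition theta n : R := n%:R + k * (1 - (-1) ^+ n).

(** The Dunkl factorial: T_k^n x^n = [gam n]. *)
Definition gam n : R := \prod_(i < n) theta i.+1.

(** This sign changes by (-1)^n from n to n + 1, which is what makes T_k act on cas as the
    reflection ([kapS]). *)
Definition csgn n : R := (-1) ^+ 'C(n, 2).

(* The coefficients of T_k (fs c). *)
Definition Tc c n : R := theta n.+1 * c n.+1.

(** Coefficients of the Dunkl exponential, which T_k fixes and which is 1 at 0. *)
Definition ecoef n : R := (gam n)^-1.

(* The signs [csgn] are + + - - + + - - ..., as in the series of cos + sin. *)
Definition kap n : R := csgn n / gam n.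

Lemma sgnP n : (-1) ^+ n = 1 :> R \/ (-1) ^+ n = -1 :> R.
Proof. by rewrite -signr_odd; case: (odd n); [right|left]. Qed.

Lemma theta_ge n : n%:R <= theta n.
Proof. by rewrite lerDl mulr_ge0// subr_ge0; case: (sgnP n) => ->; lra. Qed.

Lemma theta_le n : theta n <= n%:R + 2 * k.
Proof. by rewrite /theta; case: (sgnP n) => ->; move: hk; lra. Qed.

Lemma thetaS_gt0 n : 0 < theta n.+1.
Proof. exact: lt_le_trans (theta_ge _). Qed.

Lemma theta0 : theta 0 = 0.
Proof. by rewrite /theta expr0 subrr mulr0 addr0. Qed.

Lemma gamS n : gam n.+1 = gam n * theta n.+1.
Proof. by rewrite /gam big_ord_recr. Qed.

Lemma gam0 : gam 0 = 1.
Proof. by rewrite /gam big_ord0. Qed.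

Lemma gam_ge_fact n : n`!%:R <= gam n.
Proof.
elim: n => [|n IH]; first by rewrite gam0.
by rewrite gamS factS mulnC natrM ler_pM// theta_ge.
Qed.

Lemma gam_gt0 n : 0 < gam n.
Proof. by apply: lt_le_trans (gam_ge_fact n); rewrite ltr0n fact_gt0. Qed.

Lemma gam_neq0 n : gam n != 0.
Proof. by rewrite gt_eqF// gam_gt0. Qed.

Lemma theta_neq0 n : theta n.+1 != 0.
Proof. by rewrite gt_eqF// thetaS_gt0. Qed.

Lemma csgnS n : csgn n.+1 = (-1) ^+ n * csgn n.
Proof. by rewrite /csgn binS bin1 exprD mulrC. Qed.

Lemma csgn_norm n : `|csgn n| = 1.
Proof. by rewrite normrX normrN1 expr1n. Qed.

Lemma ecoef_le n : `|ecoef n| <= (n`!%:R)^-1.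
Proof.
rewrite ger0_norm ?invr_ge0 ?(ltW (gam_gt0 _))//.
by rewrite lef_pV2 ?posrE ?gam_gt0 ?ltr0n ?fact_gt0// gam_ge_fact.
Qed.

Lemma ent_ecoef : ent ecoef.
Proof.
apply: (ent_le _ ent_fact) => n; apply: (le_trans (ecoef_le n)); exact: ler_norm.
Qed.

Lemma ent_kap : ent kap.
Proof. by apply: (ent_le _ ent_ecoef) => n; rewrite /kap normrM csgn_norm mul1r. Qed.

Lemma kap0 : kap 0 = 1.
Proof. by rewrite /kap gam0 /csgn bin0n expr0 divr1. Qed.

Lemma ecoef0 : ecoef 0 = 1.
Proof. by rewrite /ecoef gam0 invr1. Qed.

Lemma kapS n : theta n.+1 * kap n.+1 = (-1) ^+ n * kap n.
Proof.
by rewrite /kap csgnS gamS; field; rewrite theta_neq0 gam_neq0.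
Qed.

Lemma Tc_kap : Tc kap =1 calt kap.
Proof. by move=> n; rewrite /Tc kapS. Qed.

Lemma Tc_ecoef : Tc ecoef =1 ecoef.
Proof. by move=> n; rewrite /Tc /ecoef gamS; field; rewrite theta_neq0 gam_neq0. Qed.

Lemma ent_Tc c : ent c -> ent (Tc c).
Proof.
move=> ec; apply: (@ent_poly _ c (fun n => theta n.+1) (1 + 2 * k)) => // n.
rewrite ger0_norm ?(ltW (thetaS_gt0 _))//.
apply: (le_trans (theta_le _)); rewrite [leRHS]mulrDl mul1r; apply: lerD; first exact: succn_le_exp2.
by rewrite ler_peMr ?mulr_ge0// exprn_ege1// ler1n.
Qed.

Lemma ent_iterT n c : ent c -> ent (iter n Tc c).
Proof. by move=> ec; elim: n => //= n; exact: ent_Tc. Qed.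

Lemma ent_iterd n c : ent c -> ent (iter n (@pseries_diffs R) c).
Proof. by move=> ec; elim: n => //= n; exact: ent_diffs. Qed.

(** Coefficients of (f(x) - f(-x)) / x; as a series it needs no exception at x = 0. *)
Definition cquot c n : R := (1 - (-1) ^+ n.+1) * c n.+1.

Lemma ent_cquot c : ent c -> ent (cquot c).
Proof.
move=> ec; apply: (@ent_poly _ c (fun n => 1 - (-1) ^+ n.+1) 2) => // n.
apply: (le_trans (ler_normB _ _)); rewrite normr1 normrX normrN1 expr1n.
by have : 1 <= 2 ^+ n :> R by [rewrite exprn_ege1// ler1n]; lra.
Qed.

Lemma cshift_cquot c n : cshift (cquot c) n = c n - calt c n.
Proof.
by case: n => [|n]; rewrite /cshift /cquot /calt ?expr0 ?mul1r ?subrr// mulrBl mul1r.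
Qed.

Lemma fs_cquot c x : ent c -> x * fs (cquot c) x = fs c x - fs c (- x).
Proof.
move=> ec; rewrite -fs_shift; last exact: ent_cquot.
rewrite (eq_fs _ (cshift_cquot c)) fsB ?fs_alt//; exact: ent_alt.
Qed.

Lemma TcE c n : Tc c n = pseries_diffs c n + k * cquot c n.
Proof. by rewrite /Tc /theta /pseries_diffs /cquot; ring. Qed.

Lemma fs_Tc c x : ent c -> x != 0 ->
  fs (Tc c) x = fs (pseries_diffs c) x + k * (fs c x - fs c (- x)) / x.
Proof.
move=> ec x0; rewrite (eq_fs _ (TcE c)) fsD ?fsZ//.
- by rewrite -fs_cquot//; congr (_ + _); field.
- exact: ent_cquot.
- exact: ent_diffs.
- by apply: entZ; exact: ent_cquot.
Qed.

Lemma is_derive_fsT c x : ent c -> x != 0 ->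
  is_derive x (1 : R) (fs c) (fs (Tc c) x - k * (fs c x - fs c (- x)) / x).
Proof.
by move=> ec x0; apply: dv_eq (is_derive_fs x ec) _; rewrite fs_Tc// addrK.
Qed.

Lemma Tc_dil a c : Tc (cdil a c) =1 cdil a (fun n => a * Tc c n).
Proof. by move=> n; rewrite /Tc /cdil exprS; ring. Qed.

Lemma fs_Tdil a c x : ent c -> fs (Tc (cdil a c)) x = a * fs (Tc c) (a * x).
Proof.
by move=> ec; rewrite (eq_fs _ (Tc_dil a c)) fs_dil fsZ//; exact: ent_Tc.
Qed.

Lemma Tc_alt c : Tc (calt c) =1 (fun n => - calt (Tc c) n).
Proof. by move=> n; rewrite /Tc /calt exprS; ring. Qed.

Lemma iter_diffsE j c n : iter j (@pseries_diffs R) c n = ((n + j) ^_ j)%:R * c (n + j)%N.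
Proof.
elim: j n => [|j IH] n; first by rewrite addn0 ffactn0 mul1r.
rewrite iterS /pseries_diffs IH addSn -addnS ffactnSr mulnC natrM mulrA.
by congr (_%:R * _ * _); lia.
Qed.

(** Leibniz's rule for the derivatives of x q(x) = f(x) - f(-x). *)
Lemma iter_diffs_cquot j c n :
  iter j.+1 (@pseries_diffs R) (fun m => c m - calt c m) n =
  j.+1%:R * iter j (@pseries_diffs R) (cquot c) n +
  cshift (iter j.+1 (@pseries_diffs R) (cquot c)) n.
Proof.
rewrite iter_diffsE [X in _ = _ * X + _]iter_diffsE.
have -> : cshift (iter j.+1 (@pseries_diffs R) (cquot c)) n =
    ((n + j) ^_ j * n)%:R * cquot c (n + j)%N.
  case: n => [|n]; first by rewrite muln0 mul0r.
  rewrite /cshift iter_diffsE ffactnSr; congr ((_ * _)%:R * cquot c _); last by lia.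
    by congr (_ ^_ _); lia.
  by lia.
rewrite addnS ffactSS /cquot /calt !natrM -addnS natrD; ring.
Qed.

Lemma iter_diffs_alt j c n :
  iter j (@pseries_diffs R) (calt c) n = (-1) ^+ j * calt (iter j (@pseries_diffs R) c) n.
Proof. by rewrite /calt !iter_diffsE exprD; ring. Qed.

(** With q(x) = (f(x) - f(-x)) / x, the function t^(j+1) q^(j)(t x) has as t-derivative t^j times
    the derivative of order j + 1 of f(y) - f(-y) at y = t x, which is of size 2 B t^j;
    [derive_bound_Xn] integrates this. *)
Lemma cquot_deriv_bound j c (B : R) : ent c ->
  (forall x, `|fs (iter j.+1 (@pseries_diffs R) c) x| <= B) ->
  forall x, `|fs (iter j (@pseries_diffs R) (cquot c)) x| <= 2 * B / j.+1%:R.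
Proof.
move=> ec HB x.
set q := iter j _ (cquot c); have eq : ent q by apply: ent_iterd; exact: ent_cquot.
pose f t := t ^+ j.+1 * fs q (t * x).
have -> : fs q x = f 1 by rewrite /f expr1n !mul1r.
have fd t : is_derive t (1 : R) f
    (j.+1%:R * t ^+ j * 1 * fs q (t * x) + t ^+ j.+1 * (fs (pseries_diffs q) (t * x) * x)).
  apply: dvM; first by apply: (@dvX R j.+1); exact: dvI.
  apply: (@dv_comp _ (fs q) (fun t => t * x)); first exact: is_derive_fs.
  by apply: dv_eq (dvM (dvI _) (dvC _ _)) _; rewrite mul1r mulr0 addr0.
apply: (@derive_bound_Xn _ f (fun t => j.+1%:R * t ^+ j * 1 * fs q (t * x) +
  t ^+ j.+1 * (fs (pseries_diffs q) (t * x) * x)) (2 * B) j).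
- by move=> t; exact: dv_cont (fd t).
- by rewrite /f exprS !mul0r.
- move=> t /andP[t0 _].
  have -> : j.+1%:R * t ^+ j * 1 * fs q (t * x) + t ^+ j.+1 * (fs (pseries_diffs q) (t * x) * x) =
     t ^+ j * fs (iter j.+1 (@pseries_diffs R) (fun m => c m - calt c m)) (t * x).
    rewrite (eq_fs _ (iter_diffs_cquot j c)) fsD; last 2 first.
    - exact: entZ.
    - by apply: ent_shift; apply: ent_diffs.
    by rewrite fsZ// fs_shift; [rewrite exprS -/q /=; ring|exact: ent_diffs].
  rewrite normrM mulrC (ger0_norm (exprn_ge0 _ (ltW t0))) ler_wpM2r ?exprn_ge0 ?(ltW t0)//.
  set y := t * x.
  have -> : fs (iter j.+1 (@pseries_diffs R) (fun m => c m - calt c m)) y =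
    fs (iter j.+1 (@pseries_diffs R) c) y -
    (-1) ^+ j.+1 * fs (iter j.+1 (@pseries_diffs R) c) (- y).
    rewrite -fs_alt -fsZ; last by apply: ent_alt; exact: ent_iterd.
    rewrite -fsB; [|exact: ent_iterd|by apply/entZ/ent_alt/ent_iterd].
    by apply: eq_fs => n; rewrite -iter_diffs_alt !iter_diffsE; ring.
  apply: (le_trans (ler_normB _ _)); rewrite normrM normrX normrN1 expr1n mul1r.
  by have := HB y; have := HB (- y); lra.
Qed.

Lemma Tc_deriv_bound j c (B : R) : ent c ->
  (forall x, `|fs (iter j.+1 (@pseries_diffs R) c) x| <= B) ->
  forall x, `|fs (iter j (@pseries_diffs R) (Tc c)) x| <= (1 + 2 * k / j.+1%:R) * B.
Proof.
move=> ec HB x.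
have -> : fs (iter j (@pseries_diffs R) (Tc c)) x =
  fs (iter j.+1 (@pseries_diffs R) c) x + k * fs (iter j (@pseries_diffs R) (cquot c)) x.
  rewrite -fsZ; last by apply: ent_iterd; exact: ent_cquot.
  rewrite -fsD; [|exact: ent_iterd|by apply/entZ/ent_iterd/ent_cquot].
  by apply: eq_fs => n; rewrite iterSr !iter_diffsE TcE; ring.
apply: (le_trans (ler_normD _ _)); rewrite normrM (ger0_norm hk).
have := HB x; have := ler_wpM2l hk (cquot_deriv_bound ec HB x) => /[swap].
rewrite [(1 + _) * B]mulrDl mul1r (_ : 2 * k / j.+1%:R * B = k * (2 * B / j.+1%:R)); last by ring.
by move=> h1 h2; apply: lerD.
Qed.

(** Each T_k uses up one ordinary derivative and costs a factor 1 + 2k/(j+1). Over n steps these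
    factors grow only polynomially, so the exponential type is not affected. *)
Lemma iterT_deriv_bound c (B : nat -> R) : ent c ->
  (forall j x, `|fs (iter j (@pseries_diffs R) c) x| <= B j) ->
  forall n j x, `|fs (iter j (@pseries_diffs R) (iter n Tc c)) x| <=
     (\prod_(i < n) (1 + 2 * k / (j + i).+1%:R)) * B (j + n)%N.
Proof.
move=> ec HB; elim=> [|n IH] j x; first by rewrite big_ord0 mul1r addn0.
rewrite iterS big_ord_recl addn0 -mulrA.
apply: Tc_deriv_bound => [|y]; first exact: ent_iterT.
apply: le_trans (IH j.+1 y) _; rewrite addSnnS ler_wpM2r//.
  by apply: le_trans (HB _ 0).
rewrite le_eqVlt; apply/orP; left; apply/eqP.
by apply: eq_bigr => i _; rewrite /= /bump /= addSnnS.
Qed.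

(* The real-variable counterpart of exponential type r with decay |x|^(-i). *)
Definition Tbdd i c (r : R) := forall r' : R, r < r' ->
  exists C : R, 0 < C /\ forall n x, `|x| ^+ i * `|fs (iter n Tc c) x| <= C * r' ^+ n.

Lemma Tbdd_derivs c (r : R) : 0 < r -> ent c ->
  (forall r' : R, r < r' -> exists C : R, 0 < C /\
    forall j x, `|fs (iter j (@pseries_diffs R) c) x| <= C * r' ^+ j) -> Tbdd 0 c r.
Proof.
move=> r0 ec H r' rr'.
have [C [C0 HC]] := H ((r + r') / 2) ltac:(lra).
pose a n : R := \prod_(i < n) (1 + 2 * k / i.+1%:R) * ((r + r') / 2) ^+ n.
have [N HN] : exists N : nat, forall n, (N <= n)%N -> a n.+1 <= r' * a n.
  (* The derivatives are taken at the midpoint radius; the room e left up to r' absorbs the factor 1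
     + 2k/(n+1) as soon as n exceeds 2k/e. *)
  pose e := r' / ((r + r') / 2) - 1.
  have e0 : 0 < e by rewrite subr_gt0 ltr_pdivlMr; lra.
  exists (Num.truncn (2 * k / e)).+1 => n Nn; rewrite /a big_ord_recr exprS/=.
  set P := \prod_(_ < _) _; set S := _ ^+ n.
  rewrite (_ : P * _ * _ = (1 + 2 * k / n.+1%:R) * ((r + r') / 2) * (P * S)); last by ring.
  apply: ler_wpM2r.
    rewrite mulr_ge0 ?exprn_ge0//; last by lra.
    by apply: prodr_ge0 => i _; rewrite addr_ge0// divr_ge0// mulr_ge0.
  rewrite -ler_pdivlMr; last by lra.
  rewrite -lerBrDl -/e.
  have : 2 * k / e <= n.+1%:R.
    by apply: ltW; apply: lt_le_trans (truncnS_gt _) _; rewrite ler_nat; exact: ltnW.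
  by rewrite !ler_pdivrMr// [e * _]mulrC.
have [D [D0 HD]] := ratio_bound (lt_trans r0 rr') HN.
exists (C * D); split=> [|n x]; first exact: mulr_gt0.
rewrite expr0 mul1r; have := @iterT_deriv_bound c _ ec HC n 0 x.
move/le_trans; apply; rewrite add0n.
have -> : \prod_(i < n) (1 + 2 * k / (0 + i).+1%:R) * (C * ((r + r') / 2) ^+ n) = C * a n.
  by rewrite /a mulrCA; congr (_ * (_ * _)).
by rewrite -mulrA ler_wpM2l// ltW.
Qed.

(** The commutation relation T x - x T = 1 + 2k s, where s is the reflection. *)
Lemma Tc_shift c j : Tc (cshift c) j = cshift (Tc c) j + c j + 2 * k * calt c j.
Proof.
rewrite /Tc /cshift /calt; case: j => [|j]; rewrite /theta; last by rewrite !exprS; ring.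
by rewrite !(expr1,expr0); ring.
Qed.

(** As T and the reflection anticommute, the reflection terms of successive commutators cancel in
    pairs: at most one is left, according to the parity of n. *)
Lemma iterT_shift n c j : iter n.+1 Tc (cshift c) j =
  cshift (iter n.+1 Tc c) j + n.+1%:R * iter n Tc c j + k * (1 + (-1) ^+ n) * calt (iter n Tc c) j.
Proof.
elim: n c j => [|n IH] c j; first by rewrite /= Tc_shift expr0; ring.
rewrite iterS {1}/Tc IH -[n.+2%:R]natr1.
have -> : theta j.+1 * (cshift (iter n.+1 Tc c) j.+1 + n.+1%:R * iter n Tc c j.+1 +
     k * (1 + (-1) ^+ n) * calt (iter n Tc c) j.+1) =
   Tc (cshift (iter n.+1 Tc c)) j + n.+1%:R * iter n.+1 Tc c j + k * (1 + (-1) ^+ n) * Tc (calt (iter n Tc c)) j.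
  by rewrite /Tc /=; ring.
by rewrite Tc_shift Tc_alt exprS /=; ring.
Qed.

Lemma fs_iterT_shift n c x : ent c -> x * fs (iter n.+1 Tc c) x =
  fs (iter n.+1 Tc (cshift c)) x - n.+1%:R * fs (iter n Tc c) x
   - k * (1 + (-1) ^+ n) * fs (iter n Tc c) (- x).
Proof.
move=> ec; have e1 := ent_iterT n ec; have e2 := ent_iterT n.+1 ec.
rewrite (eq_fs _ (iterT_shift n c)) fsD ?fsD ?fs_shift ?fsZ ?fs_alt//.
- by ring.
- exact: ent_alt.
- exact: ent_shift.
- exact: entZ.
- by apply: entD; [exact: ent_shift|exact: entZ].
- by apply: entZ; exact: ent_alt.
Qed.

Lemma linear_geometric_bound (r r' A : R) : 0 < r -> r < r' ->
  exists C : R, 0 < C /\ forall n, (n%:R + A) * r ^+ n <= C * r' ^+ n.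
Proof.
move=> r0 rr'.
pose B : R := `|A| + 1; have B0 : 0 < B by rewrite ltr_wpDl.
have [N HN] : exists N : nat, forall n, (N <= n)%N ->
    (n.+1%:R + B) * r ^+ n.+1 <= r' * ((n%:R + B) * r ^+ n).
  exists (Num.truncn (r / (r' - r))).+1 => n Nn.
  rewrite exprS !mulrA; apply: ler_wpM2r; first by rewrite exprn_ge0 ?(ltW r0).
  rewrite [r' * _]mulrC; have : r / (r' - r) <= n%:R.
    apply: ltW; apply: lt_le_trans (truncnS_gt _) _; rewrite ler_nat; exact: leq_trans Nn _.
  rewrite ler_pdivrMr ?subr_gt0// -natr1; nra.
have [C [C0 HC]] := @ratio_bound _ (fun n => (n%:R + B) * r ^+ n) r' N (lt_trans r0 rr') HN.
exists C; split=> // n; apply: le_trans (HC n).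
rewrite ler_wpM2r ?exprn_ge0 ?(ltW r0)// lerD2l /B.
by have := ler_norm A; lra.
Qed.

(** The commutator expresses x T^(n+1) f through T^(n+1)(x f) and the values of T^n f at x and -x.
    The factor n + 1 in front of the latter is absorbed between the radii (r + r')/2 and r'. *)
Lemma Tbdd_shift i c (r : R) : 0 < r -> ent c -> Tbdd i c r -> Tbdd i (cshift c) r -> Tbdd i.+1 c r.
Proof.
move=> r0 ec H1 H2 r' rr'.
have [C1 [C10 HC1]] := H1 ((r + r') / 2) ltac:(lra).
have [C2 [C20 HC2]] := H2 r' rr'.
have [D [D0 HD]] := @linear_geometric_bound ((r + r') / 2) r' (1 + 2 * k) ltac:(lra) ltac:(lra).
have r'0 : 0 < r' by lra.
exists (C2 * (1 + r') + C1 * D * (1 + r'^-1)); split.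
  by rewrite addr_gt0 ?mulr_gt0 ?addr_gt0 ?invr_gt0.
have E (a b : R) : 0 < a -> 0 < b -> a <= a + b by lra.
(* The commutator formula starts at order 1; at order 0, x f is [cshift c] itself. *)
move=> [|n] x.
  have h := HC2 0%N x; move: h; rewrite /= fs_shift// normrM expr0 !mulr1.
  rewrite exprSr -mulrA => h; apply: (le_trans h).
  apply: (@le_trans _ _ (C2 * (1 + r'))).
    by rewrite ler_peMr ?(ltW C20)//; lra.
  by rewrite lerDl !mulr_ge0 ?addr_ge0 ?invr_ge0 ?(ltW C10) ?(ltW D0)// ltW.
rewrite exprSr -mulrA -normrM fs_iterT_shift//.
have h2 := HC2 n.+1 x.
have h1 := HC1 n x; have h1' := HC1 n (- x); rewrite normrN in h1'.
set p := `|x| ^+ i in h2 h1 h1' *; have p0 : 0 <= p by exact: exprn_ge0.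
apply: (@le_trans _ _ (p * (`|fs (iter n.+1 Tc (cshift c)) x| + n.+1%:R * `|fs (iter n Tc c) x| +
    2 * k * `|fs (iter n Tc c) (- x)|))).
  rewrite ler_wpM2l//; apply: (le_trans (ler_normB _ _)); apply: lerD; last first.
    rewrite !normrM (ger0_norm hk) -mulrA mulrCA mulrA ler_wpM2r//.
    by case: (sgnP n) => ->; rewrite ?subrr ?normr0 ?(ger0_norm (addr_ge0 ler01 ler01)); move: hk; lra.
  by apply: (le_trans (ler_normB _ _)); rewrite normrM normr_nat.
have h3 : (n%:R + (1 + 2 * k)) * (C1 * ((r + r') / 2) ^+ n) <= C1 * D * (r'^-1 * r' ^+ n.+1).
  by rewrite exprS mulKf ?gt_eqF// mulrCA -mulrA ler_wpM2l ?(ltW C10)// HD.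
have h4 : C2 * r' ^+ n.+1 <= C2 * (1 + r') * r' ^+ n.+1.
  by rewrite ler_wpM2r ?exprn_ge0 ?(ltW r'0)// ler_peMr ?(ltW C20)//; lra.
have h5 : C1 * D * (r'^-1 * r' ^+ n.+1) <= C1 * D * (1 + r'^-1) * r' ^+ n.+1.
  rewrite mulrA ler_wpM2r ?exprn_ge0 ?(ltW r'0)// ler_wpM2l ?mulr_ge0 ?(ltW C10) ?(ltW D0)//; lra.
have n0 : 0 <= n%:R :> R by [].
rewrite [leRHS]mulrDl; apply: le_trans (lerD h4 h5); apply: le_trans (lerD h2 h3).
rewrite -natr1 !mulrDr -addrA lerD2l.
have := ler_wpM2l hk h1'; have := ler_wpM2l n0 h1; move: h1.
set Q := C1 * _; set F := `|fs _ x|; set G := `|fs _ (- x)|; rewrite mulrDl => a1 a2 a3; nra.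
Qed.

(* Gronwall for the sum of the squares of f1 and f2 at x and -x: the reflection
   terms have a favourable sign because 0 <= k. *)
Lemma energy (al be : R) (f1 f2 : R -> R) : continuous f1 -> continuous f2 ->
  (forall x, x != 0 -> is_derive x (1 : R) f1 (al * f1 x - be * f2 x - k * (f1 x - f1 (- x)) / x)) ->
  (forall x, x != 0 -> is_derive x (1 : R) f2 (be * f1 x + al * f2 x - k * (f2 x - f2 (- x)) / x)) ->
  forall x, f1 x ^+ 2 + f2 x ^+ 2 <= 2 * expR (2 * `|al| * `|x|) * (f1 0 ^+ 2 + f2 0 ^+ 2).
Proof.
move=> c1 c2 d1 d2.
have key x : 0 <= x -> f1 x ^+ 2 + f2 x ^+ 2 + (f1 (- x) ^+ 2 + f2 (- x) ^+ 2) <=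
    2 * expR (2 * `|al| * `|x|) * (f1 0 ^+ 2 + f2 0 ^+ 2).
  move=> x0.
  pose N y := f1 y * f1 y + f2 y * f2 y + (f1 (- y) * f1 (- y) + f2 (- y) * f2 (- y)).
  pose dN y := 2 * al * (f1 y ^+ 2 + f2 y ^+ 2 - (f1 (- y) ^+ 2 + f2 (- y) ^+ 2)) -
     2 * k / y * ((f1 y - f1 (- y)) ^+ 2 + (f2 y - f2 (- y)) ^+ 2).
  have NE y : N y = f1 y ^+ 2 + f2 y ^+ 2 + (f1 (- y) ^+ 2 + f2 (- y) ^+ 2) by rewrite /N; ring.
  have Nd y : y != 0 -> is_derive y (1 : R) N (dN y).
    move=> y0; have y0' : - y != 0 by rewrite oppr_eq0.
    have e1 := d1 _ y0; have e2 := d2 _ y0.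
    have e1' := dv_opp (d1 _ y0'); have e2' := dv_opp (d2 _ y0').
    apply: dv_eq (dvD (dvD (dvM e1 e1) (dvM e2 e2)) (dvD (dvM e1' e1') (dvM e2' e2'))) _.
    by rewrite /dN opprK; field.
  have cN : continuous N.
    by apply: ctD; apply: ctD; apply: ctM => //; exact: ct_opp.
  pose G y := expR (- (2 * `|al|) * y) * N y.
  have : G x <= G 0.
    apply: (@nincr_of_derive _ G (fun y => (expR (- (2 * `|al|) * y) * (- (2 * `|al|) * 1)) * N y +
       expR (- (2 * `|al|) * y) * dN y) _ _ x0).
    - by apply: ctM => //; apply: ct_exp; apply: ctM; [exact: ctC|exact: ctI].
    - move=> y /andP[y0 _]; have h := Nd y (lt0r_neq0 y0).
      by apply: dvM => //; apply: dv_exp; apply: dvZ; exact: dvI.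
    - move=> y /andP[y0 _]; rewrite mulr1 -mulrA -mulrDr.
      rewrite pmulr_rle0 ?expR_gt0// NE /dN.
      set p := f1 y ^+ 2 + f2 y ^+ 2; set q := f1 (- y) ^+ 2 + f2 (- y) ^+ 2.
      have p0 : 0 <= p by rewrite addr_ge0 ?sqr_ge0.
      have q0 : 0 <= q by rewrite addr_ge0 ?sqr_ge0.
      have : 0 <= 2 * k / y * ((f1 y - f1 (- y)) ^+ 2 + (f2 y - f2 (- y)) ^+ 2).
        by rewrite !mulr_ge0 ?invr_ge0 ?addr_ge0 ?sqr_ge0// ltW.
      have := ler_norm al; have := ler_norm (- al); rewrite normrN; nra.
  rewrite /G mulr0 expR0 mul1r !NE oppr0 mulNr expRN.
  by rewrite -ler_pdivlMl ?invr_gt0 ?expR_gt0// invrK (ger0_norm x0); lra.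
move=> x; case: (leP 0 x) => [x0|x0].
  by apply: le_trans (key x x0); rewrite lerDl addr_ge0 ?sqr_ge0.
have := key (- x); rewrite oppr_ge0 => /(_ (ltW x0)); rewrite opprK normrN; apply: le_trans.
by rewrite lerDr addr_ge0 ?sqr_ge0.
Qed.

(** In complex terms T(c + i d) = (al + i be)(c + i d): only the real part of the eigenvalue lets
    the function grow. *)
Lemma energy_fs (al be : R) c d : ent c -> ent d ->
  (forall n, Tc c n = al * c n - be * d n) -> (forall n, Tc d n = be * c n + al * d n) ->
  forall x, fs c x ^+ 2 + fs d x ^+ 2 <= 2 * expR (2 * `|al| * `|x|) * (c 0%N ^+ 2 + d 0%N ^+ 2).
Proof.
move=> ec ed hc hd x; rewrite -!fs0; apply: (@energy al be (fs c) (fs d)).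
- exact: continuous_fs.
- exact: continuous_fs.
- move=> y y0; apply: dv_eq (is_derive_fsT ec y0) _.
  by rewrite (eq_fs _ hc) fsB ?fsZ//; exact: entZ.
- move=> y y0; apply: dv_eq (is_derive_fsT ed y0) _.
  by rewrite (eq_fs _ hd) fsD ?fsZ//; exact: entZ.
Qed.

Definition cas x := fs kap x.

(** T_k rotates the even part u and the odd part v of cas: T u = -v and T v = u. The energy
    inequality with al = 0 bounds u^2 + v^2 by 2, and (u + v)^2 <= 2 (u^2 + v^2). *)
Lemma cas_bound x : `|cas x| <= 2.
Proof.
have h : cas x ^+ 2 <= 4.
  have := @energy_fs 0 1 (fun n => (kap n + calt kap n) / 2) (fun n => (kap n - calt kap n) / 2).
  have ea := ent_alt ent_kap.
  have e1 : ent (fun n => (kap n + calt kap n) / 2).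
    by apply: (eq_ent _ (entZ 2^-1 (entD ent_kap ea))) => n; rewrite mulrC.
  have e2 : ent (fun n => (kap n - calt kap n) / 2).
    by apply: (eq_ent _ (entZ 2^-1 (entB ent_kap ea))) => n; rewrite mulrC.
  move=> /(_ e1 e2) /(_ _ _ x) H.
  have h1 n : kap n = (-1) ^+ n * theta n.+1 * kap n.+1.
    by rewrite -mulrA kapS mulrA -exprMn mulrNN mul1r expr1n mul1r.
  have {}H := H ltac:(move=> n; rewrite /Tc /calt (h1 n) exprS; case: (sgnP n) => ->; field)
               ltac:(move=> n; rewrite /Tc /calt (h1 n) exprS; case: (sgnP n) => ->; field).
  have E : cas x = fs (fun n => (kap n + calt kap n) / 2) x + fs (fun n => (kap n - calt kap n) / 2) x.
    by rewrite -fsD//; apply: eq_fs => n; field.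
  move: H; rewrite normr0 mulr0 mul0r expR0 /calt expr0 mul1r kap0 subrr mul0r expr0n addr0 E.
  set u := fs _ x; set v := fs _ x; have := sqr_ge0 (u - v); nra.
rewrite -[2%R]ger0_norm// -ler_sqr ?nnegrE// -!normrX; rewrite !ger0_norm ?sqr_ge0//.
by apply: le_trans h _; lra.
Qed.

End dunkl_coefficients.

(** * Integration against |x|^(2k) *)

Section real_integrals.
Context d (T : measurableType d) {R : realType} (mu : {measure set T -> \bar R}).
Implicit Types (f g h : T -> R).

Definition ibl f := mu.-integrable setT (EFin \o f).

Lemma ibl_meas f : ibl f -> measurable_fun setT f.
Proof. by move=> /measurable_int /measurable_EFinP. Qed.

Lemma iblP f : measurable_fun setT f -> (\int[mu]_x `|f x|%:E < +oo)%E -> ibl f.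
Proof. by move=> mf fi; apply/integrableP; split=> //; exact/measurable_EFinP. Qed.

Lemma iblD f g : ibl f -> ibl g -> ibl (fun x => f x + g x).
Proof.
move=> fi gi; have := @integrableD _ _ _ mu setT measurableT _ _ fi gi.
by apply: eq_integrable => // x _ /=; rewrite EFinD.
Qed.

Lemma iblZ (c : R) f : ibl f -> ibl (fun x => c * f x).
Proof.
move=> fi; have := @integrableZl _ _ _ mu setT measurableT c _ fi.
by apply: eq_integrable => // x _ /=; rewrite EFinM.
Qed.

Lemma iblN f : ibl f -> ibl (fun x => - f x).
Proof. by move=> /(iblZ (-1)); apply: eq_integrable => // x _ /=; rewrite mulN1r. Qed.

Lemma iblB f g : ibl f -> ibl g -> ibl (fun x => f x - g x).
Proof. by move=> fi gi; apply: iblD => //; exact: iblN. Qed.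

Lemma ibl_le f g : measurable_fun setT f -> ibl g -> (forall x, `|f x| <= g x) -> ibl f.
Proof.
move=> mf gi fg; apply: (@le_integrable _ _ _ mu setT measurableT _ (EFin \o g)) => //.
- exact/measurable_EFinP.
- by move=> x _ /=; rewrite lee_fin; apply: le_trans (fg x) _; exact: ler_norm.
Qed.

Lemma ibl_norm f : ibl f -> ibl (fun x => `|f x|).
Proof.
move=> fi; apply: (@ibl_le _ (fun x => `|f x|)); last by move=> x; rewrite normr_id.
  by apply: measurableT_comp => //; exact: ibl_meas.
exact: (@integrable_abse _ _ _ mu setT (EFin \o f) fi).
Qed.

Lemma ibl_eq f g : f =1 g -> ibl f -> ibl g.
Proof. by move=> /funext ->. Qed.

Lemma ibl_leN f g : measurable_fun setT f -> ibl g -> (forall x, `|f x| <= `|g x|) -> ibl f.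
Proof. by move=> mf gi fg; exact: (ibl_le mf (ibl_norm gi)). Qed.

Lemma ibl_bM (C : R) f g : measurable_fun setT f -> ibl g -> (forall x, `|f x| <= C) ->
  ibl (fun x => f x * g x).
Proof.
move=> mf gi fC; apply: (ibl_leN _ (iblZ C gi)).
  by apply: measurable_funM => //; exact: ibl_meas.
move=> x; rewrite !normrM ler_wpM2r//; apply: le_trans (fC x) _; exact: ler_norm.
Qed.

Lemma iblE f : ibl f -> (\int[mu]_x (f x)%:E)%E = (\int[mu]_x f x)%:E.
Proof.
move=> fi; rewrite /Rintegral fineK//.
exact: (@integrable_fin_num _ _ _ mu setT measurableT (EFin \o f) fi).
Qed.

Lemma rintD f g : ibl f -> ibl g ->
  \int[mu]_x (f x + g x) = \int[mu]_x f x + \int[mu]_x g x.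
Proof. by move=> fi gi; rewrite RintegralD. Qed.

Lemma rintB f g : ibl f -> ibl g ->
  \int[mu]_x (f x - g x) = \int[mu]_x f x - \int[mu]_x g x.
Proof. by move=> fi gi; rewrite RintegralB. Qed.

Lemma rintZ (c : R) f : ibl f -> \int[mu]_x (c * f x) = c * \int[mu]_x f x.
Proof. by move=> fi; rewrite RintegralZl. Qed.

Lemma rint_eq f g : f =1 g -> \int[mu]_x f x = \int[mu]_x g x.
Proof. by move=> /funext ->. Qed.

Lemma rint0 : \int[mu]_x (0 : R) = 0.
Proof. by rewrite /Rintegral integral0. Qed.

Lemma rint_ge0 f : (forall x, 0 <= f x) -> 0 <= \int[mu]_x f x.
Proof. by move=> f0; apply: Rintegral_ge0. Qed.

Lemma rint_le f g : ibl f -> ibl g -> (forall x, f x <= g x) -> \int[mu]_x f x <= \int[mu]_x g x.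
Proof. by move=> fi gi fg; apply: le_Rintegral. Qed.

Lemma rint_norm f : ibl f -> `|\int[mu]_x f x| <= \int[mu]_x `|f x|.
Proof. by move=> fi; apply: le_normr_Rintegral. Qed.

Lemma rint_norm_le f g : ibl f -> ibl g -> (forall x, `|f x| <= g x) ->
  `|\int[mu]_x f x| <= \int[mu]_x g x.
Proof.
move=> fi gi fg; apply: le_trans (rint_norm fi) _.
by apply: rint_le => //; exact: ibl_norm.
Qed.

Lemma ibl0 : ibl (fun=> 0).
Proof. exact: integrable0. Qed.

Lemma ibl_sum (F : nat -> T -> R) n : (forall i, ibl (F i)) ->
  ibl (fun x => \sum_(0 <= i < n) F i x).
Proof.
move=> iF; elim: n => [|n IH].
  by apply: (ibl_eq _ ibl0) => x; rewrite big_nil.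
by apply: (ibl_eq _ (iblD IH (iF n))) => x; rewrite big_nat_recr.
Qed.

Lemma rint_sum (F : nat -> T -> R) n : (forall i, ibl (F i)) ->
  \int[mu]_x \sum_(0 <= i < n) F i x = \sum_(0 <= i < n) \int[mu]_x F i x.
Proof.
move=> iF; elim: n => [|n IH].
  by rewrite big_nil -[RHS]rint0; apply: rint_eq => x; rewrite big_nil.
rewrite big_nat_recr//= -IH -rintD//; last exact: ibl_sum.
by apply: rint_eq => x; rewrite big_nat_recr.
Qed.

Lemma rint_dct (f_ : nat -> T -> R) f g : (forall n, measurable_fun setT (f_ n)) ->
  (forall x, f_ ^~ x @ \oo --> f x) -> ibl g -> (forall n x, `|f_ n x| <= g x) ->
  ibl f /\ (fun n => \int[mu]_x f_ n x) @ \oo --> \int[mu]_x f x.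
Proof.
move=> mf ff gi fg.
have mlim : measurable_fun setT f.
  by apply: (measurable_fun_cvg mf) => x _; exact: ff.
have ae1 : {ae mu, forall x, setT x -> (EFin \o f_ n) x @[n --> \oo] --> (EFin \o f) x}.
  by apply/aeW => x _; apply/cvg_EFin; [near=> n|exact: ff].
have ae2 : {ae mu, forall x n, setT x -> (`|(EFin \o f_ n) x| <= (EFin \o g) x)%E}.
  by apply/aeW => x n _ /=; rewrite lee_fin.
have [fi _ cv] := @dominated_convergence _ _ _ mu setT measurableT (fun n => EFin \o f_ n)
  (EFin \o f) (EFin \o g) (fun n => (measurable_EFinP _ _).2 (mf n)) ((measurable_EFinP _ _).2 mlim)
  ae1 gi ae2.
split=> //; apply: fine_cvg; rewrite (iblE fi) in cv.
by rewrite /Rintegral in cv *; exact: cv.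
Unshelve. all: by end_near. Qed.

Lemma fatou_le (f_ : nat -> T -> R) f (C : \bar R) : (forall n, measurable_fun setT (f_ n)) ->
  (forall n x, 0 <= f_ n x) ->
  {ae mu, forall x, f_ ^~ x @ \oo --> f x} -> (forall x, 0 <= f x) -> measurable_fun setT f ->
  (forall n, (\int[mu]_x (f_ n x)%:E <= C)%E) -> (\int[mu]_x (f x)%:E <= C)%E.
Proof.
move=> mf f0 ff fx0 mff HC.
have -> : (\int[mu]_x (f x)%:E)%E = (\int[mu]_x limn_einf (fun n => (f_ n x)%:E))%E.
  apply: ge0_ae_eq_integral => //.
  - exact/measurable_EFinP.
  - have -> : (fun x => limn_einf (fun n => (f_ n x)%:E)) =
      (fun x => - limn_esup (-%E \o (fun n => (f_ n x)%:E)))%E.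
      by apply/funext => x; rewrite limn_esupN oppeK.
    apply: measurableT_comp => //; apply: measurable_fun_limn_esup => n.
    by apply: measurableT_comp => //; exact/measurable_EFinP.
  - by move=> x _; rewrite lee_fin.
  - move=> x _; rewrite limn_einf_lim; apply: lime_ge; first exact: is_cvg_einfs.
    by near=> n; apply: le_ereal_inf_tmp => _ [m _ <-]; rewrite lee_fin.
  - apply: filterS ff => x fx _.
    have h : (f_ n x)%:E @[n --> \oo] --> (f x)%:E by apply/cvg_EFin; [near=> n|exact: fx].
    by rewrite is_cvg_limn_einfE ?(cvg_lim _ h)//; apply/cvg_ex; exists (f x)%:E.
apply: le_trans (fatou _ measurableT _ _) _ => //.
- by move=> n; exact/measurable_EFinP.
- by move=> n x _; rewrite lee_fin.
rewrite limn_einf_lim; apply: lime_le; first exact: is_cvg_einfs.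
near=> n; apply: le_trans (HC n); apply: ereal_inf_lbound; exists n => //=.
Unshelve. all: by end_near. Qed.

End real_integrals.

Import HBNNSimple.

(** * The measure |x|^(2k) dx: density, symmetry, decay, integration by parts *)

Section dunkl_measure_integrals.
Context {R : realType} (k : R) (hk : 0 <= k).
Local Notation leb := (@lebesgue_measure R).
Local Notation mu := (dunkl_measure k).
Local Notation w := (dunkl_weight k).
Implicit Types (f g h : R -> R) (x y : R).

Lemma dunkl_weight_ge0 x : 0 <= w x.
Proof. exact: powR_ge0. Qed.

Lemma dunkl_weightN x : w (- x) = w x.
Proof. by rewrite /dunkl_weight normrN. Qed.

Lemma dunkl_weight_pos x : 0 < x -> w x = x `^ (2 * k).
Proof. by move=> x0; rewrite /dunkl_weight gtr0_norm. Qed.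

Lemma is_derive_weight_pos x : 0 < x -> is_derive x (1 : R) w (2 * k / x * w x).
Proof.
move=> x0; have h : is_derive x (1 : R) (fun y : R => y `^ (2 * k)) (2 * k / x * w x).
  apply: dv_eq (is_derive1_powR (2 * k) x0) _.
  have E : x `^ (2 * k - 1) = x `^ (2 * k) / x by rewrite powRB; [rewrite powRr1 ?ltW|apply/implyP => _; rewrite gt_eqF].
  by rewrite E (dunkl_weight_pos x0); ring.
apply: (near_eq_is_derive _ h).
by near=> y; rewrite dunkl_weight_pos//; near: y; exact: lt_nbhsr.
Unshelve. all: by end_near. Qed.

Lemma continuous_dunkl_weight : continuous w.
Proof.
(* For k = 0 the weight is 1 even at 0, whereas for k > 0 it vanishes there. *)
have [k0|k0] := eqVneq k 0.
  rewrite (_ : w = fun=> 1); first exact: ctC.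
  by apply/funext => x; rewrite /dunkl_weight k0 mulr0 powRr0.
have kp : 0 < 2 * k by rewrite mulr_gt0// lt_neqAle eq_sym k0.
move=> x; case: (ltrgt0P x) => [x0|x0|->].
- exact: dv_cont (is_derive_weight_pos x0).
- rewrite (_ : w = fun y => w (- y)); last by apply/funext => y; rewrite dunkl_weightN.
  by apply: dv_cont; apply: dv_opp; apply: is_derive_weight_pos; rewrite oppr_gt0.
- apply/cvgrPdist_lt => e e0; rewrite /dunkl_weight normr0 powR0 ?gt_eqF//.
  near=> y; rewrite sub0r normrN ger0_norm ?powR_ge0//.
  have E : e = (e `^ (2 * k)^-1) `^ (2 * k) by rewrite -powRrM mulVf ?gt_eqF// powRr1 ?ltW.
  rewrite [ltRHS]E; apply: gt0_ltr_powR => //; rewrite ?nnegrE ?powR_ge0//.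
  by near: y; apply: (@nbhs0_lt R R); rewrite powR_gt0.
Unshelve. all: by end_near. Qed.

(** On the indicators that make up simple functions the identity is the definition of the measure;
    monotone convergence does the rest. *)
Lemma ge0_integral_dunkl (f : measurableTypeR R -> \bar R) : measurable_fun [set: measurableTypeR R] f ->
  (forall x, (0 <= f x)%E) -> (\int[mu]_x f x = \int[leb]_x (f x * (w x)%:E))%E.
Proof.
move=> mf f0; have mw : measurable_fun setT (fun x : measurableTypeR R => (w x)%:E).
  by apply/measurable_EFinP; exact: measurable_dunkl_weight.
pose f_ := nnsfun_approx measurableT mf.
have ef (x : measurableTypeR R) : (f_ n x)%:E @[n --> \oo] --> f x by apply: cvg_nnsfun_approx.
transitivity (limn (fun n => \int[mu]_x (f_ n x)%:E)%E).
  rewrite -monotone_convergence//.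
  - by apply: eq_integral => y _; apply/esym/cvg_lim => //; exact: ef.
  - by move=> n; exact/measurable_EFinP/measurable_funP.
  - by move=> n y _; rewrite lee_fin.
  - by move=> y _ m n mn; rewrite lee_fin; exact/lefP/nd_nnsfun_approx.
rewrite [X in limn X](_ : _ = (fun n => (\int[leb]_x ((f_ n x)%:E * (w x)%:E))%E)).
  rewrite -monotone_convergence//; last 3 first.
  - by move=> n; apply: emeasurable_funM => //; exact/measurable_EFinP/measurable_funP.
  - by move=> n x _; rewrite -EFinM lee_fin mulr_ge0// dunkl_weight_ge0.
  - move=> x _ m n mn; rewrite -!EFinM lee_fin ler_wpM2r ?dunkl_weight_ge0//.
    exact/lefP/nd_nnsfun_approx.
  apply: eq_integral => x _; apply/cvg_lim => //.
  by apply: cvgeZr => //; exact: ef.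
apply/funext => n.
transitivity (\sum_(r \in range (f_ n))
    \int[mu]_x (r * \1_(f_ n @^-1` [set r]) x)%:E)%E.
  under eq_integral do rewrite fimfunE -fsumEFin//.
  rewrite ge0_integral_fsum//.
  - by move=> y; exact/measurable_EFinP/measurable_funM.
  - by move=> y x _; rewrite nnfun_muleindic_ge0.
transitivity (\sum_(r \in range (f_ n))
    \int[leb]_x ((r * \1_(f_ n @^-1` [set r]) x)%:E * (w x)%:E))%E; last first.
  rewrite -ge0_integral_fsum//.
  - apply: eq_integral => x _; rewrite [in RHS]fimfunE -fsumEFin//.
    rewrite ge0_mule_fsuml//.
    by move=> r; rewrite nnfun_muleindic_ge0.
  - by move=> y; apply: emeasurable_funM => //; exact/measurable_EFinP/measurable_funM.
  - by move=> y x _; rewrite EFinM mule_ge0// ?lee_fin ?dunkl_weight_ge0//; exact: nnfun_muleindic_ge0.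
apply: eq_fsbigr => r /set_mem [z _ rz].
have r0 : 0 <= r by rewrite -rz.
transitivity (r%:E * dunkl_measure k (f_ n @^-1` [set r]))%E.
  under eq_integral do rewrite EFinM.
  rewrite ge0_integralZl_EFin//.
  - by rewrite integral_indic// setIT.
  - by apply/measurable_EFinP; exact: measurable_indic.
under [RHS]eq_integral do rewrite EFinM -muleA.
rewrite ge0_integralZl_EFin//.
- congr (_ * _)%E; rewrite /dunkl_measure /= integral_mkcond; apply: eq_integral => x _.
  by rewrite patchE indicE; case: ifPn => _; rewrite ?mul1e ?mul0e.
- by move=> x _; rewrite -EFinM lee_fin mulr_ge0// dunkl_weight_ge0.
- by apply: emeasurable_funM => //; apply/measurable_EFinP; exact: measurable_indic.
Qed.

Lemma integral_dunkl f : measurable_fun [set: measurableTypeR R] f ->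
  (\int[mu]_x (f x)%:E = \int[leb]_x (f x * w x)%:E)%E.
Proof.
move=> mf; rewrite integralE [RHS]integralE.
have mfE : measurable_fun setT (EFin \o f) by exact/measurable_EFinP.
congr (_ - _)%E.
- rewrite ge0_integral_dunkl//; last exact: measurable_funepos.
  apply: eq_integral => x _; rewrite !funeposE -EFin_max -[in RHS]EFin_max -EFinM; congr (_%:E).
  by rewrite maxr_pMl ?dunkl_weight_ge0// mul0r.
- rewrite ge0_integral_dunkl//; last exact: measurable_funeneg.
  apply: eq_integral => x _; rewrite !funenegE -!EFinN -EFin_max -[in RHS]EFin_max -EFinM; congr (_%:E).
  by rewrite maxr_pMl ?dunkl_weight_ge0// mul0r mulNr.
Qed.

Lemma rint_dunkl f : measurable_fun [set: measurableTypeR R] f -> \int[mu]_x f x = \int[leb]_x (f x * w x).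
Proof. by move=> mf; rewrite /Rintegral integral_dunkl. Qed.

Lemma mfun_w f : measurable_fun [set: measurableTypeR R] f -> measurable_fun [set: measurableTypeR R] (fun x => f x * w x).
Proof. by move=> mf; apply: measurable_funM => //; exact: measurable_dunkl_weight. Qed.

Lemma ibl_dunkl f : measurable_fun [set: measurableTypeR R] f -> ibl mu f <-> ibl leb (fun x => f x * w x).
Proof.
move=> mf; have e : (\int[mu]_x `|(EFin \o f) x| = \int[leb]_x `|(EFin \o (fun x => f x * w x)%R) x|)%E.
  rewrite -[LHS]/(\int[mu]_x (`|f x|)%:E)%E integral_dunkl; last exact: measurableT_comp.
  by apply: eq_integral => x _ /=; rewrite normrM (ger0_norm (dunkl_weight_ge0 _)).
split=> /integrableP [_ h]; apply/integrableP; split.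
- by apply/measurable_EFinP; exact: mfun_w.
- by rewrite -e.
- exact/measurable_EFinP.
- by rewrite e.
Qed.

Lemma ge0_integral_lebN (f : measurableTypeR R -> \bar R) : measurable_fun [set: measurableTypeR R] f ->
  (forall x, (0 <= f x)%E) -> (\int[leb]_x f (- x)%R = \int[leb]_x f x)%E.
Proof.
move=> mf f0; have mN : measurable_fun setT (-%R : measurableTypeR R -> measurableTypeR R).
  exact: oppr_measurable.
have := ge0_integral_pushforward mN leb measurableT mf (fun y _ => f0 y).
rewrite preimage_setT => <-; apply: eq_measure_integral => A mA _.
exact: lebesgue_measureN.
Qed.

Lemma ge0_integral_dunklN (f : measurableTypeR R -> \bar R) : measurable_fun [set: measurableTypeR R] f ->
  (forall x, (0 <= f x)%E) -> (\int[mu]_x f (- x)%R = \int[mu]_x f x)%E.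
Proof.
move=> mf f0; have mw : measurable_fun setT (fun x : measurableTypeR R => (w x)%:E).
  by apply/measurable_EFinP; exact: measurable_dunkl_weight.
rewrite ge0_integral_dunkl//; last exact: measurableT_comp.
rewrite [RHS]ge0_integral_dunkl// -[RHS]ge0_integral_lebN.
- by apply: eq_integral => x _; rewrite dunkl_weightN.
- exact: emeasurable_funM.
- by move=> x; rewrite mule_ge0// lee_fin dunkl_weight_ge0.
Qed.

Lemma rint_dunklN f : measurable_fun [set: measurableTypeR R] f -> \int[mu]_x f (- x) = \int[mu]_x f x.
Proof.
move=> mf; have mfE : measurable_fun setT (EFin \o f) by exact/measurable_EFinP.
rewrite /Rintegral; congr fine; rewrite integralE [RHS]integralE; congr (_ - _)%E.
- rewrite -(ge0_integral_dunklN (measurable_funepos mfE))//.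
  by apply: eq_integral => x _; rewrite !funeposE.
- rewrite -(ge0_integral_dunklN (measurable_funeneg mfE))//.
  by apply: eq_integral => x _; rewrite !funenegE.
Qed.

Lemma mfun_opp f : measurable_fun [set: measurableTypeR R] f -> measurable_fun [set: measurableTypeR R] (fun x => f (- x)).
Proof. by move=> mf; apply: measurableT_comp => //; exact: oppr_measurable. Qed.

Lemma ibl_dunklN f : ibl mu f -> ibl mu (fun x => f (- x)).
Proof.
move=> fi; have mf := ibl_meas fi; apply: iblP; first exact: mfun_opp.
rewrite (ge0_integral_dunklN (f := fun x => `|f x|%:E)) //.
  by case/integrableP: fi.
by apply/measurable_EFinP; exact: measurableT_comp.
Qed.

(** Homogeneity of degree 2k + 1: s^(2k) from the weight and s from dx. *)
Lemma ge0_integral_dunkl_scale f (s : R) : 0 < s -> continuous f -> (forall x, 0 <= f x) ->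
  (\int[mu]_x (f x)%:E = (s `^ (2 * k + 1))%:E * \int[mu]_x (f (s * x)%R)%:E)%E.
Proof.
move=> s0 cf f0.
have mf : measurable_fun [set: measurableTypeR R] f by exact: continuous_measurable_fun.
have csf : continuous (fun x => f (s * x)).
  by apply: ct_comp => //; apply: ctM; [exact: ctC|exact: ctI].
have msf : measurable_fun [set: measurableTypeR R] (fun x => f (s * x)) by exact: continuous_measurable_fun.
rewrite !integral_dunkl//.
have dF x : is_derive x (1 : R) (fun y => s * y) s.
  by apply: dv_eq (dvZ s (dvI x)) _; rewrite mulr1.
have dF1 : ((fun y : R => s * y)^`())%classic = fun=> s.
  by apply/funext => x; rewrite derive1E; have h := dF x; rewrite derive_val.
rewrite (@increasing_ge0_integration_by_substitutionT R (fun y => s * y) (fun x => f x * w x)).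
- rewrite -ge0_integralZl_EFin//; last 3 first.
  - by move=> x _; rewrite lee_fin mulr_ge0// dunkl_weight_ge0.
  - by apply/measurable_EFinP; exact: mfun_w.
  - exact: powR_ge0.
  apply: eq_integral => x _; rewrite dF1 -EFinM; congr (_%:E).
  rewrite -[LHS]/(f (s * x) * w (s * x) * s) /dunkl_weight normrM (gtr0_norm s0) powRM ?(ltW s0)//.
  have -> : s `^ (2 * k + 1) = s `^ (2 * k) * s.
    by rewrite powRD; [rewrite powRr1 ?ltW|apply/implyP => _; rewrite gt_eqF].
  by ring.
- by move=> x y xy; rewrite ltr_pM2l.
- by rewrite dF1; exact: ctC.
- by rewrite dF1; exact: is_cvg_cst.
- by rewrite dF1; exact: is_cvg_cst.
- by move=> x; have h := dF x; exact: (@ex_derive _ _ _ _ _ _ _ h).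
- by apply: gt0_cvgMrNy => //; exact: cvg_id.
- by apply: gt0_cvgMry => //; exact: cvg_id.
- by apply: ctM => //; exact: continuous_dunkl_weight.
- by move=> x; rewrite mulr_ge0// dunkl_weight_ge0.
Qed.

(* An order of decay that makes a bounded function integrable against |x|^(2k). *)
Definition decay_order : nat := (Num.truncn (2 * k)).+3.

Lemma ibl_oneDsqrV : ibl leb (fun x => (oneDsqr x)^-1).
Proof.
have ge0 (x : R) : 0 <= (oneDsqr x)^-1 by rewrite invr_ge0 (le_trans ler01).
have c1 : continuous (fun x : R => (oneDsqr x)^-1) by exact: continuous_oneDsqrV.
apply: iblP; first exact: continuous_measurable_fun.
under eq_integral do rewrite (ger0_norm (ge0 _)).
rewrite ge0_symfun_integralT//.
  rewrite (_ : [set x | 0 <= x] = `[0, +oo[%classic); last first.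
    by apply/seteqP; split=> x /=; rewrite in_itv/= andbT.
  by rewrite integral0y_oneDsqr -EFinM ltry.
by move=> x /=; rewrite /oneDsqr sqrrN.
Qed.

(** Where |x| > 1, all but two of the powers in [decay_order] beat the weight and the last two
    produce 1/(1 + x^2); where |x| <= 1 the weight is at most 1. *)
Lemma weight_decay (C : R) x (a : R) : `|a| <= C -> `|x| ^+ decay_order * `|a| <= C ->
  `|a| * w x <= 2 * C * (oneDsqr x)^-1.
Proof.
move=> h1 h2; have C0 : 0 <= C by apply: le_trans h1.
have k2 : 0 <= 2 * k by rewrite mulr_ge0.
have q0 : 0 < oneDsqr x by rewrite (lt_le_trans ltr01).
rewrite ler_pdivlMr// /oneDsqr -(real_normK (num_real x)).
have [x1|x1] := leP `|x| 1.
  have w1 : w x <= 1.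
    have <- : (1 : R) `^ (2 * k) = 1 by rewrite powR1.
    by apply: ge0_ler_powR => //; rewrite nnegrE.
  have x2 : `|x| ^+ 2 <= 1 by rewrite exprn_ile1.
  have w0 := dunkl_weight_ge0 x.
  have : `|a| * w x <= C by rewrite -[leRHS]mulr1 ler_pM.
  have aw : 0 <= `|a| * w x by rewrite mulr_ge0.
  have := sqr_ge0 `|x|; nra.
have w1 : w x <= `|x| ^+ (Num.truncn (2 * k)).+1.
  rewrite -powR_mulrn//; apply: ler_powR; first exact: ltW.
  by apply: ltW; exact: truncnS_gt.
have x2 : 1 <= `|x| ^+ 2 by rewrite exprn_ege1// ltW.
have : `|a| * w x * `|x| ^+ 2 <= C.
  apply: le_trans h2; have -> : decay_order = ((Num.truncn (2 * k)).+1 + 2)%N by rewrite addn2.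
  rewrite exprD; set p := _ ^+ _.+1 in w1 *; set q := _ ^+ 2.
  have -> : p * q * `|a| = `|a| * p * q by ring.
  by apply: ler_wpM2r; [exact: exprn_ge0|apply: ler_wpM2l].
have aw : 0 <= `|a| * w x by rewrite mulr_ge0 ?dunkl_weight_ge0.
nra.
Qed.

Lemma ibl_decay f (C : R) : measurable_fun [set: measurableTypeR R] f -> (forall x, `|f x| <= C) ->
  (forall x, `|x| ^+ decay_order * `|f x| <= C) -> ibl mu f.
Proof.
move=> mf h1 h2; apply/ibl_dunkl => //.
apply: (ibl_le (mfun_w mf) (iblZ (2 * C) ibl_oneDsqrV)) => x.
by rewrite normrM (ger0_norm (dunkl_weight_ge0 _)); exact: weight_decay.
Qed.

Lemma ibl_gauss f (C a t : R) : 0 < t -> measurable_fun [set: measurableTypeR R] f ->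
  (forall x, `|f x| <= C * expR (a * `|x|)) -> ibl mu (fun x => f x * expR (- (t * x ^+ 2))).
Proof.
move=> t0 mf hf; have C0 : 0 <= C.
  have := hf 0; rewrite normr0 mulr0 expR0 mulr1; exact: le_trans.
pose N := decay_order.
(* The added 1 lets one Gaussian estimate serve both for exp(a|x|) and for |x|^N exp(a|x|), as |x|^N
   <= N! exp|x|. *)
pose a' := `|a| + 1.
have me : measurable_fun [set: measurableTypeR R] (fun x : R => expR (- (t * x ^+ 2))).
  by apply: continuous_measurable_fun; apply: ct_exp; apply: ctN; apply: ctM; [exact: ctC|exact: ctX ctI].
have key (b x : R) : b <= a' -> expR (b * `|x|) * expR (- (t * x ^+ 2)) <= expR (a' ^+ 2 / (4 * t)).
  move=> ba; rewrite -expRD ler_expR -subr_ge0.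
  have -> : a' ^+ 2 / (4 * t) - (b * `|x| - t * x ^+ 2) =
     (a' / 2 - t * `|x|) ^+ 2 / t + (a' - b) * `|x|.
    by rewrite -[in LHS](real_normK (num_real x)); field; rewrite gt_eqF.
  by rewrite addr_ge0 ?divr_ge0 ?sqr_ge0 ?(ltW t0)// mulr_ge0// subr_ge0.
have fact_exp (x : R) : `|x| ^+ N <= N`!%:R * expR `|x|.
  rewrite -ler_pdivrMl ?ltr0n ?fact_gt0// -fs_expR.
  by apply: (@term_le_fs _ (fun n => n`!%:R^-1)) => //; exact: ent_fact.
apply: (@ibl_decay _ (C * expR (a' ^+ 2 / (4 * t)) * (1 + N`!%:R))).
- exact: measurable_funM.
- move=> x; rewrite normrM (ger0_norm (expR_ge0 _)).
  apply: (@le_trans _ _ (C * expR (a' ^+ 2 / (4 * t)))).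
    apply: le_trans (ler_wpM2r (expR_ge0 _) (hf x)) _.
    by rewrite -mulrA ler_wpM2l// key// /a' ; have := ler_norm a; lra.
  by rewrite ler_peMr ?mulr_ge0 ?expR_ge0// lerDl.
- move=> x; rewrite normrM (ger0_norm (expR_ge0 _)).
  apply: (@le_trans _ _ (C * expR (a' ^+ 2 / (4 * t)) * N`!%:R)); last first.
    by rewrite ler_wpM2l ?mulr_ge0 ?expR_ge0// lerDr.
  apply: le_trans (ler_wpM2l _ (ler_wpM2r (expR_ge0 _) (hf x))) _; first by rewrite exprn_ge0.
  apply: le_trans (ler_wpM2r _ (fact_exp x)) _; first by rewrite !mulr_ge0 ?expR_ge0.
  have -> : N`!%:R * expR `|x| * (C * expR (a * `|x|) * expR (- (t * x ^+ 2))) =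
      C * (expR ((1 + a) * `|x|) * expR (- (t * x ^+ 2))) * N`!%:R.
    by rewrite mulrDl mul1r expRD; ring.
  apply: ler_wpM2r => //; apply: ler_wpM2l => //.
  by apply: key; rewrite /a'; have := ler_norm a; lra.
Qed.

(** For x > 0 the derivative of P w is S w, because w' = (2k/x) w. The boundary terms vanish, at 0
    by P(0) = 0 and at infinity by decay. The half-line keeps away from 0, where w need not be
    differentiable. *)
Lemma rint_weight_FTC (S P : R -> R) (C : R) :
  continuous S -> continuous P -> ibl mu S -> P 0 = 0 ->
  (forall x, 0 < x -> is_derive x (1 : R) P (S x - 2 * k / x * P x)) ->
  (forall x, `|P x| * w x <= C * (oneDsqr x)^-1) ->
  \int[leb]_x (S x * w x * (0 <= x)%R%:R) = 0.
Proof.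
move=> cS cP iS P0 dP PC.
have iSw : ibl leb (fun x => S x * w x) by apply/ibl_dunkl => //; exact: ibl_meas iS.
have cSw : continuous (fun x => S x * w x) by apply: ctM => //; exact: continuous_dunkl_weight.
have cPw : continuous (fun x => P x * w x) by apply: ctM => //; exact: continuous_dunkl_weight.
pose I n : set R := `[0, n.+1%:R]%classic.
pose f_ n x : R := S x * w x * \1_(I n) x.
have fE n : \int[leb]_x f_ n x = P n.+1%:R * w n.+1%:R.
  rewrite /f_ /Rintegral.
  have -> : (\int[leb]_x (S x * w x * \1_(I n) x)%:E = \int[leb]_(x in I n) (S x * w x)%:E)%E.
    rewrite [RHS]integral_mkcond; apply: eq_integral => x _.
    by rewrite patchE indicE; case: ifPn => _; rewrite ?mulr1 ?mulr0.
  rewrite (@continuous_FTC2 _ _ (fun x => P x * w x)).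
  - by rewrite P0 mul0r sube0.
  - by rewrite ltr0n.
  - exact: continuous_subspaceT.
  - split=> [x||].
    + rewrite in_itv/= => /andP[x0 _].
      have h := dvM (dP x x0) (is_derive_weight_pos x0); exact: (@ex_derive _ _ _ _ _ _ _ h).
    + by apply: cvg_at_right_filter; exact: cPw.
    + by apply: cvg_at_left_filter; exact: cPw.
  - move=> x; rewrite in_itv/= => /andP[x0 _].
    rewrite derive1E; have h := dvM (dP x x0) (is_derive_weight_pos x0).
    by rewrite derive_val; ring.
have [_ cv] : ibl leb (fun x => S x * w x * (0 <= x)%R%:R) /\
   (fun n => \int[leb]_x f_ n x) @ \oo --> \int[leb]_x (S x * w x * (0 <= x)%R%:R).
  apply: (@rint_dct _ (measurableTypeR R) R leb f_ (fun x => S x * w x * (0 <= x)%R%:R) (fun x => `|S x * w x|)).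
  - move=> n; apply: measurable_funM; first exact: ibl_meas iSw.
    apply: measurable_indic; exact: measurable_itv.
  - move=> x; apply: cvg_near_cst; near=> n.
    rewrite /f_ indicE (_ : (x \in I n) = (0 <= x)%R)//.
    have xn : x <= n.+1%:R.
      near: n; exists (Num.truncn x) => // m /= xm.
      by apply: ltW; apply: lt_le_trans (truncnS_gt _) _; rewrite ler_nat ltnS.
    by apply/idP/idP => [|x0]; rewrite in_setE /I /= in_itv/= ?x0 ?xn// => /andP[].
  - exact: ibl_norm.
  - by move=> n x; rewrite /f_ normrM ler_piMr// indicE; case: (_ \in _); rewrite ?normr1 ?normr0.
apply: (cvg_unique _ cv) => //.
rewrite (_ : (fun n => _) = fun n => P n.+1%:R * w n.+1%:R); last by apply/funext => n; exact: fE.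
have h0 : (fun n : nat => C * n.+1%:R^-1) @ \oo --> (0 : R).
  by rewrite -(mulr0 C); apply: cvgM; [exact: cvg_cst|exact: cvg_harmonic].
apply: (@squeeze_cvgr _ _ _ _ (fun n : nat => - (C * n.+1%:R^-1)) (fun n : nat => C * n.+1%:R^-1)) => //.
  near=> n; rewrite -ler_norml normrM (ger0_norm (dunkl_weight_ge0 _)).
  apply: le_trans (PC _) _; rewrite ler_wpM2l//.
    have := PC 0; rewrite P0 normr0 mul0r; rewrite /oneDsqr expr0n addr0 invr1 mulr1 //.
  rewrite lef_pV2 ?posrE//.
  by rewrite /oneDsqr expr2; have : 1 <= n.+1%:R :> R by [rewrite ler1n]; nra.
by rewrite -oppr0; apply: cvgN.
Unshelve. all: by end_near. Qed.

Lemma bool_indic (P : pred R) (A : set R) : (forall x, A x <-> P x) ->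
  (fun x => (P x)%:R : R) = \1_A.
Proof.
move=> AP; apply/funext => x; rewrite indicE; congr ((nat_of_bool _)%:R).
by apply/idP/idP; rewrite in_setE => /AP.
Qed.

(** The measure is even, so the negative half-line folds onto the positive one. *)
Lemma rint_half (L : R -> R) : ibl mu L ->
  \int[mu]_x L x = \int[leb]_x ((L x + L (- x)) * w x * (0 <= x)%R%:R).
Proof.
move=> iL; have mL := ibl_meas iL.
have iLw : ibl leb (fun x => L x * w x) by apply/ibl_dunkl.
have iLw' : ibl leb (fun x => L (- x) * w x).
  by apply/ibl_dunkl; [exact: mfun_opp|exact: ibl_dunklN].
have m0 : measurable_fun [set: measurableTypeR R] (fun x : R => (0 <= x)%R%:R : R).
  rewrite (@bool_indic _ (`[0, +oo[%classic)); first exact: measurable_indic.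
  by move=> x; rewrite /= in_itv/= ?andbT.
have mneg : measurable_fun [set: measurableTypeR R] (fun x : R => (x < 0)%R%:R : R).
  rewrite (@bool_indic _ (`]-oo, 0[%classic)); first exact: measurable_indic.
  by move=> x; rewrite /= in_itv/= ?andbT.
have mpos : measurable_fun [set: measurableTypeR R] (fun x : R => (0 < x)%R%:R : R).
  rewrite (@bool_indic _ (`]0, +oo[%classic)); first exact: measurable_indic.
  by move=> x; rewrite /= in_itv/= ?andbT.
have b01 (b : bool) : `|b%:R : R| <= 1 by case: b; rewrite ?normr1 ?normr0.
have iP f g : ibl leb f -> measurable_fun [set: measurableTypeR R] g -> (forall x, `|g x| <= 1) -> ibl leb (fun x => f x * g x).
  move=> fi mg g1; apply: (ibl_eq _ (ibl_bM mg fi g1)) => x; exact: mulrC.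
have -> : \int[mu]_x L x = \int[mu]_x (L x * (0 <= x)%R%:R) + \int[mu]_x (L x * (x < 0)%R%:R).
  rewrite -rintD.
  - by apply: rint_eq => x; case: leP => _; rewrite ?mulr1 ?mulr0 ?addr0 ?add0r.
  - by apply: (ibl_eq _ (ibl_bM m0 iL (fun x => b01 _))) => x; exact: mulrC.
  - by apply: (ibl_eq _ (ibl_bM mneg iL (fun x => b01 _))) => x; exact: mulrC.
rewrite -[X in _ + X]rint_dunklN; last exact: measurable_funM.
rewrite !rint_dunkl; last 2 first.
- apply: measurable_funM; first exact: mfun_opp.
  by apply: (mfun_opp (f := fun x : R => (x < 0)%R%:R)).
- exact: measurable_funM.
(* Reflection turns x < 0 into 0 < x; the missing endpoint 0 is a null set. *)
have -> : \int[leb]_x (L (- x) * (- x < 0)%R%:R * w x) = \int[leb]_x (L (- x) * w x * (0 <= x)%R%:R).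
  have e1 : (fun x => L (- x) * (- x < 0)%R%:R * w x) = (fun x => L (- x) * w x) \_ (`]0, +oo[%classic).
    apply/funext => x; rewrite patchE oppr_lt0; have -> : (x \in (`]0, +oo[%classic : set R)) = (0 < x).
      by apply/idP/idP; rewrite in_setE/= in_itv/= andbT.
    by case: ifPn => _; rewrite ?mulr1 ?mulr0 ?mul0r.
  have e2 : (fun x => L (- x) * w x * (0 <= x)%R%:R) = (fun x => L (- x) * w x) \_ (`[0, +oo[%classic).
    apply/funext => x; rewrite patchE; have -> : (x \in (`[0, +oo[%classic : set R)) = (0 <= x).
      by apply/idP/idP; rewrite in_setE/= in_itv/= andbT.
    by case: ifPn => _; rewrite ?mulr1 ?mulr0 ?mul0r.
  rewrite (rint_eq leb (f := fun x => L (- x) * (- x < 0)%R%:R * w x) (g := (fun x => L (- x) * w x) \_ (`]0, +oo[%classic))); last by move=> x; rewrite -e1.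
  rewrite (rint_eq leb (f := fun x => L (- x) * w x * (0 <= x)%R%:R) (g := (fun x => L (- x) * w x) \_ (`[0, +oo[%classic))); last by move=> x; rewrite -e2.
  rewrite -!Rintegral_mkcond; apply: Rintegral_itv_obnd_cbnd.
  exact: (integrableS measurableT).
rewrite -rintD.
- by apply: rint_eq => x; rewrite mulrDl mulrDl; congr (_ + _); rewrite mulrAC.
- by apply: (ibl_eq _ (iP _ _ iLw m0 (fun x => b01 _))) => x; rewrite mulrAC.
- exact: iP.
Qed.

(** Skew-symmetry of T_k. After folding, the sum of the two integrands times w is the derivative of
    (f(x) h(x) - f(-x) h(-x)) w(x): the reflection terms supply exactly the part that comes from
    w'. *)
Lemma rint_dunkl_antisym (f h f1 h1 : R -> R) (C : R) :
  continuous f -> continuous h -> continuous f1 -> continuous h1 ->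
  (forall x, x != 0 -> is_derive x (1 : R) f (f1 x - k * (f x - f (- x)) / x)) ->
  (forall x, x != 0 -> is_derive x (1 : R) h (h1 x - k * (h x - h (- x)) / x)) ->
  ibl mu (fun x => f1 x * h x) -> ibl mu (fun x => f x * h1 x) ->
  (forall x, `|f x * h x| * w x <= C * (oneDsqr x)^-1) ->
  \int[mu]_x (f1 x * h x) = - \int[mu]_x (f x * h1 x).
Proof.
move=> cf ch cf1 ch1 df dh i1 i2 HC.
apply/eqP; rewrite -subr_eq0 opprK -rintD//; apply/eqP.
pose L x := f1 x * h x + f x * h1 x.
rewrite -[LHS]/(\int[mu]_x L x) rint_half; last exact: iblD.
have cL : continuous L by apply: ctD; apply: ctM.
apply: (@rint_weight_FTC (fun x => L x + L (- x)) (fun x => f x * h x - f (- x) * h (- x)) (2 * C)).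
- by apply: ctD => //; exact: ct_opp.
- by apply: ctB; apply: ctM => //; exact: ct_opp.
- by apply: iblD; [exact: iblD|apply: ibl_dunklN; exact: iblD].
- by rewrite oppr0 subrr.
- move=> x x0; have xn0 : x != 0 by rewrite gt_eqF.
  have xn0' : - x != 0 by rewrite oppr_eq0.
  apply: dv_eq (dvB (dvM (df _ xn0) (dh _ xn0)) (dvM (dv_opp (df _ xn0')) (dv_opp (dh _ xn0')))) _.
  by rewrite /L opprK; field.
- move=> x; have q1 := HC x; have := HC (- x); rewrite dunkl_weightN /oneDsqr sqrrN -/(oneDsqr x) => q2.
  rewrite -mulrA [2 * _](_ : _ = C * (oneDsqr x)^-1 + C * (oneDsqr x)^-1); last by ring.
  apply: le_trans (lerD q1 q2); rewrite -mulrDl ler_wpM2r ?dunkl_weight_ge0//.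
  exact: ler_normB.
Qed.

Lemma dunkl_measure_itv_lty (a : R) : (mu [set` (`[- a, a])%R] < +oo)%E.
Proof.
set I := [set` _]; have mI : measurable I by exact: measurable_itv.
rewrite /= /dunkl_measure; apply: (@le_lt_trans _ _ (\int[leb]_(x in I) (`|a| `^ (2 * k))%:E)%E).
  apply: ge0_le_integral => //.
  - by move=> x _; rewrite lee_fin powR_ge0.
  - by apply/measurable_EFinP; apply: measurable_funTS; exact: measurable_dunkl_weight.
  - move=> x; rewrite /I /= in_itv/= => /andP[h1 h2]; rewrite lee_fin.
    apply: ge0_ler_powR; rewrite ?nnegrE ?mulr_ge0//.
    have : `|x| <= a by rewrite ler_norml h1.
    by move/le_trans; apply; exact: ler_norm.
rewrite integral_cst//= lebesgue_measure_itv/=; case: ifP => _; last by rewrite mule0 ltry.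
by rewrite -EFinB -EFinM ltry.
Qed.

End dunkl_measure_integrals.

(** * Sigma-finiteness, for the use of Fubini and Tonelli *)

Section dunkl_measure_sigma_finite.
Context {R : realType} (k : R).
Local Notation leb := (@lebesgue_measure R).

(** For negative k the weight is unbounded near 0; the exhausting sets are therefore cut by w <= n
    as well as by |x| <= n. *)
Lemma sigma_finite_dunkl : sigma_finite setT (dunkl_measure k).
Proof.
have mw : measurable_fun [set: measurableTypeR R] (dunkl_weight k : _ -> R).
  exact: measurable_dunkl_weight.
pose I n : set R := [set` (`[- n%:R, n%:R])%R].
pose A n : set (measurableTypeR R) := I n `&` (dunkl_weight k) @^-1` [set` (`]-oo, n%:R])%R].
have mI n : measurable (I n : set (measurableTypeR R)) by exact: measurable_itv.
have mA n : measurable (A n).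
  apply: measurableI => //.
  by have := mw measurableT [set` (`]-oo, n%:R])%R] (measurable_itv _); rewrite setTI.
exists A.
  apply/esym; rewrite -subTset => x _; exists (maxn (Num.truncn `|x|).+1 (Num.truncn (dunkl_weight k x)).+1) => //=.
  split; rewrite /I /= in_itv/=.
    rewrite -ler_norml ltW// (lt_le_trans (truncnS_gt _))// ler_nat.
    exact: leq_maxl.
  rewrite ltW// (lt_le_trans (truncnS_gt _))// ler_nat; exact: leq_maxr.
move=> n; split => //.
rewrite /= /dunkl_measure; apply: (@le_lt_trans _ _ (\int[leb]_(x in A n) (n%:R)%:E)%E).
  apply: ge0_le_integral => //.
  - by move=> x _; rewrite lee_fin powR_ge0.
  - by apply/measurable_EFinP; apply: measurable_funTS.
  - by move=> x [_ /=]; rewrite in_itv/= lee_fin.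
rewrite integral_cst//= lte_mul_pinfty//.
apply: (@le_lt_trans _ _ (leb (I n))); first by apply: le_measure; rewrite ?inE//; exact: subIsetl.
rewrite /I lebesgue_measure_itv/=; case: ifP => _ //.
by rewrite -EFinB ltry.
Qed.

HB.instance Definition _ := @Measure_isSigmaFinite.Build _ (measurableTypeR R) R (dunkl_measure k) sigma_finite_dunkl.

End dunkl_measure_sigma_finite.

(** * Term-by-term integration of entire series *)

Section series_integral.
Context {R : realType} (mu : {measure set (measurableTypeR R) -> \bar R}).

Lemma continuous_psum (c : nat -> R) n : continuous (fun x => pseries c x n).
Proof.
elim: n => [|n IH].
  rewrite (_ : (fun x => _) = fun=> 0); first exact: ctC.
  by apply/funext => x; rewrite /pseries /series /= big_nil.
rewrite (_ : (fun x => _) = fun x => pseries c x n + c n * x ^+ n); last first.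
  by apply/funext => x; rewrite /pseries seriesSr.
by apply: ctD => //; apply: ctM; [exact: ctC|exact: ctX ctI].
Qed.

Lemma rint_fs (h : R -> R) (c : nat -> R) : ent c -> measurable_fun [set: measurableTypeR R] h ->
  ibl mu (fun x => `|h x| * fs (fun n => `|c n|) `|x|) ->
  (forall n, ibl mu (fun x => x ^+ n * h x)) ->
  ibl mu (fun x => h x * fs c x) /\
  series (fun n => c n * \int[mu]_x (x ^+ n * h x)) @ \oo --> \int[mu]_x (h x * fs c x).
Proof.
move=> ec mh ih ihn.
have E n : series (fun n => c n * \int[mu]_x (x ^+ n * h x)) n = \int[mu]_x (h x * pseries c x n).
  rewrite /series /= /pseries /series /=.
  under eq_bigr do rewrite -rintZ//.
  rewrite -rint_sum; last by move=> i; exact: iblZ.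
  by apply: rint_eq => x; rewrite mulr_sumr; apply: eq_bigr => i _; ring.
rewrite (_ : series _ = fun n => \int[mu]_x (h x * pseries c x n)); last by apply/funext.
apply: (@rint_dct _ (measurableTypeR R) R mu (fun n x => h x * pseries c x n) (fun x => h x * fs c x) (fun x => `|h x| * fs (fun n => `|c n|) `|x|)) => //.
- move=> n; apply: measurable_funM => //.
  by apply: continuous_measurable_fun; exact: continuous_psum.
- by move=> x; apply: cvgM; [exact: cvg_cst|exact: ent_fs].
- by move=> n x; rewrite normrM ler_wpM2l// psum_norm_le.
Qed.

End series_integral.

(** * The real Dunkl transform *)

Section multiplication_formula.
Context {R : realType} (k : R).
Local Notation mu := (dunkl_measure k).

(** For k = 0 this is the classical Hartley transform, with kernel cos + sin. It keeps real
    functions real and squares to a multiple of the identity. *)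
Definition hartley (f : R -> R) (y : R) : R := \int[mu]_x (f x * cas k (x * y)).

Context (hk : 0 <= k).

Lemma continuous_cas : continuous (cas k).
Proof. by apply: continuous_fs; exact: ent_kap. Qed.

Lemma measurable_cas2 : measurable_fun [set: measurableTypeR R * measurableTypeR R]
   (fun z => cas k (z.1 * z.2)).
Proof.
have mc : measurable_fun [set: measurableTypeR R] (cas k : measurableTypeR R -> R).
  by apply: continuous_measurable_fun; exact: continuous_cas.
apply: (measurableT_comp mc); exact: measurable_funM.
Qed.

Lemma measurable_cas1 y : measurable_fun [set: measurableTypeR R] (fun x => cas k (x * y)).
Proof.
apply: continuous_measurable_fun; apply: ct_comp; first exact: continuous_cas.
by apply: ctM; [exact: ctI|exact: ctC].
Qed.

Lemma ibl_cas f y : ibl mu f -> ibl mu (fun x => f x * cas k (x * y)).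
Proof.
move=> fi; apply: (ibl_eq _ (ibl_bM (measurable_cas1 y) fi (C := 2) _)).
  by move=> x; rewrite mulrC.
by move=> x; exact: cas_bound.
Qed.

Lemma hartley_bound f y : ibl mu f -> `|hartley f y| <= 2 * \int[mu]_x `|f x|.
Proof.
move=> fi; rewrite -rintZ; last exact: ibl_norm.
apply: rint_norm_le; [exact: ibl_cas|exact: iblZ (ibl_norm fi)|].
by move=> x; rewrite normrM mulrC ler_wpM2r// cas_bound.
Qed.

Lemma measurable_hartley f : ibl mu f -> measurable_fun [set: measurableTypeR R] (hartley f).
Proof.
move=> fi.
have mF : measurable_fun [set: measurableTypeR R * measurableTypeR R]
    (fun z => (f z.2 * cas k (z.2 * z.1))%:E).
  apply/measurable_EFinP; apply: measurable_funM.
    by apply: measurableT_comp => //; exact: ibl_meas fi.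
  rewrite (_ : (fun x => _) = fun z => cas k (z.1 * z.2)); first exact: measurable_cas2.
  by apply/funext => z; rewrite mulrC.
(* Positive and negative parts are integrated separately by Tonelli: this gives measurability in y
   although the integrand need not be integrable on the product. *)
pose Fp := fubini_F mu (fun z : measurableTypeR R * measurableTypeR R => (f z.2 * cas k (z.2 * z.1))%:E)^\+%E.
pose Fm := fubini_F mu (fun z : measurableTypeR R * measurableTypeR R => (f z.2 * cas k (z.2 * z.1))%:E)^\-%E.
have mp : measurable_fun [set: measurableTypeR R] Fp.
  by apply: measurable_fun_fubini_tonelli_F => //; exact: measurable_funepos.
have mm : measurable_fun [set: measurableTypeR R] Fm.
  by apply: measurable_fun_fubini_tonelli_F => //; exact: measurable_funeneg.
rewrite (_ : hartley f = fun y => fine (Fp y - Fm y)%E).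
  by apply: measurableT_comp => //; exact: emeasurable_funB.
apply/funext => y; rewrite /hartley /Rintegral integralE; congr (fine (_ - _)%E).
  by apply: eq_integral => x _; rewrite !funeposE.
by apply: eq_integral => x _; rewrite !funenegE.
Qed.

Lemma rint_Fubini (F : measurableTypeR R * measurableTypeR R -> R) :
  (mu \x mu)%E.-integrable setT (EFin \o F) ->
  (forall x, ibl mu (fun y => F (x, y))) -> (forall y, ibl mu (fun x => F (x, y))) ->
  \int[mu]_x \int[mu]_y F (x, y) = \int[mu]_y \int[mu]_x F (x, y).
Proof.
move=> iF i1 i2; have h := Fubini iF.
transitivity (fine (\int[mu]_x \int[mu]_y (EFin \o F) (x, y))%E).
  by rewrite /Rintegral; congr fine; apply: eq_integral => x _; rewrite -[RHS](esym (iblE (i1 x))).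
rewrite h /Rintegral; congr fine; apply: eq_integral => y _.
exact: (iblE (i2 y)).
Qed.

(** The multiplication formula: Fubini for a kernel that is bounded and symmetric in x and y. *)
Lemma rint_hartley (a b : R -> R) : ibl mu a -> ibl mu b ->
  \int[mu]_x (a x * hartley b x) = \int[mu]_x (b x * hartley a x).
Proof.
move=> ia ib.
have ma := ibl_meas ia; have mb := ibl_meas ib.
pose F (z : measurableTypeR R * measurableTypeR R) : R := a z.1 * b z.2 * cas k (z.1 * z.2).
have mF : measurable_fun setT (EFin \o F).
  apply/measurable_EFinP; apply: measurable_funM; last exact: measurable_cas2.
  by apply: measurable_funM; apply: measurableT_comp.
have i1 x : ibl mu (fun y => F (x, y)).
  apply: (ibl_eq _ (iblZ (a x) (ibl_cas x ib))) => y.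
  by rewrite /F /= [y * x]mulrC; ring.
have i2 y : ibl mu (fun x => F (x, y)).
  by apply: (ibl_eq _ (iblZ (b y) (ibl_cas y ia))) => x; rewrite /F /=; ring.
have iF : (mu \x mu)%E.-integrable setT (EFin \o F).
  apply/integrable12ltyP => //.
  apply: (@le_lt_trans _ _ (\int[mu]_x (`|a x| * (2 * \int[mu]_y `|b y|))%:E)%E).
    apply: ge0_le_integral => //.
    - by move=> x _; apply: integral_ge0.
    - have mFa : measurable_fun setT (abse \o (EFin \o F)) by exact: measurableT_comp.
      rewrite -[X in measurable_fun _ X]/(fubini_F mu (abse \o (EFin \o F))).
      by apply: measurable_fun_fubini_tonelli_F => // z; exact: abse_ge0.
    - by apply/measurable_EFinP; apply: measurable_funM => //; exact: measurableT_comp.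
    move=> x _; rewrite -rintZ; last exact: ibl_norm.
    rewrite -rintZ; last exact: iblZ (ibl_norm _).
    rewrite -iblE; last by apply: iblZ; apply: iblZ; exact: ibl_norm.
    apply: ge0_le_integral => //.
    - by apply/measurable_EFinP; exact: ibl_meas (ibl_norm (i1 x)).
    - by apply/measurable_EFinP; do 2 apply: measurable_funM => //; exact: measurableT_comp.
    move=> y _ /=; rewrite lee_fin !normrM -mulrA ler_wpM2l// mulrC ler_wpM2r//.
    exact: cas_bound.
  have h : ibl mu (fun x => `|a x| * (2 * \int[mu]_y `|b y|)).
    by apply: (ibl_eq _ (iblZ (2 * \int[mu]_y `|b y|) (ibl_norm ia))) => x; rewrite mulrC.
  by rewrite iblE// ltry.
transitivity (\int[mu]_x \int[mu]_y F (x, y)).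
  apply: rint_eq => x; rewrite /hartley -rintZ; last exact: ibl_cas.
  by apply: rint_eq => y; rewrite /F /= [y * x]mulrC; ring.
rewrite rint_Fubini//; apply: rint_eq => y; rewrite /hartley -rintZ; last exact: ibl_cas.
by apply: rint_eq => x; rewrite /F /=; ring.
Qed.

End multiplication_formula.

(** * Gaussian integrals of cas and of the Dunkl exponential *)

Section gaussian.
Context {R : realType} (k : R) (hk : 0 <= k).
Local Notation mu := (dunkl_measure k).
Local Notation cas := (cas k).
Local Notation theta := (theta k).
Implicit Types (x y a s t : R).

Definition gauss t x : R := expR (- (t * x ^+ 2)).

Definition Ek x := fs (ecoef k) x.

Definition gauss_mass t : R := \int[mu]_x gauss t x.

Lemma gaussN t x : gauss t (- x) = gauss t x.
Proof. by rewrite /gauss sqrrN. Qed.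

Lemma gauss_ge0 t x : 0 <= gauss t x.
Proof. exact: expR_ge0. Qed.

Lemma continuous_gauss t : continuous (gauss t).
Proof. by apply: ct_exp; apply: ctN; apply: ctM; [exact: ctC|exact: ctX ctI]. Qed.

Lemma is_derive_gauss t x : is_derive x (1 : R) (gauss t) (- (2 * t * x) * gauss t x).
Proof.
apply: dv_eq (dv_exp (dvN (dvZ t (dvX 2 (dvI x))))) _.
by rewrite /gauss expr1; ring.
Qed.

Lemma Xn_le_exp n x : `|x| ^+ n <= n`!%:R * expR `|x|.
Proof.
rewrite -ler_pdivrMl ?ltr0n ?fact_gt0// -fs_expR.
by apply: (@term_le_fs _ (fun n => n`!%:R^-1)) => //; exact: ent_fact.
Qed.

Lemma ibl_gauss_b (b : R -> R) n t : 0 < t -> measurable_fun [set: measurableTypeR R] b ->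
  (forall x, `|b x| <= 2) -> ibl mu (fun x => x ^+ n * b x * gauss t x).
Proof.
move=> t0 mb b2; apply: (@ibl_gauss _ _ hk _ (n`!%:R * 2) 1) => //.
  by apply: measurable_funM => //; exact: measurable_funX.
move=> x; rewrite normrM normrX mul1r mulrAC.
by apply: ler_pM => //; exact: Xn_le_exp.
Qed.

(** As |c n| <= 1/n!, the series stays below an exponential, which the Gaussian absorbs, and may be
    integrated term by term. The result is an entire series in a, to be identified through
    [gauss_ode]. *)
Lemma gauss_series (c : nat -> R) (b : R -> R) t : 0 < t ->
  measurable_fun [set: measurableTypeR R] b -> (forall x, `|b x| <= 2) ->
  (forall n, `|c n| <= (n`!%:R)^-1) ->
  let r := fun n => c n * \int[mu]_x (x ^+ n * b x * gauss t x) in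
  ent r /\ forall a, ibl mu (fun x => b x * gauss t x * fs c (a * x)) /\
                     \int[mu]_x (b x * gauss t x * fs c (a * x)) = fs r a.
Proof.
move=> t0 mb b2 hc r.
have mg : measurable_fun [set: measurableTypeR R] (gauss t).
  by apply: continuous_measurable_fun; exact: continuous_gauss.
have ec : ent c.
  by apply: (ent_le _ ent_fact) => n; apply: le_trans (hc n) _; exact: ler_norm.
have ib n : ibl mu (fun x => x ^+ n * b x * gauss t x) by exact: ibl_gauss_b.
have iexp q : ibl mu (fun x => 2 * expR (q * `|x|) * gauss t x).
  apply: (@ibl_gauss _ _ hk _ 2 q) => //; last by move=> x; rewrite ger0_norm// mulr_ge0 ?expR_ge0.
  apply: measurable_funM => //; apply: measurableT_comp => //; exact: measurable_funM.
have cexp q x : 0 <= q -> fs (fun n => `|c n|) (q * `|x|) <= expR (q * `|x|).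
  move=> q0; rewrite -fs_expR; apply: ler_fs => //; [exact: ent_norm|exact: ent_fact|exact: mulr_ge0].
have er : ent r.
  move=> q q0; exists (\int[mu]_x (2 * expR (q * `|x|) * gauss t x)) => n.
  rewrite /r normrM mulrAC -(ger0_norm (exprn_ge0 n q0)) -normrM -normrM -rintZ//.
  apply: rint_norm_le => //; first exact: iblZ.
  move=> x; rewrite normrM (normrM (_ * b x)) (ger0_norm (gauss_ge0 _ _)) mulrA.
  rewrite ler_wpM2r ?gauss_ge0// [`|_ * b x|]normrM mulrA [leRHS]mulrC; apply: ler_pM => //.
  apply: le_trans (cexp q x q0).
  rewrite -normrM [in leLHS](_ : c n * q ^+ n * x ^+ n = c n * (q * x) ^+ n); last by rewrite exprMn; ring.
  rewrite normrM normrX normrM (ger0_norm q0).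
  by apply: term_le_fs; [exact: ent_norm|move=> m|rewrite mulr_ge0].
split=> // a.
have ih : ibl mu (fun x => `|b x * gauss t x| * fs (fun n => `|cdil a c n|) `|x|).
  apply: (ibl_le _ (iexp `|a|)).
    apply: measurable_funM; first by apply: measurableT_comp => //; exact: measurable_funM.
    apply: (measurableT_comp (measurable_fs (ent_norm (ent_dil a ec)))) => //.
  move=> x; rewrite normrM normr_id normrM (ger0_norm (gauss_ge0 _ _)) mulrAC.
  rewrite ler_wpM2r ?gauss_ge0//; apply: ler_pM => //.
  rewrite ger0_norm; last first.
    by apply: fs_ge0 => //; apply/ent_norm/ent_dil.
  rewrite (_ : fs _ _ = fs (fun n => `|c n|) (`|a| * `|x|)); first exact: cexp.
  by rewrite -fs_dil; apply: eq_fs => n; rewrite /cdil normrM normrX.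
have ihn n : ibl mu (fun x => x ^+ n * (b x * gauss t x)).
  by apply: (ibl_eq _ (ib n)) => x; rewrite mulrA.
have [i cv] := @rint_fs _ mu (fun x => b x * gauss t x) (cdil a c) (ent_dil a ec)
  (measurable_funM mb mg) ih ihn.
split; first by apply: (ibl_eq _ i) => x; rewrite fs_dil.
rewrite -[LHS](rint_eq mu (f := fun x => b x * gauss t x * fs (cdil a c) x)); last by move=> x; rewrite fs_dil.
apply: (cvg_unique _ cv) => //.
rewrite (_ : series _ = pseries r a); first exact: ent_fs.
apply/funext => n; rewrite /pseries /series /=; apply: eq_bigr => j _.
rewrite /cdil /r mulrAC [RHS]mulrC [c j * _]mulrC mulrA; congr (_ * _ * _).
by apply: rint_eq => x; rewrite mulrA.
Qed.

(** The recurrence says 2t T f = (y - s x) f. Multiplication by exp(s x^2 / (4t)), an even function,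
    for which T obeys the Leibniz rule, removes the term in x. The difference J with the expected
    solution then satisfies T J = u J and J(0) = 0, and the energy inequality forces J = 0. *)
Lemma gauss_ode (r : nat -> R) s t y : 0 < t -> ent r ->
  (forall n, 2 * t * (theta n.+1 * r n.+1) = y * r n - s * cshift r n) ->
  forall x, fs r x = r 0%N * Ek (y * x / (2 * t)) * gauss (s / (4 * t)) x.
Proof.
move=> t0 er hr x.
have tn0 : t != 0 by rewrite gt_eqF.
pose u := y / (2 * t).
have eE := ent_dil u (ent_ecoef hk).
pose J z := fs r z * gauss (- (s / (4 * t))) z - r 0%N * fs (cdil u (ecoef k)) z.
have TrE z : z != 0 -> fs (Tc k r) z = (y - s * z) / (2 * t) * fs r z.
  move=> z0; have -> : (y - s * z) / (2 * t) * fs r z = (2 * t)^-1 * (y * fs r z - s * (z * fs r z)) by ring.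
  rewrite -fs_shift// -!fsZ//; last exact: ent_shift.
  rewrite -fsB; [|exact: entZ|by apply: entZ; exact: ent_shift].
  rewrite -fsZ; last by apply: entB; [exact: entZ|by apply: entZ; exact: ent_shift].
  apply: eq_fs => n; rewrite -hr /Tc; field; exact: tn0.
have J0 z : J z = 0.
  have h := @energy _ k hk u 0 J (fun=> 0) _ _ _ _ z.
  have : J z ^+ 2 <= 0.
    move: h; rewrite expr0n /= !addr0 => h; apply: le_trans (h _ _ _ _) _.
    - apply: ctB; apply: ctM; [exact: continuous_fs|exact: continuous_gauss|exact: ctC|exact: continuous_fs].
    - exact: ctC.
    - move=> w w0.
      have D := dvB (dvM (is_derive_fsT k er w0) (is_derive_gauss (- (s / (4 * t))) w)) (dvZ (r 0%N) (is_derive_fsT k eE w0)).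
      apply: dv_eq D _.
      rewrite TrE// (fs_Tdil hk u w (ent_ecoef hk)) (eq_fs _ (Tc_ecoef hk)) /J gaussN !fs_dil /u; field.
      by rewrite w0 tn0.
    - by move=> w w0; apply: dv_eq (dvC _ _) _; rewrite !(mulr0, mul0r, subr0, addr0, oppr0, subrr).
    - by rewrite /J !fs0 /gauss expr0n mulr0 oppr0 expR0 /cdil expr0 ecoef0 !mulr1 subrr expr0n/= mulr0.
  by move=> h2; apply/eqP; rewrite -sqrf_eq0 eq_le h2 sqr_ge0.
have := J0 x; rewrite /J fs_dil => /eqP; rewrite subr_eq0 => /eqP e.
rewrite /Ek (_ : y * x / (2 * t) = u * x); last by rewrite /u; ring.
rewrite -e -mulrA /gauss -expRD (_ : _ + _ = 0) ?expR0 ?mulr1//; ring.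
Qed.

Lemma measurable_dil_cas y : measurable_fun [set: measurableTypeR R] (fun x => cas (y * x)).
Proof.
apply: continuous_measurable_fun; apply: ct_comp; first exact: continuous_cas.
by apply: ctM; [exact: ctC|exact: ctI].
Qed.

Definition gauss_moment t y n : R := \int[mu]_x (x ^+ n * cas (y * x) * gauss t x).

Lemma gauss_moment_ibl t y n : 0 < t -> ibl mu (fun x => x ^+ n * cas (y * x) * gauss t x).
Proof.
move=> t0; apply: ibl_gauss_b => //; first exact: measurable_dil_cas.
by move=> x; exact: cas_bound.
Qed.

(** Skew-symmetry of T_k for f(x) = x^n exp(-t x^2) and h(x) = cas(yx), with T_k h(x) = y cas(-yx).
    For n = 0 the default value of [n.-1] is harmless, as theta 0 = 0. *)
Lemma gauss_moment_rec t y n : 0 < t ->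
  2 * t * gauss_moment t y n.+1 =
  theta n * gauss_moment t y n.-1 + (-1) ^+ n * y * gauss_moment t y n.
Proof.
move=> t0.
have ik := ent_kap hk.
pose f x := x ^+ n * gauss t x.
pose f1 x := (theta n * x ^+ n.-1 - 2 * t * x ^+ n.+1) * gauss t x.
pose h x := cas (y * x).
pose h1 x := y * cas (- (y * x)).
have cX m : continuous (fun x : R => x ^+ m) by exact: ctX ctI.
have cg := continuous_gauss (t := t).
have ch : continuous h by apply: ct_comp; [exact: continuous_cas|apply: ctM; [exact: ctC|exact: ctI]].
have ch1 : continuous h1.
  apply: ctM; first exact: ctC.
  by apply: ct_comp; [exact: continuous_cas|apply: ctN; apply: ctM; [exact: ctC|exact: ctI]].
have iI m := @gauss_moment_ibl t y m t0.
have iIN m : ibl mu (fun x => x ^+ m * cas (- (y * x)) * gauss t x).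
  by apply: (ibl_eq _ (@gauss_moment_ibl t (- y) m t0)) => x; rewrite mulNr.
have INE m : \int[mu]_x (x ^+ m * cas (- (y * x)) * gauss t x) = (-1) ^+ m * gauss_moment t y m.
  rewrite /gauss_moment -rintZ// -[RHS]rint_dunklN; last by exact: ibl_meas (iblZ _ (iI m)).
  apply: rint_eq => x; by rewrite [(- x) ^+ m]exprNn gaussN mulrN; case: (@sgnP R m) => ->; ring.
(* Skew-symmetry requires decay of f h: completing the square gives |x|^m exp(-t x^2) <= m!
   exp(1/(4t)), used for m = n and m = n + [decay_order]. *)
have [D HD] : exists D : R, forall x, `|f x * h x| * dunkl_weight k x <= D * (oneDsqr x)^-1.
  pose N := decay_order k.
  have gb m x : `|x ^+ m * gauss t x| <= m`!%:R * expR (1 / (4 * t)).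
    rewrite normrM normrX (ger0_norm (gauss_ge0 _ _)).
    apply: le_trans (ler_wpM2r (gauss_ge0 _ _) (Xn_le_exp m x)) _.
    rewrite -mulrA ler_wpM2l// /gauss -expRD ler_expR -subr_ge0.
    rewrite -(real_normK (num_real x)).
    have -> : 1 / (4 * t) - (`|x| - t * `|x| ^+ 2) = (1 / 2 - t * `|x|) ^+ 2 / t.
      by field; rewrite gt_eqF.
    by rewrite divr_ge0 ?sqr_ge0// ltW.
  pose C := 2 * ((n`!%:R + (n + N)`!%:R) * expR (1 / (4 * t))).
  exists (2 * C) => x; apply: weight_decay => //.
    rewrite normrM mulrC; apply: ler_pM => //; first exact: cas_bound.
    apply: le_trans (gb n x) _; rewrite ler_wpM2r ?expR_ge0// lerDl//.
  rewrite normrM mulrCA mulrA mulrC; apply: ler_pM => //.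
  - exact: cas_bound.
  - rewrite -normrX -normrM (_ : f x * x ^+ N = x ^+ (n + N) * gauss t x); last by rewrite /f exprD; ring.
    apply: le_trans (gb (n + N)%N x) _.
    by rewrite ler_wpM2r ?expR_ge0// lerDr.
have := @rint_dunkl_antisym _ k hk f h f1 h1 D _ _ _ _ _ _ _ _ HD.
have e1 : (fun x => f1 x * h x) =1 (fun x => theta n * (x ^+ n.-1 * cas (y * x) * gauss t x) -
      2 * t * (x ^+ n.+1 * cas (y * x) * gauss t x)).
  by move=> x; rewrite /f1 /h; ring.
have e2 : (fun x => f x * h1 x) =1 (fun x => y * (x ^+ n * cas (- (y * x)) * gauss t x)).
  by move=> x; rewrite /f /h1; ring.
have i1 : ibl mu (fun x => f1 x * h x).
  have i0 := iblB (iblZ (theta n) (iI n.-1)) (iblZ (2 * t) (iI n.+1)).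
  by apply: (ibl_eq _ i0) => x; rewrite e1.
have i2 : ibl mu (fun x => f x * h1 x) by apply: (ibl_eq _ (iblZ y (iIN n))) => x; rewrite e2.
move=> H; have {H} : \int[mu]_x (f1 x * h x) = - \int[mu]_x (f x * h1 x).
  apply: H => //.
  - exact: ctM.
  - by apply: ctM => //; apply: ctB; apply: ctM => //; exact: ctC.
  - move=> x x0; apply: dv_eq (dvM (dvX n (dvI x)) (is_derive_gauss t x)) _.
    rewrite /f1 /f gaussN exprNn /theta; case: (n) => [|m] /=; rewrite ?expr0 ?exprS; field; exact: x0.
  - move=> x x0; have hE : h = fs (cdil y (kap k)) by apply/funext => z; rewrite fs_dil.
    have := is_derive_fsT k (ent_dil y ik) x0; rewrite hE => D0; apply: dv_eq D0 _.
    by rewrite (fs_Tdil hk)// (eq_fs _ (Tc_kap hk)) fs_alt !fs_dil.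
rewrite (rint_eq mu e1) (rint_eq mu e2) rintB; [|exact: iblZ|exact: iblZ].
rewrite !rintZ// INE -!/(gauss_moment _ _ _) => /eqP.
rewrite subr_eq => /eqP ->; ring.
Qed.

End gaussian.

(** * The Dunkl heat kernel *)

Section heat_kernel.
Context {R : realType} (k : R) (hk : 0 <= k).
Local Notation mu := (dunkl_measure k).
Local Notation cas := (cas k).
Local Notation theta := (theta k).
Local Notation gauss_mass := (gauss_mass k).
Implicit Types (x y a s t : R).

Lemma gauss_ibl t : 0 < t -> ibl mu (gauss t).
Proof.
move=> t0; apply: (ibl_eq _ (@gauss_moment_ibl _ k hk t 0 0 t0)) => x.
by rewrite expr0 mul1r /cas mul0r fs0 kap0 mul1r.
Qed.

Lemma kap_gauss_moment_rec t y n : 0 < t ->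
  let r := fun n => kap k n * gauss_moment k t y n in
  2 * t * (theta n.+1 * r n.+1) = y * r n - 1 * cshift r n.
Proof.
move=> t0 r; have e := gauss_moment_rec hk y n t0.
have -> : 2 * t * (theta n.+1 * r n.+1) =
    (theta n.+1 * kap k n.+1) * (2 * t * gauss_moment k t y n.+1) by rewrite /r; ring.
rewrite kapS// e; case: n {e} => [|n] /=.
  by rewrite /theta /r expr0 subrr mulr0 addr0 !mul0r; ring.
have -> : (-1) ^+ n.+1 * kap k n.+1 * (theta n.+1 * gauss_moment k t y n +
     (-1) ^+ n.+1 * y * gauss_moment k t y n.+1) =
   (-1) ^+ n.+1 * (theta n.+1 * kap k n.+1) * gauss_moment k t y n +
   (-1) ^+ n.+1 * (-1) ^+ n.+1 * y * (kap k n.+1 * gauss_moment k t y n.+1) by ring.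
by rewrite kapS// /r exprS; case: (@sgnP R n) => ->; ring.
Qed.

Lemma kap_le n : `|kap k n| <= (n`!%:R)^-1.
Proof. by rewrite /kap normrM csgn_norm mul1r; exact: ecoef_le. Qed.

Lemma gauss_cas_cas t x y : 0 < t ->
  \int[mu]_l (cas (y * l) * gauss t l * cas (x * l)) =
  \int[mu]_l (cas (y * l) * gauss t l) * Ek k (y * x / (2 * t)) * gauss (1 / (4 * t)) x.
Proof.
move=> t0; have bc (l : R) : `|cas (y * l)| <= 2 by exact: cas_bound.
have [er /(_ x)[_ ->]] := gauss_series hk t0 (measurable_dil_cas hk y) bc kap_le.
rewrite (gauss_ode hk t0 er (fun n => kap_gauss_moment_rec y n t0)) kap0 mul1r.
by congr (_ * _ * _); apply: rint_eq => l; rewrite expr0 mul1r.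
Qed.

Lemma hartley_gauss t y : 0 < t -> hartley k (gauss t) y = gauss_mass t * gauss (1 / (4 * t)) y.
Proof.
move=> t0; have := @gauss_cas_cas t y 0 t0; rewrite !mul0r /Ek fs0 ecoef0 mulr1.
have cas0 l : cas (0 * l) = 1 by rewrite /cas mul0r fs0 kap0.
rewrite (rint_eq mu (f := fun l => cas (0 * l) * gauss t l) (g := gauss t)); last by move=> l; rewrite cas0 mul1r.
by move=> <-; apply: rint_eq => l; rewrite cas0 mul1r [l * y]mulrC.
Qed.

(** Up to normalisation this is the Dunkl heat kernel: transforming, multiplying by a Gaussian and
    transforming again is the integral operator with this kernel. *)
Lemma gauss_kernel t x y : 0 < t ->
  hartley k (fun l => gauss t l * cas (l * x)) y =
  gauss_mass t * gauss (1 / (4 * t)) x * gauss (1 / (4 * t)) y * Ek k (x * y / (2 * t)).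
Proof.
move=> t0; have := @gauss_cas_cas t y x t0.
rewrite (rint_eq mu (f := fun l => cas (x * l) * gauss t l) (g := fun l => gauss t l * cas (l * x))); last first.
  by move=> l; rewrite mulrC [l * x]mulrC.
rewrite -/(hartley k (gauss t) x) hartley_gauss// => h.
have -> : gauss_mass t * gauss (1 / (4 * t)) x * gauss (1 / (4 * t)) y * Ek k (x * y / (2 * t)) =
  gauss_mass t * gauss (1 / (4 * t)) x * Ek k (x * y / (2 * t)) * gauss (1 / (4 * t)) y by ring.
by rewrite -h; apply: rint_eq => l; rewrite [l * y]mulrC [l * x]mulrC; ring.
Qed.

(** The source of the constant mass of the heat kernel: its own Gaussian factor in y cancels the one
    on the right. The proof is again [gauss_ode], now with eigenvalue 0 and s = -1. *)
Lemma gauss_Ek t y : 0 < t ->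
  ibl mu (fun x => gauss t x * Ek k (y * x)) /\
  \int[mu]_x (gauss t x * Ek k (y * x)) = gauss_mass t * gauss (- (1 / (4 * t))) y.
Proof.
move=> t0; have m1 : measurable_fun [set: measurableTypeR R] (fun=> 1 : R) by [].
have b1 (x : R) : `|1 : R| <= 2 by rewrite normr1 ler1n.
have [er /(_ y)[i h]] := gauss_series hk t0 m1 b1 (ecoef_le hk).
split; first by apply: (ibl_eq _ i) => x; rewrite mul1r.
pose r n := ecoef k n * \int[mu]_x (x ^+ n * 1 * gauss t x).
have rE n : r n = ecoef k n * gauss_moment k t 0 n.
  by congr (_ * _); apply: rint_eq => x; rewrite /cas mul0r fs0 kap0.
have hr n : 2 * t * (theta n.+1 * r n.+1) = 0 * r n - (- 1) * cshift r n.
  have -> : 2 * t * (theta n.+1 * r n.+1) =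
    Tc k (ecoef k) n * (2 * t * gauss_moment k t 0 n.+1) by rewrite rE /Tc; ring.
  rewrite Tc_ecoef// gauss_moment_rec//; case: n => [|n].
    by rewrite /= /theta expr0 subrr mulr0 addr0 !mul0r; ring.
  have tE : ecoef k n = theta n.+1 * ecoef k n.+1 by rewrite -[LHS](Tc_ecoef hk).
  by rewrite (_ : cshift r n.+1 = r n)// !rE tE /=; ring.
rewrite (rint_eq mu (g := fun x => 1 * gauss t x * fs (ecoef k) (y * x))); last by move=> x; rewrite mul1r.
rewrite h -/r (gauss_ode hk t0 er hr) !mul0r /Ek fs0 ecoef0 mulr1 mulNr; congr (_ * _).
by rewrite mul1r; apply: rint_eq => x; rewrite expr0 !mul1r.
Qed.

(** Schur's test wants a nonnegative kernel, and nothing is known here about the sign of [Ek] on the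
    negative axis; an even majorant takes its place. The constant 2 comes from bounding the odd part
    at |x| by three times the even part. *)
Lemma Ek_le x : `|Ek k x| <= 2 * (Ek k x + Ek k (- x)).
Proof.
have eE := ent_ecoef hk; have eA := ent_alt eE.
have e0 n : 0 <= ecoef k n by rewrite invr_ge0 ltW// gam_gt0.
have s0 n : 0 <= 1 + (-1) ^+ n :> R by case: (@sgnP R n) => ->; lra.
have tS n : ecoef k n.+1 * theta n.+1 = ecoef k n.
  by rewrite mulrC -[LHS]/(Tc k (ecoef k) n) Tc_ecoef.
apply: le_trans (fs_norm_le x eE) _; rewrite /Ek -fs_alt -fsD//.
have -> : fs (fun n => ecoef k n + calt (ecoef k) n) x = fs (fun n => ecoef k n + calt (ecoef k) n) `|x|.
  have [x0|x0] := leP 0 x; first by rewrite ger0_norm.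
  rewrite ltr0_norm// -fs_alt; apply: eq_fs => n; rewrite /calt.
  by case: (@sgnP R n) => ->; ring.
set X := `|x|; have X0 : 0 <= X by exact: normr_ge0.
pose ev n := ecoef k n + calt (ecoef k) n.
pose od n := ecoef k n - calt (ecoef k) n.
have eev : ent ev by exact: entD.
have eod : ent od by exact: entB.
have evE n : ev n = (1 + (-1) ^+ n) * ecoef k n by rewrite /ev /calt; ring.
have odE n : od n = (1 - (-1) ^+ n) * ecoef k n by rewrite /od /calt; ring.
have ev0 n : 0 <= ev n by rewrite evE mulr_ge0.
have -> : fs (fun n => `|ecoef k n|) X = (fs ev X + fs od X) / 2.
  rewrite -fsD// mulrC -fsZ; last exact: entD.
  by apply: eq_fs => n; rewrite ger0_norm// /ev /od; field.
suff : fs od X <= 3 * fs ev X by lra.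
have od0 n : 0 <= od n by rewrite odE; case: (@sgnP R n) => ->; rewrite mulr_ge0//; lra.
(* The odd term of degree 2N + 1 is controlled by its two even neighbours, by an inequality between
   arithmetic and geometric means that rests on theta (2N+2) <= 2 theta (2N+1). *)
have st N : od N.*2 * X ^+ N.*2 + od N.*2.+1 * X ^+ N.*2.+1 <=
    ev N.*2 * X ^+ N.*2 + 2 * (ev N.*2.+2 * X ^+ N.*2.+2).
  have sg : (-1) ^+ N.*2 = 1 :> R by rewrite -signr_odd odd_double.
  have : 0 <= ecoef k N.*2.+2 * X ^+ N.*2 by rewrite mulr_ge0 ?exprn_ge0.
  rewrite !odE !evE !exprS sg -(tS N.*2) -(tS N.*2.+1).
  have : theta N.*2.+2 <= 2 * theta N.*2.+1.
    rewrite /theta !exprS sg -[N.*2.+2]addn1 natrD.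
    have : 1 <= N.*2.+1%:R :> R by rewrite ler1n.
    by move: hk; lra.
  have : 0 < theta N.*2.+1 by exact: thetaS_gt0.
  have : 0 < theta N.*2.+2 by exact: thetaS_gt0.
  set b := theta _.+2; set a := theta _.+1; set e := ecoef _ _; set Y := X ^+ _.
  move=> b0 a0 ba eY.
  have -> : (1 - 1) * (e * b * a) * Y + (1 - -1 * 1) * (e * b) * (X * Y) = (e * Y) * (2 * b * X) by ring.
  have -> : (1 + 1) * (e * b * a) * Y + 2 * ((1 + -1 * (-1 * 1)) * e * (X * (X * Y))) =
    (e * Y) * (2 * (a * b) + 4 * X ^+ 2) by ring.
  by apply: ler_wpM2l => //; nra.
have P N : pseries od X N.*2 <= pseries ev X N.*2 + 2 * pseries ev X N.*2.+2.
  rewrite /pseries /series /=; elim: N => [|N IH].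
    apply: (@le_trans _ _ 0); first by rewrite big_geq.
    by apply: addr_ge0; [|apply: mulr_ge0 => //]; apply: sumr_ge0 => i _; rewrite mulr_ge0 ?exprn_ge0.
  rewrite doubleS [X in X <= _]big_nat_recr//= [X in X + _ <= _]big_nat_recr//=.
  rewrite [X in _ <= X + _]big_nat_recr//= [X in _ <= X + _ + _]big_nat_recr//=.
  rewrite [X in _ <= _ + 2 * X]big_nat_recr//= [X in _ <= _ + 2 * (X + _)]big_nat_recr//=.
  have := st N; have : 0 <= ev N.*2.+1 * X ^+ N.*2.+1 by rewrite mulr_ge0 ?exprn_ge0.
  have : 0 <= ev N.*2.+3 * X ^+ N.*2.+3 by rewrite mulr_ge0 ?exprn_ge0.
  by move: IH; lra.
have -> : 3 * fs ev X = fs ev X + 2 * fs ev X by ring.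
apply: (limr_le (f := pseries od X)).
  by apply/cvg_ex; exists (fs od X); exact: ent_fs.
apply: nearW => N.
have le1 : pseries od X N <= pseries od X N.*2.
  rewrite /pseries /series /= (@big_cat_nat _ _ _ N _ N.*2) //= ?lerDl; last by rewrite -addnn leq_addr.
  by apply: sumr_ge0 => i _; rewrite mulr_ge0 ?exprn_ge0.
apply: le_trans le1 (le_trans (P N) _).
by apply: lerD; [|apply: ler_wpM2l => //]; rewrite /pseries /series /=; apply: psum_le_fs.
Qed.

End heat_kernel.

(** * Schur's test for a symmetric kernel of constant mass *)

Section schur.
Context d (T : measurableType d) {R : realType} (mu : {sigma_finite_measure set T -> \bar R}).

(** Under the kernel, |f(x) f(y)| <= (f(x)^2 + f(y)^2) / 2, and by symmetry both halves integrate to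
    A/2 times int f^2. The bound B makes f^2 K(., y) integrable for every single y. *)
Lemma schur_test (K : T -> T -> R) (A : R) (B : T -> R) (f G : T -> R) :
  measurable_fun setT (fun z : T * T => K z.1 z.2) ->
  (forall x y, 0 <= K x y) -> (forall x y, K x y = K y x) ->
  (forall x y, K x y <= B y) ->
  (forall y, ibl mu (K ^~ y)) -> (forall y, \int[mu]_x K x y = A) ->
  measurable_fun setT f -> ibl mu (fun x => f x ^+ 2) -> measurable_fun setT G ->
  (forall y, `|G y| <= \int[mu]_x (`|f x| * K x y)) ->
  ibl mu (fun y => f y * G y) /\ \int[mu]_y (f y * G y) <= A * \int[mu]_x f x ^+ 2.
Proof.
move=> mK K0 Ks KB iK KA mf if2 mG GK.
pose F (z : T * T) := (f z.1 ^+ 2 * K z.1 z.2)%:E.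
have mF : measurable_fun setT F.
  apply/measurable_EFinP; apply: measurable_funM => //.
  by apply: measurable_funX; exact: measurableT_comp.
have F0 z : (0 <= F z)%E by rewrite lee_fin mulr_ge0 ?sqr_ge0.
have iQ y : ibl mu (fun x => f x ^+ 2 * K x y).
  apply: (ibl_le _ (iblZ (B y) if2)); first exact: measurable_funM (ibl_meas if2) (ibl_meas (iK y)).
  by move=> x; rewrite ger0_norm; [rewrite mulrC ler_wpM2r ?sqr_ge0|rewrite mulr_ge0 ?sqr_ge0].
pose Q y := \int[mu]_x (f x ^+ 2 * K x y).
have QE y : (Q y)%:E = fubini_G mu F y by rewrite -iblE.
have Q0 y : 0 <= Q y by apply: rint_ge0 => x; rewrite mulr_ge0 ?sqr_ge0.
have mQ : measurable_fun setT Q.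
  apply/measurable_EFinP; rewrite (_ : EFin \o Q = fubini_G mu F).
    exact: measurable_fun_fubini_tonelli_G.
  by apply/funext => y; exact: QE.
have IQ : (\int[mu]_y (Q y)%:E = (A * \int[mu]_x f x ^+ 2)%:E)%E.
  under eq_integral do rewrite QE.
  rewrite -fubini_tonelli// -rintZ// -iblE; last exact: iblZ.
  apply: eq_integral => x _; rewrite /fubini_F /F /=.
  rewrite (_ : (fun y => _) = fun y => (f x ^+ 2 * K y x)%:E); last by apply/funext => y; rewrite Ks.
  by rewrite iblE ?rintZ ?KA 1?mulrC//; exact: iblZ.
have ibQ : ibl mu Q.
  apply: iblP => //; under eq_integral do rewrite ger0_norm//.
  by rewrite IQ ltry.
have {IQ} IQ : \int[mu]_y Q y = A * \int[mu]_x f x ^+ 2.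
  by move: IQ; rewrite iblE// => -[].
pose D y := 2^-1 * (A * f y ^+ 2) + 2^-1 * Q y.
have iD : ibl mu D by apply: iblD; apply: iblZ => //; exact: iblZ.
have iP y : ibl mu (fun x => `|f x| * K x y).
  apply: (ibl_le _ (iblD (iQ y) (iK y))).
    by apply: measurable_funM (ibl_meas (iK y)); exact: measurableT_comp.
  move=> x; rewrite normrM normr_id (ger0_norm (K0 _ _)) (_ : _ + _ = (f x ^+ 2 + 1) * K x y); last by ring.
  rewrite ler_wpM2r//.
  by rewrite -(real_normK (num_real (f x))); nra.
have fGD y : `|f y * G y| <= D y.
  rewrite normrM; apply: le_trans (ler_wpM2l (normr_ge0 _) (GK y)) _.
  have -> : D y = \int[mu]_x (2^-1 * (f y ^+ 2 * K x y) + 2^-1 * (f x ^+ 2 * K x y)).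
    rewrite rintD; [|by apply: iblZ; exact: iblZ|exact: iblZ].
    by rewrite !rintZ ?KA//; [rewrite /D [A * _]mulrC|exact: iblZ].
  rewrite -rintZ//.
  apply: rint_le; [exact: iblZ|by apply: iblD; apply: iblZ => //; exact: iblZ|].
  move=> x; have := K0 x y; rewrite -(real_normK (num_real (f x))) -(real_normK (num_real (f y))).
  by move: (normr_ge0 (f x)) (normr_ge0 (f y)); have := sqr_ge0 (`|f x| - `|f y|); nra.
have iFG : ibl mu (fun y => f y * G y) by apply: (ibl_le _ iD) => //; exact: measurable_funM.
split=> //; apply: le_trans (rint_le iFG iD (fun y => le_trans (ler_norm _) (fGD y))) _.
rewrite rintD; [|by apply: iblZ; exact: iblZ|exact: iblZ].
rewrite !rintZ//; last exact: iblZ.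
by rewrite IQ; lra.
Qed.

End schur.

(** * The mean-square estimate for the real transform *)

Section bessel.
Context {R : realType} (k : R) (hk : 0 <= k).
Local Notation mu := (dunkl_measure k).
Local Notation cas := (cas k).
Implicit Types (x y a s t : R) (f : R -> R).

Lemma gauss_mass_scale t s : 0 < s -> 0 < t ->
  gauss_mass k t = s `^ (2 * k + 1) * gauss_mass k (t * s ^+ 2).
Proof.
move=> s0 t0; have := @ge0_integral_dunkl_scale _ k hk (gauss t) s s0 (continuous_gauss (t := t)) (gauss_ge0 t).
rewrite (iblE (gauss_ibl hk t0)).
have i2 : ibl mu (fun x => gauss t (s * x)).
  apply: (ibl_eq _ (gauss_ibl hk (t := t * s ^+ 2) _)) => [x|]; first by rewrite /gauss; congr expR; ring.
  by rewrite mulr_gt0 ?exprn_gt0.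
rewrite (iblE i2) => -[h]; rewrite /gauss_mass h; congr (_ * _); apply: rint_eq => x.
by rewrite /gauss; congr expR; ring.
Qed.

(** By homogeneity the mass of a Gaussian times that of its dual Gaussian does not depend on the
    width: both are scaled to width 1, by n + 1 and by (n + 1)/2, and the powers of n cancel. *)
Lemma gauss_mass_prod n :
  gauss_mass k (n.+1%:R ^- 2) * gauss_mass k (1 / (4 * n.+1%:R ^- 2)) =
  2 `^ (2 * k + 1) * gauss_mass k 1 ^+ 2.
Proof.
set p := 2 * k + 1.
have n0 : 0 < n.+1%:R :> R by rewrite ltr0n.
have h1 := gauss_mass_scale (s := n.+1%:R) n0 (t := n.+1%:R ^- 2) _.
have h2 := gauss_mass_scale (s := n.+1%:R / 2) _ (t := 1) ltr01.
rewrite h1 ?invr_gt0 ?exprn_gt0// mulVf ?expf_neq0 ?gt_eqF// !mul1r.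
rewrite [in RHS]expr2 [X in _ = _ * (_ * X)]h2 ?divr_gt0//.
rewrite -/p !mul1r (_ : (n.+1%:R / 2) ^+ 2 = (4 * n.+1%:R ^- 2)^-1); last by field; rewrite gt_eqF.
rewrite (_ : n.+1%:R `^ p = 2 `^ p * (n.+1%:R / 2) `^ p); first by ring.
by rewrite -powRM ?divr_ge0//; congr (_ `^ _); field.
Qed.

Lemma gauss_mass_gt0 t : 0 < t -> 0 < gauss_mass k t.
Proof.
move=> t0; rewrite -lte_fin -iblE; last exact: gauss_ibl.
have mg : measurable_fun [set: measurableTypeR R] (gauss t).
  by apply: continuous_measurable_fun; exact: continuous_gauss.
rewrite ge0_integral_dunkl//; [|exact/measurable_EFinP|by move=> x; rewrite lee_fin gauss_ge0].
have mi : measurable ([set` (`[1, 2])%R] : set (measurableTypeR R)) by exact: measurable_itv.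
(* On [1, 2] the Gaussian is at least its value at 2 and the weight is at least 1. *)
apply: (@lt_le_trans _ _ (\int[lebesgue_measure]_(x in [set` (`[1%R, 2%R])%R]) (gauss t 2)%:E)%E).
  rewrite integral_cst//= lebesgue_measure_itv/= lte_fin ltrDl ltr01 -EFinB -EFinM lte_fin.
  by rewrite mulr_gt0 ?expR_gt0//; lra.
apply: (@le_trans _ _ (\int[lebesgue_measure]_(x in [set` (`[1%R, 2%R])%R]) ((gauss t x) * dunkl_weight k x)%:E)%E).
  apply: ge0_le_integral => //.
  - by move=> x _; rewrite lee_fin gauss_ge0.
  - apply/measurable_EFinP; apply: measurable_funTS; apply: measurable_funM => //.
    exact: measurable_dunkl_weight.
  move=> x; rewrite /= in_itv/= => /andP[x1 x2]; rewrite lee_fin.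
  rewrite -[leLHS]mulr1; apply: ler_pM; [exact: gauss_ge0|by []| |].
    by rewrite /gauss ler_expR lerN2; apply: ler_wpM2l; [exact: ltW|nra].
  rewrite /dunkl_weight ger0_norm; last by lra.
  rewrite -[leLHS](powRr0 x); apply: ler_powR => //; move: hk; lra.
apply: ge0_subset_integral => //.
- apply/measurable_EFinP; apply: measurable_funM => //; exact: measurable_dunkl_weight.
- by move=> x _; rewrite lee_fin mulr_ge0 ?gauss_ge0 ?dunkl_weight_ge0.
Qed.

(* Expanding the square and integrating the Gaussian first gives the quadratic
   form of a heat kernel in |f|, which Schur's test bounds. *)
Lemma rint_gauss_sqr f t : 0 < t -> ibl mu f -> ibl mu (fun x => f x ^+ 2) ->
  \int[mu]_x (gauss t x * hartley k f x ^+ 2) <=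
  4 * (gauss_mass k t * gauss_mass k (1 / (4 * t))) * \int[mu]_x f x ^+ 2.
Proof.
move=> t0 fi f2; set s := 1 / (4 * t); have s0 : 0 < s by rewrite divr_gt0// mulr_gt0.
have mH := measurable_hartley hk fi.
have mg u : measurable_fun [set: measurableTypeR R] (gauss u).
  by apply: continuous_measurable_fun; exact: continuous_gauss.
have igH : ibl mu (fun x => gauss t x * hartley k f x).
  apply: (ibl_le (measurable_funM (mg t) mH) (iblZ (2 * \int[mu]_x `|f x|) (gauss_ibl hk t0))) => x.
  by rewrite normrM (ger0_norm (gauss_ge0 _ _)) mulrC ler_wpM2r ?gauss_ge0// hartley_bound.
have igc y : ibl mu (fun l => gauss t l * cas (l * y)) by apply: ibl_cas => //; exact: gauss_ibl.
pose Kt x y := gauss_mass k t * gauss s x * gauss s y * Ek k (x * y / (2 * t)).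
pose G y := \int[mu]_x (f x * Kt y x).
have GE y : hartley k (fun x => gauss t x * hartley k f x) y = G y.
  rewrite {1}/hartley (rint_eq mu (f := fun x => gauss t x * hartley k f x * cas (x * y)) (g := fun x => gauss t x * cas (x * y) * hartley k f x)); last by move=> x; ring.
  by rewrite rint_hartley//; apply: rint_eq => x; rewrite gauss_kernel.
(* The majorant from [Ek_le]. Each of its two exponentials carries the mass of one heat kernel, so
   with the factor 2 of [Ek_le] the total mass is 4 times that of [Kt]. *)
pose K x y := 2 * gauss_mass k t * (gauss s x * gauss s y * (Ek k (x * y / (2 * t)) + Ek k (- (x * y / (2 * t))))).
have M0 : 0 <= gauss_mass k t by apply: rint_ge0 => x; exact: gauss_ge0.
have E0 x : 0 <= Ek k x + Ek k (- x) by have := le_trans (normr_ge0 _) (Ek_le hk x); lra.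
have KtK x y : `|Kt y x| <= K x y.
  rewrite /Kt /K normrM ger0_norm ?mulr_ge0 ?gauss_ge0// [y * x]mulrC.
  apply: le_trans (ler_wpM2l _ (Ek_le hk _)) _; rewrite ?mulr_ge0 ?gauss_ge0//.
  by rewrite le_eqVlt; apply/orP; left; apply/eqP; ring.
have iKt y : ibl mu (fun x => gauss s x * Ek k (y / (2 * t) * x)).
  by have [] := gauss_Ek hk (y / (2 * t)) s0.
have IKt y : \int[mu]_x (gauss s x * Ek k (y / (2 * t) * x)) * gauss s y = gauss_mass k s.
  have [_ ->] := gauss_Ek hk (y / (2 * t)) s0.
  rewrite -mulrA /gauss -expRD (_ : _ + _ = 0) ?expR0 ?mulr1//.
  by rewrite /s; field; rewrite gt_eqF.
have KE x y : K x y = 2 * gauss_mass k t * gauss s y * (gauss s x * Ek k (y / (2 * t) * x)) +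
   2 * gauss_mass k t * gauss s y * (gauss s x * Ek k (- y / (2 * t) * x)).
  rewrite /K (_ : y / (2 * t) * x = x * y / (2 * t)); last by ring.
  by rewrite (_ : - y / (2 * t) * x = - (x * y / (2 * t))); ring.
have iK y : ibl mu (K ^~ y).
  by apply: (ibl_eq _ (iblD (iblZ _ (iKt y)) (iblZ _ (iKt (- y))))) => x; rewrite KE.
have cE : continuous (Ek k) by apply: continuous_fs; exact: ent_ecoef.
pose B y := 2 * gauss_mass k t * gauss s y * (2 * expR ((y / (2 * t)) ^+ 2 / (4 * s))).
have KB x y : K x y <= B y.
  rewrite KE -mulrDr /B; apply: ler_wpM2l; first by rewrite !mulr_ge0 ?gauss_ge0.
  have b u : gauss s x * Ek k (u * x) <= expR (u ^+ 2 / (4 * s)).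
    have : Ek k (u * x) <= expR (`|u| * `|x|).
      rewrite -normrM -fs_expR; apply: le_trans (ler_norm _) _.
      apply: le_trans (fs_norm_le _ (ent_ecoef hk)) _; apply: ler_fs => //; last exact: ecoef_le.
        by apply: ent_norm; exact: ent_ecoef.
      exact: ent_fact.
    move=> /(ler_wpM2l (gauss_ge0 s x)) /le_trans; apply.
    rewrite /gauss -expRD ler_expR -subr_ge0 -(real_normK (num_real u)) -(real_normK (num_real x)).
    have -> : `|u| ^+ 2 / (4 * s) - (- (s * `|x| ^+ 2) + `|u| * `|x|) = (`|u| / 2 - s * `|x|) ^+ 2 / s.
      by field; rewrite gt_eqF.
    by rewrite divr_ge0 ?sqr_ge0// ltW.
  have h1 := b (y / (2 * t)); have := b (- y / (2 * t)).
  by rewrite {2}mulNr sqrrN; lra.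
have mKt y : measurable_fun [set: measurableTypeR R] (Kt y).
  apply: measurable_funM; first by apply: measurable_funM => //; apply: measurable_funM.
  by apply: continuous_measurable_fun; apply: ct_comp => //; apply: ctM; [apply: ctM; [exact: ctC|exact: ctI]|exact: ctC].
have [] := @schur_test _ _ R mu K (4 * (gauss_mass k t * gauss_mass k s))
  B f G.
- apply: measurable_funM => //.
  have h (u : R -> R) (v : measurableTypeR R * measurableTypeR R -> R) : continuous u ->
      measurable_fun setT v -> measurable_fun setT (fun z => u (v z)).
    by move=> cu mv; apply: measurableT_comp => //; exact: continuous_measurable_fun.
  have mp : measurable_fun setT (fun z : measurableTypeR R * measurableTypeR R => z.1 * z.2 / (2 * t)).
    by apply: measurable_funM => //; exact: measurable_funM.
  apply: measurable_funM.
    by apply: measurable_funM; apply: (h (gauss s)) => //; exact: continuous_gauss.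
  by apply: measurable_funD; apply: h => //; exact: measurableT_comp.
- by move=> x y; rewrite /K !mulr_ge0 ?gauss_ge0.
- by move=> x y; rewrite /K [x * y]mulrC; ring.
- exact: KB.
- exact: iK.
- move=> y; rewrite (rint_eq mu (fun x => KE x y)) rintD; [|exact: iblZ|exact: iblZ].
  rewrite !rintZ//.
  have := IKt y; have := IKt (- y); rewrite gaussN => h1 h2.
  transitivity (2 * gauss_mass k t * gauss_mass k s + 2 * gauss_mass k t * gauss_mass k s); last by ring.
  by rewrite -{1}h2 -h1; ring.
- exact: ibl_meas fi.
- exact: f2.
- rewrite (_ : G = hartley k (fun x => gauss t x * hartley k f x)); first exact: measurable_hartley.
  by apply/funext => y; rewrite GE.
- move=> y; apply: rint_norm_le.
  + apply: (ibl_eq _ (ibl_bM (mKt y) fi (C := B y) _)) => [x|x]; first by rewrite mulrC.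
    exact: le_trans (KtK _ _) _.
  + apply: (ibl_eq _ (ibl_bM (ibl_meas (iK y)) (ibl_norm fi) (C := B y) _)) => [x|x]; first by rewrite mulrC.
    by rewrite ger0_norm; [exact: KB|rewrite /K !mulr_ge0 ?gauss_ge0].
  + by move=> x; rewrite normrM ler_wpM2l.
move=> _; apply: le_trans; rewrite le_eqVlt; apply/orP; left; apply/eqP.
rewrite -(rint_eq mu (fun y => congr1 (fun u => f y * u) (GE y))) -rint_hartley//.
by apply: rint_eq => x; ring.
Qed.

Lemma cvg_gauss x : (fun n => gauss (n.+1%:R ^- 2) x) @ \oo --> (1 : R).
Proof.
rewrite -[X in _ --> X]expR0; apply: continuous_cvg; first exact: continuous_expR.
rewrite -[X in _ --> X]oppr0; apply: cvgN; rewrite -[X in _ --> X](mul0r (x ^+ 2)).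
apply: cvgM; last exact: cvg_cst.
rewrite (_ : (fun n => _) = fun n => (n.+1%:R^-1 * n.+1%:R^-1)); last first.
  by apply/funext => n; rewrite -exprVn expr2.
rewrite -[X in _ --> X](mulr0 (0 : R)); apply: cvgM; exact: cvg_harmonic.
Qed.

(** Four times the constant of the inversion formula; the 4 is the price of the majorant in
    [Ek_le]. *)
Definition bessel_const : R := 4 * (2 `^ (2 * k + 1) * gauss_mass k 1 ^+ 2).

(** The Gaussian bound is uniform along t = (n+1)^-2, and the Gaussians tend to 1: Fatou. *)
Lemma bessel f : ibl mu f -> ibl mu (fun x => f x ^+ 2) ->
  ibl mu (fun x => hartley k f x ^+ 2) /\
  \int[mu]_x hartley k f x ^+ 2 <= bessel_const * \int[mu]_x f x ^+ 2.
Proof.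
move=> fi f2; have mH := measurable_hartley hk fi.
have mH2 : measurable_fun [set: measurableTypeR R] (fun x => hartley k f x ^+ 2) by exact: measurable_funX.
have mg u : measurable_fun [set: measurableTypeR R] (gauss u).
  by apply: continuous_measurable_fun; exact: continuous_gauss.
have h : (\int[mu]_x (hartley k f x ^+ 2)%:E <= (bessel_const * \int[mu]_x f x ^+ 2)%:E)%E.
  apply: (@fatou_le _ (measurableTypeR R) R mu (fun n x => gauss (n.+1%:R ^- 2) x * hartley k f x ^+ 2)) => //.
  - by move=> n; exact: measurable_funM.
  - by move=> n x; rewrite mulr_ge0 ?gauss_ge0 ?sqr_ge0.
  - apply: aeW => x; rewrite -[X in _ --> X]mul1r; apply: cvgM; [exact: cvg_gauss|exact: cvg_cst].
  - by move=> x; exact: sqr_ge0.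
  move=> n; have n0 : 0 < n.+1%:R ^- 2 :> R by rewrite invr_gt0 exprn_gt0.
  rewrite iblE; first by rewrite lee_fin /bessel_const -(gauss_mass_prod n); exact: rint_gauss_sqr.
  pose B := 2 * \int[mu]_x `|f x|.
  have ig : ibl mu (fun x => B ^+ 2 * gauss (n.+1%:R ^- 2) x) by apply: iblZ; exact: gauss_ibl.
  apply: (ibl_le (measurable_funM (mg _) mH2) ig) => x.
  rewrite normrM (ger0_norm (gauss_ge0 _ _)) mulrC ler_wpM2r ?gauss_ge0// normrX.
  by apply: lerXn2r; rewrite ?nnegrE//; [apply: le_trans (hartley_bound hk x fi)|exact: hartley_bound].
have i : ibl mu (fun x => hartley k f x ^+ 2).
  apply: iblP => //; under eq_integral do rewrite ger0_norm ?sqr_ge0//.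
  by apply: le_lt_trans h _; rewrite ltry.
by split=> //; rewrite -lee_fin -iblE.
Qed.

Lemma dunkl_constE : dunkl_const k = gauss_mass k 2^-1.
Proof. by apply: rint_eq => x; rewrite /gauss; congr expR; ring. Qed.

Lemma dunkl_const_gt0 : 0 < dunkl_const k.
Proof. by rewrite dunkl_constE gauss_mass_gt0 ?invr_gt0. Qed.

End bessel.

(** * Support and inversion *)

Section band_limited.
Context {R : realType} (k r : R) (hk : 0 <= k) (hr : 0 < r).
Local Notation mu := (dunkl_measure k).
Local Notation cas := (cas k).
Local Notation Tc := (Tc k).
Implicit Types (x y a s t : R) (c : nat -> R).

(** A real-variable form of the Paley-Wiener condition: order 0 bounds the iterated Dunkl
    derivatives, order [decay_order] makes them integrable against the weight. *)
Definition band c := [/\ ent c, Tbdd k 0 c r & Tbdd k (decay_order k) c r].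

Lemma Tbdd_Tc i c : Tbdd k i c r -> Tbdd k i (Tc c) r.
Proof.
move=> h r' rr'; have [C [C0 hC]] := h r' rr'; have r0 : 0 < r' by apply: lt_trans rr'.
exists (C * r'); split=> [|n x]; first exact: mulr_gt0.
by rewrite -iterSr -mulrA -exprS; exact: hC.
Qed.

Lemma band_Tc c : band c -> band (Tc c).
Proof. by move=> [ec h0 h1]; split; [exact: ent_Tc|exact: Tbdd_Tc|exact: Tbdd_Tc]. Qed.

Lemma band_bounds c : band c -> forall r' : R, r < r' -> exists C : R, 0 < C /\
  forall n x, `|fs (iter n Tc c) x| <= C * r' ^+ n /\
    `|x| ^+ decay_order k * `|fs (iter n Tc c) x| <= C * r' ^+ n.
Proof.
move=> [_ h0 h1] r' rr'; have r0 : 0 <= r' by apply: ltW; apply: lt_trans rr'.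
have [C [C0 hC]] := h0 _ rr'; have [D [D0 hD]] := h1 _ rr'.
exists (C + D); split=> [|n x]; first exact: addr_gt0.
have := hC n x; have := hD n x; rewrite expr0 mul1r => h2 h3.
have P : 0 <= r' ^+ n by exact: exprn_ge0.
by split; [apply: le_trans h3 _|apply: le_trans h2 _]; apply: ler_wpM2r => //; lra.
Qed.

Lemma band_bound1 c : band c -> exists C : R, 0 < C /\ forall x, `|fs c x| <= C /\
    `|x| ^+ decay_order k * `|fs c x| <= C.
Proof.
move=> bc; have rr : r < r + 1 by rewrite ltrDl.
have [C [C0 h]] := band_bounds bc rr; exists C; split=> // x.
by have := h 0%N x; rewrite /= expr0 mulr1.
Qed.

Lemma band_ibl c : band c -> ibl mu (fs c).
Proof.
move=> bc; have [ec _ _] := bc; have [C [_ h]] := band_bound1 bc.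
by apply: (@ibl_decay _ _ hk _ C); [exact: measurable_fs|move=> x|move=> x]; have [] := h x.
Qed.

Lemma band_rint_norm c : band c -> forall r' : R, r < r' -> exists C : R, 0 < C /\
  forall n, \int[mu]_x `|fs (iter n Tc c) x| <= C * r' ^+ n.
Proof.
move=> bc r' rr'; have [C [C0 h]] := band_bounds bc rr'.
have r0 : 0 <= r' by apply: ltW; apply: lt_trans rr'.
pose D := \int[@lebesgue_measure R]_x (oneDsqr x)^-1.
have D0 : 0 <= D by apply: rint_ge0 => x; rewrite invr_ge0 (le_trans ler01).
exists (2 * C * D + 1); split=> [|n]; first by rewrite ltr_wpDl// !mulr_ge0// ltW.
have bn : band (iter n Tc c) by elim: n => //= n; exact: band_Tc.
have i1 := ibl_norm (band_ibl bn).
rewrite rint_dunkl//; last exact: ibl_meas i1.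
apply: (@le_trans _ _ (2 * (C * r' ^+ n) * D)); last first.
  have : 0 <= r' ^+ n by exact: exprn_ge0.
  by set q := r' ^+ n; nra.
rewrite -rintZ; last exact: ibl_oneDsqrV.
apply: rint_le.
- exact/(ibl_dunkl k (ibl_meas i1)).
- by apply: iblZ; exact: ibl_oneDsqrV.
by move=> x; have [h1 h2] := h n x; exact: weight_decay.
Qed.

(** Skew-symmetry of T_k, applied to f and x -> cas(xy), whose Dunkl derivative is y cas(-xy). *)
Lemma hartley_Tc c y : band c -> hartley k (fs (Tc c)) y = - (y * hartley k (fs c) (- y)).
Proof.
move=> bc; have [ec _ _] := bc; have ik := ent_kap hk; have eT := ent_Tc hk ec.
have [C [C0 hC]] := band_bound1 bc.
pose h := fs (cdil y (kap k)).
have hE x : h x = cas (x * y) by rewrite /h fs_dil mulrC.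
have h1E x : fs (Tc (cdil y (kap k))) x = y * cas (x * - y).
  by rewrite (fs_Tdil hk)// (eq_fs _ (Tc_kap hk)) fs_alt mulrN [x * y]mulrC.
have ed := ent_dil y ik.
have i1 : ibl mu (fun x => fs (Tc c) x * h x).
  by apply: (ibl_eq _ (ibl_cas hk y (band_ibl (band_Tc bc)))) => x; rewrite hE.
have i2 : ibl mu (fun x => fs c x * (y * cas (x * - y))).
  by apply: (ibl_eq _ (iblZ y (ibl_cas hk (- y) (band_ibl bc)))) => x; ring.
have i2' : ibl mu (fun x => fs c x * fs (Tc (cdil y (kap k))) x).
  by apply: (ibl_eq _ i2) => x; rewrite h1E.
have := @rint_dunkl_antisym _ k hk (fs c) h (fs (Tc c)) (fs (Tc (cdil y (kap k)))) (2 * (2 * C))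
  (continuous_fs ec) (continuous_fs ed) (continuous_fs eT) (continuous_fs (ent_Tc hk ed))
  (fun x => is_derive_fsT k ec (x := x)) (fun x => is_derive_fsT k ed (x := x)) i1 i2' _.
rewrite /hartley => e.
transitivity (\int[mu]_x (fs (Tc c) x * h x)); first by apply: rint_eq => x; rewrite hE.
rewrite e.
  rewrite -rintZ; last exact: ibl_cas (band_ibl bc).
  by congr (- _); apply: rint_eq => x; rewrite h1E; ring.
move=> x; have [b1 b2] := hC x; have cb := cas_bound hk (x * y).
apply: weight_decay => //.
  by rewrite normrM mulrC hE; apply: ler_pM.
rewrite (_ : `|x| ^+ _ * _ = `|cas (x * y)| * (`|x| ^+ decay_order k * `|fs c x|)).
  by apply: ler_pM => //; rewrite mulr_ge0 ?exprn_ge0.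
by rewrite normrM hE; ring.
Qed.

(** Each T_k multiplies by y up to sign and exchanges y with -y; the sum over both points is blind
    to this. *)
Lemma hartley_iterTc c n y : band c ->
  `|y| ^+ n * (`|hartley k (fs c) y| + `|hartley k (fs c) (- y)|) =
  `|hartley k (fs (iter n Tc c)) y| + `|hartley k (fs (iter n Tc c)) (- y)|.
Proof.
elim: n c => [|n IH] c bc; first by rewrite expr0 mul1r.
rewrite iterSr -IH; last exact: band_Tc.
rewrite !hartley_Tc// opprK !normrN !normrM normrN exprS.
by set u := `|hartley _ _ _|; set v := `|hartley _ _ _|; ring.
Qed.

Lemma hartley_moment_bound c : band c -> forall r' : R, r < r' -> exists C : R, 0 < C /\
  forall n y, `|y| ^+ n * `|hartley k (fs c) y| <= C * r' ^+ n.
Proof.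
move=> bc r' rr'; have [C [C0 h]] := band_rint_norm bc rr'.
exists (4 * C); split=> [|n y]; first by rewrite mulr_gt0.
apply: (@le_trans _ _ (`|y| ^+ n * (`|hartley k (fs c) y| + `|hartley k (fs c) (- y)|))).
  by rewrite ler_wpM2l ?exprn_ge0// lerDl.
rewrite hartley_iterTc//.
have bn : band (iter n Tc c) by elim: n => //= n; exact: band_Tc.
have h1 := hartley_bound hk y (band_ibl bn); have h2 := hartley_bound hk (- y) (band_ibl bn).
apply: le_trans (lerD h1 h2) _; rewrite -mulrDl (_ : 2 + 2 = 4); last by ring.
by rewrite -mulrA ler_wpM2l.
Qed.

(* |y|^n |Hf(y)| = O(r'^n) for every n and some r' < |y|. *)
Lemma hartley_support c y : band c -> r < `|y| -> hartley k (fs c) y = 0.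
Proof.
move=> bc ry; pose r' := (r + `|y|) / 2.
have rr' : r < r' by rewrite /r'; lra.
have ry' : r' < `|y| by rewrite /r'; lra.
have r0 : 0 < r' by apply: lt_trans rr'.
have [C [C0 h]] := hartley_moment_bound bc rr'.
pose q := r' / `|y|; have y0 : 0 < `|y| by apply: lt_trans ry'.
have q0 : 0 < q by exact: divr_gt0.
have q1 : `|q| < 1 by rewrite (gtr0_norm q0) /q ltr_pdivrMr// mul1r.
have cv : (fun n => C * q ^+ n) @ \oo --> (0 : R).
  by rewrite -[X in _ --> X](mulr0 C); apply: cvgM; [exact: cvg_cst|exact: cvg_expr].
apply/eqP; rewrite -normr_le0 -(cvg_lim _ cv)//; apply: limr_ge; first by apply/cvg_ex; exists 0.
apply: nearW => n; rewrite /q expr_div_n mulrA ler_pdivlMr ?exprn_gt0// mulrC; exact: h.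
Qed.

Lemma band_hartley_ibl c n : band c -> ibl mu (fun y => y ^+ n * hartley k (fs c) y).
Proof.
move=> bc; have rr : r < r + 1 by rewrite ltrDl.
have [C [C0 h]] := hartley_moment_bound bc rr.
have mH := measurable_hartley hk (band_ibl bc).
have r10 : 0 <= r + 1 by apply: ltW; apply: lt_trans rr.
have mm : measurable_fun [set: measurableTypeR R] (fun y => y ^+ n * hartley k (fs c) y).
  by apply: measurable_funM => //; exact: measurable_funX.
apply: (@ibl_decay _ _ hk _ (C * (r + 1) ^+ n + C * (r + 1) ^+ (n + decay_order k))) => // y.
  by rewrite normrM normrX; apply: le_trans (h n y) _; rewrite lerDl mulr_ge0 ?exprn_ge0// ltW.
rewrite normrM normrX mulrA -exprD addnC; apply: le_trans (h _ y) _.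
by rewrite lerDr mulr_ge0 ?exprn_ge0// ltW.
Qed.

Lemma band_hartley_ibl1 c : band c -> ibl mu (hartley k (fs c)).
Proof. by move=> bc; apply: (ibl_eq _ (band_hartley_ibl 0 bc)) => y; rewrite expr0 mul1r. Qed.

(** The constant product of masses found in [gauss_mass_prod]: the first mass comes from
    transforming a Gaussian, the second from averaging against the result. *)
Definition inv_const : R := 2 `^ (2 * k + 1) * gauss_mass k 1 ^+ 2.

Lemma inv_const_gt0 : 0 < inv_const.
Proof. by rewrite mulr_gt0 ?powR_gt0 ?exprn_gt0 ?gauss_mass_gt0. Qed.

(** The multiplication formula moves the transform from f to the Gaussian, which becomes a Gaussian
    concentrating at 0. Rescaled to a fixed one, it compares f(0) with f at the points 2y/(n+1). *)
Lemma gauss_average c n : band c ->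
  `|\int[mu]_y (gauss (n.+1%:R ^- 2) y * hartley k (fs c) y) - inv_const * fs c 0| <=
  inv_const / gauss_mass k 1 * \int[mu]_y (`|fs c (2 / n.+1%:R * y) - fs c 0| * gauss 1 y).
Proof.
move=> bc; set t : R := n.+1%:R ^- 2; have [ec _ _] := bc; have t0 : 0 < t by rewrite invr_gt0 exprn_gt0.
pose s := 1 / (4 * t); have s0 : 0 < s by rewrite divr_gt0// mulr_gt0.
have i0 := band_ibl bc.
have [C [C0 hC]] := band_bound1 bc.
have cf := continuous_fs ec.
have mg u : measurable_fun [set: measurableTypeR R] (gauss u).
  by apply: continuous_measurable_fun; exact: continuous_gauss.
have M0 : gauss_mass k t != 0 by rewrite gt_eqF// gauss_mass_gt0.
have P : gauss_mass k t * gauss_mass k s = inv_const by rewrite /inv_const -(gauss_mass_prod hk n).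
have ig : ibl mu (fun x => fs c x * gauss s x).
  apply: (ibl_bM (measurable_fs ec) (gauss_ibl hk s0) (C := C)) => x; by case: (hC x).
rewrite rint_hartley//; last exact: gauss_ibl.
rewrite (rint_eq mu (g := fun x => gauss_mass k t * (fs c x * gauss s x))); last first.
  by move=> x; rewrite hartley_gauss// /s; ring.
rewrite rintZ// -P -mulrA -mulrBr normrM gtr0_norm ?gauss_mass_gt0//.
rewrite [gauss_mass k s * fs c 0]mulrC -[fs c 0 * gauss_mass k s](rintZ (fs c 0) (gauss_ibl hk s0)).
rewrite -rintB//; last by apply: iblZ; exact: gauss_ibl.
(* Chosen so that s v^2 = 1, where s = (n+1)^2 / 4. *)
pose v : R := 2 / n.+1%:R; have v0 : 0 < v by rewrite divr_gt0.
have sv : s * v ^+ 2 = 1 by have N0 : n.+1%:R != 0 :> R by [rewrite pnatr_eq0]; move: N0; rewrite /s /v /t; set N := n.+1%:R => N0; field.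
have := gauss_mass_scale hk v0 s0; rewrite sv => Ms.
pose F x := `|fs c x - fs c 0| * gauss s x.
have cF : continuous F.
  apply: ctM; last exact: continuous_gauss.
  apply: ct_comp; first by move=> x; exact: norm_continuous.
  by apply: ctB => //; exact: ctC.
have F0 x : 0 <= F x by rewrite mulr_ge0 ?gauss_ge0.
have iF' u (w : R) : 0 < u -> ibl mu (fun x => `|fs c (w * x) - fs c 0| * gauss u x).
  move=> u0; apply: (ibl_bM _ (gauss_ibl hk u0) (C := 2 * C)) => [|x].
    apply: continuous_measurable_fun; apply: ct_comp; first by move=> x; exact: norm_continuous.
    by apply: ctB; [apply: ct_comp => //; apply: ctM; [exact: ctC|exact: ctI]|exact: ctC].
  have [h1 _] := hC (w * x); have [h2 _] := hC 0.
  by rewrite normr_id; apply: le_trans (ler_normB _ _) _; apply: le_trans (lerD h1 h2) _; rewrite mulr_natl mulr2n.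
have iF : ibl mu F by apply: (ibl_eq _ (iF' s 1 s0)) => x; rewrite mul1r.
have iF1 : ibl mu (fun x => F (v * x)).
  apply: (ibl_eq _ (iF' 1 v ltr01)) => x; rewrite /F /gauss -sv; congr (_ * expR _); ring.
have := @ge0_integral_dunkl_scale _ k hk F v v0 cF F0; rewrite !iblE// => -[hF].
apply: (@le_trans _ _ (gauss_mass k t * \int[mu]_x F x)).
  apply: ler_wpM2l; first by rewrite ltW// gauss_mass_gt0.
  apply: rint_norm_le => //; first by apply: iblB => //; apply: iblZ; exact: gauss_ibl.
  by move=> x; rewrite -mulrBl normrM (ger0_norm (gauss_ge0 _ _)).
rewrite hF mulrA le_eqVlt; apply/orP; left; apply/eqP; congr (_ * _).
  by rewrite Ms; field; rewrite gt_eqF// gauss_mass_gt0.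
apply: rint_eq => x; rewrite /F (_ : gauss s (v * x) = gauss 1 x)//.
by rewrite /gauss; congr expR; rewrite mul1r -[X in _ = - X]mul1r -sv; ring.
Qed.

(** As cas(0) = 1, this is the inversion formula at the point 0, where the Gaussian averages
    concentrate. *)
Lemma rint_band_hartley c : band c -> \int[mu]_y hartley k (fs c) y = inv_const * c 0%N.
Proof.
move=> bc; have [ec _ _] := bc; have iH := band_hartley_ibl1 bc.
have [C [C0 hC]] := band_bound1 bc; have cf := continuous_fs ec.
have mH := ibl_meas iH.
have mg u : measurable_fun [set: measurableTypeR R] (gauss u).
  by apply: continuous_measurable_fun; exact: continuous_gauss.
have gauss1 u y : 0 <= u -> gauss u y <= 1.
  by move=> u0; rewrite /gauss -expR0 ler_expR oppr_le0 mulr_ge0 ?sqr_ge0.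
have [_ c1] : ibl mu (hartley k (fs c)) /\
    (fun n => \int[mu]_y (gauss (n.+1%:R ^- 2) y * hartley k (fs c) y)) @ \oo --> \int[mu]_y hartley k (fs c) y.
  apply: (@rint_dct _ (measurableTypeR R) R mu (fun n y => gauss (n.+1%:R ^- 2) y * hartley k (fs c) y) _ (fun y => `|hartley k (fs c) y|)).
  - by move=> n; exact: measurable_funM.
  - by move=> x; rewrite -[X in _ --> X]mul1r; apply: cvgM; [exact: cvg_gauss|exact: cvg_cst].
  - exact: ibl_norm.
  - move=> n x; rewrite normrM (ger0_norm (gauss_ge0 _ _)) -[leRHS]mul1r ler_wpM2r// gauss1//.
pose E n := inv_const / gauss_mass k 1 * \int[mu]_y (`|fs c (2 / n.+1%:R * y) - fs c 0| * gauss 1 y).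
have cE : E @ \oo --> (0 : R).
  rewrite -[X in _ --> X](mulr0 (inv_const / gauss_mass k 1)); apply: cvgM; first exact: cvg_cst.
  rewrite -[X in _ --> X](rint0 mu).
  have := @rint_dct _ (measurableTypeR R) R mu (fun n y => `|fs c (2 / n.+1%:R * y) - fs c 0| * gauss 1 y) (fun=> 0) (fun y => 2 * C * gauss 1 y).
  case=> //.
  - move=> n; apply: measurable_funM => //; apply: continuous_measurable_fun.
    apply: ct_comp; first by move=> x; exact: norm_continuous.
    by apply: ctB; [apply: ct_comp => //; apply: ctM; [exact: ctC|exact: ctI]|exact: ctC].
  - move=> x; rewrite -[X in _ --> X](mul0r (gauss 1 x)); apply: cvgM; last exact: cvg_cst.
    rewrite [X in _ --> X](_ : 0 = `|fs c 0 - fs c 0|); last by rewrite subrr normr0.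
    apply: cvg_norm; apply: cvgB; last exact: cvg_cst.
    apply: continuous_cvg; first exact: cf.
    rewrite -[X in _ --> X](mul0r x); apply: cvgM; last exact: cvg_cst.
    rewrite -[X in _ --> X](mulr0 (2 : R)); apply: cvgM; [exact: cvg_cst|exact: cvg_harmonic].
  - by apply: iblZ; exact: gauss_ibl.
  - move=> n x; rewrite normrM normr_id (ger0_norm (gauss_ge0 _ _)) ler_wpM2r ?gauss_ge0//.
    have [h1 _] := hC (2 / n.+1%:R * x); have [h2 _] := hC 0.
    by apply: le_trans (ler_normB _ _) _; apply: le_trans (lerD h1 h2) _; rewrite mulr_natl mulr2n.
have c2 : (fun n => \int[mu]_y (gauss (n.+1%:R ^- 2) y * hartley k (fs c) y)) @ \oo --> inv_const * fs c 0.
  apply/cvgrPdist_le => e e0; have /cvgrPdist_le /(_ e e0) := cE.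
  apply: filterS => n; rewrite sub0r normrN => h; rewrite distrC.
  by apply: le_trans (gauss_average n bc) _; apply: le_trans h; exact: ler_norm.
by rewrite -(fs0 c); exact: (cvg_unique _ c1 c2).
Qed.

(** By [hartley_Tc] a moment of order n + 1 of Hf is, up to sign, one of order n of H(T_k f); order
    0 is inversion at 0. *)
Lemma band_hartley_moment c n : band c ->
  \int[mu]_y (y ^+ n * hartley k (fs c) y) = csgn n * (inv_const * (gam k n * c n)).
Proof.
elim: n c => [|n IH] c bc.
  rewrite gam0 mul1r -rint_band_hartley// -rintZ; last exact: band_hartley_ibl1.
  by apply: rint_eq => y; rewrite /csgn bin0n.
have i1 := band_hartley_ibl n.+1 bc.
have e : \int[mu]_y (y ^+ n * hartley k (fs (Tc c)) y) = (-1) ^+ n * \int[mu]_y (y ^+ n.+1 * hartley k (fs c) y).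
  rewrite -rintZ// -[RHS]rint_dunklN; last by exact: ibl_meas (iblZ _ i1).
  apply: rint_eq => y; rewrite hartley_Tc// exprS [(- y) ^+ n]exprNn.
  by case: (@sgnP R n) => ->; ring.
have := IH (Tc c) (band_Tc bc); rewrite e => h.
rewrite csgnS gamS; have -> : (-1) ^+ n * csgn n * (inv_const * (gam k n * theta k n.+1 * c n.+1)) =
  (-1) ^+ n * (csgn n * (inv_const * (gam k n * Tc c n))) by rewrite /Tc; ring.
by rewrite -h mulrA; case: (@sgnP R n) => ->; ring.
Qed.

(** The series of cas is integrated against Hf term by term, which is legitimate because Hf vanishes
    outside [-r, r]; the Dunkl factorials and the signs cancel. *)
Theorem hartley_inversion c y : band c -> hartley k (hartley k (fs c)) y = inv_const * fs c y.
Proof.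
move=> bc; have [ec _ _] := bc.
have iH := band_hartley_ibl1 bc; have ik := ent_kap hk.
have ed := ent_dil y ik.
have mH := ibl_meas iH.
pose B := fs (fun n => `|cdil y (kap k) n|) r.
have [|n|_ cv] := @rint_fs _ mu (hartley k (fs c)) (cdil y (kap k)) ed mH.
- apply: (ibl_le _ (iblZ B (ibl_norm iH))) => [|x].
    apply: measurable_funM; first exact: measurableT_comp.
    by apply: (measurableT_comp (measurable_fs (ent_norm ed))); exact: normr_measurable.
  have [rx|xr] := ltP r `|x|.
    by rewrite hartley_support// normr0 mul0r normr0 mulr0.
  rewrite normrM normr_id mulrC ler_wpM2r// ger0_norm; last by apply: fs_ge0 => //; exact: ent_norm.
  have := fs_norm_mono (x := x) (y := r) ed; rewrite (gtr0_norm hr); exact.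
- exact: band_hartley_ibl.
rewrite /hartley (rint_eq mu (g := fun x => hartley k (fs c) x * fs (cdil y (kap k)) x)); last first.
  by move=> x; rewrite fs_dil mulrC [y * x]mulrC mulrC.
apply: (cvg_unique _ cv) => //.
rewrite (_ : series _ = (fun n => inv_const * pseries c y n)).
  by apply: cvgM; [exact: cvg_cst|exact: ent_fs].
apply/funext => n; rewrite /pseries /series /= mulr_sumr; apply: eq_bigr => j _.
rewrite band_hartley_moment// /cdil /kap.
have -> : y ^+ j * (csgn j / gam k j) * (csgn j * (inv_const * (gam k j * c j))) =
  csgn j ^+ 2 * (inv_const * (c j * y ^+ j)) * (gam k j / gam k j) by ring.
by rewrite divff ?gam_neq0// -(real_normK (num_real (csgn j))) csgn_norm expr1n mul1r mulr1.
Qed.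

End band_limited.

Local Open Scope complex_scope.

(** * Cauchy theory on squares *)

Section complex_basics.
Context {R : realType}.
Implicit Types (x y t : R) (z u h D : R[i]) (F : R[i] -> R[i]).

Lemma normE z : `|z| = (normc z)%:C.
Proof. by []. Qed.

Lemma normc_ge0 z : 0 <= normc z.
Proof. by case: z => a b; exact: sqrtr_ge0. Qed.

Lemma sqr_normc2 z : normc z ^+ 2 = complex.Re z ^+ 2 + complex.Im z ^+ 2.
Proof. by case: z => a b /=; rewrite sqr_sqrtr// addr_ge0 ?sqr_ge0. Qed.

Lemma Re_le_normc z : `|complex.Re z| <= normc z.
Proof.
rewrite -ler_sqr ?nnegrE ?normc_ge0// sqr_normc2 real_normK ?num_real//.
by rewrite lerDl sqr_ge0.
Qed.

Lemma Im_le_normc z : `|complex.Im z| <= normc z.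
Proof.
rewrite -ler_sqr ?nnegrE ?normc_ge0// sqr_normc2 real_normK ?num_real//.
by rewrite lerDr sqr_ge0.
Qed.

Lemma normc_le_ReIm z : normc z <= `|complex.Re z| + `|complex.Im z|.
Proof.
rewrite -ler_sqr ?nnegrE ?normc_ge0 ?addr_ge0// sqr_normc2.
rewrite -(real_normK (num_real (complex.Re z))) -(real_normK (num_real (complex.Im z))).
by rewrite sqrrD lerD2r lerDl mulrn_wge0 ?mulr_ge0.
Qed.

Lemma normcR x : normc x%:C = `|x|.
Proof. by rewrite /= expr0n /= addr0 sqrtr_sqr. Qed.

Lemma normcX z n : normc (z ^+ n) = normc z ^+ n.
Proof. by elim: n => [|n IH]; rewrite ?expr0 ?normc1// !exprS normcM IH. Qed.

Lemma normcB z u : normc (z - u) = normc (u - z).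
Proof. by rewrite -normcN opprB. Qed.

Lemma le_normcB z u : normc (z - u) <= normc z + normc u.
Proof. by apply: le_trans (le_normcD _ _) _; rewrite normcN. Qed.

Lemma normci : normc ('i : R[i]) = 1.
Proof. by rewrite /= expr0n /= add0r expr1n sqrtr1. Qed.

Lemma normc_eq0 z : (normc z == 0) = (z == 0).
Proof. by apply/eqP/eqP => [/eq0_normc//|->]; rewrite normc0. Qed.

Lemma normc_gt0 z : (0 < normc z) = (z != 0).
Proof. by rewrite lt_neqAle normc_ge0 andbT eq_sym normc_eq0. Qed.

Lemma normc_sum (I : Type) (s : seq I) (f : I -> R[i]) :
  normc (\sum_(i <- s) f i) <= \sum_(i <- s) normc (f i).
Proof.
elim/big_ind2: _ => [|a b c d h1 h2|//]; first by rewrite normc0.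
by apply: le_trans (le_normcD _ _) _; exact: lerD.
Qed.

(* D is the complex derivative of F at z, in terms of real epsilons. *)
Definition cdiff F z D := forall e : R, 0 < e -> exists2 d : R, 0 < d &
  forall h, normc h < d -> normc (F (z + h) - F z - h * D) <= e * normc h.

Lemma cdiffP F z D : cdiff F z D <-> derivable F z 1 /\ derive1 F z = D.
Proof.
have E : (fun h => h^-1 *: ((F \o shift z) (h *: 1) - F z)) =
         (fun h => h^-1 * (F (z + h) - F z)).
  by apply/funext => h /=; rewrite [h *: _]mulr1 [h + z]addrC.
have E2 : (fun h : R[i] => h^-1 *: (F (h + z) - F z)) =
         (fun h => h^-1 * (F (z + h) - F z)).
  by apply/funext => h /=; rewrite [h + z]addrC.
have cvP : cdiff F z D <-> (fun h => h^-1 * (F (z + h) - F z)) @ 0^' --> D.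
  split=> [H|/cvgrPdist_le H].
    apply/cvgrPdist_le => e; rewrite ltcE /= => /andP[/eqP e0 e1].
    have [d d0 hd] := H _ e1; exists (d%:C) => /=; first by rewrite ltcR.
    move=> h /=; rewrite sub0r normrN normE ltcR => hd1 h0.
    have n0 : 0 < normc h by rewrite normc_gt0.
    rewrite (_ : e = (complex.Re e)%:C); last by apply/eqP; rewrite eq_complex /= e0 !eqxx.
    rewrite normE lecR normcB -(ler_pM2r n0) -normcM; apply: le_trans (hd _ hd1).
    by rewrite (_ : (h^-1 * _ - D) * h = F (z + h) - F z - h * D)//; field.
  move=> e e0; have /H : 0 < (e%:C : R[i]) by rewrite ltcR.
  case=> d /=; rewrite ltcE /= => /andP[/eqP d0 d1] hd.
  have dE : d = (complex.Re d)%:C by apply/eqP; rewrite eq_complex /= d0 !eqxx.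
  exists (complex.Re d) => // h hh; have [->|h0] := eqVneq h 0.
    by rewrite addr0 subrr mul0r subr0 normc0 mulr0.
  have := hd h; rewrite /= sub0r normrN normE dE ltcR normE lecR => /(_ hh h0).
  have n0 : 0 < normc h by rewrite normc_gt0.
  rewrite normcB -(ler_pM2r n0) -normcM; apply: le_trans.
  by rewrite (_ : (h^-1 * _ - D) * h = F (z + h) - F z - h * D)//; field.
split=> [/cvP H|[dF dE]].
  have dv : derivable F z 1 by rewrite /derivable E; apply/cvg_ex; exists D.
  split; first exact: dv.
  by rewrite /derive1 E2; apply: (cvg_lim _ H); exact: norm_hausdorff.
by apply/cvP; move: dF dE; rewrite /derivable /derive1 E E2 => dF <-.
Qed.

End complex_basics.

(** * Primitives and oriented integrals of continuous functions *)

Section primitives.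
Context {R : realType}.
Implicit Types (f g A : R -> R) (a b t x : R).
Local Notation leb := (@lebesgue_measure R).

(** As f vanishes for x <= 0, integration from the base point -1 works on the whole line: left of 0
    the result is constantly 0. *)
Lemma primitive_exists_pos f : continuous f -> (forall x, x <= 0 -> f x = 0) ->
  exists A, forall x, is_derive x (1 : R) A (f x).
Proof.
move=> cf f0.
pose A x := \int[leb]_(t in [set` (`[(-1 : R), x])%R]) f t.
exists A => x; have [x1|x1] := ltP (-1) x.
  have ii : leb.-integrable [set` (`[(-1 : R), (x + 1)])%R] (EFin \o f).
    apply: continuous_compact_integrable; first exact: segment_compact.
    by apply: continuous_subspaceT.
  have xx : x < x + 1 by rewrite ltrDl.
  have [dA AE] := continuous_FTC1_closed xx ii x1 (cf x).
  by apply: DeriveDef; [exact: dA|rewrite -derive1E].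
have xn : x <= 0 by apply: le_trans x1 _; rewrite lerN10.
rewrite f0//.
have E : \forall y \near x, (fun=> 0 : R) y = A y.
  near=> y; rewrite /A; have y0 : y <= 0.
    near: y; have x0 : x < 0 by apply: le_lt_trans x1 _; rewrite ltrN10.
    have : \forall y \near x, y < 0 by apply: open_nbhs_nbhs; split=> //; exact: open_lt.
    by apply: filterS => y /ltW.
  rewrite /Rintegral integral0_eq ?fine0// => t /=; rewrite in_itv/= => /andP[_ ty].
  by rewrite f0//; exact: le_trans ty y0.
exact: near_eq_is_derive E (dvC 0 x).
Unshelve. all: by end_near. Qed.

(** The two halves of f - f(0), extended by 0 across the origin and one of them reflected, fall
    under the previous lemma; f(0) x is added back. *)
Lemma primitive_exists f : continuous f -> exists A, forall x, is_derive x (1 : R) A (f x).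
Proof.
move=> cf.
have cM : continuous (fun x : R => Num.max x 0) by move=> x; apply: continuous_max; [exact: cvg_id|exact: cvg_cst].
have [A1 h1] : exists A, forall x, is_derive x (1 : R) A (f (Num.max x 0) - f 0).
  apply: primitive_exists_pos => [|x x0]; last by rewrite (max_idPr x0) subrr.
  by apply: ctB; [exact: ct_comp|exact: ctC].
have [A2 h2] : exists A, forall x, is_derive x (1 : R) A (f (- Num.max x 0) - f 0).
  apply: primitive_exists_pos => [|x x0]; last by rewrite (max_idPr x0) oppr0 subrr.
  apply: ctB; last exact: ctC.
  by apply: (ct_comp cf); apply: ctN.
exists (fun x => A1 x - A2 (- x) + f 0 * x) => x.
apply: dv_eq (dvD (dvB (h1 x) (dv_opp (h2 (- x)))) (dvZ (f 0) (dvI x))) _.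
have [x0|x0] := leP 0 x.
  have -> : Num.max (- x) 0 = 0 by apply/max_idPr; rewrite oppr_le0.
  by rewrite oppr0; ring.
have -> : Num.max (- x) 0 = - x by apply/max_idPl; rewrite oppr_ge0 ltW.
by rewrite (opprK x); ring.
Qed.

(** Integrals are taken through a chosen primitive, so that orientation and additivity in the
    endpoints are mere subtraction. For continuous f the default value never occurs. *)
Definition prim f : R -> R := xget (fun=> 0) [set A | forall x, is_derive x (1 : R) A (f x)].

Definition lint f a b := prim f b - prim f a.

Lemma is_derive_prim f x : continuous f -> is_derive x (1 : R) (prim f) (f x).
Proof.
move=> cf; rewrite /prim; case: xgetP => [A _ /(_ x)//|h].
by have [A hA] := primitive_exists cf; case: (h A).
Qed.

Lemma derive_bound A f a b M : a <= b -> (forall x, is_derive x (1 : R) A (f x)) ->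
  (forall t, a <= t <= b -> `|f t| <= M) -> `|A b - A a| <= M * (b - a).
Proof.
move=> ab dA fM; have [abl|] := ltP a b; last first.
  move=> ba; have -> : a = b by apply/eqP; rewrite eq_le ab ba.
  by rewrite !subrr normr0 mulr0.
have cA : {within [set` (`[a, b])%R], continuous A}.
  by apply: continuous_subspaceT => x; apply: dv_cont (dA x).
have [c cab ->] := MVT abl (fun x _ => dA x) cA.
rewrite normrM [`|b - a|]ger0_norm ?subr_ge0// ler_wpM2r ?subr_ge0//.
by apply: fM; move: cab; rewrite in_itv/= => /andP[/ltW -> /ltW ->].
Qed.

Lemma lint_bound f a b M : continuous f -> a <= b -> (forall t, a <= t <= b -> `|f t| <= M) ->
  `|lint f a b| <= M * (b - a).
Proof. by move=> cf ab; apply: derive_bound ab _ => x; exact: is_derive_prim. Qed.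

Lemma lint_prim A f a b : continuous f -> (forall x, is_derive x (1 : R) A (f x)) ->
  lint f a b = A b - A a.
Proof.
move=> cf dA.
have H u v : u <= v -> (prim f v - A v) - (prim f u - A u) = 0.
  move=> uv; apply/eqP; rewrite -normr_le0.
  apply: le_trans (@derive_bound (fun x => prim f x - A x) (fun=> 0) u v 0 uv _ _) _.
  - move=> x; apply: dv_eq (dvB (is_derive_prim x cf) (dA x)) _; exact: subrr.
  - by move=> t _; rewrite normr0.
  - by rewrite mul0r.
rewrite /lint; have [ab|/ltW ba] := leP a b.
  by have := H _ _ ab; lra.
by have := H _ _ ba; lra.
Qed.

Lemma lint_split f a b c : lint f a b + lint f b c = lint f a c.
Proof. by rewrite /lint; ring. Qed.

Lemma lintD f g a b : continuous f -> continuous g ->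
  lint (fun x => f x + g x) a b = lint f a b + lint g a b.
Proof.
move=> cf cg.
have h := @lint_prim (fun x => prim f x + prim g x) _ a b (ctD cf cg)
  (fun x => dvD (is_derive_prim x cf) (is_derive_prim x cg)).
by rewrite h /lint; ring.
Qed.

Lemma lintZ c f a b : continuous f -> lint (fun x => c * f x) a b = c * lint f a b.
Proof.
move=> cf.
have h := @lint_prim (fun x => c * prim f x) _ a b (ctM (@ctC _ c) cf)
  (fun x => dvZ c (is_derive_prim x cf)).
by rewrite h /lint; ring.
Qed.

End primitives.

(** * Complex-valued functions of a real variable *)

Section complex_line_integrals.
Context {R : realType}.
Implicit Types (q p : R -> R[i]) (a b t x : R) (D z : R[i]).

Definition ccont q := continuous (fun x => complex.Re (q x)) /\ continuous (fun x => complex.Im (q x)).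

Definition cder q t D := is_derive t (1 : R) (fun x => complex.Re (q x)) (complex.Re D) /\
  is_derive t (1 : R) (fun x => complex.Im (q x)) (complex.Im D).

Definition cint q a b : R[i] :=
  (lint (fun x => complex.Re (q x)) a b) +i* (lint (fun x => complex.Im (q x)) a b).

Lemma cReD z D : complex.Re (z + D) = complex.Re z + complex.Re D.
Proof. by case: z D => a b []. Qed.
Lemma cImD z D : complex.Im (z + D) = complex.Im z + complex.Im D.
Proof. by case: z D => a b []. Qed.
Lemma cReM z D : complex.Re (z * D) = complex.Re z * complex.Re D - complex.Im z * complex.Im D.
Proof. by case: z D => a b []. Qed.
Lemma cImM z D : complex.Im (z * D) = complex.Re z * complex.Im D + complex.Im z * complex.Re D.
Proof. by case: z D => a b []. Qed.
Lemma cReN z : complex.Re (- z) = - complex.Re z.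
Proof. by case: z. Qed.
Lemma cImN z : complex.Im (- z) = - complex.Im z.
Proof. by case: z. Qed.
Lemma cReV z : complex.Re z^-1 = complex.Re z / (complex.Re z ^+ 2 + complex.Im z ^+ 2).
Proof. by case: z. Qed.
Lemma cImV z : complex.Im z^-1 = - complex.Im z / (complex.Re z ^+ 2 + complex.Im z ^+ 2).
Proof. by case: z => a b /=; rewrite mulNr. Qed.

Lemma complex_eq z D : complex.Re z = complex.Re D -> complex.Im z = complex.Im D -> z = D.
Proof. by case: z D => a b [c d] /= -> ->. Qed.

Lemma ReIm2_neq0 z : z != 0 -> complex.Re z ^+ 2 + complex.Im z ^+ 2 != 0.
Proof. by move=> z0; rewrite -sqr_normc2 sqrf_eq0 normc_eq0. Qed.

Lemma eq_ccont q p : q =1 p -> ccont q -> ccont p.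
Proof. by move=> /funext ->. Qed.

Lemma ccontC z : ccont (fun=> z).
Proof. by split; exact: ctC. Qed.

Lemma ccontD q p : ccont q -> ccont p -> ccont (fun x => q x + p x).
Proof.
move=> [h1 h2] [h3 h4]; split.
  by under eq_fun do rewrite cReD; exact: ctD.
by under eq_fun do rewrite cImD; exact: ctD.
Qed.

Lemma ccontM q p : ccont q -> ccont p -> ccont (fun x => q x * p x).
Proof.
move=> [h1 h2] [h3 h4]; split.
  by under eq_fun do rewrite cReM; apply: ctB; exact: ctM.
by under eq_fun do rewrite cImM; apply: ctD; exact: ctM.
Qed.

Lemma ccontN q : ccont q -> ccont (fun x => - q x).
Proof.
move=> [h1 h2]; split.
  by under eq_fun do rewrite cReN; exact: ctN.
by under eq_fun do rewrite cImN; exact: ctN.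
Qed.

Lemma ccontB q p : ccont q -> ccont p -> ccont (fun x => q x - p x).
Proof. by move=> h1 h2; apply: ccontD => //; exact: ccontN. Qed.

Lemma ccontX q n : ccont q -> ccont (fun x => q x ^+ n).
Proof.
move=> cq; elim: n => [|n IH]; first exact: ccontC.
by apply: (eq_ccont (q := fun x => q x * q x ^+ n)) => [x|]; [rewrite exprS|exact: ccontM].
Qed.

Lemma ccontV q : (forall x, q x != 0) -> ccont q -> ccont (fun x => (q x)^-1).
Proof.
move=> q0 [h1 h2].
have cn : continuous (fun x => (complex.Re (q x) ^+ 2 + complex.Im (q x) ^+ 2)^-1).
  move=> x; apply: cvgV; first exact: ReIm2_neq0.
  by have cN : continuous (fun x => complex.Re (q x) ^+ 2 + complex.Im (q x) ^+ 2) by [apply: ctD; exact: ctX]; exact: cN.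
split.
  by under eq_fun do rewrite cReV; exact: ctM.
by under eq_fun do rewrite cImV; apply: ctM => //; exact: ctN.
Qed.

Lemma cder_eq q t D D' : cder q t D -> D = D' -> cder q t D'.
Proof. by move=> h <-. Qed.

Lemma cderC z t : cder (fun=> z) t 0.
Proof. by split; exact: dvC. Qed.

Lemma cderD q p t D D' : cder q t D -> cder p t D' -> cder (fun x => q x + p x) t (D + D').
Proof.
move=> [h1 h2] [h3 h4]; split.
  by rewrite cReD; under eq_fun do rewrite cReD; exact: dvD.
by rewrite cImD; under eq_fun do rewrite cImD; exact: dvD.
Qed.

Lemma cderM q p t D D' : cder q t D -> cder p t D' ->
  cder (fun x => q x * p x) t (D * p t + q t * D').
Proof.
move=> [h1 h2] [h3 h4]; split.
  under eq_fun do rewrite cReM; apply: dv_eq (dvB (dvM h1 h3) (dvM h2 h4)) _.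
  by rewrite cReD !cReM; ring.
under eq_fun do rewrite cImM; apply: dv_eq (dvD (dvM h1 h4) (dvM h2 h3)) _.
by rewrite cImD !cImM; ring.
Qed.

Lemma cderX q t D n : cder q t D -> cder (fun x => q x ^+ n) t (n%:R * q t ^+ n.-1 * D).
Proof.
move=> dq; elim: n => [|n IH]; first by apply: cder_eq (cderC 1 t) _; rewrite !mul0r.
have -> : (fun x => q x ^+ n.+1) = fun x => q x * q x ^+ n by apply/funext => x; rewrite exprS.
apply: cder_eq (cderM dq IH) _; rewrite -[n.+1]add1n natrD; case: n {IH} => [|n] /=.
  by rewrite !expr0; ring.
by rewrite exprS; ring.
Qed.

Lemma cderV q t D : (forall x, q x != 0) -> cder q t D -> cder (fun x => (q x)^-1) t (- D / q t ^+ 2).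
Proof.
move=> q0 [h1 h2]; have n0 x := ReIm2_neq0 (q0 x).
pose N x := complex.Re (q x) ^+ 2 + complex.Im (q x) ^+ 2.
have dN : is_derive t (1 : R) N (2 * complex.Re (q t) * complex.Re D + 2 * complex.Im (q t) * complex.Im D).
  by apply: dv_eq (dvD (dvX 2 h1) (dvX 2 h2)) _; rewrite !expr1.
have dV : is_derive t (1 : R) (fun x => (N x)^-1) (- (N t) ^- 2 * (2 * complex.Re (q t) * complex.Re D + 2 * complex.Im (q t) * complex.Im D)).
  by apply: dv_eq (@is_deriveV _ N t _ 1 (n0 t) dN) _.
have e : D / q t ^+ 2 = D * (q t)^-1 * (q t)^-1 by rewrite -exprVn expr2 mulrA.
rewrite mulNr e; split.
  under eq_fun do rewrite cReV; apply: dv_eq (dvM h1 dV) _.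
  by rewrite cReN !(cReM, cImM, cReV, cImV) /N; field; exact: n0.
under eq_fun do rewrite cImV; apply: dv_eq (dvM (dvN h2) dV) _.
by rewrite cImN !(cReM, cImM, cReV, cImV) /N; field; exact: n0.
Qed.

(** The factor 2 comes from estimating real and imaginary parts separately. *)
Lemma cint_bound q a b M : ccont q -> a <= b -> (forall t, a <= t <= b -> normc (q t) <= M) ->
  normc (cint q a b) <= 2 * M * (b - a).
Proof.
move=> [h1 h2] ab hM; apply: le_trans (normc_le_ReIm _) _.
rewrite (_ : 2 * M * (b - a) = M * (b - a) + M * (b - a)); last by ring.
apply: lerD; apply: lint_bound => // t /hM; apply: le_trans.
  exact: Re_le_normc.
exact: Im_le_normc.
Qed.

Lemma cint_prim q Q a b : ccont q -> (forall t, cder Q t (q t)) -> cint q a b = Q b - Q a.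
Proof.
move=> [h1 h2] dQ; apply: complex_eq => /=.
  by rewrite cReD cReN; exact: (@lint_prim _ (fun x => complex.Re (Q x)) _ a b h1 (fun x => (dQ x).1)).
by rewrite cImD cImN; exact: (@lint_prim _ (fun x => complex.Im (Q x)) _ a b h2 (fun x => (dQ x).2)).
Qed.

Lemma cint_split q a b c : cint q a b + cint q b c = cint q a c.
Proof. by apply: complex_eq; rewrite ?cReD ?cImD /= lint_split. Qed.

Lemma eq_cint q p a b : q =1 p -> cint q a b = cint p a b.
Proof. by move=> /funext ->. Qed.

Lemma cintD q p a b : ccont q -> ccont p ->
  cint (fun x => q x + p x) a b = cint q a b + cint p a b.
Proof.
move=> [h1 h2] [h3 h4]; apply: complex_eq => /=.
  by rewrite -lintD//; congr lint; apply/funext => x; rewrite cReD.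
by rewrite -lintD//; congr lint; apply/funext => x; rewrite cImD.
Qed.

Lemma cintZ z q a b : ccont q -> cint (fun x => z * q x) a b = z * cint q a b.
Proof.
move=> [h1 h2]; have cz c (f : R -> R) : continuous f -> continuous (fun x => c * f x).
  by move=> cf; apply: ctM => //; exact: ctC.
apply: complex_eq.
  rewrite cReM /= (_ : (fun x => _) = fun x => complex.Re z * complex.Re (q x) + (- complex.Im z) * complex.Im (q x)).
    by rewrite lintD ?lintZ//; [ring|exact: cz|exact: cz].
  by apply/funext => x; rewrite cReM; ring.
rewrite cImM /= (_ : (fun x => _) = fun x => complex.Re z * complex.Im (q x) + complex.Im z * complex.Re (q x)).
  by rewrite lintD ?lintZ//; exact: cz.
by apply/funext => x; rewrite cImM.
Qed.

End complex_line_integrals.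

(** * Bisection of rectangles *)

Section bisection.
Context {R : realType}.
Implicit Types (I : R * R) (Q : (R * R) * (R * R)).

Definition half I I' := I' = (I.1, (I.1 + I.2) / 2) \/ I' = ((I.1 + I.2) / 2, I.2).

Lemma nested_halves (J : nat -> R * R) : (J 0%N).1 <= (J 0%N).2 ->
  (forall n, half (J n) (J n.+1)) ->
  (forall n, (J n).2 - (J n).1 = ((J 0%N).2 - (J 0%N).1) / 2 ^+ n) /\
  exists x, forall n, (J n).1 <= x <= (J n).2.
Proof.
move=> J0 hJ.
have st n : (J n).1 <= (J n).2 -> [/\ (J n).1 <= (J n.+1).1, (J n.+1).1 <= (J n.+1).2,
    (J n.+1).2 <= (J n).2 & (J n.+1).2 - (J n.+1).1 = ((J n).2 - (J n).1) / 2].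
  by move=> ab; case: (hJ n) => -> /=; split => //; lra.
have le n : (J n).1 <= (J n).2 by elim: n => // n /st [].
split.
  elim=> [|n IH]; first by rewrite expr0 divr1.
  by have [_ _ _ ->] := st n (le n); rewrite IH exprS; field; rewrite expf_neq0.
have m1 n m : (n <= m)%N -> (J n).1 <= (J m).1.
  move=> /subnK <-; elim: (m - n)%N => [|i IH]; first by rewrite add0n.
  by rewrite addSn; apply: le_trans IH _; have [] := st _ (le (i + n)%N).
have m2 n m : (n <= m)%N -> (J m).2 <= (J n).2.
  move=> /subnK <-; elim: (m - n)%N => [|i IH]; first by rewrite add0n.
  by rewrite addSn; apply: le_trans _ IH; have [] := st _ (le (i + n)%N).
have ub n m : (J n).1 <= (J m).2.
  apply: le_trans (m1 n (maxn n m) (leq_maxl _ _)) (le_trans (le _) _).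
  exact: m2 (leq_maxr _ _).
pose S := [set (J n).1 | n in [set: nat]].
exists (sup S) => n; apply/andP; split.
  apply: ub_le_sup; last by exists n.
  by exists (J 0%N).2 => _ [m _ <-]; exact: ub.
apply: ge_sup; first by exists (J 0%N).1, 0%N.
by move=> _ [m _ <-]; exact: ub.
Qed.

(** If the property failed for Q it would fail for one of the quarters, and so on; the nested bad
    rectangles shrink to a point near which it holds. This serves both for Goursat's theorem and for
    boundedness on rectangles. *)
Lemma bisection2 (good : (R * R) * (R * R) -> Prop) Q : Q.1.1 <= Q.1.2 -> Q.2.1 <= Q.2.2 ->
  (forall I J, let m := (I.1 + I.2) / 2 in let p := (J.1 + J.2) / 2 in
     good ((I.1, m), (J.1, p)) -> good ((I.1, m), (p, J.2)) ->
     good ((m, I.2), (J.1, p)) -> good ((m, I.2), (p, J.2)) -> good (I, J)) ->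
  (forall x y, Q.1.1 <= x <= Q.1.2 -> Q.2.1 <= y <= Q.2.2 -> exists2 d : R, 0 < d &
     forall I J, I.1 <= x <= I.2 -> J.1 <= y <= J.2 -> I.2 - I.1 < d -> J.2 - J.1 < d -> good (I, J)) ->
  good Q.
Proof.
move=> ab cd gq loc; apply: contrapT => ngQ.
have /choice[st hst] : forall r, exists r' : (R * R) * (R * R),
    [/\ half r.1 r'.1, half r.2 r'.2 & ~ good r -> ~ good r'].
  move=> [I J]; set m := (I.1 + I.2) / 2; set p := (J.1 + J.2) / 2.
  have [g1|n1] := pselect (good ((I.1, m), (J.1, p))); last first.
    by exists ((I.1, m), (J.1, p)); split => //; left.
  have [g2|n2] := pselect (good ((I.1, m), (p, J.2))); last first.
    by exists ((I.1, m), (p, J.2)); split => //; [left|right].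
  have [g3|n3] := pselect (good ((m, I.2), (J.1, p))); last first.
    by exists ((m, I.2), (J.1, p)); split => //; [right|left].
  exists ((m, I.2), (p, J.2)); split => //; [right|right|] => //.
  by move=> ng g4; apply: ng; exact: gq.
pose r n := iter n st Q.
have [sx [x hx]] : _ /\ _ := @nested_halves (fun n => (r n).1) ab (fun n => let: And3 h _ _ := hst (r n) in h).
have [sy [y hy]] : _ /\ _ := @nested_halves (fun n => (r n).2) cd (fun n => let: And3 _ h _ := hst (r n) in h).
have ng n : ~ good (r n) by elim: n => [//|n IH]; have [_ _] := hst (r n); exact.
have [d d0 hd] := loc x y (hx 0%N) (hy 0%N).
pose L := (Q.1.2 - Q.1.1) + (Q.2.2 - Q.2.1).
have L0 : 0 <= L by rewrite addr_ge0 ?subr_ge0.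
have [n hn] : exists n, L / 2 ^+ n < d.
  exists (Num.truncn (L / d)).+1; rewrite ltr_pdivrMr ?exprn_gt0// mulrC -ltr_pdivrMr//.
  by apply: lt_le_trans (truncnS_gt _) _; rewrite -natrX ler_nat ltnW// ltn_expl.
apply: (ng n); rewrite (surjective_pairing (r n)); apply: hd => //.
  rewrite sx; apply: le_lt_trans hn; rewrite ler_pM2r ?invr_gt0 ?exprn_gt0//.
  by rewrite /L lerDl subr_ge0.
rewrite sy; apply: le_lt_trans hn; rewrite ler_pM2r ?invr_gt0 ?exprn_gt0//.
by rewrite /L lerDr subr_ge0.
Qed.

End bisection.

(** * Goursat's theorem on rectangles *)

Section goursat.
Context {R : realType}.
Implicit Types (g h : R[i] -> R[i]) (a b c d x y : R) (z D : R[i]).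

(** Continuity along horizontal and vertical lines is all that integrals over sides require. *)
Definition lcont g := (forall y, ccont (fun x => g (x +i* y))) /\ (forall x, ccont (fun y => g (x +i* y))).

(* The integral of g over the positively oriented boundary of [a, b] x [c, d]. *)
Definition bd g a b c d : R[i] :=
  cint (fun x => g (x +i* c)) a b + 'i * cint (fun y => g (b +i* y)) c d
  - cint (fun x => g (x +i* d)) a b - 'i * cint (fun y => g (a +i* y)) c d.

#[local] Arguments bd : simpl never.
#[local] Arguments normc : simpl never.

Lemma bd_splitx g a m b c d : bd g a m c d + bd g m b c d = bd g a b c d.
Proof.
rewrite /bd -(cint_split (fun x => g (x +i* c)) a m b) -(cint_split (fun x => g (x +i* d)) a m b).
ring.
Qed.

Lemma bd_splity g a b c p d : bd g a b c p + bd g a b p d = bd g a b c d.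
Proof.
rewrite /bd -(cint_split (fun y => g (a +i* y)) c p d) -(cint_split (fun y => g (b +i* y)) c p d).
ring.
Qed.

(** Continuity along the four lines that carry the sides, for functions such as 1/(u - z) that are
    singular inside. *)
Definition frame g a b c d := [/\ ccont (fun x => g (x +i* c)), ccont (fun x => g (x +i* d)),
  ccont (fun y => g (a +i* y)) & ccont (fun y => g (b +i* y))].

Lemma lcont_frame g a b c d : lcont g -> frame g a b c d.
Proof. by move=> [h1 h2]. Qed.

Lemma bd_bound g a b c d M : frame g a b c d -> a <= b -> c <= d ->
  (forall x, a <= x <= b -> normc (g (x +i* c)) <= M /\ normc (g (x +i* d)) <= M) ->
  (forall y, c <= y <= d -> normc (g (a +i* y)) <= M /\ normc (g (b +i* y)) <= M) ->
  normc (bd g a b c d) <= 4 * M * ((b - a) + (d - c)).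
Proof.
move=> [h1 h2 h3 h4] ab cd hx hy.
have e1 := @cint_bound _ _ a b M h1 ab (fun t ht => (hx t ht).1).
have e2 := @cint_bound _ _ a b M h2 ab (fun t ht => (hx t ht).2).
have e3 := @cint_bound _ _ c d M h3 cd (fun t ht => (hy t ht).1).
have e4 := @cint_bound _ _ c d M h4 cd (fun t ht => (hy t ht).2).
have := le_normcB (cint (fun x => g (x +i* c)) a b + 'i * cint (fun y => g (b +i* y)) c d - cint (fun x => g (x +i* d)) a b) ('i * cint (fun y => g (a +i* y)) c d).
have := le_normcB (cint (fun x => g (x +i* c)) a b + 'i * cint (fun y => g (b +i* y)) c d) (cint (fun x => g (x +i* d)) a b).
have := le_normcD (cint (fun x => g (x +i* c)) a b) ('i * cint (fun y => g (b +i* y)) c d).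
rewrite !normcM !normci !mul1r -/(bd g a b c d).
by move: e1 e2 e3 e4; lra.
Qed.

Lemma bdD g h a b c d : frame g a b c d -> frame h a b c d ->
  bd (fun z => g z + h z) a b c d = bd g a b c d + bd h a b c d.
Proof. by move=> [? ? ? ?] [? ? ? ?]; rewrite /bd !cintD//; ring. Qed.

Lemma bdZ z g a b c d : frame g a b c d -> bd (fun u => z * g u) a b c d = z * bd g a b c d.
Proof. by move=> [? ? ? ?]; rewrite /bd !cintZ//; ring. Qed.

Lemma frameD g h a b c d : frame g a b c d -> frame h a b c d -> frame (fun z => g z + h z) a b c d.
Proof. by move=> [? ? ? ?] [? ? ? ?]; split; exact: ccontD. Qed.

Lemma frameM g h a b c d : frame g a b c d -> frame h a b c d -> frame (fun z => g z * h z) a b c d.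
Proof. by move=> [? ? ? ?] [? ? ? ?]; split; exact: ccontM. Qed.

Lemma frameC z a b c d : frame (fun=> z) a b c d.
Proof. by split; exact: ccontC. Qed.

Lemma eq_bd g h a b c d : g =1 h -> bd g a b c d = bd h a b c d.
Proof. by move=> /funext ->. Qed.

Lemma bd_prim g G a b c d : frame g a b c d ->
  (forall x, cder (fun x => G (x +i* c)) x (g (x +i* c))) ->
  (forall x, cder (fun x => G (x +i* d)) x (g (x +i* d))) ->
  (forall y, cder (fun y => G (a +i* y)) y ('i * g (a +i* y))) ->
  (forall y, cder (fun y => G (b +i* y)) y ('i * g (b +i* y))) -> bd g a b c d = 0.
Proof.
move=> [h1 h2 h3 h4] d1 d2 d3 d4; rewrite /bd -!cintZ//.
rewrite (cint_prim _ _ h1 d1) (cint_prim _ _ h2 d2).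
rewrite (cint_prim _ _ _ d3); last by apply: ccontM => //; exact: ccontC.
rewrite (cint_prim _ _ _ d4); last by apply: ccontM => //; exact: ccontC.
by ring.
Qed.

Lemma cder_hline c x : cder (fun x => x +i* c) x 1.
Proof. by split => /=; [exact: dvI|exact: dvC]. Qed.

Lemma cder_vline a y : cder (fun y => a +i* y) y 'i.
Proof. by split => /=; [exact: dvC|exact: dvI]. Qed.

Lemma ccont_hline c : ccont (fun x => x +i* c).
Proof. by split => /=; [exact: ctI|exact: ctC]. Qed.

Lemma ccont_vline a : ccont (fun y => a +i* y).
Proof. by split => /=; [exact: ctC|exact: ctI]. Qed.

Lemma lcont_id : lcont (fun z => z).
Proof. by split => *; [exact: ccont_hline|exact: ccont_vline]. Qed.

Lemma bd_affine z D a b c d : bd (fun u => z + D * u) a b c d = 0.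
Proof.
pose G u := z * u + D * 2^-1 * u ^+ 2.
have fr : frame (fun u => z + D * u) a b c d.
  apply: frameD; first exact: frameC.
  by apply: frameM; [exact: frameC|exact: lcont_frame lcont_id].
have dG q t u : cder q t u -> cder (fun t => G (q t)) t (u * (z + D * q t)).
  move=> dq; apply: cder_eq (cderD (cderM (cderC z t) dq) (cderM (cderC (D * 2^-1) t) (cderX 2 dq))) _.
  by rewrite expr1; field.
apply: (bd_prim (G := G)) => // t.
- by apply: cder_eq (dG _ _ _ (cder_hline _ _)) _; rewrite mul1r.
- by apply: cder_eq (dG _ _ _ (cder_hline _ _)) _; rewrite mul1r.
- exact: dG (cder_vline _ _).
- exact: dG (cder_vline _ _).
Qed.

Lemma goursat g a b c d : lcont g -> a <= b -> c <= d ->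
  (forall x y, a <= x <= b -> c <= y <= d -> exists D, cdiff g (x +i* y) D) ->
  bd g a b c d = 0.
Proof.
move=> lg ab cd dg.
(* The error is measured by the squared half-perimeter: halving both sides divides it by 4, so the
   estimate passes from the quarters to the whole. *)
pose S (Q : (R * R) * (R * R)) : R := ((Q.1.2 - Q.1.1) + (Q.2.2 - Q.2.1)) ^+ 2.
suff H e : 0 < e -> normc (bd g a b c d) <= e * S ((a, b), (c, d)).
  apply/eqP; rewrite -normc_eq0 eq_le normc_ge0 andbT; apply/ler_addgt0Pl => e e0.
  rewrite addr0; have S1 : 0 < S ((a, b), (c, d)) + 1 by rewrite ltr_wpDl// sqr_ge0.
  apply: le_trans (H _ (divr_gt0 e0 S1)) _.
  by rewrite mulrAC ler_pdivrMr// ler_pM2l// lerDl.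
move=> e0; pose good (Q : (R * R) * (R * R)) := normc (bd g Q.1.1 Q.1.2 Q.2.1 Q.2.2) <= e * S Q.
apply: (@bisection2 _ good ((a, b), (c, d))) => //=.
  move=> [p q] [u v]; rewrite /good /S /=; set m := (p + q) / 2; set w := (u + v) / 2.
  move=> g1 g2 g3 g4.
  rewrite -(bd_splitx g p m q) -(bd_splity g p m u w v) -(bd_splity g m q u w v).
  apply: le_trans (le_normcD _ _) _; apply: le_trans (lerD (le_normcD _ _) (le_normcD _ _)) _.
  apply: le_trans (lerD (lerD g1 g2) (lerD g3 g4)) _.
  rewrite le_eqVlt; apply/orP; left; apply/eqP.
  by rewrite /m /w; field.
move=> x y xab ycd; have [D hD] := dg x y xab ycd.
(* On a rectangle of half-perimeter L the remainder of the affine approximation is at most e/8 * 2L,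
   and [bd_bound] turns this into 4 * (e/8 * 2L) * L = e L^2. *)
have e8 : 0 < e / 8 by rewrite divr_gt0.
have [dl dl0 hdl] := hD _ e8.
exists (dl / 2) => [|[p q] [u v] /= /andP[px xq] /andP[uy yv] pq uv]; first by rewrite divr_gt0.
rewrite /good /S /=; set L := (q - p) + (v - u).
have L0 : 0 <= L by rewrite /L; lra.
pose z0 := x +i* y.
pose er z := g z - (g z0 - D * z0 + D * z).
have la : lcont (fun z => g z0 - D * z0 + D * z).
  by split => t; apply: ccontD; [exact: ccontC|apply: ccontM; [exact: ccontC|exact: ccont_hline]|exact: ccontC|apply: ccontM; [exact: ccontC|exact: ccont_vline]].
have fer : frame er p q u v.
  apply: frameD; first exact: lcont_frame.
  by have [? ? ? ?] := lcont_frame p q u v la; split; exact: ccontN.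
rewrite (@eq_bd _ (fun z => er z + (g z0 - D * z0 + D * z))); last by move=> z; rewrite /er subrK.
rewrite bdD//; last exact: lcont_frame.
rewrite bd_affine addr0.
have B s t : p <= s <= q -> u <= t <= v -> normc (er (s +i* t)) <= e / 8 * (2 * L).
  move=> /andP[ps sq] /andP[ut tv].
  pose w := (s - x) +i* (t - y).
  have wE : s +i* t = z0 + w by apply: complex_eq => /=; ring.
  have wb : normc w <= L.
    apply: le_trans (normc_le_ReIm _) _; rewrite /L /=; apply: lerD; rewrite ler_norml; lra.
  rewrite (_ : er _ = g (z0 + w) - g z0 - w * D); last by rewrite /er wE; ring.
  apply: le_trans (hdl w _) _; first by apply: le_lt_trans wb _; rewrite /L; lra.
  apply: ler_wpM2l; first exact: ltW.
  by move: wb L0; set n := normc w; lra.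
apply: le_trans (@bd_bound er p q u v (e / 8 * (2 * L)) fer _ _ _ _) _.
- by apply: le_trans xq.
- by apply: le_trans yv.
- by move=> s hs; split; apply: B => //; rewrite lexx ?(le_trans uy yv).
- by move=> s hs; split; apply: B => //; rewrite lexx ?(le_trans px xq).
rewrite -/L le_eqVlt; apply/orP; left; apply/eqP; by field.
Qed.

End goursat.

(** * Cauchy's theorem with one exceptional point *)

Section cauchy.
Context {R : realType}.
Implicit Types (F g h : R[i] -> R[i]) (a b c d x y r : R) (z u D : R[i]).
#[local] Arguments bd : simpl never.
#[local] Arguments normc : simpl never.

Definition cct g z := forall e : R, 0 < e -> exists2 d : R, 0 < d &
  forall u, normc u < d -> normc (g (z + u) - g z) <= e.

Lemma cdiff_cct F z D : cdiff F z D -> cct F z.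
Proof.
move=> h e e0; have [d d0 hd] := h 1 ltr01.
pose K := 1 + normc D; have K0 : 0 < K by rewrite ltr_pwDl// normc_ge0.
exists (Num.min d (e / K)); first by rewrite lt_min d0 divr_gt0.
move=> u; rewrite lt_min => /andP[ud uK].
have -> : F (z + u) - F z = (F (z + u) - F z - u * D) + u * D by ring.
apply: le_trans (le_normcD _ _) _; rewrite normcM.
have := hd u ud; have := normc_ge0 u; have := normc_ge0 D.
by move: uK; rewrite ltr_pdivlMr// /K mul1r; nra.
Qed.

Lemma lcont_cct g : (forall z, cct g z) -> lcont g.
Proof.
move=> cg; split => t; split => s; apply/cvgrPdist_le => e e0.
- have [d d0 hd] := cg (s +i* t) e e0; exists d => //= v vd0; have vd : `|v - s| < d by rewrite distrC.
  rewrite -cReN -cReD; apply: le_trans (Re_le_normc _) _; rewrite normcB.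
  have := hd ((v - s)%:C); rewrite normcR => /(_ vd).
  by rewrite (_ : s +i* t + _ = v +i* t)//; apply: complex_eq => /=; ring.
- have [d d0 hd] := cg (s +i* t) e e0; exists d => //= v vd0; have vd : `|v - s| < d by rewrite distrC.
  rewrite -cImN -cImD; apply: le_trans (Im_le_normc _) _; rewrite normcB.
  have := hd ((v - s)%:C); rewrite normcR => /(_ vd).
  by rewrite (_ : s +i* t + _ = v +i* t)//; apply: complex_eq => /=; ring.
- have [d d0 hd] := cg (t +i* s) e e0; exists d => //= v vd0; have vd : `|v - s| < d by rewrite distrC.
  rewrite -cReN -cReD; apply: le_trans (Re_le_normc _) _; rewrite normcB.
  have := hd ((v - s)%:C * 'i); rewrite normcM normcR normci mulr1 => /(_ vd).
  by rewrite (_ : t +i* s + _ = t +i* v)//; apply: complex_eq => /=; ring.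
- have [d d0 hd] := cg (t +i* s) e e0; exists d => //= v vd0; have vd : `|v - s| < d by rewrite distrC.
  rewrite -cImN -cImD; apply: le_trans (Im_le_normc _) _; rewrite normcB.
  have := hd ((v - s)%:C * 'i); rewrite normcM normcR normci mulr1 => /(_ vd).
  by rewrite (_ : t +i* s + _ = t +i* v)//; apply: complex_eq => /=; ring.
Qed.

Lemma cct_bounded g a b c d : (forall z, cct g z) -> a <= b -> c <= d ->
  exists M : R, forall x y, a <= x <= b -> c <= y <= d -> normc (g (x +i* y)) <= M.
Proof.
move=> cg ab cd.
pose good (Q : (R * R) * (R * R)) := exists M : R, forall x y, Q.1.1 <= x <= Q.1.2 ->
  Q.2.1 <= y <= Q.2.2 -> normc (g (x +i* y)) <= M.
apply: (@bisection2 _ good ((a, b), (c, d))) => //=.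
  move=> [p q] [v w] /=; set m := (p + q) / 2; set s := (v + w) / 2.
  move=> [M1 h1] [M2 h2] [M3 h3] [M4 h4]; exists (Num.max (Num.max M1 M2) (Num.max M3 M4)) => x y /=.
  move=> /andP[px xq] /andP[vy yw]; rewrite !le_max.
  have [xm|/ltW xm] := leP x m; have [ys|/ltW ys] := leP y s.
  - by rewrite h1//= ?px ?vy.
  - by rewrite (h2 x y)/= ?orbT// ?px ?ys.
  - by rewrite (h3 x y)/= ?orbT// ?xm ?vy.
  - by rewrite (h4 x y)/= ?orbT// ?xm ?ys.
move=> x y _ _; have [dl dl0 hd] := cg (x +i* y) 1 ltr01.
exists (dl / 2) => [|[p q] [v w] /= /andP[px xq] /andP[vy yw] pq vw]; first by rewrite divr_gt0.
exists (normc (g (x +i* y)) + 1) => s t /= /andP[ps sq] /andP[vt tw].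
pose u := (s - x) +i* (t - y).
have e : s +i* t = x +i* y + u by apply: complex_eq => /=; ring.
have ub : normc u < dl.
  apply: le_lt_trans (normc_le_ReIm _) _; rewrite /=.
  have h1 : `|s - x| <= q - p by rewrite ler_norml; lra.
  have h2 : `|t - y| <= w - v by rewrite ler_norml; lra.
  by lra.
have := hd u ub; rewrite e => h.
have -> : g (x +i* y + u) = g (x +i* y) + (g (x +i* y + u) - g (x +i* y)) by ring.
by apply: le_trans (le_normcD _ _) _; rewrite lerD2l.
Qed.

(** A square of half-side t around z0 carries the whole integral, the four rectangles around it
    contributing 0. By boundedness it is at most 16 M t. *)
Lemma goursat_except g (z0 : R[i]) a b c d : (forall z, cct g z) ->
  a < complex.Re z0 < b -> c < complex.Im z0 < d ->
  (forall z, z != z0 -> exists D, cdiff g z D) -> bd g a b c d = 0.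
Proof.
move=> cg /andP[ax xb] /andP[cy yd] dg; have lg := lcont_cct cg.
case: z0 ax xb cy yd dg => x0 y0 /= ax xb cy yd dg.
have [M hM] := @cct_bounded g a b c d cg (ltW (lt_trans ax xb)) (ltW (lt_trans cy yd)).
have M0 : 0 <= M.
  by apply: le_trans (normc_ge0 (g (x0 +i* y0))) (hM _ _ _ _); rewrite !ltW.
pose m := Num.min (Num.min (x0 - a) (b - x0)) (Num.min (y0 - c) (d - y0)).
have m0 : 0 < m by rewrite !lt_min !subr_gt0 ax xb cy yd.
have mE : [/\ m <= x0 - a, m <= b - x0, m <= y0 - c & m <= d - y0].
  by split; rewrite /m !ge_min lexx ?orbT.
case: mE => m1 m2 m3 m4.
have key t : 0 < t -> t <= m -> normc (bd g a b c d) <= 16 * M * t.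
  move=> t0 tm.
  rewrite -(bd_splitx g a (x0 - t) b) -(bd_splitx g (x0 - t) (x0 + t) b).
  rewrite -(bd_splity g (x0 - t) (x0 + t) c (y0 - t) d) -(bd_splity g (x0 - t) (x0 + t) (y0 - t) (y0 + t) d).
  rewrite (@goursat _ g a (x0 - t))//; [|by lra|by lra|]; last first.
    by move=> x y xx yy; apply: dg; rewrite eq_complex /= negb_and; apply/orP; left; lra.
  rewrite (@goursat _ g (x0 + t) b)//; [|by lra|by lra|]; last first.
    by move=> x y xx yy; apply: dg; rewrite eq_complex /= negb_and; apply/orP; left; lra.
  rewrite (@goursat _ g (x0 - t) (x0 + t) c (y0 - t))//; [|by lra|by lra|]; last first.
    by move=> x y xx yy; apply: dg; rewrite eq_complex /= negb_and; apply/orP; right; lra.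
  rewrite (@goursat _ g (x0 - t) (x0 + t) (y0 + t) d)//; [|by lra|by lra|]; last first.
    by move=> x y xx yy; apply: dg; rewrite eq_complex /= negb_and; apply/orP; right; lra.
  rewrite !add0r !addr0; apply: le_trans (@bd_bound _ g _ _ _ _ M _ _ _ _ _) _.
  - exact: lcont_frame.
  - by lra.
  - by lra.
  - by move=> x xx; split; apply: hM; lra.
  - by move=> y yy; split; apply: hM; lra.
  - by rewrite le_eqVlt; apply/orP; left; apply/eqP; ring.
apply/eqP; rewrite -normc_eq0 eq_le normc_ge0 andbT; apply/ler_addgt0Pl => e e0; rewrite addr0.
have K0 : 0 < 16 * M + 1 by rewrite ltr_wpDl// mulr_ge0.
have t0 : 0 < Num.min m (e / (16 * M + 1)) by rewrite lt_min m0 divr_gt0.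
apply: le_trans (key _ t0 _) _; first by rewrite ge_min lexx.
apply: (@le_trans _ _ (16 * M * (e / (16 * M + 1)))).
  by rewrite ler_wpM2l ?mulr_ge0// ge_min lexx orbT.
by rewrite mulrA ler_pdivrMr// mulrC ler_pM2l// lerDl.
Qed.

Lemma cdiff_quot F z u : (forall v, exists D, cdiff F v D) -> u != z ->
  exists D, cdiff (fun v => (F v - F z) / (v - z)) u D.
Proof.
move=> dF uz; have [D /cdiffP[dFu _]] := dF u.
pose C : numFieldType := R[i].
pose V : normedModType C := R[i].
have d1 := @derivableB C V V F (cst (F z)) u 1 dFu (@derivable_cst C V V (F z) u 1).
have d2 := @derivableB C V V id (cst z) u 1 (@derivable_id C V u 1) (@derivable_cst C V V z u 1).
have uz0 : (id - cst z : V -> V) u != 0 by rewrite subr_eq0.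
have d3 := @derivableV C V (id - cst z) u 1 uz0 d2.
have d4 := @derivableM C V _ _ u 1 d1 d3.
exists (derive1 (fun v => (F v - F z) / (v - z)) u); apply/cdiffP; split=> //.
Qed.

(** With the derivative filled in at z the difference quotient is continuous there, so z is an
    admissible exceptional point; on the sides nothing changes. *)
Lemma cauchy_quotient F z r : (forall v, exists D, cdiff F v D) ->
  `|complex.Re z| < r -> `|complex.Im z| < r ->
  bd (fun v => (F v - F z) / (v - z)) (- r) r (- r) r = 0.
Proof.
move=> dF zr zi; have [D hD] := dF z.
pose h v := if v == z then D else (F v - F z) / (v - z).
have hE v : v != z -> h v = (F v - F z) / (v - z) by rewrite /h => /negPf ->.
have dh v : v != z -> exists D, cdiff h v D.
  move=> vz; have [D' h'] := cdiff_quot dF vz; exists D' => e e0.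
  have [d d0 hd] := h' e e0.
  have n0 : 0 < normc (v - z) by rewrite normc_gt0 subr_eq0.
  exists (Num.min d (normc (v - z))); first by rewrite lt_min d0.
  move=> w; rewrite lt_min => /andP[wd wn].
  rewrite !hE//; first exact: hd.
  apply: contraTneq wn => vwz; rewrite -leNgt -(normcN w).
  by rewrite (_ : - w = v - z)// -vwz; ring.
have ch v : cct h v.
  have [->|vz] := eqVneq v z; last by have [D' h'] := dh v vz; exact: cdiff_cct h'.
  move=> e e0; have [d d0 hd] := hD e e0; exists d => // w wd.
  have [->|w0] := eqVneq w 0; first by rewrite addr0 subrr normc0 ltW.
  rewrite hE; last by rewrite -subr_eq0 addrAC subrr add0r.
  have n0 : 0 < normc w by rewrite normc_gt0.
  rewrite /h eqxx -(ler_pM2r n0) -normcM; apply: le_trans (hd w wd).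
  have -> : z + w - z = w by ring.
  by rewrite (_ : (_ / _ - D) * w = F (z + w) - F z - w * D)//; field.
have := @goursat_except h z (- r) r (- r) r ch.
rewrite -!ltr_norml => /(_ zr zi dh) <-.
have ne x y : (`|x| >= r) || (`|y| >= r) -> x +i* y != z.
  by case: (z) zr zi => p q /= pr qr; apply: contraTneq => -[-> ->]; rewrite negb_or -!ltNge pr qr.
have r0 : 0 <= r by apply: le_trans (ltW zr).
rewrite /bd; congr (_ + 'i * _ - _ - 'i * _); apply: eq_cint => t; rewrite hE//; apply: ne; rewrite ?normrN (ger0_norm r0) lexx ?orbT//.
Qed.

End cauchy.

(** * Cauchy's formula and Taylor expansion in a square *)

Section cauchy_series.
Context {R : realType} (r : R) (hr : 0 < r).
Implicit Types (F g h : R[i] -> R[i]) (x y M : R) (z u D : R[i]).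
#[local] Arguments bd : simpl never.
#[local] Arguments normc : simpl never.

Definition sq g := bd g (- r) r (- r) r.

Local Notation sqframe g := (frame g (- r) r (- r) r).

Lemma line_neq z x y : normc z < r -> (`|x| == r) || (`|y| == r) -> x +i* y != z.
Proof.
move=> zr; apply: contraTneq => e; rewrite negb_or; apply/andP; split; rewrite lt_eqF//.
  by apply: le_lt_trans zr; rewrite -e; exact: (Re_le_normc (x +i* y)).
by apply: le_lt_trans zr; rewrite -e; exact: (Im_le_normc (x +i* y)).
Qed.

Lemma frame_inv z : normc z < r -> sqframe (fun u => (u - z)^-1).
Proof.
move=> zr; have n1 : `|- r| == r by rewrite normrN gtr0_norm.
have n2 : `|r| == r by rewrite gtr0_norm.
split; apply: ccontV => [t|]; rewrite ?subr_eq0 ?line_neq ?n1 ?n2 ?orbT//;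
  by apply: ccontB; [exact: ccont_hline || exact: ccont_vline|exact: ccontC].
Qed.

Lemma frame_inv0 : sqframe (fun u => u^-1).
Proof.
have h : normc (0 : R[i]) < r by rewrite normc0.
have e : (fun u : R[i] => (u - 0)^-1) = (fun u => u^-1) by apply/funext => u; rewrite subr0.
by have := frame_inv h; rewrite e.
Qed.

Lemma frameX g n : sqframe g -> sqframe (fun u => g u ^+ n).
Proof. by move=> [h1 h2 h3 h4]; split; exact: ccontX. Qed.

Lemma frame_invX n : sqframe (fun u => u^-1 ^+ n).
Proof. exact: frameX frame_inv0. Qed.

Lemma sq_sum F (f : nat -> R[i] -> R[i]) n : (forall i, sqframe (f i)) ->
  sqframe (fun u => \sum_(i < n) f i u) /\
  sq (fun u => \sum_(i < n) f i u) = \sum_(i < n) sq (f i).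
Proof.
move=> hf; elim: n => [|n [IH1 IH2]].
  have e : (fun u => \sum_(i < 0) f i u) = fun=> 0 * 1 by apply/funext => u; rewrite big_ord0 mul0r.
  split; first by rewrite e; exact: frameC.
  by rewrite e big_ord0 /sq (bdZ _ (frameC _ _ _ _ _)) mul0r.
have e : (fun u => \sum_(i < n.+1) f i u) = fun u => \sum_(i < n) f i u + f n u.
  by apply/funext => u; rewrite big_ord_recr.
rewrite e; split; first exact: frameD.
by rewrite /sq bdD// big_ord_recr /= -IH2.
Qed.

(** Every power of 1/u from the second on has a primitive along the sides. *)
Lemma sq_invX n : sq (fun u => u^-1 ^+ n.+2) = 0.
Proof.
have N0 : n.+1%:R != 0 :> R[i] by rewrite pnatr_eq0.
pose G u := - n.+1%:R^-1 * u^-1 ^+ n.+1.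
have h0 : normc (0 : R[i]) < r by rewrite normc0.
have n1 : `|- r| == r by rewrite normrN gtr0_norm.
have n2 : `|r| == r by rewrite gtr0_norm.
have fl (N w p v : R[i]) : N != 0 -> w != 0 -> - N^-1 * (N * p * (- v / (w * w))) = v * (w^-1 * (w^-1 * p)).
  by move=> ? ?; field; apply/andP.
have dG q t u : (forall x, q x != 0) -> cder q t u -> cder (fun t => G (q t)) t (u * (q t)^-1 ^+ n.+2).
  move=> q0 dq; apply: cder_eq (cderM (cderC (- n.+1%:R^-1) t) (cderX n.+1 (cderV q0 dq))) _.
  by rewrite mul0r add0r /= expr2 !exprS; apply: fl.
apply: (bd_prim (G := G)); first exact: frame_invX.
- move=> x; apply: cder_eq (dG _ _ _ _ (cder_hline _ _)) _; last by rewrite mul1r.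
  by move=> t; rewrite line_neq// n1 orbT.
- move=> x; apply: cder_eq (dG _ _ _ _ (cder_hline _ _)) _; last by rewrite mul1r.
  by move=> t; rewrite line_neq// n2 orbT.
- move=> y; apply: dG (cder_vline _ _); by move=> t; rewrite line_neq// n1.
- move=> y; apply: dG (cder_vline _ _); by move=> t; rewrite line_neq// n2.
Qed.

(* This is 2 pi i, but only a lower bound on its modulus is needed. *)
Definition kappa : R[i] := sq (fun u => u^-1).

(** Each side adds to the imaginary part the integral of r / (x^2 + r^2) over [-r, r], where the
    integrand is at least 1/(2r). *)
Lemma kappa_ge : 4 <= normc kappa.
Proof.
pose f x := r / (x ^+ 2 + r ^+ 2).
have p0 x : 0 < x ^+ 2 + r ^+ 2 by rewrite ltr_wpDl ?sqr_ge0// exprn_gt0.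
have cf : continuous f.
  have cp : continuous (fun x => x ^+ 2 + r ^+ 2) by apply: ctD; [exact: ctX ctI|exact: ctC].
  apply: ctM; first exact: ctC.
  by move=> x; apply: cvgV; [rewrite gt_eqF|exact: cp].
have f1 : 1 <= lint f (- r) r.
  (* The constant 3/(4r) is the middle of the interval [1/(2r), 1/r] that contains the values of f;
     centring is needed because [lint_bound] controls absolute values only. *)
  have : `|lint (fun x => f x + (- (3 / (4 * r)))) (- r) r| <= 1 / (4 * r) * (r - - r).
    apply: lint_bound; [by apply: ctD => //; exact: ctC|by move: hr; lra|] => t /andP[t1 t2].
    have t3 : t ^+ 2 <= r ^+ 2 by nra.
    have h1 : f t <= 1 / r.
      rewrite /f ler_pdivrMr// mulrC mulrA ler_pdivlMr// mulr1 expr2.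
      by have := sqr_ge0 t; rewrite expr2; lra.
    have h2 : 1 / (2 * r) <= f t.
      rewrite /f ler_pdivlMr// mulrC mulrA ler_pdivrMr ?mulr_gt0// mulr1.
      by move: t3; rewrite !expr2; lra.
    have e3 : 3 / (4 * r) = 3 / 4 * (1 / r) by field; rewrite gt_eqF.
    have e2 : 1 / (2 * r) = 1 / 2 * (1 / r) by field; rewrite gt_eqF.
    have e1 : 1 / (4 * r) = 1 / 4 * (1 / r) by field; rewrite gt_eqF.
    by move: h1 h2; rewrite e1 e2 e3 ler_norml; lra.
  rewrite lintD//; last exact: ctC.
  have -> : lint (fun=> - (3 / (4 * r))) (- r) r = - (3 / 2).
    rewrite (_ : (fun=> _) = fun x => - (3 / (4 * r)) * 1); last by apply/funext => x; rewrite mulr1.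
    rewrite lintZ; last exact: ctC.
    rewrite (@lint_prim _ (fun x => x) _ _ _ (@ctC _ 1) (fun x => dvI x)).
    by field; rewrite gt_eqF.
  have -> : 1 / (4 * r) * (r - - r) = 1 / 2 by field; rewrite gt_eqF.
  by rewrite ler_norml; lra.
have [h1 h2 h3 h4] := frame_inv0.
have E : complex.Im kappa = 4 * lint f (- r) r.
  have Ii (u : R[i]) : complex.Im ('i * u) = complex.Re u by rewrite cImM /= mul0r mul1r add0r.
  have ei : lint (fun x => complex.Im (x +i* - r)^-1) (- r) r = lint f (- r) r.
    by congr lint; apply/funext => x; rewrite cImV /= opprK sqrrN.
  have eii : lint (fun x => complex.Im (x +i* r)^-1) (- r) r = - lint f (- r) r.
    by rewrite -[RHS]mulN1r -lintZ//; congr lint; apply/funext => x; rewrite cImV /= /f; ring.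
  have eiii : lint (fun x => complex.Re (r +i* x)^-1) (- r) r = lint f (- r) r.
    by congr lint; apply/funext => x; rewrite cReV /= /f addrC.
  have eiv : lint (fun x => complex.Re (- r +i* x)^-1) (- r) r = - lint f (- r) r.
    by rewrite -[RHS]mulN1r -lintZ//; congr lint; apply/funext => x; rewrite cReV /= /f sqrrN addrC; ring.
  transitivity (lint (fun x => complex.Im (x +i* - r)^-1) (- r) r + lint (fun x => complex.Re (r +i* x)^-1) (- r) r -
    lint (fun x => complex.Im (x +i* r)^-1) (- r) r - lint (fun x => complex.Re (- r +i* x)^-1) (- r) r).
    by rewrite /kappa /sq /bd !cImD !cImN !Ii.
  by rewrite ei eii eiii eiv; ring.
apply: le_trans (Im_le_normc _); rewrite E ger0_norm; lra.
Qed.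

Lemma kappa_neq0 : kappa != 0.
Proof. by rewrite -normc_gt0; apply: lt_le_trans kappa_ge. Qed.

Lemma geometric_sum z u N : u != 0 -> u != z ->
  (u - z)^-1 = \sum_(i < N) z ^+ i * u^-1 ^+ i.+1 + z ^+ N * (u^-1 ^+ N * (u - z)^-1).
Proof.
move=> u0; rewrite -subr_eq0 => uz; elim: N => [|N {1}->].
  by rewrite big_ord0 add0r !expr0 !mul1r.
rewrite big_ord_recr /= -addrA; congr (_ + _); rewrite !exprS.
by set p := z ^+ N; set q := _ ^+ N; field; rewrite u0 uz.
Qed.

Lemma eq_sq g h : (forall u, (`|complex.Re u| == r) || (`|complex.Im u| == r) -> g u = h u) -> sq g = sq h.
Proof.
move=> gh; have n1 : `|- r| == r by rewrite normrN gtr0_norm.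
have n2 : `|r| == r by rewrite gtr0_norm.
by rewrite /sq /bd; congr (_ + 'i * _ - _ - 'i * _); apply: eq_cint => t; apply: gh => /=; rewrite ?n1 ?n2 ?orbT.
Qed.

Lemma sq_bound g M : sqframe g -> (forall u, `|complex.Re u| <= r -> `|complex.Im u| <= r ->
    (`|complex.Re u| == r) || (`|complex.Im u| == r) -> normc (g u) <= M) ->
  normc (sq g) <= 16 * r * M.
Proof.
move=> fg hM; have n1 : `|- r| == r by rewrite normrN gtr0_norm.
have n2 : `|r| == r by rewrite gtr0_norm.
have rr : - r <= r by move: hr; lra.
apply: le_trans (bd_bound fg rr rr (M := M) _ _) _; last by rewrite le_eqVlt; apply/orP; left; apply/eqP; ring.
  move=> x xr; rewrite -ler_norml in xr; split; apply: hM => //=; rewrite ?n1 ?n2 ?orbT//.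
    by rewrite (eqP n1).
  by rewrite (eqP n2).
move=> x xr; rewrite -ler_norml in xr; split; apply: hM => //=; rewrite ?n1 ?n2 ?orbT//.
  by rewrite (eqP n1).
by rewrite (eqP n2).
Qed.

Lemma frame_normc u : (`|complex.Re u| == r) || (`|complex.Im u| == r) -> r <= normc u.
Proof. by move=> /orP[/eqP <-|/eqP <-]; [exact: Re_le_normc|exact: Im_le_normc]. Qed.

(** The Cauchy kernel 1/(u - z) is expanded in powers of z/u; on the sides |u| >= r, which gives the
    remainder its geometric factor. *)
Lemma sq_geometric g z M : sqframe g -> normc z < r ->
  (forall u, `|complex.Re u| <= r -> `|complex.Im u| <= r -> normc (g u) <= M) -> forall N,
  normc (sq (fun u => g u * (u - z)^-1) - \sum_(i < N) z ^+ i * sq (fun u => g u * u^-1 ^+ i.+1)) <=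
  16 * r * (M / (r - normc z)) * (normc z / r) ^+ N.
Proof.
move=> fg zr hM N.
have zr0 : 0 < r - normc z by rewrite subr_gt0.
have fi i : sqframe (fun u => g u * u^-1 ^+ i.+1) by apply: frameM => //; exact: frame_invX.
have fz i : sqframe (fun u => z ^+ i * (g u * u^-1 ^+ i.+1)).
  by apply: frameM; [exact: frameC|exact: fi].
have fR : sqframe (fun u => g u * (u^-1 ^+ N * (u - z)^-1)).
  by apply: frameM => //; apply: frameM; [exact: frame_invX|exact: frame_inv].
have [fS sS] := sq_sum g N fz.
have -> : sq (fun u => g u * (u - z)^-1) = sq (fun u => \sum_(i < N) z ^+ i * (g u * u^-1 ^+ i.+1)
    + z ^+ N * (g u * (u^-1 ^+ N * (u - z)^-1))).
  apply: eq_sq => u hu; have ru := frame_normc hu.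
  have u0 : u != 0 by rewrite -normc_gt0; apply: lt_le_trans ru.
  have uz : u != z by apply: contraTneq ru => ->; rewrite -ltNge.
  rewrite [in LHS](geometric_sum N u0 uz) mulrDr mulr_sumr; congr (_ + _); last by rewrite mulrCA.
  by apply: eq_bigr => i _; rewrite mulrCA.
rewrite /sq bdD//; last by apply: frameM => //; exact: frameC.
rewrite bdZ// -!/(sq _) sS.
rewrite (eq_bigr (fun i : 'I_N => z ^+ i * sq (fun u => g u * u^-1 ^+ i.+1))); last first.
  by move=> i _; rewrite /sq bdZ.
rewrite addrAC subrr add0r normcM normcX.
apply: le_trans (ler_wpM2l _ (sq_bound (M := M / (r - normc z) * r^-1 ^+ N) fR _)) _.
- by rewrite exprn_ge0 ?normc_ge0.
- move=> u h1 h2 hu; have ru := frame_normc hu.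
  have u0 : 0 < normc u by apply: lt_le_trans ru.
  have uzn : r - normc z <= normc (u - z).
    by have := le_normcD (u - z) z; rewrite subrK; lra.
  rewrite !normcM normcX !normcV [leLHS]mulrA mulrAC.
  have M0 : 0 <= M by apply: le_trans (hM u h1 h2); exact: normc_ge0.
  apply: ler_pM; [by rewrite mulr_ge0 ?invr_ge0 ?normc_ge0|by rewrite exprn_ge0 ?invr_ge0 ?normc_ge0| |].
  + apply: ler_pM; rewrite ?normc_ge0 ?invr_ge0 ?normc_ge0//; first exact: hM.
    by rewrite lef_pV2 ?posrE//; apply: lt_le_trans uzn.
  + by apply: lerXn2r; rewrite ?nnegrE ?invr_ge0 ?(ltW hr) ?(ltW u0)// lef_pV2 ?posrE.
by rewrite le_eqVlt; apply/orP; left; apply/eqP; rewrite exprMn; ring.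
Qed.

Lemma geo_cvg0 (K q : R) : 0 <= q < 1 -> (fun N => K * q ^+ N) @ \oo --> (0 : R).
Proof.
move=> /andP[q0 q1]; rewrite -[X in _ --> X](mulr0 K); apply: cvgM; first exact: cvg_cst.
by apply: cvg_expr; rewrite ger0_norm.
Qed.

(** In the expansion of 1/(u - z) only the term 1/u has a nonzero integral. *)
Lemma sq_inv z : normc z < r -> sq (fun u => (u - z)^-1) = kappa.
Proof.
move=> zr.
have h := @sq_geometric (fun=> 1) z 1 (frameC _ _ _ _ _) zr (fun u _ _ => _).
have {h} := h _; rewrite normc1 => /(_ (fun _ => lexx 1)) h.
have q1 : 0 <= normc z / r < 1 by rewrite divr_ge0 ?normc_ge0 ?ltW//= ltr_pdivrMr// mul1r.
set K := 16 * r * (1 / (r - normc z)) in h.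
have cv := geo_cvg0 K q1.
apply/eqP; rewrite -subr_eq0 -normc_eq0 eq_le normc_ge0 andbT.
rewrite -(cvg_lim _ cv)//; apply: limr_ge; first by apply/cvg_ex; exists 0.
exists 1%N => // N /= N1; have := h N.
rewrite (_ : sq (fun u => 1 * (u - z)^-1) = sq (fun u => (u - z)^-1)); last first.
  by apply: eq_sq => u _; rewrite mul1r.
apply: le_trans; rewrite le_eqVlt; apply/orP; left; apply/eqP; congr (normc (_ - _)).
case: N N1 => // N _; rewrite big_ord_recl big1 => [|i _].
  by rewrite expr0 mul1r addr0; apply: eq_sq => u _; rewrite mul1r expr1.
rewrite (_ : sq _ = sq (fun u => u^-1 ^+ i.+2)); first by rewrite sq_invX mulr0.
by apply: eq_sq => u _; rewrite mul1r.
Qed.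

(** The coefficients are those of Cauchy's formula. The constant 4 is 16 / 4, the 16 of [sq_bound]
    over the lower bound for the modulus of kappa. *)
Lemma cauchy_local F M : (forall v, exists D, cdiff F v D) ->
  (forall u, `|complex.Re u| <= r -> `|complex.Im u| <= r -> normc (F u) <= M) ->
  exists a : nat -> R[i], (forall n, normc (a n) * r ^+ n <= 4 * M) /\
   forall z, normc z < r -> exists K : R, forall N,
     normc (F z - \sum_(i < N) a i * z ^+ i) <= K * (normc z / r) ^+ N.
Proof.
move=> dF hM.
have lF : lcont F by apply: lcont_cct => z; have [D /cdiff_cct] := dF z.
have fF : sqframe F by exact: lcont_frame.
have k0 : 0 < normc kappa by apply: lt_le_trans kappa_ge.
exists (fun n => sq (fun u => F u * u^-1 ^+ n.+1) / kappa); split=> [n|z zr].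
  rewrite normcM normcV.
  have b : normc (sq (fun u => F u * u^-1 ^+ n.+1)) <= 16 * r * (M * r^-1 ^+ n.+1).
    apply: sq_bound; first by apply: frameM => //; exact: frame_invX.
    move=> u h1 h2 /frame_normc ru; rewrite normcM normcX normcV.
    have u0 : 0 < normc u by apply: lt_le_trans ru.
    apply: ler_pM; rewrite ?normc_ge0 ?exprn_ge0 ?invr_ge0 ?normc_ge0//; first exact: hM.
    by apply: lerXn2r; rewrite ?nnegrE ?invr_ge0 ?(ltW hr) ?(ltW u0)// lef_pV2 ?posrE.
  have M0 : 0 <= M by apply: le_trans (hM 0 _ _); rewrite ?normc_ge0 ?normr0 ?ltW.
  rewrite mulrAC ler_pdivrMr//.
  apply: (@le_trans _ _ (16 * r * (M * r^-1 ^+ n.+1) * r ^+ n)).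
    by rewrite ler_wpM2r ?exprn_ge0// ltW.
  have -> : 16 * r * (M * r^-1 ^+ n.+1) * r ^+ n = 4 * M * 4.
    have r0 : r != 0 by rewrite gt_eqF.
    rewrite exprS exprVn; have := expf_neq0 n r0.
    by set p := r ^+ n => p0; field; rewrite ?r0 ?p0.
  by rewrite ler_wpM2l ?mulr_ge0// kappa_ge.
have zz : `|complex.Re z| < r /\ `|complex.Im z| < r.
  by split; apply: le_lt_trans zr; [exact: Re_le_normc|exact: Im_le_normc].
have cq := cauchy_quotient dF zz.1 zz.2.
have fi := frame_inv zr.
have eF : sq (fun u => F u * (u - z)^-1) = F z * kappa.
  rewrite -(sq_inv zr) /sq -bdZ// -[RHS]add0r -cq -bdD.
  - by apply: eq_bd => u; ring.
  - apply: frameM => //; apply: frameD => //; exact: frameC.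
  - by apply: frameM => //; exact: frameC.
exists (16 * r * (M / (r - normc z)) / normc kappa) => N.
have := sq_geometric fF zr hM N; rewrite eF => h.
rewrite mulrAC ler_pdivlMr// -normcM; apply: le_trans h.
rewrite le_eqVlt; apply/orP; left; apply/eqP; congr normc.
rewrite mulrBl; congr (_ - _); rewrite mulr_suml; apply: eq_bigr => i _.
by field; exact: kappa_neq0.
Qed.

End cauchy_series.

(** * One Taylor series for all radii *)

Section entire_series.
Context {R : realType}.
Implicit Types (F : R[i] -> R[i]) (a b : nat -> R[i]) (x y M r s : R) (z u D : R[i]).
#[local] Arguments normc : simpl never.

(** Cauchy's formula gives coefficients that depend on the square; uniqueness identifies them for
    different radii. *)
Lemma power_series_uniq a b r s (A B : R) F : 0 < r -> 0 < s ->
  (forall n, normc (a n) * r ^+ n <= A) -> (forall n, normc (b n) * s ^+ n <= B) ->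
  (forall z, normc z < r -> exists K : R, forall N,
     normc (F z - \sum_(i < N) a i * z ^+ i) <= K * (normc z / r) ^+ N) ->
  (forall z, normc z < s -> exists K : R, forall N,
     normc (F z - \sum_(i < N) b i * z ^+ i) <= K * (normc z / s) ^+ N) ->
  a =1 b.
Proof.
move=> r0 s0 hA hB hr hs.
pose t := Num.min r s; have t0 : 0 < t by rewrite lt_min r0.
have tr : t <= r by rewrite ge_min lexx.
have ts : t <= s by rewrite ge_min lexx orbT.
pose d n := a n - b n.
have dC n : normc (d n) * t ^+ n <= A + B.
  apply: (@le_trans _ _ ((normc (a n) + normc (b n)) * t ^+ n)).
    by rewrite ler_wpM2r ?exprn_ge0 ?(ltW t0)// le_normcB.
  rewrite mulrDl; apply: lerD; [apply: le_trans (hA n)|apply: le_trans (hB n)];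
    by rewrite ler_wpM2l ?normc_ge0//; apply: lerXn2r; rewrite ?nnegrE ?(ltW t0) ?(ltW r0) ?(ltW s0).
have C0 : 0 <= A + B by apply: le_trans (dC 0%N); rewrite mulr_ge0 ?normc_ge0 ?exprn_ge0 ?(ltW t0).
suff d0 n : d n = 0 by move=> n; apply/eqP; rewrite -subr_eq0 -/(d n) d0.
have [m] := ubnP n; elim: m n => // m IH n nm.
have dz i : (i < n)%N -> d i = 0 by move=> ni; apply: IH; apply: leq_trans ni _.
(* At z = q t the lower differences vanish, the term of degree n is of order q^n and the tail of
   order q^(n+1); division by q^n leaves O(q), and q is arbitrary. *)
have key q : 0 < q -> q <= 1 / 2 -> normc (d n) * t ^+ n <= 2 * (A + B) * q.
  move=> q0 q1; pose z : R[i] := (q * t)%:C.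
  have zn : normc z = q * t by rewrite normcR gtr0_norm// mulr_gt0.
  have zt : normc z < t by rewrite zn -[ltRHS]mul1r ltr_pM2r//; lra.
  have [K1 h1] := hr z (lt_le_trans zt tr); have [K2 h2] := hs z (lt_le_trans zt ts).
  have rq : normc z / r <= q by rewrite zn ler_pdivrMr// ler_pM2l.
  have sq_ : normc z / s <= q by rewrite zn ler_pdivrMr// ler_pM2l.
  have K10 : 0 <= K1 by have := le_trans (normc_ge0 _) (h1 0%N); rewrite expr0 mulr1.
  have K20 : 0 <= K2 by have := le_trans (normc_ge0 _) (h2 0%N); rewrite expr0 mulr1.
  have hd N : normc (\sum_(i < N) d i * z ^+ i) <= (K1 + K2) * q ^+ N.
    rewrite (_ : \sum_(i < N) _ = (F z - \sum_(i < N) b i * z ^+ i) - (F z - \sum_(i < N) a i * z ^+ i)); last first.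
      transitivity (\sum_(i < N) a i * z ^+ i - \sum_(i < N) b i * z ^+ i); last by ring.
      by rewrite -sumrB; apply: eq_bigr => i _; rewrite /d mulrBl.
    apply: le_trans (le_normcB _ _) _; rewrite addrC mulrDl; apply: lerD.
      by apply: le_trans (h1 N) _; rewrite ler_wpM2l//; apply: lerXn2r => //; rewrite nnegrE ?(ltW q0)// divr_ge0 ?normc_ge0 ?(ltW r0).
    by apply: le_trans (h2 N) _; rewrite ler_wpM2l//; apply: lerXn2r => //; rewrite nnegrE ?(ltW q0)// divr_ge0 ?normc_ge0 ?(ltW s0).
  have tail p : normc (\sum_(i < n.+1 + p) d i * z ^+ i - d n * z ^+ n) <= (A + B) * (2 * q ^+ n.+1 - 2 * q ^+ (n.+1 + p)).
    elim: p => [|p IHp].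
      rewrite addn0 subrr mulr0 big_ord_recr /= big1 => [|i _]; first by rewrite add0r subrr normc0.
      by rewrite dz ?mul0r//=.
    have st : normc (d (n.+1 + p)%N * z ^+ (n.+1 + p)) <= (A + B) * q ^+ (n.+1 + p).
      rewrite normcM normcX zn exprMn (_ : _ * (_ * _) = normc (d (n.+1 + p)%N) * t ^+ (n.+1 + p) * q ^+ (n.+1 + p)); last by ring.
      by rewrite ler_wpM2r ?exprn_ge0 ?(ltW q0).
    rewrite addnS big_ord_recr /= addrAC; apply: le_trans (le_normcD _ _) _.
    apply: le_trans (lerD IHp st) _.
    rewrite -mulrDr ler_wpM2l// [q ^+ (n.+1 + p).+1]exprS.
    have : 0 <= q ^+ (n.+1 + p) by rewrite exprn_ge0// ltW.
    by nra.
  have bnd p : normc (d n) * t ^+ n * q ^+ n <= (K1 + K2) * q ^+ p + 2 * (A + B) * q * q ^+ n.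
    have -> : normc (d n) * t ^+ n * q ^+ n = normc (d n * z ^+ n).
      by rewrite normcM normcX zn exprMn; ring.
    have -> : d n * z ^+ n = \sum_(i < n.+1 + p) d i * z ^+ i - (\sum_(i < n.+1 + p) d i * z ^+ i - d n * z ^+ n) by ring.
    apply: le_trans (le_normcB _ _) _; apply: lerD.
      apply: le_trans (hd _) _; rewrite ler_wpM2l ?addr_ge0// exprD ler_piMl ?exprn_ge0 ?(ltW q0)//.
      by rewrite exprn_ile1 ?(ltW q0)//; lra.
    apply: le_trans (tail p) _.
    have -> : 2 * (A + B) * q * q ^+ n = (A + B) * (2 * q ^+ n.+1) by rewrite exprS; ring.
    by rewrite ler_wpM2l// lerBlDr lerDl mulr_ge0// exprn_ge0// ltW.
  have qn : 0 < q ^+ n by rewrite exprn_gt0.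
  rewrite -(ler_pM2r qn); apply/ler_addgt0Pl => e e0.
  have qq : 0 <= q < 1 by apply/andP; split; [exact: ltW|lra].
  have /cvgrPdist_lt /(_ e e0) [N _ /(_ N (leqnn N))] := geo_cvg0 (K1 + K2) qq.
  rewrite sub0r normrN => /= hN; apply: le_trans (bnd N) _; rewrite lerD2r ltW//.
  by apply: le_lt_trans hN; exact: ler_norm.
have : normc (d n) * t ^+ n <= 0.
  apply/ler_addgt0Pl => e e0; rewrite addr0.
  have K0 : 0 < 2 * (A + B) + 1 by rewrite ltr_wpDl// mulr_ge0.
  have q0 : 0 < Num.min (1 / 2) (e / (2 * (A + B) + 1)) :> R by rewrite lt_min !divr_gt0.
  apply: le_trans (key _ q0 _) _; first by rewrite ge_min lexx.
  apply: (@le_trans _ _ (2 * (A + B) * (e / (2 * (A + B) + 1)))).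
    by rewrite ler_wpM2l ?mulr_ge0// ge_min lexx orbT.
  by rewrite mulrA ler_pdivrMr// mulrC ler_pM2l// lerDl.
rewrite pmulr_lle0 ?exprn_gt0// => h; apply/eqP; rewrite -normc_eq0 eq_le h.
exact: normc_ge0.
Qed.

Lemma entire_series F : (forall v, exists D, cdiff F v D) -> exists a,
  (forall r M, 0 < r -> (forall u, `|complex.Re u| <= r -> `|complex.Im u| <= r -> normc (F u) <= M) ->
     forall n, normc (a n) * r ^+ n <= 4 * M) /\
  (forall z, (fun N => normc (F z - \sum_(i < N) a i * z ^+ i)) @ \oo --> (0 : R)).
Proof.
move=> dF.
have cF z : cct F z by have [D /cdiff_cct] := dF z.
have bF r : 0 < r -> exists M, forall u, `|complex.Re u| <= r -> `|complex.Im u| <= r -> normc (F u) <= M.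
  move=> r0; have rr : - r <= r by lra.
  have [M hM] := cct_bounded cF rr rr; exists M => -[x y] /=; rewrite !ler_norml; exact: hM.
have [M1 hM1] := bF 1 ltr01.
have [a [ha sa]] := cauchy_local ltr01 dF hM1.
have loc r M : 0 < r -> (forall u, `|complex.Re u| <= r -> `|complex.Im u| <= r -> normc (F u) <= M) ->
  (forall n, normc (a n) * r ^+ n <= 4 * M) /\
  (forall z, normc z < r -> exists K : R, forall N,
     normc (F z - \sum_(i < N) a i * z ^+ i) <= K * (normc z / r) ^+ N).
  move=> r0 hM; have [b [hb sb]] := cauchy_local r0 dF hM.
  by have /funext -> := power_series_uniq ltr01 r0 ha hb sa sb.
exists a; split=> [r M r0 hM|z]; first exact: (loc r M r0 hM).1.
have r0 : 0 < normc z + 1 by rewrite ltr_wpDl// normc_ge0.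
have [M hM] := bF _ r0; have [_ /(_ z)] := loc _ _ r0 hM.
case=> [|K hK]; first by rewrite ltrDl.
have q1 : 0 <= normc z / (normc z + 1) < 1.
  by rewrite divr_ge0 ?normc_ge0 ?(ltW r0)//= ltr_pdivrMr// mul1r ltrDl.
apply: (squeeze_cvgr _ (cvg_cst (0 : R)) (geo_cvg0 K q1)).
by apply: nearW => N; rewrite normc_ge0 hK.
Qed.

End entire_series.

(** * Entire functions on the real line *)

Section real_restriction.
Context {R : realType}.
Implicit Types (F G : R[i] -> R[i]) (c d : nat -> R) (x y M r s : R) (z u D : R[i]).
#[local] Arguments normc : simpl never.

Definition reps F c d := [/\ ent c, ent d & forall x, F x%:C = fs c x +i* fs d x].

Lemma entire_cdiff F : entire F -> forall v, exists D, cdiff F v D.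
Proof. by move=> eF v; exists (derive1 F v); apply/cdiffP. Qed.

Lemma cdiff_entire F : (forall v, exists D, cdiff F v D) -> entire F.
Proof. by move=> h v; have [D /cdiffP []] := h v. Qed.

Lemma Re_real_pow (a : R[i]) x n : complex.Re (a * x%:C ^+ n) = complex.Re a * x ^+ n.
Proof. by rewrite -rmorphXn cReM /= mulr0 subr0. Qed.

Lemma Im_real_pow (a : R[i]) x n : complex.Im (a * x%:C ^+ n) = complex.Im a * x ^+ n.
Proof. by rewrite -rmorphXn cImM /= mulr0 add0r. Qed.

Lemma cRe_sum n (f : nat -> R[i]) : complex.Re (\sum_(i < n) f i) = \sum_(i < n) complex.Re (f i).
Proof. by elim: n => [|n IH]; rewrite ?big_ord0// !big_ord_recr /= cReD IH. Qed.

Lemma cIm_sum n (f : nat -> R[i]) : complex.Im (\sum_(i < n) f i) = \sum_(i < n) complex.Im (f i).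
Proof. by elim: n => [|n IH]; rewrite ?big_ord0// !big_ord_recr /= cImD IH. Qed.

Lemma entire_seriesW F : entire F -> exists a : nat -> R[i],
  [/\ reps F (fun n => complex.Re (a n)) (fun n => complex.Im (a n)),
   forall r M, 0 < r -> (forall u, `|complex.Re u| <= r -> `|complex.Im u| <= r -> normc (F u) <= M) ->
     forall n, normc (a n) * r ^+ n <= 4 * M &
   forall z, (fun N => normc (F z - \sum_(i < N) a i * z ^+ i)) @ \oo --> (0 : R)].
Proof.
move=> eF; have dF := entire_cdiff eF; have [a [ha sa]] := entire_series dF.
exists a; split => //.
have cF z : cct F z by have [D /cdiff_cct] := dF z.
have ca s : 0 <= s -> exists C : R, forall n, normc (a n) * s ^+ n <= C.
  move=> s0; have s1 : 0 < s + 1 by rewrite ltr_wpDl.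
  have rr : - (s + 1) <= s + 1 by lra.
  have [M hM] := cct_bounded cF rr rr; exists (4 * M) => n.
  apply: le_trans (ha _ M s1 _ n); last by move=> -[x y] /=; rewrite !ler_norml; exact: hM.
  by rewrite ler_wpM2l ?normc_ge0//; apply: lerXn2r; rewrite ?nnegrE ?(ltW s1)// lerDl.
have e1 : ent (fun n => complex.Re (a n)).
  move=> s s0; have [C hC] := ca s s0; exists C => n; apply: le_trans (hC n).
  by rewrite ler_wpM2r ?exprn_ge0// Re_le_normc.
have e2 : ent (fun n => complex.Im (a n)).
  move=> s s0; have [C hC] := ca s s0; exists C => n; apply: le_trans (hC n).
  by rewrite ler_wpM2r ?exprn_ge0// Im_le_normc.
split => // x; have h := sa x%:C; apply: complex_eq => /=.
  apply/esym; apply: (@cvg_unique _ _ (pseries (fun n => complex.Re (a n)) x @ \oo)) => //.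
    exact: ent_fs.
  apply/cvgrPdist_le => e e0; have /cvgrPdist_le /(_ e e0) := h; apply: filterS => N.
  rewrite sub0r normrN ger0_norm ?normc_ge0//; apply: le_trans.
  apply: le_trans (Re_le_normc _); rewrite cReD cReN (cRe_sum N (fun i => a i * x%:C ^+ i)) /pseries /series /= big_mkord.
  by rewrite (eq_bigr _ (fun (i : 'I_N) _ => Re_real_pow (a i) x i)).
apply/esym; apply: (@cvg_unique _ _ (pseries (fun n => complex.Im (a n)) x @ \oo)) => //.
  exact: ent_fs.
apply/cvgrPdist_le => e e0; have /cvgrPdist_le /(_ e e0) := h; apply: filterS => N.
rewrite sub0r normrN ger0_norm ?normc_ge0//; apply: le_trans.
apply: le_trans (Im_le_normc _); rewrite cImD cImN (cIm_sum N (fun i => a i * x%:C ^+ i)) /pseries /series /= big_mkord.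
by rewrite (eq_bigr _ (fun (i : 'I_N) _ => Im_real_pow (a i) x i)).
Qed.

Lemma reps_uniq F c d c' d' : reps F c d -> reps F c' d' -> c =1 c' /\ d =1 d'.
Proof.
move=> [ec ed h] [ec' ed' h']; split; apply: fs_uniq => // x; have := h x; rewrite h'; by case.
Qed.

Lemma entire_eq_real F G : entire F -> entire G -> (forall x, F x%:C = G x%:C) -> F = G.
Proof.
move=> eF eG FG; have [a [[ea eb ra] _ ca]] := entire_seriesW eF.
have [b [rb _ cb]] := entire_seriesW eG.
have ab : a = b.
  have rFb : reps F (fun n => complex.Re (b n)) (fun n => complex.Im (b n)).
    by case: rb => ? ? hb; split => // x; rewrite FG hb.
  have [h1 h2] := reps_uniq (And3 ea eb ra) rFb.
  by apply/funext => n; apply: complex_eq; [exact: h1|exact: h2].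
apply/funext => z; apply/eqP; rewrite -subr_eq0 -normc_eq0 eq_le normc_ge0 andbT.
have cv : (fun N => normc (F z - \sum_(i < N) a i * z ^+ i) + normc (G z - \sum_(i < N) b i * z ^+ i)) @ \oo --> (0 : R).
  by rewrite -[X in _ --> X](addr0 0); apply: cvgD.
rewrite -(cvg_lim _ cv)//; apply: limr_ge; first by apply/cvg_ex; exists 0.
apply: nearW => N; rewrite /= ab.
rewrite (_ : F z - G z = (F z - \sum_(i < N) b i * z ^+ i) - (G z - \sum_(i < N) b i * z ^+ i)); last by ring.
exact: le_normcB.
Qed.

(** Derivatives at x are read off the expansion at 0 of the translated function. *)
Lemma iter_diffs_eq c d x : ent c -> ent d -> (forall h, fs c (x + h) = fs d h) ->
  forall j, fs (iter j (@pseries_diffs R) c) x = j`!%:R * d j.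
Proof.
move=> ec ed cd j.
have H i h : fs (iter i (@pseries_diffs R) c) (x + h) = fs (iter i (@pseries_diffs R) d) h.
  elim: i h => [|i IH] h; first exact: cd.
  rewrite !iterS.
  have D1 : is_derive h (1 : R) (fun h => fs (iter i (@pseries_diffs R) c) (x + h)) (fs (pseries_diffs (iter i (@pseries_diffs R) c)) (x + h)).
    apply: dv_eq (dv_comp (is_derive_fs (x + h) (ent_iterd i ec)) (dvD (dvC x h) (dvI h))) _.
    by rewrite add0r mulr1.
  have D2 := is_derive_fs h (ent_iterd i ed).
  have e : (fun h => fs (iter i (@pseries_diffs R) c) (x + h)) = fs (iter i (@pseries_diffs R) d).
    by apply/funext => t; exact: IH.
  rewrite e in D1; by rewrite -(@derive_val _ _ _ _ _ _ _ D1) (@derive_val _ _ _ _ _ _ _ D2).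
by have := H j 0; rewrite addr0 fs0 (iter_diffsE (lexx (0 : R))) add0n ffactnn.
Qed.

(** A weak Stirling bound, m! <= e m (m/e)^m with m = n + 1; the induction step is (m/(m+1))^(m+1)
    <= 1/e. *)
Lemma fact_exp_bound n : n.+1`!%:R * expR (n.+1%:R : R) <= expR 1 * n.+1%:R ^+ n.+2.
Proof.
elim: n => [|n IH]; first by rewrite mul1r expr1n mulr1.
have key : expR 1 * n.+1%:R ^+ n.+2 <= n.+2%:R ^+ n.+2 :> R.
  pose q : R := n.+2%:R^-1; have n0 : 0 < n.+2%:R :> R by [].
  have q0 : 1 + - q = n.+1%:R / n.+2%:R.
    have e : n.+2%:R = n.+1%:R + 1 :> R by rewrite natr1.
    by move: n0; rewrite /q e; set m := n.+1%:R => m0; field; rewrite gt_eqF.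
  have h := expR_ge1Dx (- q); rewrite q0 in h.
  have h2 : (n.+1%:R / n.+2%:R) ^+ n.+2 <= expR (- 1) :> R.
    have -> : expR (- 1) = expR (- q) ^+ n.+2 :> R.
      by rewrite -expRM_natl /q mulrN divff// gt_eqF.
    by apply: lerXn2r; rewrite ?nnegrE ?divr_ge0 ?expR_ge0.
  rewrite expr_div_n ler_pdivrMr ?exprn_gt0// expRN in h2.
  by rewrite -ler_pdivlMl ?expR_gt0.
rewrite factS natrM -[X in _ * expR X <= _]natr1 expRD.
have -> : n.+2%:R * n.+1`!%:R * (expR n.+1%:R * expR 1) = n.+2%:R * expR 1 * (n.+1`!%:R * expR (n.+1%:R : R)) by ring.
apply: le_trans (ler_wpM2l _ IH) _; first by rewrite mulr_ge0 ?expR_ge0.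
rewrite [n.+2%:R ^+ n.+3]exprS -mulrA mulrCA.
by apply: ler_wpM2l; [exact: expR_ge0|apply: ler_wpM2l].
Qed.

(** Cauchy's estimates on a square of half-side s about the real point x: the translation leaves Im
    z alone, so the function is at most C exp(r s) there. With s = j/r and Stirling's bound the loss
    is only linear in j. *)
Lemma entire_derivs F c d r (C : R) : 0 < r -> entire F -> reps F c d ->
  (forall z, normc (F z) <= C * expR (r * `|complex.Im z|)) ->
  forall j x, `|fs (iter j (@pseries_diffs R) c) x| <= 4 * C * expR 1 * (j%:R + 1) * r ^+ j /\
              `|fs (iter j (@pseries_diffs R) d) x| <= 4 * C * expR 1 * (j%:R + 1) * r ^+ j.
Proof.
move=> r0 eF [ec ed hF] hC j x.
have C0 : 0 <= C by have := le_trans (normc_ge0 _) (hC 0); rewrite /= normr0 mulr0 expR0 mulr1.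
have eG : entire (fun z => F (x%:C + z)).
  apply: cdiff_entire => v; have [D hD] := entire_cdiff eF (x%:C + v); exists D => e e0.
  by have [dl dl0 hdl] := hD e e0; exists dl => // h; rewrite addrA; exact: hdl.
have [a [[ea eb ra] ba _]] := entire_seriesW eG.
have hc h : fs c (x + h) = fs (fun n => complex.Re (a n)) h /\ fs d (x + h) = fs (fun n => complex.Im (a n)) h.
  by have := ra h; rewrite -rmorphD /= hF => -[-> ->].
rewrite (iter_diffs_eq ec ea (fun h => (hc h).1)) (iter_diffs_eq ed eb (fun h => (hc h).2)).
suff H : j`!%:R * normc (a j) <= 4 * C * expR 1 * (j%:R + 1) * r ^+ j.
  by split; rewrite normrM normr_nat; apply: le_trans H; rewrite ler_wpM2l// ?Re_le_normc ?Im_le_normc.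
have bnd s : 0 < s -> normc (a j) * s ^+ j <= 4 * (C * expR (r * s)).
  move=> s0; apply: ba => // u _ iu; apply: le_trans (hC _) _.
  by rewrite cImD /= add0r ler_wpM2l// ler_expR ler_wpM2l// ltW.
case: j bnd => [|n] bnd.
  have h := bnd r^-1; rewrite !expr0 !mulr1 divff ?gt_eqF// in h.
  have := h ltac:(by rewrite invr_gt0); rewrite add0r fact0 mul1r mulr1.
  by rewrite !expr0 mulr1 !mulrA.
(* This half-side minimises exp(r s) / s^(n+1). It would be 0 for order 0, which was settled above
   with 1/r. *)
have s0 : 0 < n.+1%:R / r :> R by rewrite divr_gt0.
have e : r * (n.+1%:R / r) = n.+1%:R by rewrite mulrCA divff ?gt_eqF// mulr1.
have := bnd _ s0; rewrite e expr_div_n [normc _ * _]mulrA ler_pdivrMr ?exprn_gt0// => h.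
have p0 : 0 < n.+1%:R ^+ n.+1 :> R by rewrite exprn_gt0.
rewrite -(ler_pM2r p0) -[X in X <= _]mulrA.
apply: le_trans (ler_wpM2l _ h) _ => //.
have -> : n.+1`!%:R * (4 * (C * expR n.+1%:R) * r ^+ n.+1) = 4 * C * r ^+ n.+1 * (n.+1`!%:R * expR (n.+1%:R : R)) by ring.
apply: le_trans (ler_wpM2l _ (fact_exp_bound n)) _; first by rewrite !mulr_ge0 ?exprn_ge0// ltW.
have -> : 4 * C * expR 1 * (n.+1%:R + 1) * r ^+ n.+1 * n.+1%:R ^+ n.+1 = 4 * C * r ^+ n.+1 * (expR 1 * ((n.+1%:R + 1) * n.+1%:R ^+ n.+1)) by ring.
apply: ler_wpM2l; first by rewrite !mulr_ge0 ?exprn_ge0// ltW.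
apply: ler_wpM2l; first exact: expR_ge0.
by rewrite exprS ler_wpM2r ?(ltW p0)// lerDl.
Qed.

Lemma entireM F G : entire F -> entire G -> entire (fun z => F z * G z).
Proof.
move=> eF eG z; pose C : numFieldType := R[i]; pose V : normedModType C := R[i].
exact: (@derivableM C V F G z 1 (eF z) (eG z)).
Qed.

Lemma entire_id : entire (fun z : R[i] => z).
Proof.
move=> z; pose C : numFieldType := R[i]; pose V : normedModType C := R[i].
exact: (@derivable_id C V z 1).
Qed.

(** Induction on i: z F(z) has the same type and one order of decay less, and [Tbdd_shift] turns a
    bound for x f into one more power of |x| for f. *)
Lemma entire_Tbdd (k : R) i F c d r : 0 <= k -> 0 < r -> entire F -> reps F c d ->
  (forall l, (l <= i)%N -> exists C : R, forall z, normc z ^+ l * normc (F z) <= C * expR (r * `|complex.Im z|)) ->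
  Tbdd k i c r /\ Tbdd k i d r.
Proof.
move=> hk r0; elim: i F c d => [|i IH] F c d eF rF hF.
  have [C hC] := hF 0%N isT; have [ec ed _] := rF.
  have hC' z : normc (F z) <= C * expR (r * `|complex.Im z|) by have := hC z; rewrite expr0 mul1r.
  have b := entire_derivs r0 eF rF hC'.
  have C0 : 0 <= C by have := le_trans (normc_ge0 _) (hC' 0); rewrite /= normr0 mulr0 expR0 mulr1.
  have K0 : 0 <= 4 * C * expR 1 by rewrite !mulr_ge0 ?expR_ge0.
  have H r' : r < r' -> exists C' : R, 0 < C' /\ forall j x,
      `|fs (iter j (@pseries_diffs R) c) x| <= C' * r' ^+ j /\ `|fs (iter j (@pseries_diffs R) d) x| <= C' * r' ^+ j.
    move=> rr'; have [A [A0 hA]] := linear_geometric_bound 1 r0 rr'.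
    have r'0 : 0 <= r' by apply: ltW; apply: lt_trans rr'.
    exists (4 * C * expR 1 * A + 1); split=> [|j x]; first by rewrite ltr_wpDl// mulr_ge0// ltW.
    have [h1 h2] := b j x; have h3 : 4 * C * expR 1 * (j%:R + 1) * r ^+ j <= (4 * C * expR 1 * A + 1) * r' ^+ j.
      rewrite -mulrA; apply: le_trans (ler_wpM2l K0 (hA j)) _.
      by rewrite mulrA ler_wpM2r ?exprn_ge0// lerDl.
    by split; [apply: le_trans h1 h3|apply: le_trans h2 h3].
  split; apply: Tbdd_derivs => // r' /H [C' [C'0 h]]; exists C'; split=> // j x; have [] := h j x => //.
have [t1 t2] := IH F c d eF rF (fun l li => hF l (leqW li)).
have [ec ed hr] := rF.
have rz : reps (fun z => z * F z) (cshift c) (cshift d).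
  split; [exact: ent_shift|exact: ent_shift|] => x; rewrite hr !fs_shift//.
  by apply: complex_eq => /=; ring.
have [] := IH _ _ _ (entireM entire_id eF) rz.
  move=> l li; have [C hC] := hF l.+1 li; exists C => z.
  by rewrite normcM mulrA -exprSr; exact: hC.
by move=> s1 s2; split; apply: Tbdd_shift.
Qed.

End real_restriction.

(** * Complex power series and their derivatives *)

Section complex_power_series.
Context {R : realType}.
Implicit Types (a b : nat -> R[i]) (x y r : R) (z u h : R[i]) (n N : nat).
#[local] Arguments normc : simpl never.

Definition cent a := ent (fun n => normc (a n)).

Definition csum a z N := \sum_(i < N) a i * z ^+ i.

Definition cfs a z : R[i] :=
  limn (series (fun n => complex.Re (a n * z ^+ n))) +i* limn (series (fun n => complex.Im (a n * z ^+ n))).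

Lemma normc_Re_Im_cvg (f : nat -> R[i]) (l : R[i]) : (fun N => complex.Re (f N)) @ \oo --> complex.Re l ->
  (fun N => complex.Im (f N)) @ \oo --> complex.Im l -> (fun N => normc (l - f N)) @ \oo --> (0 : R).
Proof.
move=> /cvgrPdist_le h1 /cvgrPdist_le h2; apply/cvgrPdist_le => e e0.
have e2 : 0 < e / 2 by rewrite divr_gt0.
near=> N; rewrite sub0r normrN ger0_norm ?normc_ge0//.
apply: le_trans (normc_le_ReIm _) _; rewrite cReD cImD cReN cImN.
have -> : e = e / 2 + e / 2 by field.
by apply: lerD; near: N; [exact: h1|exact: h2].
Unshelve. all: by end_near. Qed.

Lemma cfs_cvg a z : cent a -> (fun N => normc (cfs a z - csum a z N)) @ \oo --> (0 : R).
Proof.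
move=> ca; have h := @ent_cvg_norm R (fun n => normc (a n)) (normc z) ca.
have hc (p : R[i] -> R) : (forall u, `|p u| <= normc u) -> cvgn (series (fun n => p (a n * z ^+ n))).
  move=> hp; apply: normed_cvg; apply: (@series_le_cvg _ _ (fun n => `|normc (a n) * normc z ^+ n|)) => // n; first exact: normr_ge0.
  by apply: le_trans (hp _) _; rewrite normcM normcX; exact: ler_norm.
apply: normc_Re_Im_cvg => /=.
  rewrite (_ : (fun N => _) = series (fun n => complex.Re (a n * z ^+ n))); first exact: hc (@Re_le_normc R).
  by apply/funext => N; rewrite /csum (cRe_sum N (fun i => a i * z ^+ i)) /series /= big_mkord.
rewrite (_ : (fun N => _) = series (fun n => complex.Im (a n * z ^+ n))); first exact: hc (@Im_le_normc R).
by apply/funext => N; rewrite /csum (cIm_sum N (fun i => a i * z ^+ i)) /series /= big_mkord.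
Qed.

Lemma normc_cvg_uniq (f : nat -> R[i]) (l l' : R[i]) : (fun N => normc (l - f N)) @ \oo --> (0 : R) ->
  (fun N => normc (l' - f N)) @ \oo --> (0 : R) -> l = l'.
Proof.
move=> h h'; apply/eqP; rewrite -subr_eq0 -normc_eq0 eq_le normc_ge0 andbT.
have cv : (fun N => normc (l - f N) + normc (l' - f N)) @ \oo --> (0 : R).
  by rewrite -[X in _ --> X](addr0 0); apply: cvgD.
rewrite -(cvg_lim _ cv)//; apply: limr_ge; first by apply/cvg_ex; exists 0.
apply: nearW => N; rewrite (_ : l - l' = (l - f N) - (l' - f N)); last by ring.
exact: le_normcB.
Qed.

Lemma cfs_uniq_lim a z (l : R[i]) : cent a -> (fun N => normc (l - csum a z N)) @ \oo --> (0 : R) -> cfs a z = l.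
Proof. by move=> ca; apply: normc_cvg_uniq; exact: cfs_cvg. Qed.

Lemma eq_cfs a b z : a =1 b -> cfs a z = cfs b z.
Proof. by move=> /funext ->. Qed.

Lemma eq_cent a b : a =1 b -> cent a -> cent b.
Proof. by move=> /funext ->. Qed.

Lemma cent_le a (c : nat -> R) : (forall n, normc (a n) <= `|c n|) -> ent c -> cent a.
Proof. by move=> h; apply: ent_le => n; rewrite ger0_norm ?normc_ge0. Qed.

Lemma centD a b : cent a -> cent b -> cent (fun n => a n + b n).
Proof.
move=> ca cb; apply: (cent_le _ (entD ca cb)) => n.
by rewrite ger0_norm ?addr_ge0 ?normc_ge0// le_normcD.
Qed.

Lemma centZ u a : cent a -> cent (fun n => u * a n).
Proof.
move=> ca; apply: (cent_le _ (entZ (normc u) ca)) => n.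
by rewrite normcM ger0_norm// mulr_ge0 ?normc_ge0.
Qed.

Lemma cent_alt a : cent a -> cent (fun n => (-1) ^+ n * a n).
Proof.
move=> ca; apply: (cent_le _ ca) => n.
by rewrite normcM normcX normcN normc1 expr1n mul1r ger0_norm ?normc_ge0.
Qed.

Lemma cent_shift a : cent a -> cent (fun n => if n is m.+1 then a m else 0).
Proof.
move=> ca; apply: (cent_le _ (ent_shift ca)) => -[|n] /=; first by rewrite normc0 normr0.
by rewrite ger0_norm ?normc_ge0.
Qed.

Lemma cent_diffs a : cent a -> cent (fun n => n.+1%:R * a n.+1).
Proof.
move=> ca; apply: (cent_le _ (ent_diffs ca)) => n.
rewrite normcM /pseries_diffs (_ : n.+1%:R = (n.+1%:R : R)%:C); last by rewrite rmorph_nat.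
by rewrite normcR ger0_norm// ger0_norm// mulr_ge0 ?normc_ge0.
Qed.

Lemma cfsD a b z : cent a -> cent b -> cfs (fun n => a n + b n) z = cfs a z + cfs b z.
Proof.
move=> ca cb; apply: cfs_uniq_lim; first exact: centD.
have cv : (fun N => normc (cfs a z - csum a z N) + normc (cfs b z - csum b z N)) @ \oo --> (0 : R).
  by rewrite -[X in _ --> X](addr0 0); apply: cvgD; exact: cfs_cvg.
apply: (squeeze_cvgr _ (cvg_cst (0 : R)) cv); apply: nearW => N; rewrite normc_ge0 /=.
apply: le_trans (le_normcD _ _); rewrite le_eqVlt; apply/orP; left; apply/eqP; congr normc.
rewrite (_ : csum _ z N = csum a z N + csum b z N); first by ring.
by rewrite /csum -big_split /=; apply: eq_bigr => i _; rewrite mulrDl.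
Qed.

Lemma cfsZ u a z : cent a -> cfs (fun n => u * a n) z = u * cfs a z.
Proof.
move=> ca; apply: cfs_uniq_lim; first exact: centZ.
have cv : (fun N => normc u * normc (cfs a z - csum a z N)) @ \oo --> (0 : R).
  by rewrite -[X in _ --> X](mulr0 (normc u)); apply: cvgM; [exact: cvg_cst|exact: cfs_cvg].
apply: (squeeze_cvgr _ (cvg_cst (0 : R)) cv); apply: nearW => N; rewrite normc_ge0 /=.
rewrite -normcM le_eqVlt; apply/orP; left; apply/eqP; congr normc; rewrite mulrBr; congr (_ - _).
by rewrite /csum mulr_sumr; apply: eq_bigr => i _; rewrite mulrA.
Qed.

Lemma cfs_alt a z : cfs (fun n => (-1) ^+ n * a n) z = cfs a (- z).
Proof.
rewrite /cfs; congr (limn (series _) +i* limn (series _)); apply/funext => n;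
  by rewrite [(- z) ^+ n]exprNn [(-1) ^+ n * a n]mulrC mulrA.
Qed.

Lemma cfs_shift a z : cent a -> cfs (fun n => if n is m.+1 then a m else 0) z = z * cfs a z.
Proof.
move=> ca; apply: cfs_uniq_lim; first exact: cent_shift.
rewrite -cvg_shiftS.
have cv : (fun N => normc z * normc (cfs a z - csum a z N)) @ \oo --> (0 : R).
  by rewrite -[X in _ --> X](mulr0 (normc z)); apply: cvgM; [exact: cvg_cst|exact: cfs_cvg].
apply: (squeeze_cvgr _ (cvg_cst (0 : R)) cv); apply: nearW => N; rewrite normc_ge0 /=.
rewrite -normcM le_eqVlt; apply/orP; left; apply/eqP; congr normc; rewrite mulrBr; congr (_ - _).
rewrite /csum big_ord_recl mul0r add0r mulr_sumr; apply: eq_bigr => i _ /=.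
by rewrite exprS mulrCA.
Qed.

Lemma cfs0 a : cfs a 0 = a 0%N.
Proof.
have e (p : R[i] -> R) : p 0 = 0 -> limn (series (fun n => p (a n * 0 ^+ n))) = p (a 0%N).
  move=> p0; apply: lim_near_cst => //; exists 1%N => // -[//|N _] /=.
  rewrite /series /= big_nat_recl// expr0 mulr1 big1 ?addr0// => i _.
  by rewrite exprS mul0r mulr0.
by rewrite /cfs !e//; case: (a 0%N).
Qed.

Lemma cent_Re a : cent a -> ent (fun n => complex.Re (a n)).
Proof. by apply: ent_le => n; rewrite [X in _ <= X]ger0_norm ?normc_ge0// Re_le_normc. Qed.

Lemma cent_Im a : cent a -> ent (fun n => complex.Im (a n)).
Proof. by apply: ent_le => n; rewrite [X in _ <= X]ger0_norm ?normc_ge0// Im_le_normc. Qed.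

Lemma cfs_real a x : cfs a x%:C = fs (fun n => complex.Re (a n)) x +i* fs (fun n => complex.Im (a n)) x.
Proof.
rewrite /cfs /fs /pseries; congr (limn (series _) +i* limn (series _)); apply/funext => n.
  exact: Re_real_pow.
exact: Im_real_pow.
Qed.

Lemma cfs_uniq0 a : cent a -> (forall x, cfs a x%:C = 0) -> forall n, a n = 0.
Proof.
move=> ca h n; have h1 x : fs (fun n => complex.Re (a n)) x = 0 by have := h x; rewrite cfs_real => -[].
have h2 x : fs (fun n => complex.Im (a n)) x = 0 by have := h x; rewrite cfs_real => -[].
have := fs_uniq0 (cent_Re ca) h1 n; have := fs_uniq0 (cent_Im ca) h2 n.
by move=> e2 e1; apply: complex_eq.
Qed.

(** The remainder is quadratic in h, with a constant that is summable in n against the coefficients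
    of an entire series. *)
Lemma pow_second_order z h r n : 1 <= r -> normc z + normc h <= r ->
  normc ((z + h) ^+ n.+1 - z ^+ n.+1 - n.+1%:R * h * z ^+ n) <= normc h ^+ 2 * (n.+1%:R ^+ 2 * r ^+ n.+1).
Proof.
move=> r1 zr; have r0 : 0 <= r by apply: le_trans r1.
have zr1 : normc z <= r by apply: le_trans zr; rewrite lerDl normc_ge0.
elim: n => [|n IH].
  rewrite !expr1 expr0 mulr1 mul1r (_ : _ - h = 0); last by ring.
  by rewrite normc0 expr1n mul1r mulr_ge0 ?sqr_ge0.
have -> : (z + h) ^+ n.+2 - z ^+ n.+2 - n.+2%:R * h * z ^+ n.+1 =
   (z + h) * ((z + h) ^+ n.+1 - z ^+ n.+1 - n.+1%:R * h * z ^+ n) + n.+1%:R * (h ^+ 2 * z ^+ n).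
  by rewrite [_ ^+ n.+2]exprS [z ^+ n.+2]exprS [z ^+ n.+1]exprS -[n.+2%:R]natr1; ring.
apply: le_trans (le_normcD _ _) _; rewrite !normcM.
have hz : normc (z + h) <= r by apply: le_trans (le_normcD _ _) zr.
have Nn : normc (n.+1%:R : R[i]) = n.+1%:R.
  by rewrite (_ : n.+1%:R = (n.+1%:R : R)%:C) ?normcR ?ger0_norm// rmorph_nat.
apply: (@le_trans _ _ (r * (normc h ^+ 2 * (n.+1%:R ^+ 2 * r ^+ n.+1)) + n.+1%:R * (normc h ^+ 2 * r ^+ n.+2))).
  apply: lerD; first by apply: ler_pM; rewrite ?normc_ge0.
  rewrite Nn ler_wpM2l// !normcX ler_wpM2l ?sqr_ge0//.
  apply: (@le_trans _ _ (r ^+ n)); first by apply: lerXn2r; rewrite ?nnegrE ?normc_ge0.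
  by rewrite ler_weXn2l// ltnW// ltnW.
rewrite -[X in _ <= _ * (X ^+ 2 * _)]natr1 [r ^+ n.+2]exprS.
have : 0 <= normc h ^+ 2 * (r * r ^+ n.+1) by rewrite mulr_ge0 ?sqr_ge0// mulr_ge0 ?exprn_ge0.
have : 0 <= n.+1%:R :> R by [].
set q := normc h ^+ 2; set p := r ^+ n.+1; set m := n.+1%:R => m0 qp.
have -> : r * (q * (m ^+ 2 * p)) + m * (q * (r * p)) = (q * (r * p)) * (m ^+ 2 + m) by ring.
have -> : q * ((m + 1) ^+ 2 * (r * p)) = (q * (r * p)) * (m + 1) ^+ 2 by ring.
by apply: ler_wpM2l => //; nra.
Qed.

Lemma cfs_cdiff a z : cent a -> cdiff (cfs a) z (cfs (fun n => n.+1%:R * a n.+1) z).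
Proof.
move=> ca; pose b n := n.+1%:R * a n.+1; have cb : cent b by exact: cent_diffs.
pose r := normc z + 1; have r1 : 1 <= r by rewrite /r lerDr normc_ge0.
have r0 : 0 <= r by apply: le_trans r1.
pose c n := (n.+1%:R : R) ^+ 2 * normc (a n.+1).
have ec : ent c.
  apply: (@eq_ent _ (fun n => n.+1%:R * pseries_diffs (fun n => normc (a n)) n)).
    by move=> n; rewrite /c /pseries_diffs; ring.
  move=> s s0; have h := ent_diffs (ent_shift (ent_diffs ca)).
  by apply: (eq_ent _ h) s s0 => n; rewrite /pseries_diffs.
pose S := fs c r * r.
have S0 : 0 <= S by rewrite mulr_ge0// fs_ge0// => n; rewrite mulr_ge0 ?sqr_ge0 ?normc_ge0.
have key h : normc h <= 1 -> normc (cfs a (z + h) - cfs a z - h * cfs b z) <= S * normc h ^+ 2.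
  move=> h1.
  have cv : (fun N => normc (cfs a (z + h) - csum a (z + h) N.+1) + normc (cfs a z - csum a z N.+1) +
     normc h * normc (cfs b z - csum b z N) + S * normc h ^+ 2) @ \oo --> S * normc h ^+ 2.
    rewrite -[X in _ --> X]add0r; apply: cvgD; last exact: cvg_cst.
    rewrite -[X in _ --> X]add0r -[X in _ --> _ + X](mulr0 (normc h)); apply: cvgD.
      rewrite -[X in _ --> X]add0r; apply: cvgD.
        by have := cfs_cvg (z + h) ca; rewrite -cvg_shiftS.
      by have := cfs_cvg z ca; rewrite -cvg_shiftS.
    by apply: cvgM; [exact: cvg_cst|exact: cfs_cvg].
  rewrite -(cvg_lim _ cv)//; apply: limr_ge; first by apply/cvg_ex; exists (S * normc h ^+ 2).
  apply: nearW => N.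
  pose X := csum a (z + h) N.+1 - csum a z N.+1 - h * csum b z N.
  have -> : cfs a (z + h) - cfs a z - h * cfs b z = (cfs a (z + h) - csum a (z + h) N.+1) -
     (cfs a z - csum a z N.+1) - h * (cfs b z - csum b z N) + X.
    rewrite /X; move: (cfs a _) (cfs a _) (cfs b _) (csum a _ _) (csum a _ _) (csum b _ _) => A B C D E G; ring.
  apply: le_trans (le_normcD _ _) _; apply: lerD.
    apply: le_trans (le_normcB _ _) _; rewrite normcM lerD2r; exact: le_normcB.
  have -> : X = \sum_(i < N) a i.+1 * ((z + h) ^+ i.+1 - z ^+ i.+1 - i.+1%:R * h * z ^+ i).
    rewrite /X /csum !big_ord_recl !expr0 opprD addrACA subrr add0r mulr_sumr -!sumrB.
    by apply: eq_bigr => i _; rewrite /b /=; ring.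
  apply: le_trans (normc_sum _ _) _.
  apply: (@le_trans _ _ (\sum_(i < N) c i * r ^+ i * (r * normc h ^+ 2))).
    apply: ler_sum => i _; rewrite normcM.
    apply: le_trans (ler_wpM2l (normc_ge0 _) (pow_second_order (r := r) i r1 _)) _.
      by rewrite /r lerD2l.
    rewrite le_eqVlt; apply/orP; left; apply/eqP; rewrite /c [r ^+ i.+1]exprS; ring.
  rewrite -mulr_suml /S -mulrA ler_wpM2r ?mulr_ge0 ?sqr_ge0 ?normc_ge0//.
  have := @psum_le_fs _ c r N ec _ r0; rewrite /pseries /series /= big_mkord; apply=> n.
  by rewrite mulr_ge0 ?sqr_ge0 ?normc_ge0.
move=> e e0; have S1 : 0 < S + 1 by rewrite ltr_wpDl.
exists (Num.min 1 (e / (S + 1))); first by rewrite lt_min ltr01 divr_gt0.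
move=> h; rewrite lt_min => /andP[h1 h2]; apply: le_trans (key h (ltW h1)) _.
rewrite expr2 mulrA ler_wpM2r ?normc_ge0//.
have := normc_ge0 h; move: h2; rewrite ltr_pdivlMr//; nra.
Qed.

Lemma cfs_entire a : cent a -> entire (cfs a).
Proof. by move=> ca; apply: cdiff_entire => z; eexists; exact: cfs_cdiff. Qed.

Lemma cfs_derive1 a z : cent a -> derive1 (cfs a) z = cfs (fun n => n.+1%:R * a n.+1) z.
Proof. by move=> ca; have /cdiffP [] := cfs_cdiff z ca. Qed.

Lemma entire_cfs F : entire F -> exists2 a, cent a & F = cfs a.
Proof.
move=> eF; have [a [[ea eb ra] ba ca]] := entire_seriesW eF.
have cc : cent a.
  apply: (cent_le _ (entD (ent_norm ea) (ent_norm eb))) => n.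
  by rewrite ger0_norm ?addr_ge0//; exact: normc_le_ReIm.
by exists a => //; apply/funext => z; apply/esym; apply: cfs_uniq_lim => //; exact: ca.
Qed.

End complex_power_series.

(** * The Dunkl kernel: series, bound, values on the line *)

Section kernel.
Context {R : realType} (k : R) (hk : 0 <= k).
Implicit Types (a b : nat -> R[i]) (x y r : R) (z u h l : R[i]) (n N : nat).
#[local] Arguments normc : simpl never.

(** The Dunkl exponential evaluated at i l z. *)
Definition kcoef l n : R[i] := ('i * l) ^+ n * (ecoef k n)%:C.

Lemma normc_kcoef l n : normc (kcoef l n) = normc l ^+ n * ecoef k n.
Proof.
rewrite /kcoef normcM normcX normcM normci mul1r normcR ger0_norm//.
by rewrite invr_ge0 ltW// gam_gt0.
Qed.

Lemma cent_kcoef l : cent (kcoef l).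
Proof.
apply: (cent_le _ (ent_dil (normc l) (ent_ecoef hk))) => n.
by rewrite normc_kcoef /cdil ler_norm.
Qed.

Lemma kcoef0 l : kcoef l 0 = 1.
Proof. by rewrite /kcoef expr0 mul1r ecoef0. Qed.

Lemma theta_kcoef l n : (theta k n.+1)%:C * kcoef l n.+1 = 'i * l * kcoef l n.
Proof.
have e : ecoef k n = theta k n.+1 * ecoef k n.+1 by rewrite -[LHS](Tc_ecoef hk).
by rewrite /kcoef e rmorphM exprS; ring.
Qed.

(** Coefficients of z (T_k f - i l f)(z): the factor z clears the quotient, so that 0 is no
    exceptional point. *)
Definition dcoef a l n : R[i] := (theta k n)%:C * a n - 'i * l * (if n is m.+1 then a m else 0).

Lemma dcoefE a l n : dcoef a l n = (if n is m.+1 then n%:R * a m.+1 else 0) + k%:C * a n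
  + (- k%:C) * ((-1) ^+ n * a n) + (- ('i * l)) * (if n is m.+1 then a m else 0).
Proof.
rewrite /dcoef /theta; case: n => [|n].
  by rewrite expr0 subrr mulr0 add0r; apply: complex_eq => /=; rewrite !(cReD, cReM, cImD, cImM, cReN, cImN) /=; ring.
rewrite rmorphD rmorphM rmorphB rmorph1 rmorphXn rmorphN1 rmorph_nat; ring.
Qed.

Lemma cfs_dcoef a l z : cent a -> cent (dcoef a l) /\
  cfs (dcoef a l) z = z * derive1 (cfs a) z + k%:C * (cfs a z - cfs a (- z)) - 'i * l * (z * cfs a z).
Proof.
move=> ca; have cd := cent_diffs ca.
pose s1 n := if n is m.+1 then m.+1%:R * a m.+1 else 0.
pose s2 n := if n is m.+1 then a m else 0.
have c1 : cent s1 by exact: (cent_shift cd).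
have c2 : cent s2 by exact: cent_shift.
have c3 := cent_alt ca.
have e : dcoef a l =1 fun n => s1 n + k%:C * a n + (- k%:C) * ((-1) ^+ n * a n) + (- ('i * l)) * s2 n.
  by case=> [|n]; rewrite dcoefE.
have c4 : cent (fun n => s1 n + k%:C * a n) by apply: centD => //; exact: centZ.
have c5 : cent (fun n => s1 n + k%:C * a n + (- k%:C) * ((-1) ^+ n * a n)) by apply: centD => //; exact: centZ.
split.
  by apply: (eq_cent (fun n => esym (e n))); apply: centD => //; exact: centZ.
rewrite (eq_cfs _ e) cfsD//; last exact: centZ.
rewrite cfsD//; last exact: centZ.
rewrite cfsD//; last exact: centZ.
rewrite !cfsZ// cfs_alt (cfs_shift z ca) (cfs_shift z cd) cfs_derive1//.
by move: (cfs a z) (cfs a (- z)) (cfs _ z) => A B C; ring.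
Qed.

Lemma dunkl_eigen a l : cent a ->
  (forall z, dunkl_op k (cfs a) z = 'i * l * cfs a z) <-> (forall n, dcoef a l n = 0).
Proof.
move=> ca; split=> H.
  have [cd _] := cfs_dcoef l 0 ca; apply: cfs_uniq0 => // x.
  have [_ ->] := cfs_dcoef l x%:C ca; have := H x%:C; rewrite /dunkl_op.
  have m0 : cfs a (- 0) = cfs a 0 by rewrite oppr0.
  case: eqVneq => [x0|x0] e.
    by rewrite x0 m0; move: (cfs a 0) (derive1 _ _) => A D; ring.
  rewrite mulrCA -e; set D := derive1 _ _; set A := cfs a _; set B := cfs a _; field; exact: x0.
move=> z; have [cd e] := cfs_dcoef l z ca.
have z0 : cfs (dcoef a l) z = 0.
  by rewrite (eq_cfs _ H); apply: cfs_uniq_lim; [exact: (eq_cent H cd)|rewrite (_ : (fun N => _) = fun=> 0); [exact: cvg_cst|apply/funext => N; rewrite /csum big1 ?subrr ?normc0// => i _; rewrite mul0r]].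
(* At z = 0 the equation multiplied by z says nothing; the value (1 + 2k) f'(0) of the operator is
   read from the coefficient n = 1 instead. *)
rewrite e in z0; rewrite /dunkl_op; case: eqVneq => [->|zn0].
  rewrite cfs_derive1// !cfs0 mul1r.
  have := H 1%N; rewrite /dcoef /theta expr1 opprK => /eqP; rewrite subr_eq0 => /eqP <-.
  by rewrite rmorphD rmorphM rmorphD rmorph1; ring.
apply: (mulfI zn0); apply/eqP; rewrite -subr_eq0 -z0.
by apply/eqP; set D := derive1 _ _; set A := cfs a _; set B := cfs a _; field; exact: zn0.
Qed.

(** The eigenvalue equation amounts to theta_(n+1) a_(n+1) = i l a_n, which yields existence and
    uniqueness together and so determines the choice of [xget]. *)
Lemma dunkl_kernelE l : dunkl_kernel k l = cfs (kcoef l).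
Proof.
rewrite /dunkl_kernel; case: xgetP => [psi _ [ep Tp p0]|/(_ (cfs (kcoef l)))]; last first.
  case; split; first exact: cfs_entire (cent_kcoef l).
    apply/(dunkl_eigen l (cent_kcoef l)) => n; rewrite /dcoef; case: n => [|n].
      by rewrite theta0 mul0r mulr0 subrr.
    by rewrite theta_kcoef subrr.
  by rewrite cfs0 kcoef0.
have [a ca pa] := entire_cfs ep; rewrite pa in Tp p0 *.
have H := (dunkl_eigen l ca).1 Tp; rewrite cfs0 in p0.
apply/funext => z; apply: eq_cfs => n; elim: n => [|n IH]; first by rewrite p0 kcoef0.
have t0 : (theta k n.+1)%:C != 0 :> R[i] by rewrite fmorph_eq0 theta_neq0.
apply: (mulfI t0); rewrite theta_kcoef -IH; apply/eqP.
by rewrite -subr_eq0; apply/eqP; exact: H.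
Qed.

(** The energy inequality for the eigenvalue i l, whose real part is -Im l. *)
Lemma kernel_bound l x : normc (cfs (kcoef l) x%:C) <= 2 * expR (`|complex.Im l| * `|x|).
Proof.
have ca := cent_kcoef l; have ec := cent_Re ca; have ed := cent_Im ca.
have h1 n : Tc k (fun n => complex.Re (kcoef l n)) n = - complex.Im l * complex.Re (kcoef l n) - complex.Re l * complex.Im (kcoef l n).
  have /(congr1 (@complex.Re R)) := theta_kcoef l n; rewrite /Tc !(cReM, cImM) /=; lra.
have h2 n : Tc k (fun n => complex.Im (kcoef l n)) n = complex.Re l * complex.Re (kcoef l n) + - complex.Im l * complex.Im (kcoef l n).
  have /(congr1 (@complex.Im R)) := theta_kcoef l n; rewrite /Tc !(cReM, cImM) /=; lra.
have := energy_fs hk ec ed h1 h2 x; rewrite kcoef0 /= expr1n expr0n addr0 mulr1 normrN => h.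
rewrite cfs_real -ler_sqr ?nnegrE ?normc_ge0 ?mulr_ge0 ?expR_ge0// sqr_normc2 /=.
apply: le_trans h _; rewrite exprMn -expRM_natl mulrA.
rewrite ler_wpM2r ?expR_ge0// expr2; lra.
Qed.

(** For k = 0 this writes exp(-it) through cos t + sin t and cos t - sin t. In general both sides
    satisfy the recurrence of the kernel, as T_k exchanges cas(lam x) and cas(-lam x) up to the
    factor lam and a sign. *)
Lemma kernel_real (lam x : R) : cfs (kcoef (- lam%:C)) x%:C =
  ((1 - 'i) * (cas k (lam * x))%:C + (1 + 'i) * (cas k (- (lam * x)))%:C) / 2%:R.
Proof.
have ik := ent_kap hk; have ed := ent_dil lam ik; have ea := ent_alt ed.
rewrite -[cas k (- _)]fs_alt -[cas k _]fs_dil -[fs (calt _) _]fs_dil cfs_real.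
have -> : fs (cdil lam (calt (kap k))) x = fs (calt (cdil lam (kap k))) x.
  by apply: eq_fs => n; rewrite /cdil /calt mulrCA.
have e n : kcoef (- lam%:C) n = ((1 - 'i) * (cdil lam (kap k) n)%:C + (1 + 'i) * (calt (cdil lam (kap k)) n)%:C) / 2%:R.
  have t2 : (2%:R : R[i]) != 0 by rewrite pnatr_eq0.
  elim: n => [|n IH].
    by rewrite kcoef0 /calt /cdil !expr0 !mul1r kap0; field.
  have t0 : (theta k n.+1)%:C != 0 :> R[i] by rewrite fmorph_eq0 theta_neq0.
  apply: (mulfI t0); rewrite theta_kcoef IH.
  have E : (theta k n.+1)%:C * (cdil lam (kap k) n.+1)%:C = lam%:C * (calt (cdil lam (kap k)) n)%:C :> R[i].
    rewrite -!rmorphM; congr (_%:C); rewrite /cdil /calt exprS.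
    have -> : theta k n.+1 * (lam * lam ^+ n * kap k n.+1) = lam * lam ^+ n * (theta k n.+1 * kap k n.+1) by ring.
    by rewrite kapS//; ring.
  have E2 : (theta k n.+1)%:C * (calt (cdil lam (kap k)) n.+1)%:C = - (lam%:C * (cdil lam (kap k) n)%:C) :> R[i].
    rewrite -!rmorphM -rmorphN; congr (_%:C); rewrite /cdil /calt !exprS.
    have -> : theta k n.+1 * (-1 * (-1) ^+ n * (lam * lam ^+ n * kap k n.+1)) =
      - (-1) ^+ n * lam * lam ^+ n * (theta k n.+1 * kap k n.+1) by ring.
    by rewrite kapS//; case: (@sgnP R n) => ->; ring.
  transitivity (((1 - 'i) * ((theta k n.+1)%:C * (cdil lam (kap k) n.+1)%:C) + (1 + 'i) * ((theta k n.+1)%:C * (calt (cdil lam (kap k)) n.+1)%:C)) / 2%:R); last first.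
    by move: ((theta k n.+1)%:C) ((cdil lam (kap k) n.+1)%:C) ((calt _ n.+1)%:C) => A B C; ring.
  rewrite E E2; move: ((cdil lam (kap k) n)%:C) ((calt (cdil lam (kap k)) n)%:C) (lam%:C) => A B L.
  have i2 : ('i : R[i]) * 'i = -1 by rewrite -expr2 sqr_i.
  have -> : 'i * - L * (((1 - 'i) * A + (1 + 'i) * B) / 2%:R) = L * ((- 'i + 'i * 'i) * A + (- 'i - 'i * 'i) * B) / 2%:R by ring.
  by rewrite i2; ring.
have eR n : complex.Re (kcoef (- lam%:C) n) = (cdil lam (kap k) n + calt (cdil lam (kap k)) n) / 2.
  rewrite e (_ : 2%:R^-1 = (2^-1)%:C :> R[i]); last by rewrite fmorphV rmorph_nat.
  by rewrite !(cReM, cImM, cReD, cImD, cReN, cImN) /=; ring.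
have eI n : complex.Im (kcoef (- lam%:C) n) = (calt (cdil lam (kap k)) n - cdil lam (kap k) n) / 2.
  rewrite e (_ : 2%:R^-1 = (2^-1)%:C :> R[i]); last by rewrite fmorphV rmorph_nat.
  by rewrite !(cReM, cImM, cReD, cImD, cReN, cImN) /=; ring.
rewrite (eq_fs _ eR) (eq_fs _ eI).
rewrite (@eq_fs _ _ (fun n => 2^-1 * (cdil lam (kap k) n + calt (cdil lam (kap k)) n))); last by move=> n; rewrite mulrC.
rewrite (@eq_fs _ (fun n => (calt (cdil lam (kap k)) n - _) / 2) (fun n => 2^-1 * (calt (cdil lam (kap k)) n - cdil lam (kap k) n))); last by move=> n; rewrite mulrC.
rewrite fsZ; last exact: entD.
rewrite fsD// fsZ; last exact: entB.
rewrite fsB//; set A := fs _ x; set B := fs _ x.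
rewrite (_ : 2%:R^-1 = (2^-1)%:C :> R[i]); last by rewrite fmorphV rmorph_nat.
by apply: complex_eq; rewrite !(cReM, cImM, cReD, cImD, cReN, cImN) /=; ring.
Qed.

End kernel.

(** * Transforms of compactly supported functions *)

Section forward.
Context {R : realType} (k r : R) (hk : 0 <= k) (hr : 0 < r).
Local Notation mu := (dunkl_measure k).
Implicit Types (u v : R -> R) (x y s : R) (l z : R[i]).
#[local] Arguments normc : simpl never.

(** Vanishing is imposed at every point outside [-r, r], so that supports can be used pointwise;
    [cut] provides such representatives. *)
Definition L2r u := [/\ measurable_fun [set: measurableTypeR R] u, ibl mu (fun x => u x ^+ 2) &
  forall x, r < `|x| -> u x = 0].

Lemma ibl_indic_itv s : ibl mu (fun x => \1_([set` (`[- s, s])%R] : set R) x).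
Proof.
have mi : measurable ([set` (`[- s, s])%R] : set (measurableTypeR R)) by exact: measurable_itv.
apply/integrableP; split; first by apply/measurable_EFinP; exact: measurable_indic.
under eq_integral do rewrite /= ger0_norm//.
rewrite integral_indic// setIT; exact: dunkl_measure_itv_lty.
Qed.

Lemma indic_itvE s x : \1_([set` (`[- s, s])%R] : set R) x = (if `|x| <= s then 1 else 0 : R).
Proof. by rewrite indicE mem_setE in_itv /= -ler_norml; case: ifP. Qed.

Lemma L2r_ibl u : L2r u -> ibl mu u.
Proof.
move=> [mu_ u2 u0]; apply: (ibl_le mu_ (iblD (ibl_indic_itv r) u2)) => x.
rewrite indic_itvE; have [xr|xr] := leP `|x| r; last by rewrite u0// normr0 add0r sqr_ge0.
by rewrite -(real_normK (num_real (u x))); nra.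
Qed.

Lemma L2r_mul u (p : R -> R) (B : R) : L2r u -> continuous p -> (forall x, `|x| <= r -> `|p x| <= B) ->
  ibl mu (fun x => u x * p x) /\ `|\int[mu]_x (u x * p x)| <= B * \int[mu]_x `|u x|.
Proof.
move=> Lu cp hp; have iu := L2r_ibl Lu; have [mu_ _ u0] := Lu.
have b x : `|u x * p x| <= B * `|u x|.
  have [xr|xr] := leP `|x| r; last by rewrite u0// mul0r normr0 mulr0.
  by rewrite normrM mulrC ler_wpM2r// hp.
have i : ibl mu (fun x => u x * p x).
  apply: (ibl_le _ (iblZ B (ibl_norm iu)) b).
  by apply: measurable_funM => //; exact: continuous_measurable_fun.
by split=> //; rewrite -rintZ; [apply: rint_norm_le => //; apply: iblZ|]; exact: ibl_norm.
Qed.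

Definition kre l x := fs (fun n => complex.Re (kcoef k (- l) n)) x.
Definition kim l x := fs (fun n => complex.Im (kcoef k (- l) n)) x.

Lemma continuous_kre l : continuous (kre l).
Proof. by apply: continuous_fs; apply: cent_Re; exact: cent_kcoef. Qed.

Lemma continuous_kim l : continuous (kim l).
Proof. by apply: continuous_fs; apply: cent_Im; exact: cent_kcoef. Qed.

Lemma kre_kim_bound l x : `|x| <= r ->
  `|kre l x| <= 2 * expR (r * `|complex.Im l|) /\ `|kim l x| <= 2 * expR (r * `|complex.Im l|).
Proof.
move=> xr; have := kernel_bound hk (- l) x; rewrite cfs_real -/(kre l x) -/(kim l x) cImN normrN => h.
have h2 : 2 * expR (`|complex.Im l| * `|x|) <= 2 * expR (r * `|complex.Im l|).
  by rewrite ler_wpM2l// ler_expR mulrC ler_wpM2r.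
split; apply: le_trans (le_trans h h2).
  exact: (Re_le_normc (kre l x +i* kim l x)).
exact: (Im_le_normc (kre l x +i* kim l x)).
Qed.

(* The transform of u + i v, by real integrals. *)
Definition trans u v l : R[i] := (dunkl_const k)^-1%:C *
  ((\int[mu]_x (u x * kre l x) - \int[mu]_x (v x * kim l x)) +i*
   (\int[mu]_x (u x * kim l x) + \int[mu]_x (v x * kre l x))).

Lemma dunkl_transformE (f : R -> R[i]) l : L2r (fun x => complex.Re (f x)) -> L2r (fun x => complex.Im (f x)) ->
  dunkl_transform k f l = trans (fun x => complex.Re (f x)) (fun x => complex.Im (f x)) l.
Proof.
move=> Lu Lv; rewrite /dunkl_transform /trans; congr (_ * _).
have b1 x (xr : `|x| <= r) := (kre_kim_bound l xr).1; have b2 x (xr : `|x| <= r) := (kre_kim_bound l xr).2.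
have [i1 _] := L2r_mul Lu (continuous_kre (l := l)) b1.
have [i2 _] := L2r_mul Lu (continuous_kim (l := l)) b2.
have [i3 _] := L2r_mul Lv (continuous_kre (l := l)) b1.
have [i4 _] := L2r_mul Lv (continuous_kim (l := l)) b2.
rewrite /Cintegral -rintB// -rintD//; congr (_ +i* _); apply: rint_eq => x.
  by rewrite dunkl_kernelE// cfs_real cReM.
by rewrite dunkl_kernelE// cfs_real cImM.
Qed.

Definition moment u n : R := \int[mu]_x (x ^+ n * u x).

Lemma moment_bound u n : L2r u -> ibl mu (fun x => x ^+ n * u x) /\ `|moment u n| <= r ^+ n * \int[mu]_x `|u x|.
Proof.
move=> Lu; have cp : continuous (fun x : R => x ^+ n) by exact: ctX ctI.
have [|i b] := L2r_mul (B := r ^+ n) Lu cp.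
  by move=> x xr; rewrite normrX; apply: lerXn2r => //; rewrite nnegrE ltW.
have e : (fun x => u x * x ^+ n) =1 (fun x => x ^+ n * u x) by move=> x; rewrite mulrC.
by split; [exact: ibl_eq i|rewrite /moment -(rint_eq mu e)].
Qed.

Lemma moment_series u (c : nat -> R) : L2r u -> ent c ->
  series (fun n => c n * moment u n) @ \oo --> \int[mu]_x (u x * fs c x).
Proof.
move=> Lu ec; have [mu_ _ u0] := Lu.
have [||_ cv] := @rint_fs _ mu u c ec mu_; last exact: cv.
- pose B := fs (fun n => `|c n|) r.
  apply: (ibl_le _ (iblZ B (ibl_norm (L2r_ibl Lu)))) => [|x].
    apply: measurable_funM; first exact: measurableT_comp.
    by apply: (measurableT_comp (measurable_fs (ent_norm ec))); exact: normr_measurable.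
  have [rx|xr] := ltP r `|x|; first by rewrite u0// normr0 mul0r normr0 mulr0.
  rewrite normrM normr_id mulrC ler_wpM2r// ger0_norm; last by apply: fs_ge0 => //; exact: ent_norm.
  have := fs_norm_mono (x := x) (y := r) ec; rewrite (gtr0_norm hr); exact.
- by move=> n; have [] := moment_bound n Lu.
Qed.

(** Taylor coefficients of the transform of u + i v at 0, from the series of the kernel under the
    integral. *)
Definition tcoef u v n : R[i] := (dunkl_const k)^-1%:C * ((- 'i) ^+ n * (ecoef k n)%:C * (moment u n +i* moment v n)).

Lemma cent_tcoef u v : L2r u -> L2r v -> cent (tcoef u v).
Proof.
move=> Lu Lv; pose A := \int[mu]_x `|u x| + \int[mu]_x `|v x|.
pose C := (dunkl_const k)^-1; have C0 : 0 <= C by rewrite invr_ge0 ltW// dunkl_const_gt0.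
apply: (cent_le _ (entZ (C * A) (ent_dil r (ent_ecoef hk)))) => n.
have A0 : 0 <= A by rewrite addr_ge0// rint_ge0.
have e0 : 0 <= ecoef k n by rewrite invr_ge0 ltW// gam_gt0.
rewrite !normcM normcX normcN normci expr1n mul1r !normcR (ger0_norm C0) (ger0_norm e0).
rewrite ger0_norm; last by rewrite !mulr_ge0 ?exprn_ge0// ltW.
rewrite /cdil -[C * A * _]mulrA ler_wpM2l//.
rewrite (_ : A * _ = ecoef k n * (r ^+ n * A)); last by ring.
rewrite ler_wpM2l//; apply: le_trans (normc_le_ReIm _) _ => /=; rewrite /A mulrDr.
apply: lerD; by have [] := moment_bound n Lu; have [] := moment_bound n Lv.
Qed.

Lemma transE u v l : L2r u -> L2r v -> trans u v l = cfs (tcoef u v) l.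
Proof.
move=> Lu Lv; apply/esym; apply: cfs_uniq_lim; first exact: cent_tcoef.
set a := fun n => complex.Re (kcoef k (- l) n); set b := fun n => complex.Im (kcoef k (- l) n).
have ca := cent_kcoef hk (- l); have ea : ent a := cent_Re ca; have eb : ent b := cent_Im ca.
have h1 : series (fun n => a n * moment u n) @ \oo --> \int[mu]_x (u x * kre l x) := moment_series Lu ea.
have h2 : series (fun n => b n * moment v n) @ \oo --> \int[mu]_x (v x * kim l x) := moment_series Lv eb.
have h3 : series (fun n => b n * moment u n) @ \oo --> \int[mu]_x (u x * kim l x) := moment_series Lu eb.
have h4 : series (fun n => a n * moment v n) @ \oo --> \int[mu]_x (v x * kre l x) := moment_series Lv ea.
have e n : tcoef u v n * l ^+ n = (dunkl_const k)^-1%:C * (kcoef k (- l) n * (moment u n +i* moment v n)).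
  rewrite /tcoef /kcoef mulrN -mulNr exprMn; ring.
have E N : csum (tcoef u v) l N = (dunkl_const k)^-1%:C *
   ((series (fun n => a n * moment u n) N - series (fun n => b n * moment v n) N) +i*
    (series (fun n => b n * moment u n) N + series (fun n => a n * moment v n) N)).
  rewrite /csum (eq_bigr _ (fun (i : 'I_N) _ => e i)) -mulr_sumr; congr (_ * _).
  rewrite /series /= !big_mkord; apply: complex_eq.
    rewrite (cRe_sum N (fun i => kcoef k (- l) i * (moment u i +i* moment v i))) /= -sumrB.
    by apply: eq_bigr => i _; rewrite cReM.
  rewrite (cIm_sum N (fun i => kcoef k (- l) i * (moment u i +i* moment v i))) /= -big_split /=.
  by apply: eq_bigr => i _; rewrite cImM addrC.
set T := trans u v l.
apply: (@normc_Re_Im_cvg _ (csum (tcoef u v) l)).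
  rewrite (_ : (fun N => _) = (fun N => (dunkl_const k)^-1 * (series (fun n => a n * moment u n) N - series (fun n => b n * moment v n) N))).
    rewrite /T /trans cReM /= mul0r subr0; apply: cvgM; first exact: cvg_cst.
    exact: (cvgB h1 h2).
  by apply/funext => N; rewrite E cReM /= mul0r subr0.
rewrite (_ : (fun N => _) = (fun N => (dunkl_const k)^-1 * (series (fun n => b n * moment u n) N + series (fun n => a n * moment v n) N))).
  rewrite /T /trans cImM /= mul0r addr0; apply: cvgM; first exact: cvg_cst.
  exact: (cvgD h3 h4).
by apply/funext => N; rewrite E cImM /= mul0r addr0.
Qed.

Lemma trans_entire u v : L2r u -> L2r v -> entire (trans u v).
Proof.
move=> Lu Lv; rewrite (_ : trans u v = cfs (tcoef u v)); last by apply/funext => l; exact: transE.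
by apply: cfs_entire; exact: cent_tcoef.
Qed.

Lemma trans_bound u v : L2r u -> L2r v -> exists2 C : R, 0 < C &
  forall l, normc (trans u v l) <= C * expR (r * `|complex.Im l|).
Proof.
move=> Lu Lv; pose A := \int[mu]_x `|u x| + \int[mu]_x `|v x|.
have A0 : 0 <= A by rewrite addr_ge0// rint_ge0.
pose C := (dunkl_const k)^-1; have C0 : 0 < C by rewrite invr_gt0 dunkl_const_gt0.
exists (C * (4 * A + 1)); first by rewrite mulr_gt0// ltr_wpDl// mulr_ge0.
move=> l; rewrite /trans normcM normcR gtr0_norm// -mulrA ler_wpM2l ?(ltW C0)//.
set E := expR _; have E0 : 0 <= E by exact: expR_ge0.
have b1 x (xr : `|x| <= r) := (kre_kim_bound l xr).1; have b2 x (xr : `|x| <= r) := (kre_kim_bound l xr).2.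
have [_ i1] := L2r_mul Lu (continuous_kre (l := l)) b1.
have [_ i2] := L2r_mul Lu (continuous_kim (l := l)) b2.
have [_ i3] := L2r_mul Lv (continuous_kre (l := l)) b1.
have [_ i4] := L2r_mul Lv (continuous_kim (l := l)) b2.
apply: le_trans (normc_le_ReIm _) _ => /=.
apply: le_trans (lerD (ler_normB _ _) (ler_normD _ _)) _.
apply: le_trans (lerD (lerD i1 i4) (lerD i2 i3)) _; rewrite -/E /A.
move: (\int[mu]_x `|u x|) (\int[mu]_x `|v x|) => p q; lra.
Qed.

Lemma trans_real u v (y : R) : L2r u -> L2r v -> trans u v y%:C = (dunkl_const k)^-1%:C *
  (((1 - 'i) * (hartley k u y +i* hartley k v y) + (1 + 'i) * (hartley k u (- y) +i* hartley k v (- y))) / 2%:R).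
Proof.
move=> Lu Lv; rewrite /trans; congr (_ * _).
have iu := L2r_ibl Lu; have iv := L2r_ibl Lv.
have t2 : (2%:R^-1 : R[i]) = (2^-1)%:C by rewrite fmorphV rmorph_nat.
have K x : kre y%:C x = 2^-1 * (cas k (x * y) + cas k (x * - y)) /\ kim y%:C x = 2^-1 * (cas k (x * - y) - cas k (x * y)).
  have := kernel_real hk y x; rewrite cfs_real -/(kre _ x) -/(kim _ x) t2 mulrN [y * x]mulrC => e.
  have := congr1 (@complex.Re R) e; have := congr1 (@complex.Im R) e.
  by rewrite !(cReM, cImM, cReD, cImD, cReN, cImN) /= => -> ->; split; ring.
have H1 f : ibl mu f -> \int[mu]_x (f x * kre y%:C x) = 2^-1 * (hartley k f y + hartley k f (- y)).
  move=> fi; rewrite /hartley -rintD ?ibl_cas// -rintZ; last by apply: iblD; exact: ibl_cas.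
  by apply: rint_eq => x; rewrite (K x).1; ring.
have H2 f : ibl mu f -> \int[mu]_x (f x * kim y%:C x) = 2^-1 * (hartley k f (- y) - hartley k f y).
  move=> fi; rewrite /hartley -rintB ?ibl_cas// -rintZ; last by apply: iblB; exact: ibl_cas.
  by apply: rint_eq => x; rewrite (K x).2; ring.
rewrite (H1 u iu) (H1 v iv) (H2 u iu) (H2 v iv) t2.
move: (hartley k u y) (hartley k v y) (hartley k u (- y)) (hartley k v (- y)) => a b c d.
by apply: complex_eq; rewrite !(cReM, cImM, cReD, cImD, cReN, cImN) /=; ring.
Qed.

Lemma sqr_ibl_lin (f g : R -> R) (a b : R) : measurable_fun [set: measurableTypeR R] f ->
  measurable_fun [set: measurableTypeR R] g ->
  ibl mu (fun x => f x ^+ 2) -> ibl mu (fun x => g x ^+ 2) -> ibl mu (fun x => (a * f x + b * g x) ^+ 2).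
Proof.
move=> mf mg f2 g2.
apply: (ibl_le _ (iblD (iblZ (2 * a ^+ 2) f2) (iblZ (2 * b ^+ 2) g2))) => [|x].
  by apply: measurable_funX; apply: measurable_funD; exact: measurable_funM.
rewrite ger0_norm ?sqr_ge0//; have := sqr_ge0 (a * f x - b * g x).
by set p := f x; set q := g x; lra.
Qed.

(** On the real line the transform is a linear combination of the values of [hartley] for u and v at
    y and -y, to each of which [bessel] applies. *)
Lemma trans_sqr_ibl u v : L2r u -> L2r v ->
  [/\ measurable_fun [set: measurableTypeR R] (fun y => complex.Re (trans u v y%:C)),
      measurable_fun [set: measurableTypeR R] (fun y => complex.Im (trans u v y%:C)),
      ibl mu (fun y => complex.Re (trans u v y%:C) ^+ 2) & ibl mu (fun y => complex.Im (trans u v y%:C) ^+ 2)].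
Proof.
move=> Lu Lv; have iu := L2r_ibl Lu; have iv := L2r_ibl Lv.
have [_ u2 _] := Lu; have [_ v2 _] := Lv.
pose c := (dunkl_const k)^-1 / 2.
pose h1 := hartley k u; pose h2 := hartley k v.
have m1 : measurable_fun [set: measurableTypeR R] h1 by exact: measurable_hartley.
have m2 : measurable_fun [set: measurableTypeR R] h2 by exact: measurable_hartley.
have m1' := mfun_opp m1; have m2' := mfun_opp m2.
have [i1 _] := bessel hk iu u2; have [i2 _] := bessel hk iv v2.
have i1' := ibl_dunklN i1; have i2' := ibl_dunklN i2.
have t2 : (2%:R^-1 : R[i]) = (2^-1)%:C by rewrite fmorphV rmorph_nat.
pose f1 y := 1 * h1 y + 1 * h2 y; pose f2 y := 1 * h1 (- y) + (-1) * h2 (- y).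
pose f3 y := 1 * h1 (- y) + 1 * h2 (- y); pose f4 y := 1 * h2 y + (-1) * h1 y.
have E1 y : complex.Re (trans u v y%:C) = c * f1 y + c * f2 y.
  by rewrite (trans_real y Lu Lv) t2 /f1 /f2 /h1 /h2 /c; move: (hartley k u y) (hartley k v y) (hartley k u (- y)) (hartley k v (- y)) (dunkl_const k)^-1 => p q p' q' C; rewrite !(cReM, cImM, cReD, cImD, cReN, cImN) /=; ring.
have E2 y : complex.Im (trans u v y%:C) = c * f3 y + c * f4 y.
  by rewrite (trans_real y Lu Lv) t2 /f3 /f4 /h1 /h2 /c; move: (hartley k u y) (hartley k v y) (hartley k u (- y)) (hartley k v (- y)) (dunkl_const k)^-1 => p q p' q' C; rewrite !(cReM, cImM, cReD, cImD, cReN, cImN) /=; ring.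
have ml (f g : R -> R) a b : measurable_fun [set: measurableTypeR R] f ->
  measurable_fun [set: measurableTypeR R] g -> measurable_fun [set: measurableTypeR R] (fun x => a * f x + b * g x).
  by move=> mf mg; apply: measurable_funD; exact: measurable_funM.
have -> : (fun y => complex.Re (trans u v y%:C)) = (fun y => c * f1 y + c * f2 y) by apply/funext.
have -> : (fun y => complex.Im (trans u v y%:C)) = (fun y => c * f3 y + c * f4 y) by apply/funext.
have -> : (fun y => complex.Re (trans u v y%:C) ^+ 2) = (fun y => (c * f1 y + c * f2 y) ^+ 2) by apply/funext => y; rewrite E1.
have -> : (fun y => complex.Im (trans u v y%:C) ^+ 2) = (fun y => (c * f3 y + c * f4 y) ^+ 2) by apply/funext => y; rewrite E2.
have n1 := ml _ _ 1 1 m1 m2; have n2 := ml _ _ 1 (-1) m1' m2'.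
have n3 := ml _ _ 1 1 m1' m2'; have n4 := ml _ _ 1 (-1) m2 m1.
have s1 := @sqr_ibl_lin h1 h2 1 1 m1 m2 i1 i2.
have s2 := @sqr_ibl_lin (fun y => h1 (- y)) (fun y => h2 (- y)) 1 (-1) m1' m2' i1' i2'.
have s3 := @sqr_ibl_lin (fun y => h1 (- y)) (fun y => h2 (- y)) 1 1 m1' m2' i1' i2'.
have s4 := @sqr_ibl_lin h2 h1 1 (-1) m2 m1 i2 i1.
split; [exact: (ml f1 f2 c c n1 n2)|exact: (ml f3 f4 c c n3 n4)| |].
  exact: (@sqr_ibl_lin f1 f2 c c n1 n2 s1 s2).
exact: (@sqr_ibl_lin f3 f4 c c n3 n4 s3 s4).
Qed.

End forward.

(** * Injectivity *)

Section moment_uniqueness.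
Context {R : realType}.
Local Notation leb := (@lebesgue_measure R).
Implicit Types (W : R -> R) (x a q s : R).

Lemma bernoulli_sub s N : 0 <= s -> s <= 1 -> 1 - N%:R * s <= (1 - s) ^+ N.
Proof.
move=> s0 s1; elim: N => [|N IH]; first by rewrite mul0r subr0 expr0.
rewrite exprS; apply: le_trans (ler_wpM2l _ IH); last by lra.
rewrite -natr1; have : 0 <= N%:R * (s * s) by rewrite !mulr_ge0.
by set m := N%:R; nra.
Qed.

Lemma bernoulli_add s N : 0 <= s -> 1 + N%:R * s <= (1 + s) ^+ N.
Proof.
move=> s0; elim: N => [|N IH]; first by rewrite mul0r addr0 expr0.
rewrite exprS; apply: le_trans (ler_wpM2l _ IH); last by lra.
rewrite -natr1; have : 0 <= N%:R * (s * s) by rewrite !mulr_ge0.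
by set m := N%:R; nra.
Qed.

(* The polynomials (1 - q^n)^(2^n) approximate the indicator of [q < 1/2]: their
   integrals against a function with zero moments vanish. *)
Lemma step_poly_bound q n : 0 <= q -> q <= 1 -> `|(1 - q ^+ n) ^+ (2 ^ n)| <= 1.
Proof.
move=> q0 q1; have h : 0 <= 1 - q ^+ n <= 1.
  by rewrite subr_ge0 exprn_ile1// lerBlDr lerDl exprn_ge0.
by case/andP: h => h0 h1; rewrite ger0_norm ?exprn_ge0// exprn_ile1.
Qed.

Lemma step_poly_cvg1 q : 0 <= q -> q < 1 / 2 -> (fun n => (1 - q ^+ n) ^+ (2 ^ n)) @ \oo --> (1 : R).
Proof.
move=> q0 q1; have q2 : `|2 * q| < 1 by rewrite ger0_norm; lra.
have cv : (fun n => 1 - (2 * q) ^+ n) @ \oo --> (1 : R).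
  by rewrite -[X in _ --> X]subr0; apply: cvgB; [exact: cvg_cst|exact: cvg_expr].
apply: (squeeze_cvgr _ cv (cvg_cst (1 : R))); apply: nearW => n; apply/andP; split.
  rewrite exprMn -natrX; apply: bernoulli_sub; first exact: exprn_ge0.
  by rewrite exprn_ile1//; lra.
by apply: le_trans (ler_norm _) (step_poly_bound n q0 _); lra.
Qed.

(** With N = 2^n and s = q^n: (1 - s)^N (1 + s)^N <= 1, while Bernoulli gives (1 + s)^N >= N s =
    (2q)^n, which tends to infinity. *)
Lemma step_poly_cvg0 q : 1 / 2 < q -> q <= 1 -> (fun n => (1 - q ^+ n) ^+ (2 ^ n)) @ \oo --> (0 : R).
Proof.
move=> q0 q1; have q2 : `|(2 * q)^-1| < 1.
  by rewrite ger0_norm ?invr_ge0; [rewrite invf_lt1; lra|lra].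
apply: (squeeze_cvgr _ (cvg_cst (0 : R)) (cvg_expr q2)); apply: nearW => n.
have s0 : 0 <= q ^+ n by rewrite exprn_ge0; lra.
have s1 : q ^+ n <= 1 by rewrite exprn_ile1//; lra.
have h0 : 0 <= (1 - q ^+ n) ^+ (2 ^ n) by rewrite exprn_ge0// subr_ge0.
rewrite h0 /= exprVn -[leRHS]mul1r ler_pdivlMr; last by rewrite exprn_gt0//; lra.
have h := bernoulli_add (2 ^ n) s0.
apply: (@le_trans _ _ ((1 - q ^+ n) ^+ (2 ^ n) * (1 + q ^+ n) ^+ (2 ^ n))).
  by rewrite ler_wpM2l//; apply: le_trans h; rewrite natrX -exprMn lerDr.
rewrite -exprMn (_ : (1 - q ^+ n) * (1 + q ^+ n) = 1 - (q ^+ n) ^+ 2); last by ring.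
by apply: exprn_ile1; [rewrite subr_ge0 exprn_ile1|rewrite lerBlDr lerDl sqr_ge0].
Qed.

Lemma moments_poly W r : 0 < r -> ibl leb W -> (forall x, r < `|x| -> W x = 0) ->
  (forall n, \int[leb]_x (x ^+ n * W x) = 0) -> forall P : {poly R}, \int[leb]_x (W x * P.[x]) = 0.
Proof.
move=> r0 iW W0 m0 P.
have im n : ibl leb (fun x => x ^+ n * W x).
  apply: (ibl_le _ (iblZ (r ^+ n) (ibl_norm iW))) => [|x].
    by apply: measurable_funM (ibl_meas iW); exact: measurable_funX.
  have [rx|xr] := ltP r `|x|; first by rewrite W0// normr0 !mulr0 normr0.
  rewrite normrM normrX ler_wpM2r//; apply: lerXn2r => //; by rewrite nnegrE ltW.
have e x : W x * P.[x] = \sum_(i < size P) P`_i * (x ^+ i * W x).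
  by rewrite horner_coef mulr_sumr; apply: eq_bigr => i _; ring.
rewrite (rint_eq leb (g := fun x => \sum_(0 <= i < size P) P`_i * (x ^+ i * W x))); last first.
  by move=> x; rewrite e big_mkord.
rewrite (@rint_sum _ _ _ leb (fun i x => P`_i * (x ^+ i * W x))); last by move=> i; exact: iblZ.
by rewrite big1// => i _; rewrite rintZ// m0 mulr0.
Qed.

Lemma moments_ray W r : 0 < r -> ibl leb W -> (forall x, r < `|x| -> W x = 0) ->
  (forall n, \int[leb]_x (x ^+ n * W x) = 0) -> forall a, \int[leb]_(x in `]-oo, a]) W x = 0.
Proof.
move=> r0 iW W0 m0 a.
(* With this d the affine map q sends a to 1/2 and [-r, r] into [1/4, 3/4]; thus q < 1/2 exactly
   where x < a. *)
pose d := 4 * (r + `|a|); have d0 : 0 < d by rewrite mulr_gt0// ltr_wpDr.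
pose q x := 1 / 2 + (x - a) / d.
pose Q : {poly R} := (1 / 2 - a / d)%:P + d^-1 *: 'X.
have QE x : Q.[x] = q x by rewrite /Q /q !hornerE; field; rewrite gt_eqF.
have qb x : `|x| <= r -> 0 <= q x <= 1.
  move=> xr; have h : `|(x - a) / d| <= 1 / 4.
    rewrite normrM normfV [`|d|]gtr0_norm// ler_pdivrMr// /d mulrA.
    by apply: le_trans (ler_normB _ _) _; lra.
  by move: h; rewrite ler_norml /q => /andP[h1 h2]; apply/andP; split; lra.
(* At x = a, where q = 1/2, the step polynomials tend to 1/e; V discards this null point. *)
pose V x := if x == a then 0 else W x.
have mV : measurable_fun [set: measurableTypeR R] V.
  have -> : V = fun x => \1_(~` [set a]) x * W x.
    apply/funext => x; rewrite /V indicE; case: eqVneq => [->|xa].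
      by have -> : (a \in ~` [set a]) = false; [apply/negbTE/negP => /set_mem /(_ erefl)|rewrite mul0r].
    have -> : (x \in ~` [set a]) = true by apply/mem_set => /= xe; move: xa; rewrite xe eqxx.
    by rewrite mul1r.
  apply: measurable_funM (ibl_meas iW); apply: measurable_indic; exact: measurableC.
have aeV (f : R -> R) : measurable_fun [set: measurableTypeR R] f -> \int[leb]_x (V x * f x) = \int[leb]_x (W x * f x).
  move=> mf; rewrite /Rintegral; congr fine; apply: ae_eq_integral => //.
  - by apply/measurable_EFinP; exact: measurable_funM.
  - by apply/measurable_EFinP; apply: measurable_funM => //; exact: ibl_meas iW.
  exists [set a]; split; [exact: measurable_set1|exact: lebesgue_measure_set1|].
  by move=> x /= h; apply: contrapT => /eqP xa; apply: h => _; rewrite /V (negPf xa).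
pose p n x := (1 - q x ^+ n) ^+ (2 ^ n).
have pE n x : p n x = ((1 - Q ^+ n) ^+ (2 ^ n)).[x] by rewrite /p horner_exp hornerD hornerN horner_exp QE hornerC.
have mp n : measurable_fun [set: measurableTypeR R] (p n).
  apply: measurable_funX; apply: measurable_funB => //; apply: measurable_funX.
  by apply: measurable_funD => //; apply: measurable_funM => //; exact: measurable_funB.
have z n : \int[leb]_x (V x * p n x) = 0.
  rewrite aeV// (rint_eq leb (g := fun x => W x * ((1 - Q ^+ n) ^+ (2 ^ n)).[x])); last by move=> x; rewrite pE.
  exact: moments_poly r0 iW W0 m0 _.
pose chi x : R := if x < a then 1 else 0.
have [||_ cv] := @rint_dct _ (measurableTypeR R) R leb (fun n x => V x * p n x) (fun x => V x * chi x)
   (fun x => `|W x|) (fun n => measurable_funM mV (mp n)) _ (ibl_norm iW) _.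
- move=> x; have [xr|rx] := leP `|x| r; last first.
    by rewrite /V W0// if_same mul0r; under eq_fun do rewrite mul0r; exact: cvg_cst.
  rewrite /V /chi; have [xa|xa|xa] := ltgtP x a.
  + apply: cvgM; first exact: cvg_cst.
    by apply: step_poly_cvg1; [case/andP: (qb x xr)|rewrite /q gtrDl pmulr_llt0 ?invr_gt0// subr_lt0].
  + apply: cvgM; first exact: cvg_cst.
    by apply: step_poly_cvg0; [rewrite /q ltrDl mulr_gt0 ?invr_gt0// subr_gt0|case/andP: (qb x xr)].
  + by rewrite mul0r; under eq_fun do rewrite mul0r; exact: cvg_cst.
- move=> n x; have [xr|rx] := leP `|x| r; last by rewrite /V W0// if_same mul0r.
  rewrite normrM -[leRHS]mulr1; apply: ler_pM => //.
    by rewrite /V; case: ifP => // _; rewrite normr0.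
  by case/andP: (qb x xr) => q0 q1; exact: step_poly_bound.
have e0 : \int[leb]_x (V x * chi x) = 0.
  apply: (cvg_unique _ cv) => //; rewrite (_ : (fun n => _) = fun=> 0); first exact: cvg_cst.
  by apply/funext => n; exact: z.
have mI : measurable ([set` (`]-oo, a])%R] : set (measurableTypeR R)) by exact: measurable_itv.
rewrite -e0 (rint_eq leb (g := fun x => V x * \1_([set` (`]-oo, a])%R] : set R) x)); last first.
  move=> x; rewrite /V /chi indicE mem_setE in_itv /=; case: ltgtP => // _; by rewrite ?mul0r.
rewrite aeV; last exact: measurable_indic.
rewrite /Rintegral integral_mkcond; congr fine; apply: eq_integral => x _.
by rewrite patchE indicE; case: ifP => _; rewrite ?mulr1 ?mulr0.
Qed.

(** All integrals of W over rays vanish, and by Lebesgue's differentiation theorem W is almost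
    everywhere the derivative of these. *)
Lemma moments_ae W r : 0 < r -> ibl leb W -> (forall x, r < `|x| -> W x = 0) ->
  (forall n, \int[leb]_x (x ^+ n * W x) = 0) -> {ae leb, forall x, W x = 0}.
Proof.
move=> r0 iW W0 m0; have h := moments_ray r0 iW W0 m0.
have iy y : leb.-integrable [set` (`]-oo, y])%R] (EFin \o W).
  by apply: integrableS iW => //; exact: measurable_itv.
have lW : locally_integrable [set: R] W.
  have := integrable_locally measurableT iW; rewrite (_ : W \_ _ = W)//.
  by apply/funext => y; rewrite patchE in_setT.
have := FTC1Ny iy lW.
apply: (@filterS _ _ (ae_filter_ringOfSetsType leb)) => x /= [_ <-].
rewrite (_ : (fun x => _) = fun=> 0); last by apply/funext => y; exact: h.
by rewrite derive1_cst.
Qed.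

End moment_uniqueness.

Section injectivity.
Context {R : realType} (k r : R) (hk : 0 <= k) (hr : 0 < r).
Local Notation mu := (dunkl_measure k).
Local Notation leb := (@lebesgue_measure R).
Implicit Types (u v : R -> R).

(** On the set where f is nonzero the weight itself vanishes almost everywhere, so that this set has
    measure 0 for the weighted measure. *)
Lemma ae_dunkl (f : R -> R) : measurable_fun [set: measurableTypeR R] f ->
  {ae leb, forall x, f x * dunkl_weight k x = 0} -> {ae mu, forall x, f x = 0}.
Proof.
move=> mf ae0; pose A := [set x : measurableTypeR R | f x != 0].
have mA : measurable A.
  rewrite (_ : A = f @^-1` (~` [set 0])).
    by rewrite -[X in measurable X]setTI; apply: mf => //; exact: measurableC.
  by apply/seteqP; split=> x /=; [move=> /eqP|move=> /eqP].
exists A; split => //; last by move=> x /= fx; apply/eqP.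
rewrite /dunkl_measure (ae_eq_integral (fun=> 0%E)) ?integral0//.
  by apply/measurable_EFinP; apply: measurable_funTS; exact: measurable_dunkl_weight.
apply: (@filterS _ _ (ae_filter_ringOfSetsType leb) _ _ _ ae0) => x /= fw fx; congr EFin.
by move/eqP: fw; rewrite mulf_eq0 (negPf fx) /= => /eqP.
Qed.

Lemma L2r_moments_ae u : L2r k r u -> (forall n, moment k u n = 0) -> {ae mu, forall x, u x = 0}.
Proof.
move=> Lu m0; have [mu_ _ u0] := Lu; have iu := L2r_ibl hk Lu.
apply: ae_dunkl => //; apply: (moments_ae hr).
- exact/ibl_dunkl.
- by move=> x rx; rewrite u0// mul0r.
move=> n; rewrite -(m0 n) /moment rint_dunkl; last first.
  by apply: measurable_funM => //; exact: measurable_funX.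
by apply: rint_eq => x; rewrite mulrA.
Qed.

Lemma L2r_sub u v : L2r k r u -> L2r k r v -> L2r k r (fun x => u x - v x).
Proof.
move=> [mu_ u2 u0] [mv v2 v0]; split; first exact: measurable_funB.
  have := @sqr_ibl_lin _ k u v 1 (-1) mu_ mv u2 v2; apply: ibl_eq => x; congr (_ ^+ 2); ring.
by move=> x rx; rewrite u0// v0// subrr.
Qed.

Lemma trans_inj u v u' v' : L2r k r u -> L2r k r v -> L2r k r u' -> L2r k r v' ->
  (forall l, trans k u v l = trans k u' v' l) ->
  {ae mu, forall x, u x = u' x} /\ {ae mu, forall x, v x = v' x}.
Proof.
move=> Lu Lv Lu' Lv' h.
have c1 := cent_tcoef hk hr Lu Lv; have c2 := cent_tcoef hk hr Lu' Lv'.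
have e n : tcoef k u v n = tcoef k u' v' n.
  apply/eqP; rewrite -subr_eq0; apply/eqP.
  have c3 : cent (fun n => tcoef k u v n + (-1) * tcoef k u' v' n) by apply: centD => //; exact: centZ.
  have := @cfs_uniq0 _ _ c3 _ n; rewrite mulN1r; apply=> x.
  rewrite cfsD//; last exact: centZ.
  rewrite (cfsZ (-1) _ c2) -(transE hk hr _ Lu' Lv') -[cfs _ _]/(cfs (tcoef k u v) (real_complex R x)) -(transE hk hr _ Lu Lv).
  by rewrite h mulN1r subrr.
have c0 : ((dunkl_const k)^-1%:C != 0 :> R[i])%C by rewrite fmorph_eq0 invr_eq0 gt_eqF// dunkl_const_gt0.
have m n : moment k u n = moment k u' n /\ moment k v n = moment k v' n.
  have := mulfI c0 (e n); move/mulfI => /(_ _) H.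
  have [] // : (moment k u n +i* moment k v n)%C = (moment k u' n +i* moment k v' n)%C.
  apply: H; rewrite mulf_neq0//; last by rewrite fmorph_eq0 invr_eq0 gam_neq0.
  by rewrite expf_neq0// oppr_eq0 eq_complex /= oner_eq0 andbF.
have mz w w' : L2r k r w -> L2r k r w' -> (forall n, moment k w n = moment k w' n) -> {ae mu, forall x, w x = w' x}.
  move=> Lw Lw' mw; have h0 : {ae mu, forall x, w x - w' x = 0}.
    apply: L2r_moments_ae => [|n]; first exact: L2r_sub.
    have [i1 _] := moment_bound hk hr n Lw; have [i2 _] := moment_bound hk hr n Lw'.
    rewrite /moment -(subrr (moment k w' n)) -{1}mw /moment -rintB//.
    by apply: rint_eq => x; rewrite mulrBr.
  by apply: (@filterS _ _ (ae_filter_ringOfSetsType mu) _ _ _ h0) => x /eqP; rewrite subr_eq0 => /eqP.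
by split; apply: mz => // n; have [] := m n.
Qed.

End injectivity.

(** * Surjectivity *)

Section l1_limits.
Context d (T : measurableType d) {R : realType} (mu : {measure set T -> \bar R}).
Implicit Types (h D : nat -> T -> R).

(** Beppo Levi: the sum of the |D n| is integrable, hence finite almost everywhere; A is the set
    where it is finite. *)
Lemma abs_series_dominated D (B : R) : (forall n, ibl mu (D n)) ->
  (forall N, \sum_(0 <= n < N) \int[mu]_x `|D n x| <= B) ->
  exists A : set T, exists g : T -> R, [/\ measurable A, {ae mu, forall x, A x}, ibl mu g &
    forall x N, A x -> \sum_(0 <= n < N) `|D n x| <= g x].
Proof.
move=> iD bD; pose G x := (\sum_(0 <= n <oo) `|D n x|%:E)%E.
have mD n : measurable_fun setT (fun x => `|D n x|%:E).
  by apply/measurable_EFinP; apply: measurableT_comp => //; exact: ibl_meas (iD n).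
have G0 x : (0 <= G x)%E by apply: nneseries_ge0 => n _ _; rewrite lee_fin.
have mG : measurable_fun setT G by apply: ge0_emeasurable_sum.
have IG : (\int[mu]_x G x <= B%:E)%E.
  rewrite /G integral_nneseries//; apply: lime_le.
    by apply: is_cvg_nneseries => n _ _; apply: integral_ge0 => x _; rewrite lee_fin.
  near=> N; rewrite (eq_bigr (fun n => (\int[mu]_x `|D n x|)%:E)); last first.
    by move=> n _; rewrite (iblE (ibl_norm (iD n))).
  by rewrite sumEFin lee_fin.
have iG : mu.-integrable setT G.
  apply/integrableP; split=> //; rewrite (eq_integral G); last by move=> x _; rewrite gee0_abs.
  exact: le_lt_trans IG (ltry _).
exists (G @^-1` [set~ +oo%E]), (fine \o G); split.
- by rewrite -[X in measurable X]setTI; apply: mG => //; exact: measurableC.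
- apply: (@filterS _ _ (ae_filter_ringOfSetsType mu) _ _ _ (integrable_ae measurableT iG)) => x /= /(_ I).
  by case: (G x).
- apply: iblP; first by apply: measurableT_comp => //; exact: measurable_fine.
  apply: (le_lt_trans (le_trans _ IG) (ltry _)); apply: ge0_le_integral => //.
  + by apply/measurable_EFinP; apply: measurableT_comp => //; apply: measurableT_comp => //; exact: measurable_fine.
  + move=> x _ /=; have := G0 x; case: (G x) => [s|//|//]; last by rewrite normr0 leey.
    by rewrite !lee_fin => s0; rewrite ger0_norm.
- move=> x N /= Gx; rewrite -lee_fin fineK; last first.
    by rewrite ge0_fin_numE//; move: Gx; case: (G x) => // r _; rewrite ltry.
  by rewrite -sumEFin; apply: nneseries_lim_ge => n _ _; rewrite lee_fin.
Unshelve. all: by end_near. Qed.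

(* The indicator discards the null set where the telescoping series diverges. *)
Lemma l1_limit h (B : R) : (forall n, ibl mu (h n)) ->
  (forall N, \sum_(0 <= n < N) \int[mu]_x `|h n.+1 x - h n x| <= B) ->
  exists (A : set T) (l g : T -> R), [/\ measurable A, {ae mu, forall x, A x},
    ibl mu g, forall x, (fun n => \1_A x * h n x) @ \oo --> l x &
    forall n x, `|\1_A x * h n x| <= g x].
Proof.
move=> ih bh; have iD n : ibl mu (fun x => h n.+1 x - h n x) by exact: iblB.
have [A [g [mA aeA ig bg]]] := abs_series_dominated iD bh.
have S n x : h n x = h 0%N x + \sum_(0 <= i < n) (h i.+1 x - h i x).
  by rewrite telescope_sumr// addrC subrK.
exists A, (fun x => \1_A x * limn (h ^~ x)), (fun x => `|h 0%N x| + `|g x|); split=> //.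
- by apply: iblD; exact: ibl_norm.
- move=> x; rewrite indicE; case: (boolP (x \in A)) => [|_]; last first.
    by rewrite mul0r; under eq_fun do rewrite mul0r; exact: cvg_cst.
  rewrite in_setE => Ax; apply: cvgM; first exact: cvg_cst.
  rewrite (_ : h ^~ x = fun n => h 0%N x + series (fun i => h i.+1 x - h i x) n); last first.
      by apply/funext => n; exact: S.
    apply: is_cvgD; first exact: is_cvg_cst.
    apply: normed_cvg; apply: nondecreasing_is_cvgn.
      by apply/nondecreasing_seqP => n; rewrite /= /series /= big_nat_recr//= lerDl.
    by exists (g x) => _ [N _ <-]; exact: bg.
move=> n x; rewrite indicE; case: (boolP (x \in A)) => [|_]; last by rewrite mul0r normr0 addr_ge0.
rewrite in_setE => Ax; rewrite mul1r S (le_trans (ler_normD _ _))// lerD2l.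
by rewrite (le_trans (ler_norm_sum _ _ _))// (le_trans (bg x n Ax))// ler_norm.
Qed.

End l1_limits.

(** * Limits of transforms of band-limited functions *)

Section hartley_surjectivity.
Context {R : realType} (k r : R) (hk : 0 <= k) (hr : 0 < r).
Local Notation mu := (dunkl_measure k).
Implicit Types (u v f g : R -> R) (x y s t : R).

(** The Cauchy-Schwarz inequality on [-s, s] in the form |u| <= (t u^2 + 1/t) / 2, with t left free
    to balance the two terms. *)
Lemma L2r_rint_norm_le s u t : L2r k s u -> 0 < t ->
  \int[mu]_x `|u x| <= (t * \int[mu]_x u x ^+ 2 + t^-1 * \int[mu]_x \1_([set` (`[- s, s])%R] : set R) x) / 2.
Proof.
move=> Lu t0; have [_ u2 u0] := Lu; have iu := L2r_ibl hk Lu; have i1 := ibl_indic_itv hk s.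
rewrite -!rintZ// -rintD; [|exact: iblZ|exact: iblZ].
rewrite mulrC -rintZ; last by apply: iblD; exact: iblZ.
apply: rint_le; first exact: ibl_norm.
  by apply: iblZ; apply: iblD; exact: iblZ.
move=> x; rewrite indic_itvE; have [xs|xs] := leP `|x| s; last first.
  by rewrite u0// normr0 expr0n mulr0 mulr0 addr0 mulr0.
have h : 0 <= t * (`|u x| - t^-1) ^+ 2 by rewrite mulr_ge0 ?sqr_ge0// ltW.
have tt : t * t^-1 = 1 by rewrite divff// gt_eqF.
have e : `|u x| ^+ 2 = u x ^+ 2 by rewrite real_normK// num_real.
rewrite -e mulr1; move: h tt; move: `|u x| t^-1 => p q h tt.
have E : t * (p - q) ^+ 2 = t * p ^+ 2 - 2 * p * (t * q) + q * (t * q) by ring.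
by move: h; rewrite E tt; lra.
Qed.

Lemma geo4_sum (K : R) N : 0 <= K -> \sum_(0 <= n < N) K * (4^-1) ^+ n <= 2 * K * (1 - (4^-1) ^+ N).
Proof.
move=> K0; elim: N => [|N IH]; first by rewrite big_nil expr0 subrr mulr0.
rewrite big_nat_recr//= exprS.
have : 0 <= K * (4^-1) ^+ N by rewrite mulr_ge0// exprn_ge0.
by move: IH; move: (\sum_(_ <= _ < _) _) (_ ^+ N) => p q; lra.
Qed.

Lemma cvg_le_bound (u : nat -> R) (l b : R) : u @ \oo --> l -> (forall n, u n <= b) -> l <= b.
Proof.
move=> ul ub; rewrite -(cvg_lim _ ul)//; apply: limr_le; first by apply/cvg_ex; exists l.
exact: nearW.
Qed.

Lemma cvgX2 (u : nat -> R) (l : R) : u @ \oo --> l -> (fun n => u n ^+ 2) @ \oo --> l ^+ 2.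
Proof. by move=> ul; apply: cvgM. Qed.

Lemma cvg_sqr_dist (u : nat -> R) (l : R) : u @ \oo --> l -> (fun n => (u n - l) ^+ 2) @ \oo --> (0 : R).
Proof.
move=> ul; have h : (fun n => u n - l) @ \oo --> (0 : R) by rewrite -(subrr l); apply: cvgB => //; exact: cvg_cst.
by have := cvgX2 h; rewrite expr0n.
Qed.

(** The majorant g makes f_n tend to f in mean square, hence the Hf_n form a Cauchy sequence by
    [bessel]. Their common support in [-s, s] turns this into L^1 control, and the shrinking radii
    confine the limit to [-r, r]. *)
Lemma hartley_limit f g (c : nat -> nat -> R) (rho : nat -> R) (s : R) :
  (forall n, 0 < rho n) -> (forall n, rho n <= s) -> rho @ \oo --> r ->
  (forall n, band k (rho n) (c n)) -> (forall x, (fun n => fs (c n) x) @ \oo --> f x) ->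
  ibl mu g -> (forall n x, fs (c n) x ^+ 2 <= g x) ->
  exists h, L2r k r h /\ forall y, hartley k h y = inv_const k * f y.
Proof.
move=> rho0 rhos rhor bc cf ig cg.
have ec n : ent (c n) by case: (bc n).
have mc n : measurable_fun [set: measurableTypeR R] (fs (c n)).
  by apply: continuous_measurable_fun; exact: continuous_fs.
have mf : measurable_fun [set: measurableTypeR R] f.
  by apply: (measurable_fun_cvg mc) => x _; exact: cf.
have fg x : f x ^+ 2 <= g x.
  exact: cvg_le_bound (cvgX2 (cf x)) (cg ^~ x).
have dg n x : `|(fs (c n) x - f x) ^+ 2| <= 4 * g x.
  rewrite ger0_norm ?sqr_ge0//; have := fg x; have := cg n x; have := sqr_ge0 (fs (c n) x + f x).
  by move: (fs _ _) (f x) => p q; nra.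
have mD n : measurable_fun [set: measurableTypeR R] (fun x => (fs (c n) x - f x) ^+ 2).
  by apply: measurable_funX; exact: measurable_funB.
have iD n : ibl mu (fun x => (fs (c n) x - f x) ^+ 2) by exact: ibl_le (mD n) (iblZ 4 ig) (dg n).
have [_ D0] := @rint_dct _ (measurableTypeR R) R mu (fun n x => (fs (c n) x - f x) ^+ 2) (fun=> 0) _ mD
  (fun x => cvg_sqr_dist (cf x)) (iblZ 4 ig) dg.
rewrite rint0 in D0.
(* Squared distances of order 16^-n, so that with t = 4^n both terms of [L2r_rint_norm_le] are of
   order 4^-n and hence summable. *)
have /choice[sg sgP] : forall n, exists m, (n <= m)%N /\ \int[mu]_x (fs (c m) x - f x) ^+ 2 <= (4^-1 ^+ n) ^+ 2.
  move=> n.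
  have e0 : 0 < (4^-1 ^+ n) ^+ 2 :> R by rewrite !exprn_gt0.
  have [N _ hN] := (cvgrPdist_le _ _).1 D0 _ e0.
  exists (maxn n N); split; first exact: leq_maxl.
  have := hN (maxn n N) (leq_maxr _ _); rewrite /= sub0r normrN; apply: le_trans; exact: ler_norm.
pose a n := c (sg n); pose H n := hartley k (fs (a n)).
have ia n : ibl mu (fs (a n)) := band_ibl hk (rho0 _) (bc (sg n)).
have ia2 n : ibl mu (fun x => fs (a n) x ^+ 2).
  apply: (ibl_le (measurable_funX 2 (mc (sg n))) ig) => x.
  by rewrite ger0_norm ?sqr_ge0.
have iH n : ibl mu (H n) := band_hartley_ibl1 hk (rho0 _) (bc (sg n)).
have H0 n y : rho (sg n) < `|y| -> H n y = 0 by move=> h; exact: (hartley_support hk (rho0 (sg n)) (bc (sg n)) h).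
have mH n := ibl_meas (iH n).
have HE n y : H n.+1 y - H n y = hartley k (fun x => fs (a n.+1) x - fs (a n) x) y.
  rewrite /H /hartley -rintB; [|exact: ibl_cas|exact: ibl_cas].
  by apply: rint_eq => x; rewrite mulrBl.
pose M := \int[mu]_x \1_([set` (`[- s, s])%R] : set R) x.
pose K := (bessel_const k * 4 + M) / 2.
have b0 : 0 <= bessel_const k.
  by rewrite mulr_ge0// mulr_ge0 ?powR_ge0// sqr_ge0.
have dH n : \int[mu]_x `|H n.+1 x - H n x| <= K * 4^-1 ^+ n.
  have md : measurable_fun [set: measurableTypeR R] (fun x => fs (a n.+1) x - fs (a n) x)
    by exact: (measurable_funB (mc (sg n.+1)) (mc (sg n))).
  have le2 x : (fs (a n.+1) x - fs (a n) x) ^+ 2 <= 2 * (fs (a n.+1) x - f x) ^+ 2 + 2 * (fs (a n) x - f x) ^+ 2.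
    have := sqr_ge0 ((fs (a n.+1) x - f x) + (fs (a n) x - f x)).
    by move: (fs _ _) (fs _ _) (f x) => p q w; lra.
  have i2 : ibl mu (fun x => (fs (a n.+1) x - fs (a n) x) ^+ 2).
    apply: (ibl_le _ (iblD (iblZ 2 (iD (sg n.+1))) (iblZ 2 (iD (sg n))))); first exact: measurable_funX.
    by move=> x; rewrite ger0_norm ?sqr_ge0//; exact: le2.
  have [iB leB] := bessel hk (iblB (ia n.+1) (ia n)) i2.
  have LD : L2r k s (fun y => H n.+1 y - H n y).
    split; first exact: measurable_funB.
      by apply: ibl_eq iB => y; rewrite HE.
    by move=> y sy; rewrite !H0 ?subrr// (le_lt_trans (rhos _)).
  have q0 : 0 < (4 : R) ^+ n by rewrite exprn_gt0.
  apply: (le_trans (L2r_rint_norm_le LD q0)).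
  rewrite (rint_eq mu (g := fun y => hartley k (fun x => fs (a n.+1) x - fs (a n) x) y ^+ 2)); last by move=> y; rewrite HE.
  have : \int[mu]_x (fs (a n.+1) x - fs (a n) x) ^+ 2 <= 4 * (4^-1 ^+ n) ^+ 2.
    apply: (le_trans (rint_le i2 (iblD (iblZ 2 (iD (sg n.+1))) (iblZ 2 (iD (sg n)))) le2)).
    rewrite rintD; [|exact: iblZ|exact: iblZ]; rewrite !rintZ//.
    have [_ h1] := sgP n.+1; have [_ h2] := sgP n; have : (4^-1 ^+ n.+1) ^+ 2 <= (4^-1 ^+ n) ^+ 2 :> R.
      by rewrite ler_sqr ?nnegrE ?exprn_ge0// exprS ler_piMl ?exprn_ge0//; lra.
    by move: h1 h2; rewrite /a; move: (4^-1 ^+ n.+1) (4^-1 ^+ n) => p q; lra.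
  rewrite -/M -exprVn /K; move: leB.
  have : 4 ^+ n * 4^-1 ^+ n = 1 :> R by rewrite -exprMn divff ?expr1n.
  move: (\int[mu]_x hartley _ _ _ ^+ 2) (\int[mu]_x (_ - _) ^+ 2) => I1 I2.
  move: b0 q0; move: (4 ^+ n) (4^-1 ^+ n) (bessel_const k) {K}M => p q b m b0 q0 pq h1 h2.
  have h3 : p * I1 <= b * 4 * q.
    have -> : b * 4 * q = p * (b * (4 * q ^+ 2)) by transitivity (b * 4 * q * (p * q)); [rewrite pq mulr1|ring].
    by rewrite ler_pM2l// (le_trans h1)// ler_wpM2l.
  lra.
have M0 : 0 <= M by apply: rint_ge0 => x.
have K0 : 0 <= K by move: b0 M0; rewrite /K; lra.
have [A [l [G [mA aeA iG Hl HG]]]] : exists (A : set (measurableTypeR R)) (l g : R -> R), [/\ measurable A, {ae mu, forall x, A x},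
    ibl mu g, forall x, (fun n => \1_A x * H n x) @ \oo --> l x &
    forall n x, `|\1_A x * H n x| <= g x].
  apply: (@l1_limit _ _ _ mu H (2 * K)) => // N.
  apply: (le_trans (ler_sum_nat (fun n _ => dH n))); apply: (le_trans (geo4_sum N K0)).
  by rewrite mulrBr mulr1 gerBl; apply: mulr_ge0; [exact: mulr_ge0|exact: exprn_ge0].
have mI : measurable_fun [set: measurableTypeR R] (\1_A : R -> R) by exact: measurable_indic.
have mAH n : measurable_fun [set: measurableTypeR R] (fun x => \1_A x * H n x) by exact: measurable_funM.
(* The indicator of A alters [H n] on a null set only, so integrals against [H n] are unchanged. *)
have aeH n (e : R -> R) : measurable_fun [set: measurableTypeR R] e ->
  (\int[mu]_x (e x * (\1_A x * H n x))%:E)%E = (\int[mu]_x (e x * H n x)%:E)%E.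
  move=> me; apply: ae_eq_integral => //.
  - by apply/measurable_EFinP; exact: measurable_funM.
  - by apply/measurable_EFinP; exact: measurable_funM.
  apply: (@filterS _ _ (ae_filter_ringOfSetsType mu) _ _ _ aeA) => x Ax _.
  by rewrite indicE mem_set// mul1r.
have [il _] := rint_dct mAH Hl iG HG.
exists l; split; first split.
- exact: ibl_meas il.
- have ml := ibl_meas il; have ml2 : measurable_fun [set: measurableTypeR R] (fun x => l x ^+ 2) by exact: measurable_funX.
  apply: iblP => //; under eq_integral do rewrite ger0_norm ?sqr_ge0//.
  apply: le_lt_trans (ltry (bessel_const k * \int[mu]_x g x)).
  apply: (@fatou_le _ (measurableTypeR R) R mu (fun n x => (\1_A x * H n x) ^+ 2)) => //.
  + by move=> n; exact: measurable_funX.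
  + by move=> n x; exact: sqr_ge0.
  + by apply: aeW => x; apply: cvgX2; exact: Hl.
  + by move=> x; exact: sqr_ge0.
  move=> n; have [iB leB] := bessel hk (ia n) (ia2 n).
  apply: (@le_trans _ _ (\int[mu]_x (H n x ^+ 2)%:E)%E).
    apply: ge0_le_integral => //.
    + by move=> x _; rewrite lee_fin sqr_ge0.
    + by apply/measurable_EFinP; exact: measurable_funX.
    + by apply/measurable_EFinP; exact: measurable_funX.
    move=> x _; rewrite lee_fin indicE; case: (x \in A); rewrite ?mul1r// mul0r expr0n sqr_ge0//.
  rewrite (iblE iB) lee_fin (le_trans leB)// ler_wpM2l//; apply: rint_le => // x; exact: cg.
- move=> y ry; apply/esym; apply: (cvg_unique _ _ (Hl y)) => //.
  (* Once r < |y|, the radii eventually drop below |y| and all later transforms vanish at y. *)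
  have h0 : \forall n \near \oo, 0 = \1_A y * H n y.
    have [N _ hN] := (cvgr_lt _ rhor) _ ry.
    exists N => // n /= Nn; rewrite H0 ?mulr0//; apply: hN => /=; apply: leq_trans Nn _; by have [] := sgP n.
  apply: cvg_trans (near_eq_cvg h0) _; exact: cvg_cst.
move=> y.
have mc1 := measurable_cas1 hk y.
have mAc n : measurable_fun [set: measurableTypeR R] (fun x => (\1_A x * H n x) * cas k (x * y)) by exact: measurable_funM.
have cv1 x : (fun n => (\1_A x * H n x) * cas k (x * y)) @ \oo --> l x * cas k (x * y).
  by apply: cvgM; [exact: Hl|exact: cvg_cst].
have bd1 n x : `|(\1_A x * H n x) * cas k (x * y)| <= 2 * G x.
  by rewrite normrM mulrC; apply: ler_pM => //; exact: cas_bound.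
have [_ cv] := rint_dct mAc cv1 (iblZ 2 iG) bd1.
apply: (cvg_unique _ cv) => //.
rewrite (_ : (fun n => _) = fun n => inv_const k * fs (c (sg n)) y); last first.
  apply/funext => n; rewrite -(hartley_inversion hk (rho0 _) y (bc (sg n))) /hartley /Rintegral; congr fine.
  under eq_integral do rewrite mulrC.
  by rewrite aeH//; apply: eq_integral => x _; rewrite mulrC.
apply: cvgM; first exact: cvg_cst.
apply: (@cvg_comp _ _ _ sg (fun n => fs (c n) y) \oo \oo); last exact: cf.
apply/cvgnyPge => N; exists N => // n /= Nn; apply: leq_trans Nn _; by have [] := sgP n.
Qed.

End hartley_surjectivity.

(** * The function sin z / z through Dunkl kernels *)

Section sinc.
Context {R : realType}.
Implicit Types (x y : R) (z : R[i]) (n m : nat).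
#[local] Arguments normc : simpl never.

Lemma gam_zero n : gam (0 : R) n = n`!%:R.
Proof.
elim: n => [|n IH]; first by rewrite gam0.
by rewrite gamS IH /theta mul0r addr0 factS natrM mulrC.
Qed.

(** For even n these are the factorials (n+1)!, the denominators in the series of sin z / z. *)
Lemma gam_one n : gam (1 : R) n = if odd n then n`!%:R * (n%:R + 2) else n.+1`!%:R.
Proof.
elim: n => [|n IH]; first by rewrite gam0.
rewrite gamS IH /theta -signr_odd /=; case: (odd n) => /=.
  by rewrite expr0 subrr mulr0 addr0 !factS !natrM -!natr1; ring.
by rewrite expr1 !factS !natrM -!natr1; ring.
Qed.

(* sin z / z is the even part of the Dunkl kernel for the parameter k = 1. *)
Definition sinc_coef n : R := if odd n then 0 else (-1) ^+ n./2 * ecoef 1 n.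

Lemma iX_even m : ('i : R[i]) ^+ m.*2 = (-1) ^+ m.
Proof. by rewrite -mul2n exprM sqr_i. Qed.

Lemma kcoef_even n : kcoef (1 : R) 1 n + (-1) ^+ n * kcoef 1 1 n = 2 * (sinc_coef n)%:C.
Proof.
rewrite -signr_odd /kcoef mulr1 /sinc_coef; case: ifPn => on.
  by rewrite expr1 mulN1r subrr rmorph0 mulr0.
rewrite expr0 mul1r -{1 3}(odd_double_half n) (negPf on) add0n iX_even rmorphM rmorphXn rmorphN1; ring.
Qed.

(** On coefficients, exp(iz) - exp(-iz) = 2 i z sinc z: the kernel for k = 0 is the exponential. *)
Lemma kcoef_odd n : kcoef (0 : R) 1 n - (-1) ^+ n * kcoef 0 1 n =
  2 * 'i * (if n is m.+1 then (sinc_coef m)%:C else 0).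
Proof.
case: n => [|m]; first by rewrite expr0 mul1r subrr mulr0.
rewrite -signr_odd /kcoef mulr1 /sinc_coef /=; case: ifPn => om /=.
  by rewrite expr0 mul1r subrr rmorph0 mulr0.
rewrite expr1 mulN1r opprK exprS /ecoef gam_zero gam_one (negPf om).
rewrite -{1 3}(odd_double_half m) (negPf om) add0n iX_even rmorphM rmorphXn rmorphN1; ring.
Qed.

Lemma ent_sinc : ent sinc_coef.
Proof.
apply: (ent_le _ (ent_ecoef (ler01 : 0 <= 1 :> R))) => n; rewrite /sinc_coef.
by case: ifP => _; rewrite ?normr0// normrM normrX normrN1 expr1n mul1r.
Qed.

Definition csinc z : R[i] := cfs (fun n => (sinc_coef n)%:C) z.

Lemma cent_sinc : cent (fun n => (sinc_coef n)%:C).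
Proof.
by apply: (cent_le _ ent_sinc) => n; rewrite normcR.
Qed.

(** Eigenvalue and point enter the kernel through their product only, so z may be moved into the
    eigenvalue and the bound for real points used at 1. *)
Lemma kernel_bound1 (k : R) z : 0 <= k -> normc (cfs (kcoef k 1) z) <= 2 * expR `|complex.Im z|.
Proof.
move=> hk; have := kernel_bound hk z 1; rewrite normr1 mulr1.
suff -> : cfs (kcoef k 1) z = cfs (kcoef k z) (1 : R)%:C by [].
rewrite /cfs; congr (limn (series _) +i* limn (series _)); apply/funext => n;
  by rewrite /kcoef rmorph1 expr1n !mulr1 exprMn mulrAC.
Qed.

Lemma csincE z : 2 * csinc z = cfs (kcoef 1 1) z + cfs (kcoef 1 1) (- z).
Proof.
have c1 := cent_kcoef (ler01 : 0 <= 1 :> R) 1.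
rewrite -cfs_alt -cfsD//; last exact: cent_alt.
rewrite (eq_cfs _ kcoef_even) cfsZ//; exact: cent_sinc.
Qed.

Lemma csincME z : 2 * 'i * (z * csinc z) = cfs (kcoef 0 1) z - cfs (kcoef 0 1) (- z).
Proof.
have c0 := cent_kcoef (lexx (0 : R)) 1.
rewrite -cfs_alt -[X in _ + X]mulN1r -(cfsZ (-1)); last exact: cent_alt.
rewrite -cfsD//; last by apply: centZ; exact: cent_alt.
rewrite (eq_cfs (b := fun n => 2 * 'i * (if n is m.+1 then (sinc_coef m)%:C else 0))); last first.
  by move=> n; rewrite -kcoef_odd mulN1r.
rewrite cfsZ; last exact: cent_shift cent_sinc.
by rewrite cfs_shift//; exact: cent_sinc.
Qed.

Lemma normc2 : normc (2 : R[i]) = 2.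
Proof. by rewrite -[2](rmorph_nat (real_complex R) 2) normcR ger0_norm. Qed.

Lemma half_bound (p a b e : R) : 2 * p <= a + b -> a <= 2 * e -> b <= 2 * e -> p <= 2 * e.
Proof. lra. Qed.

Lemma csinc_bound z : normc (csinc z) <= 2 * expR `|complex.Im z|.
Proof.
have h1 := kernel_bound1 z (ler01 : 0 <= 1 :> R); have := kernel_bound1 (- z) (ler01 : 0 <= 1 :> R).
rewrite (_ : `|complex.Im (- z)| = `|complex.Im z|); last by case: (z) => a b /=; rewrite normrN.
move=> h2; have h3 := le_normcD (cfs (kcoef 1 1) z) (cfs (kcoef 1 1) (- z)).
have e : normc (2 * csinc z) = 2 * normc (csinc z) by rewrite normcM normc2.
rewrite csincE in e; rewrite e in h3.
by apply: half_bound h3 h1 h2.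
Qed.

(** This is the bound on sin z, and gives sinc its decay 1/|z|. *)
Lemma csincM_bound z : normc z * normc (csinc z) <= 2 * expR `|complex.Im z|.
Proof.
have h1 := kernel_bound1 z (lexx (0 : R)); have := kernel_bound1 (- z) (lexx (0 : R)).
rewrite (_ : `|complex.Im (- z)| = `|complex.Im z|); last by case: (z) => a b /=; rewrite normrN.
move=> h2; have h3 := le_normcB (cfs (kcoef 0 1) z) (cfs (kcoef 0 1) (- z)).
have e : normc (2 * 'i * (z * csinc z)) = 2 * (normc z * normc (csinc z)).
  by rewrite !normcM normc2 normci mulr1.
rewrite csincME in e; rewrite e in h3.
by apply: half_bound h3 h1 h2.
Qed.

Lemma csinc_real x : csinc x%:C = (fs sinc_coef x)%:C.
Proof.
rewrite /csinc cfs_real; apply/eqP; rewrite eq_complex /= eqxx /=; apply/eqP.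
exact: fs_cst0.
Qed.

Lemma cvg_sinc (e : nat -> R) x m : e @ \oo --> (0 : R) ->
  (fun n => fs sinc_coef (e n * x) ^+ m) @ \oo --> (1 : R).
Proof.
move=> e0; have c := ctX (n := m) (continuous_fs ent_sinc).
have -> : 1 = fs sinc_coef 0 ^+ m by rewrite fs0 /sinc_coef /= ecoef0 mulr1 expr0 expr1n.
apply: (cvg_comp (fun n => e n * x) (fun y => fs sinc_coef y ^+ m)); last exact: c.
by rewrite -(mul0r x); apply: cvgM => //; exact: cvg_cst.
Qed.

End sinc.

(** * Regularisation by powers of sinc, and preimages *)

Section regularization.
Context {R : realType} (k r : R) (hk : 0 <= k) (hr : 0 < r).
Local Notation mu := (dunkl_measure k).
Implicit Types (u v f g : R -> R) (x y s t e : R) (F : R[i] -> R[i]) (z : R[i]).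
#[local] Arguments normc : simpl never.

Lemma entire_csinc_scale e m : entire (fun z : R[i] => csinc (e%:C * z) ^+ m).
Proof.
elim: m => [|m IH].
  rewrite (_ : (fun z => _) = fun=> 1); last by apply/funext => z; rewrite expr0.
  by move=> z; pose C : numFieldType := R[i]; pose V : normedModType C := R[i]; exact: (@derivable_cst C V V 1 z 1).
rewrite (_ : (fun z => _) = fun z => csinc (e%:C * z) * csinc (e%:C * z) ^+ m); last by apply/funext => z; rewrite exprS.
have e1 : entire (fun z : R[i] => csinc (e%:C * z)); last exact: (entireM e1 IH).
have ca : cent (fun n => (e ^+ n * sinc_coef n)%:C).
  apply: (cent_le _ (ent_dil e (@ent_sinc R))) => n; by rewrite normcR.
rewrite (_ : (fun z => _) = cfs (fun n => (e ^+ n * sinc_coef n)%:C)); first exact: cfs_entire.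
apply/funext => z; rewrite /csinc /cfs; congr (limn (series _) +i* limn (series _)); apply/funext => n;
  by rewrite exprMn mulrA [_%:C * _ ^+ n]mulrC rmorphM rmorphXn.
Qed.

(** Of the m factors, l are spent on |z|^l through [csincM_bound], at the price 1/e each; all m of
    them add e to the exponential type. *)
Lemma regularized_bound F (C e : R) m l z : 0 < e -> (l <= m)%N ->
  (forall z, normc (F z) <= C * expR (r * `|complex.Im z|)) ->
  normc z ^+ l * normc (F z * csinc (e%:C * z) ^+ m) <=
  e ^- l * 2 ^+ m * C * expR ((r + m%:R * e) * `|complex.Im z|).
Proof.
move=> e0 lm hF; have [b1 b2] := (csinc_bound (e%:C * z), csincM_bound (e%:C * z)).
have E : `|complex.Im (e%:C * z)| = e * `|complex.Im z|.
  by case: (z) => a b /=; rewrite mul0r addr0 normrM gtr0_norm.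
have n1 : normc (e%:C * z) = e * normc z by rewrite normcM normcR gtr0_norm.
rewrite E n1 in b1, b2.
have {}b2 : normc z * normc (csinc (e%:C * z)) <= e^-1 * (2 * expR (e * `|complex.Im z|)).
  by rewrite ler_pdivlMl// mulrA.
rewrite normcM normcX -(subnKC lm) exprD.
have s0 := normc_ge0 (csinc (e%:C * z)).
set s := normc (csinc _) in b1 b2 s0 *.
have -> : normc z ^+ l * (normc (F z) * (s ^+ l * s ^+ (m - l))) = (normc z * s) ^+ l * s ^+ (m - l) * normc (F z).
  by rewrite exprMn; ring.
rewrite subnKC//.
have -> : e ^- l * 2 ^+ m * C * expR ((r + m%:R * e) * `|complex.Im z|) =
  (e^-1 * (2 * expR (e * `|complex.Im z|))) ^+ l * (2 * expR (e * `|complex.Im z|)) ^+ (m - l) * (C * expR (r * `|complex.Im z|)).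
  rewrite exprMn -(mulrA _ (_ ^+ l)) -exprD subnKC// exprMn -expRM_natl -exprVn mulrDl expRD.
  by rewrite (mulrA m%:R); ring.
have E0 : 0 <= expR (e * `|complex.Im z|) by exact: expR_ge0.
have F0 := normc_ge0 (F z); have z0 := normc_ge0 z.
apply: ler_pM (hF z); rewrite ?F0//; first by apply: mulr_ge0; apply: exprn_ge0 => //; exact: mulr_ge0.
apply: ler_pM; [by apply: exprn_ge0; exact: mulr_ge0|exact: exprn_ge0| |].
  apply: lerXn2r => //; rewrite nnegrE; first exact: mulr_ge0.
  by rewrite mulr_ge0 ?invr_ge0 ?(ltW e0)// mulr_ge0.
by apply: lerXn2r => //; rewrite nnegrE mulr_ge0.
Qed.

Lemma regularize F (C e : R) : 0 < e -> entire F ->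
  (forall z, normc (F z) <= C * expR (r * `|complex.Im z|)) ->
  exists c d : nat -> R, [/\ band k (r + (decay_order k)%:R * e) c, band k (r + (decay_order k)%:R * e) d &
   forall x, fs c x = complex.Re (F x%:C) * fs (@sinc_coef R) (e * x) ^+ decay_order k /\
             fs d x = complex.Im (F x%:C) * fs (@sinc_coef R) (e * x) ^+ decay_order k].
Proof.
move=> e0 eF hF; set m := decay_order k; set s := r + _.
have s0 : 0 < s by rewrite ltr_pwDl// mulr_ge0// ltW.
have eG := entireM eF (@entire_csinc_scale e m).
have [a [rG _ _]] := entire_seriesW eG; have [ec ed E] := rG.
have hb i : (i <= m)%N -> forall l, (l <= i)%N -> exists C' : R, forall z,
    normc z ^+ l * normc (F z * csinc (e%:C * z) ^+ m) <= C' * expR (s * `|complex.Im z|).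
  move=> im l li; exists (e ^- l * 2 ^+ m * C) => z.
  by apply: regularized_bound => //; exact: leq_trans li im.
have [t1 t2] := entire_Tbdd hk s0 eG rG (hb 0%N (leq0n m)).
have [t3 t4] := entire_Tbdd hk s0 eG rG (hb m (leqnn m)).
exists (fun n => complex.Re (a n)), (fun n => complex.Im (a n)); split=> // x.
have := E x; rewrite -rmorphM csinc_real -rmorphXn => E'.
by have := congr1 (@complex.Re R) E'; have := congr1 (@complex.Im R) E'; rewrite cReM cImM /= !mulr0 subr0 add0r => <- <-.
Qed.

Lemma hartley_onto F (C : R) : entire F ->
  (forall z, normc (F z) <= C * expR (r * `|complex.Im z|)) ->
  ibl mu (fun x => complex.Re (F x%:C) ^+ 2) -> ibl mu (fun x => complex.Im (F x%:C) ^+ 2) ->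
  exists h1 h2, [/\ L2r k r h1, L2r k r h2, forall y, hartley k h1 y = inv_const k * complex.Re (F y%:C) &
   forall y, hartley k h2 y = inv_const k * complex.Im (F y%:C)].
Proof.
move=> eF hF i1 i2; set m := decay_order k.
have e0 n : 0 < n.+1%:R^-1 :> R by rewrite invr_gt0.
have /choice[cd cdP] : forall n, exists cd : (nat -> R) * (nat -> R), [/\ band k (r + m%:R * n.+1%:R^-1) cd.1, band k (r + m%:R * n.+1%:R^-1) cd.2 &
   forall x, fs cd.1 x = complex.Re (F x%:C) * fs (@sinc_coef R) (n.+1%:R^-1 * x) ^+ m /\
             fs cd.2 x = complex.Im (F x%:C) * fs (@sinc_coef R) (n.+1%:R^-1 * x) ^+ m].
  by move=> n; have [c [d H]] := regularize (e0 n) eF hF; exists (c, d).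
have rho0 n : 0 < r + m%:R * n.+1%:R^-1 by rewrite ltr_pwDl// mulr_ge0.
have rhos n : r + m%:R * n.+1%:R^-1 <= r + m%:R.
  by rewrite lerD2l ler_piMr// invf_le1// ler1n.
have cve : (fun n => n.+1%:R^-1) @ \oo --> (0 : R) by exact: cvg_harmonic.
have rhor : (fun n => r + m%:R * n.+1%:R^-1) @ \oo --> r.
  rewrite -[X in _ --> X]addr0; apply: cvgD; first exact: cvg_cst.
  by rewrite -(mulr0 m%:R); apply: cvgM => //; exact: cvg_cst.
(* A bound uniform in n: a fixed multiple of the square of F then dominates the squares of all
   regularised functions. *)
have sb x : `|fs (@sinc_coef R) x ^+ m| <= 2 ^+ m.
  rewrite normrX; apply: lerXn2r; rewrite ?nnegrE//.
  by have := csinc_bound x%:C; rewrite csinc_real normcR /= normr0 expR0 mulr1.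
have g (p s : R) : `|s| <= 2 ^+ m -> (p * s) ^+ 2 <= (2 ^+ m) ^+ 2 * p ^+ 2.
  move=> hs; rewrite exprMn mulrC ler_wpM2r ?sqr_ge0// -(real_normK (num_real s)).
  by apply: lerXn2r; rewrite ?nnegrE ?exprn_ge0.
have [h1 [L1 H1]] : exists h, L2r k r h /\ forall y, hartley k h y = inv_const k * complex.Re (F y%:C).
  apply: (@hartley_limit R k r hk _ (fun x => (2 ^+ m) ^+ 2 * complex.Re (F x%:C) ^+ 2) (fun n => (cd n).1) _ (r + m%:R) rho0 rhos rhor).
  - by move=> n; have [] := cdP n.
  - move=> x; rewrite (_ : (fun n => _) = fun n => complex.Re (F x%:C) * fs (@sinc_coef R) (n.+1%:R^-1 * x) ^+ m).
      by rewrite -[X in _ --> X]mulr1; apply: cvgM; [exact: cvg_cst|exact: cvg_sinc].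
    by apply/funext => n; have [_ _ /(_ x)[]] := cdP n.
  - exact: iblZ.
  - by move=> n x; have [_ _ /(_ x)[-> _]] := cdP n; exact: g.
have [h2 [L2 H2]] : exists h, L2r k r h /\ forall y, hartley k h y = inv_const k * complex.Im (F y%:C).
  apply: (@hartley_limit R k r hk _ (fun x => (2 ^+ m) ^+ 2 * complex.Im (F x%:C) ^+ 2) (fun n => (cd n).2) _ (r + m%:R) rho0 rhos rhor).
  - by move=> n; have [] := cdP n.
  - move=> x; rewrite (_ : (fun n => _) = fun n => complex.Im (F x%:C) * fs (@sinc_coef R) (n.+1%:R^-1 * x) ^+ m).
      by rewrite -[X in _ --> X]mulr1; apply: cvgM; [exact: cvg_cst|exact: cvg_sinc].
    by apply/funext => n; have [_ _ /(_ x)[]] := cdP n.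
  - exact: iblZ.
  - by move=> n x; have [_ _ /(_ x)[_ ->]] := cdP n; exact: g.
by exists h1, h2.
Qed.

Lemma L2r_lin (a b : R) f g : L2r k r f -> L2r k r g -> L2r k r (fun x => a * f x + b * g x).
Proof.
move=> [mf f2 f0] [mg g2 g0]; split.
- by apply: measurable_funD; exact: measurable_funM.
- exact: sqr_ibl_lin.
- by move=> x rx; rewrite f0// g0// !mulr0 addr0.
Qed.

Lemma L2r_opp f : L2r k r f -> L2r k r (fun x => f (- x)).
Proof.
move=> [mf f2 f0]; split; first exact: mfun_opp.
- exact: (ibl_dunklN f2).
- by move=> x rx; rewrite f0// normrN.
Qed.

Lemma hartley_lin (a b : R) f g y : L2r k r f -> L2r k r g ->
  hartley k (fun x => a * f x + b * g x) y = a * hartley k f y + b * hartley k g y.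
Proof.
move=> Lf Lg; have [fi gi] := (ibl_cas hk y (L2r_ibl hk Lf), ibl_cas hk y (L2r_ibl hk Lg)).
rewrite /hartley -!rintZ// -rintD; [|exact: iblZ|exact: iblZ].
by apply: rint_eq => x; rewrite mulrDl !mulrA.
Qed.

Lemma hartley_opp f y : L2r k r f -> hartley k (fun x => f (- x)) y = hartley k f (- y).
Proof.
move=> Lf; have fi := ibl_meas (ibl_cas hk (- y) (L2r_ibl hk Lf)).
by rewrite /hartley -(rint_dunklN k fi); apply: rint_eq => x; rewrite mulrNN.
Qed.

(** With G = Hu + i Hv and c = [dunkl_const k], [trans_real] is inverted by G(y) = c ((1 + i) F(y) +
    (1 - i) F(-y)) / 2. The values at -y come from reflected preimages, and equality on the real
    line extends to the plane. *)
Lemma trans_onto F (C : R) : entire F ->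
  (forall z, normc (F z) <= C * expR (r * `|complex.Im z|)) ->
  ibl mu (fun x => complex.Re (F x%:C) ^+ 2) -> ibl mu (fun x => complex.Im (F x%:C) ^+ 2) ->
  exists u v, [/\ L2r k r u, L2r k r v & trans k u v = F].
Proof.
move=> eF hF i1 i2; have [h1 [h2 [L1 L2 H1 H2]]] := hartley_onto eF hF i1 i2.
have LN1 := L2r_opp L1; have LN2 := L2r_opp L2.
pose c := dunkl_const k; have c0 : 0 < c := dunkl_const_gt0 hk.
(* Removes the constant of the inversion formula and restores the factor c/2 of the formula for
   G. *)
pose b := c / inv_const k / 2.
have b0 : b * inv_const k = c / 2 by rewrite /b mulrAC divfK// gt_eqF// inv_const_gt0.
have Lp := L2r_lin 1 (-1) L1 L2; have Lq := L2r_lin 1 1 LN1 LN2.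
have Lp' := L2r_lin 1 1 L1 L2; have Lq' := L2r_lin 1 (-1) LN2 LN1.
have Lu := L2r_lin b b Lp Lq; have Lv := L2r_lin b b Lp' Lq'.
pose A y := complex.Re (F y%:C); pose B y := complex.Im (F y%:C).
have Hu y : hartley k (fun x => b * (1 * h1 x + -1 * h2 x) + b * (1 * h1 (- x) + 1 * h2 (- x))) y =
   c / 2 * (A y - B y + A (- y) + B (- y)).
  by rewrite hartley_lin// hartley_lin// hartley_lin// !hartley_opp// !H1 !H2 -b0 /A /B; ring.
have Hv y : hartley k (fun x => b * (1 * h1 x + 1 * h2 x) + b * (1 * h2 (- x) + -1 * h1 (- x))) y =
   c / 2 * (A y + B y + B (- y) - A (- y)).
  by rewrite hartley_lin// hartley_lin// hartley_lin// !hartley_opp// !H1 !H2 -b0 /A /B; ring.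
exists (fun x => b * (1 * h1 x + -1 * h2 x) + b * (1 * h1 (- x) + 1 * h2 (- x))),
  (fun x => b * (1 * h1 x + 1 * h2 x) + b * (1 * h2 (- x) + -1 * h1 (- x))); split=> //.
apply: (entire_eq_real (trans_entire hk hr Lu Lv) eF).
move=> y; rewrite (trans_real hk y Lu Lv) !Hu !Hv opprK.
have -> : F y%:C = A y +i* B y by rewrite /A /B; case: (F _).
rewrite -/c.
have e2 : (2%:R : R[i])^-1 = (2^-1)%:C by rewrite rmorphV ?unitfE//= rmorph_nat.
rewrite e2; move: (A y) (B y) (A (- y)) (B (- y)) => p q p' q'.
have cn0 : c != 0 by rewrite gt_eqF.
by apply: complex_eq; rewrite ?(cReM, cImM, cReD, cImD, cReN, cImN) /=; field.
Qed.

End regularization.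

(** * Measurable classes *)

Section complex_borel.
Context {R : realType}.
Implicit Types (z w : R[i]) (U : set R[i]).
#[local] Arguments normc : simpl never.

Lemma openCP U : open U <-> forall z, U z -> exists2 d : R, 0 < d & forall w, normc (w - z) < d -> U w.
Proof.
rewrite openE; split=> [H z Uz|H z Uz].
  have /nbhs_ballP [e /= e0 he] := H z Uz.
  move: e0; rewrite ltcE /= => /andP[/eqP e0 e1]; exists (complex.Re e) => // w wz.
  apply: he; rewrite -ball_normE /= (_ : e = (complex.Re e)%:C); last by apply/eqP; rewrite eq_complex /= e0 !eqxx.
  by rewrite normE ltcR normcB.
have [d d0 hd] := H z Uz; apply/nbhs_ballP; exists d%:C; first by rewrite /= ltcR.
by move=> w; rewrite -ball_normE /= normE ltcR normcB => /hd.
Qed.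

Lemma exists_small_rat (x e : R) : 0 < e -> exists q : rat, `|x - ratr q| < e.
Proof.
move=> e0; have /rat_in_itvoo[q] : x - e < x + e by lra.
by rewrite in_itv /= => /andP[h1 h2]; exists q; rewrite ltr_norml; lra.
Qed.

Lemma close_ltr_dist (a b q e s : R) : `|a - q| < e -> `|b - q| < e -> e < s / 4 -> `|a - b| < s / 2.
Proof.
rewrite !ltr_norml => /andP[a1 a2] /andP[b1 b2] es; apply/andP; split; lra.
Qed.

(** An open set is a countable union of squares with rational centres and half-sides 1/(n+1), each a
    condition on the real and imaginary parts. *)
Lemma measurable_funCP d (T : measurableType d) (f : T -> measurableTypeC R) :
  measurable_fun [set: T] f <->
  measurable_fun [set: T] (fun x => complex.Re (f x) : measurableTypeR R) /\
  measurable_fun [set: T] (fun x => complex.Im (f x) : measurableTypeR R).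
Proof.
split=> [mf|[m1 m2]].
  have h (p : R[i] -> R) : (forall a w, p (a - w) = p a - p w) -> (forall w, `|p w| <= normc w) ->
     measurable_fun [set: T] (fun x => p (f x) : measurableTypeR R).
    move=> pB pn; apply: (measurability _ (RGenOInfty.measurableE R)) => /= _ [_ [x ->] <-].
    rewrite setTI (_ : _ @^-1` _ = f @^-1` [set z | x < p z]); last first.
      by apply/seteqP; split=> y /=; rewrite in_itv /= andbT.
    rewrite -[X in measurable X]setTI; apply: mf => //; apply: sub_sigma_algebra; apply/openCP => z /= xz.
    exists (p z - x); first by rewrite subr_gt0.
    move=> w; move: (pn (w - z)); rewrite pB ler_norml => /andP[h1 _] h2; lra.
  split; apply: h; try exact: Re_le_normc; try exact: Im_le_normc; move=> a w.
    by rewrite cReD cReN.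
  by rewrite cImD cImN.
apply: (@measurability _ _ T (measurableTypeC R) setT f (@open R[i]) erefl) => /= _ [U oU <-]; rewrite setTI.
pose P (t : rat * rat * nat) := forall w : R[i], `|complex.Re w - ratr t.1.1| < t.2.+1%:R^-1 ->
  `|complex.Im w - ratr t.1.2| < t.2.+1%:R^-1 -> U w.
pose E (t : rat * rat * nat) := [set x : T | (`|complex.Re (f x) - ratr t.1.1| < t.2.+1%:R^-1 /\
  `|complex.Im (f x) - ratr t.1.2| < t.2.+1%:R^-1) /\ P t].
rewrite (_ : f @^-1` U = \bigcup_t E t); last first.
  apply/seteqP; split=> x /=; last by move=> [t _ [[h1 h2] Pt]]; exact: Pt.
  move=> Ux; have [e e0 hd] := (openCP _).1 oU _ Ux.
  have e4 : 0 < e / 4 by rewrite divr_gt0.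
  (* With a half-side below e/4, two points of the square differ by less than e/2 in each
     coordinate, hence by less than e. *)
  have [N _ hN] := (cvgr_lt _ (@cvg_harmonic R)) _ e4.
  have eN : 0 < N.+1%:R^-1 :> R by rewrite invr_gt0.
  have [p hp] := exists_small_rat (complex.Re (f x)) eN.
  have [q hq] := exists_small_rat (complex.Im (f x)) eN.
  exists (p, q, N) => //; split=> //= w /= h1 h2; apply: hd.
  apply: le_lt_trans (normc_le_ReIm _) _; rewrite cReD cImD cReN cImN.
  have := hN N (leqnn N); rewrite /harmonic /=.
  move=> h; have := ltrD (close_ltr_dist h1 hp h) (close_ltr_dist h2 hq h).
  by rewrite -splitr.
apply: countable_bigcupT_measurable; [exact: countableP|move=> t].
have [Pt|nPt] := pselect (P t); last by rewrite (_ : E t = set0)//; apply/seteqP; split=> x // [_].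
have mb (g : T -> measurableTypeR R) (c e : R) : measurable_fun [set: T] g -> measurable [set x | `|g x - c| < e].
  move=> mg; have mi : measurable ([set` (`]c - e, c + e[)%R] : set (measurableTypeR R)) by exact: measurable_itv.
  rewrite (_ : [set x | _] = g @^-1` [set` (`]c - e, c + e[)%R]); first by rewrite -[X in measurable X]setTI; exact: mg.
  by apply/seteqP; split=> x /=; rewrite in_itv /= ltr_distl.
rewrite (_ : E t = [set x | `|complex.Re (f x) - ratr t.1.1| < t.2.+1%:R^-1] `&` [set x | `|complex.Im (f x) - ratr t.1.2| < t.2.+1%:R^-1]).
  by apply: measurableI; exact: mb.
by apply/seteqP; split=> x /= => [[[]]|[]].
Qed.

End complex_borel.

(** * From functions with pointwise support to classes modulo null sets *)

Section assembly.
Context {R : realType} (k r : R) (hk : 0 <= k) (hr : 0 < r).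
Local Notation mu := (dunkl_measure k).
Implicit Types (f g : R -> R[i]) (u v : R -> R).
#[local] Arguments normc : simpl never.

Lemma L2P f : L2 k f <->
  [/\ measurable_fun [set: measurableTypeR R] (fun x => complex.Re (f x)),
      measurable_fun [set: measurableTypeR R] (fun x => complex.Im (f x)),
      ibl mu (fun x => complex.Re (f x) ^+ 2) & ibl mu (fun x => complex.Im (f x) ^+ 2)].
Proof.
have E : (\int[mu]_x ((`|(normc (f x))%:E| `^ 2))%E = \int[mu]_x (complex.Re (f x) ^+ 2 + complex.Im (f x) ^+ 2)%:E)%E.
  by apply: eq_integral => x _; rewrite abse_EFin ger0_norm ?normc_ge0// poweR_EFin powR_mulrn ?normc_ge0// sqr_normc2.
rewrite /L2; split=> [[/measurable_funCP[m1 m2]]|[m1 m2 i1 i2]].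
  have n2 : (2^-1 : R) != 0 by rewrite invr_eq0.
  rewrite unlock E => /(lty_poweRy n2) h.
  have i : ibl mu (fun x => complex.Re (f x) ^+ 2 + complex.Im (f x) ^+ 2).
    apply: iblP; first by apply: measurable_funD; exact: measurable_funX.
    by under eq_integral do rewrite ger0_norm ?addr_ge0 ?sqr_ge0//.
  split=> //; apply: (ibl_le (measurable_funX 2 _) i) => // x; rewrite ger0_norm ?sqr_ge0//.
    by rewrite lerDl sqr_ge0.
  by rewrite lerDr sqr_ge0.
split; first by apply/measurable_funCP.
by rewrite unlock E; apply: poweR_lty; rewrite (iblE (iblD i1 i2)) ltry.
Qed.

Lemma dunkl_transform_ae f g l :
  measurable_fun [set: measurableTypeR R] (fun x => complex.Re (f x)) ->
  measurable_fun [set: measurableTypeR R] (fun x => complex.Im (f x)) ->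
  measurable_fun [set: measurableTypeR R] (fun x => complex.Re (g x)) ->
  measurable_fun [set: measurableTypeR R] (fun x => complex.Im (g x)) ->
  {ae mu, forall x, f x = g x} -> dunkl_transform k f l = dunkl_transform k g l.
Proof.
move=> m1 m2 m3 m4 fg; rewrite /dunkl_transform dunkl_kernelE// /Cintegral; congr (_ * _).
have mre : measurable_fun [set: measurableTypeR R] (kre k l) by apply: continuous_measurable_fun; exact: continuous_kre.
have mim : measurable_fun [set: measurableTypeR R] (kim k l) by apply: continuous_measurable_fun; exact: continuous_kim.
have mR (h : R -> R[i]) : measurable_fun [set: measurableTypeR R] (fun x => complex.Re (h x)) ->
  measurable_fun [set: measurableTypeR R] (fun x => complex.Im (h x)) ->
  measurable_fun [set: measurableTypeR R] (fun x => complex.Re (h x * cfs (kcoef k (- l)) x%:C)) /\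
  measurable_fun [set: measurableTypeR R] (fun x => complex.Im (h x * cfs (kcoef k (- l)) x%:C)).
  move=> a b; split.
    rewrite (_ : (fun x => _) = fun x => complex.Re (h x) * kre k l x - complex.Im (h x) * kim k l x); last first.
      by apply/funext => x; rewrite cfs_real cReM.
    by apply: measurable_funB; exact: measurable_funM.
  rewrite (_ : (fun x => _) = fun x => complex.Re (h x) * kim k l x + complex.Im (h x) * kre k l x); last first.
    by apply/funext => x; rewrite cfs_real cImM.
  by apply: measurable_funD; exact: measurable_funM.
have [f1 f2] := mR _ m1 m2; have [g1 g2] := mR _ m3 m4.
congr (_ +i* _); rewrite /Rintegral; congr fine; apply: ae_eq_integral => //; try (by apply/measurable_EFinP);
  by apply: (@filterS _ _ (ae_filter_ringOfSetsType mu) _ _ _ fg) => x -> _.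
Qed.

(* A representative of f vanishing everywhere outside [-r, r]. *)
Definition cut f x : R[i] := if `|x| <= r then f x else 0.

Lemma L2_support_cut (f : {mfun_ mu, measurableTypeR R >-> measurableTypeC R}) : L2_support r f ->
  [/\ L2r k r (fun x => complex.Re (cut f x)), L2r k r (fun x => complex.Im (cut f x)),
      {ae mu, forall x, (f : R -> R[i]) x = cut f x} &
      dunkl_transform k f = trans k (fun x => complex.Re (cut f x)) (fun x => complex.Im (cut f x))].
Proof.
move=> [/L2P[m1 m2 i1 i2] f0].
have L (p : R[i] -> R) : p 0 = 0 -> measurable_fun [set: measurableTypeR R] (fun x => p (f x)) ->
   ibl mu (fun x => p (f x) ^+ 2) -> L2r k r (fun x => p (cut f x)).
  move=> p0 mp ip; have E : (fun x => p (cut f x)) = fun x => \1_([set` (`[- r, r])%R] : set R) x * p (f x).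
    by apply/funext => x; rewrite indic_itvE /cut; case: ifP => _; rewrite ?mul1r// mul0r.
  have m : measurable_fun [set: measurableTypeR R] (fun x => p (cut f x)).
    rewrite E; apply: measurable_funM => //; apply: measurable_indic; exact: measurable_itv.
  split=> //.
    apply: (ibl_le (measurable_funX 2 m) ip) => x; rewrite ger0_norm ?sqr_ge0// /cut.
    by case: ifP => _//; rewrite p0 expr0n sqr_ge0.
  by move=> x rx; rewrite /cut leNgt rx.
have L1 := L (@complex.Re R) erefl m1 i1; have L2 := L (@complex.Im R) erefl m2 i2.
have ae : {ae mu, forall x, (f : R -> R[i]) x = cut f x}.
  apply: (@filterS _ _ (ae_filter_ringOfSetsType mu) _ _ _ f0) => x h.
  by rewrite /cut; case: ifPn => // rx; apply: h; rewrite in_itv /= -ler_norml.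
split=> //; apply/funext => l; rewrite -(dunkl_transformE hk l L1 L2).
have [n1 _ _] := L1; have [n2 _ _] := L2.
exact: dunkl_transform_ae.
Qed.

Lemma mfun_eq (f g : {mfun_ mu, measurableTypeR R >-> measurableTypeC R}) :
  {ae mu, forall x, (f : R -> R[i]) x = g x} -> f = g.
Proof.
move=> h; rewrite -[f]reprK -[g]reprK; apply/eqP; rewrite eqmodE; apply/asboolP.
exact: (@filterS _ _ (ae_filter_ringOfSetsType mu) _ _ _ h).
Qed.

Lemma ibl_ae u v : measurable_fun [set: measurableTypeR R] u -> ibl mu v ->
  {ae mu, forall x, u x = v x} -> ibl mu u.
Proof.
move=> m1 iv uv; have E : (\int[mu]_x `|u x|%:E = \int[mu]_x `|v x|%:E)%E; last first.
  by apply: iblP => //; rewrite E (iblE (ibl_norm iv)) ltry.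
apply: ae_eq_integral => //.
- by apply/measurable_EFinP; apply: measurableT_comp.
- by apply/measurable_EFinP; apply: measurableT_comp => //; exact: ibl_meas iv.
- by apply: (@filterS _ _ (ae_filter_ringOfSetsType mu) _ _ _ uv) => x -> _.
Qed.

Lemma mfun_class (f : R -> R[i]) : measurable_fun [set: measurableTypeR R] (f : measurableTypeR R -> measurableTypeC R) ->
  exists F : {mfun_ mu, measurableTypeR R >-> measurableTypeC R}, {ae mu, forall x, (F : R -> R[i]) x = f x}.
Proof.
move=> mf; pose f' : {mfun measurableTypeR R >-> measurableTypeC R} := HB.pack (f : measurableTypeR R -> measurableTypeC R) (isMeasurableFun.Build _ _ _ _ (f : measurableTypeR R -> measurableTypeC R) mf).
exists (\pi_({mfun_ mu, measurableTypeR R >-> measurableTypeC R})%qT f').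
have : (repr (\pi_({mfun_ mu, measurableTypeR R >-> measurableTypeC R})%qT f') = f' %[mod {mfun_ mu, measurableTypeR R >-> measurableTypeC R}])%qT by rewrite reprK.
move=> /eqP; rewrite eqmodE => /asboolP h.
by apply: (@filterS _ _ (ae_filter_ringOfSetsType mu) _ _ _ h) => x /(_ I).
Qed.

End assembly.

Theorem theorem12 (R : realType) (k r : R) (hr : 0 < r) (hk : 0 <= k) :
  set_bij (@L2_support R k r) (@paley_wiener R k r)
    (fun f => dunkl_transform k f).
Proof.
split=> [f Lf|f g /set_mem Lf /set_mem Lg /= E|F [eF LF [C C0 hC]]].
- have [L1 L2 _ ->] := L2_support_cut hk Lf; split.
  + exact: (trans_entire hk hr L1 L2).
  + by apply/L2P; exact: (trans_sqr_ibl hk L1 L2).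
  + exact: (trans_bound hk L1 L2).
- have [L1 L2 aef Ef] := L2_support_cut hk Lf; have [L3 L4 aeg Eg] := L2_support_cut hk Lg.
  (* Injectivity concerns the cut representatives; [mfun_eq] brings it back to the classes through
     [aef] and [aeg]. *)
  have [h1 h2] := trans_inj hk hr L1 L2 L3 L4 (fun l => congr1 (@^~ l) (etrans (esym Ef) (etrans E Eg))).
  apply: mfun_eq; have F := ae_filter_ringOfSetsType (dunkl_measure k).
  have h := filterI (filterI aef aeg) (filterI h1 h2).
  apply: (@filterS _ _ F _ _ _ (h F F F)) => x [[-> ->] [e1 e2]].
  exact: complex_eq.
have [m1 m2 i1 i2] := (L2P k (fun x => F x%:C)).1 LF.
have [u [v [Lu Lv E]]] := trans_onto hk hr eF hC i1 i2.
have [mu_ u2 u0] := Lu; have [mv v2 v0] := Lv.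
have mf : measurable_fun [set: measurableTypeR R] ((fun x => u x +i* v x) : measurableTypeR R -> measurableTypeC R).
  by apply/measurable_funCP.
have [f fE] := mfun_class k mf.
have [m3 m4] : measurable_fun [set: measurableTypeR R] (fun x => complex.Re (f x)) /\
    measurable_fun [set: measurableTypeR R] (fun x => complex.Im (f x)).
  by apply/measurable_funCP; exact: (measurable_funPT (repr f)).
(* The representative of the class agrees with u + i v only almost everywhere, so every required
   property is transferred along [fE]. *)
have aeI := @filterS _ _ (ae_filter_ringOfSetsType (dunkl_measure k)) _ _ _ fE.
exists f; last first.
  apply/funext => l; rewrite -E (dunkl_transform_ae hk l m3 m4 (g := fun x => u x +i* v x))//.
  exact: (@dunkl_transformE R k r hk (fun x => u x +i* v x)).
split.
  apply/L2P; split=> //.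
    by apply: (ibl_ae (measurable_funX 2 m3) u2); apply: aeI => x ->.
  by apply: (ibl_ae (measurable_funX 2 m4) v2); apply: aeI => x ->.
apply: aeI => x -> xr; rewrite u0 ?v0//; move: xr; rewrite in_itv /= -ler_norml -ltNge//.
Qed.
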